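(* Let $-1<a,b,\alpha,\beta<+\infty$ with $\beta=\beta_0+m$, $m\in\mathbb N$ and $\beta_0\in\mathcal J_\alpha$. Let $1\le p<+\infty$. Then $\mathbb P_{\alpha,\beta}$ is a bounded projection from $L^p(\mathbb D,d\mu_{a,b})$ onto $\mathcal A^p_{a,b}$ if and only if $p(\alpha+1)>a+1$ and $$\begin{cases} m-2<2b\le 2\beta-m & \text{if } p=1,\\ pm-2<2b<p(2\beta+2)-pm-2 & \text{if } p>1.\end{cases}$$
   Context: $\mathbb D$ is the open unit disc in $\mathbb C$, $\mathbb D^*=\mathbb D\setminus\{0\}$, $dA$ is the area measure on $\mathbb D$ normalized so that $\mathbb D$ has measure $1$, $\mathrm B(\cdot,\cdot)$ is the Euler beta function, and $\mathbb N=\{0,1,2,\dots\}$. For $-1<a,b<+\infty$, $$d\mu_{a,b}(z)=\frac{1}{\mathrm B(a+1,b+1)}|z|^{2b}(1-|z|^2)^a\,dA(z),$$ and $\mathcal A^p_{a,b}$ is the space of holomorphic functions $f$ on $\mathbb D^*$ with $\|f\|_{a,b,p}=\left(\int_{\mathbb D}|f|^p\,d\mu_{a,b}\right)^{1/p}<+\infty$. Every $\beta>-1$ is written uniquely as $\beta=\beta_0+m$ with $m\in\mathbb N$ and $-1<\beta_0\le 0$. For $\xi\in\mathbb D$, $$Q_{\alpha,\beta}(\xi)=\begin{cases}(\alpha+1)\mathrm B(\alpha+1,\beta+1) & \text{if }\beta\in\mathbb N,\\[4pt] \dfrac{\mathrm B(\alpha+1,\beta+1)}{\mathrm B(\alpha+1,\beta_0+1)}\displaystyle\sum_{n=0}^{+\infty}\frac{\beta_0(-\xi)^n}{n+\beta_0}\binom{\alpha+1}{n}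 & \text{if }\beta\notin\mathbb N.\end{cases}$$ $\mathcal J_\alpha$ denotes the set of $\beta\in(-1,0]$ such that $Q_{\alpha,\beta}$ has no zero in $\mathbb D$. $\mathbb P_{\alpha,\beta}$ is the orthogonal projection of $L^2(\mathbb D,d\mu_{\alpha,\beta})$ onto $\mathcal A^2_{\alpha,\beta}$, given by the integral formula $$\mathbb P_{\alpha,\beta}f(z)=\int_{\mathbb D}f(w)\frac{Q_{\alpha,\beta}(z\overline w)}{(z\overline w)^m(1-z\overline w)^{2+\alpha}}\,d\mu_{\alpha,\beta}(w),$$ and this formula is used to apply $\mathbb P_{\alpha,\beta}$ to functions in other $L^p$ spaces.
   Formalization: The target space is replaced by the functions in A^p_{a,b} with at worst a pole of order m at 0; ''onto A^p_{a,b}'' fails as printed (α=β=a=0, b=1/2, p=2: 1/z is in the space but not in the range). The two spaces agree when 2b+2 ≤ p(m+1). *)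

(* Defs.v *)
(* MathComp-Analysis over an arbitrary [R : realType]; the complex plane is
   [R[i]] from mathcomp-real-closed. *)
From HB Require Import structures.
From mathcomp Require Import all_boot all_order all_algebra.
From mathcomp Require Import all_classical all_reals all_analysis.
From mathcomp Require Import measurable_realfun complex.

Set Implicit Arguments.
Unset Strict Implicit.
Unset Printing Implicit Defensive.

Import Order.TTheory GRing.Theory Num.Theory.
Import numFieldNormedType.Exports.
Import ComplexField.Normc.

Local Open Scope classical_set_scope.
Local Open Scope ring_scope.
Local Open Scope complex_scope.

(* [R[i]] with the Borel sigma-algebra of [R * R]. *)
Section complex_measurable.
Context {R : realType}.

Definition of_pair (x : R * R) : R[i] := x.1 +i* x.2.

Definition to_pair (z : R[i]) : R * R := (complex.Re z, complex.Im z).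

Lemma of_pairK : cancel of_pair to_pair.
Proof. by case. Qed.

HB.instance Definition _ := isPointed.Build R[i] 0.

Let m0 : g_sigma_algebra_preimage to_pair set0.
Proof. exact: (@measurable0 _ (g_sigma_algebra_preimageType to_pair)). Qed.

Let mC (A : set R[i]) : g_sigma_algebra_preimage to_pair A ->
  g_sigma_algebra_preimage to_pair (~` A).
Proof. exact: (@measurableC _ (g_sigma_algebra_preimageType to_pair)). Qed.

Let mU (F : (set R[i])^nat) : (forall i, g_sigma_algebra_preimage to_pair (F i)) ->
  g_sigma_algebra_preimage to_pair (\bigcup_i F i).
Proof.
exact: (@bigcupT_measurable _ (g_sigma_algebra_preimageType to_pair)).
Qed.

HB.instance Definition _ := @isMeasurable.Build (preimage_display to_pair)
  R[i] (g_sigma_algebra_preimage to_pair) m0 mC mU.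

Lemma measurable_to_pair : measurable_fun [set: R[i]] to_pair.
Proof. by move=> _ A mA; exists A. Qed.

Lemma measurable_of_pair : measurable_fun [set: R * R] of_pair.
Proof.
move=> _ _ [A mA <-]; rewrite !setTI -comp_preimage.
by rewrite (_ : to_pair \o of_pair = id) //; apply/funext => -[].
Qed.

Lemma measurable_Re : measurable_fun [set: R[i]] (@complex.Re R).
Proof. exact: (measurableT_comp measurable_fst measurable_to_pair). Qed.

Lemma measurable_Im : measurable_fun [set: R[i]] (@complex.Im R).
Proof. exact: (measurableT_comp measurable_snd measurable_to_pair). Qed.

Lemma measurable_normc : measurable_fun [set: R[i]] (@normc R).
Proof.
rewrite (_ : @normc R = fun z =>
  Num.sqrt (complex.Re z ^+ 2 + complex.Im z ^+ 2)); last first.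
  by apply/funext => -[].
apply: (measurableT_comp (continuous_measurable_fun (@sqrt_continuous R))).
by apply: measurable_funD; apply: measurable_funX;
  [exact: measurable_Re | exact: measurable_Im].
Qed.

End complex_measurable.

Definition disc (R : realType) : set R[i] := [set z | normc z < 1].
Arguments disc {R}.

Definition pdisc (R : realType) : set R[i] := disc `\ 0.
Arguments pdisc {R}.

Section area.
Context {R : realType}.
Local Open Scope ereal_scope.

(* Planar Lebesgue measure divided by [pi], so that [disc] has measure 1. *)
Definition area (A : set R[i]) : \bar R :=
  (pi^-1)%:E * (@lebesgue_measure R \x @lebesgue_measure R) (of_pair @^-1` A).

Let pi_ge0 : (0 <= (pi : R)^-1)%R.
Proof. by rewrite invr_ge0 ltW // pi_gt0. Qed.

Let mpre (A : set R[i]) : measurable A -> measurable (of_pair @^-1` A).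
Proof. by move=> mA; rewrite -[X in measurable X]setTI; exact: measurable_of_pair. Qed.

Let area0 : area set0 = 0.
Proof. by rewrite /area preimage_set0 measure0 mule0. Qed.

Let area_ge0 A : 0 <= area A.
Proof. by rewrite /area mule_ge0 // lee_fin. Qed.

Let area_sigma_additive : semi_sigma_additive area.
Proof.
move=> F mF tF mUF; rewrite /area.
rewrite [X in X @ \oo --> _](_ : _ = (fun n => (pi^-1)%:E * \sum_(0 <= i < n)
  (@lebesgue_measure R \x @lebesgue_measure R) (of_pair @^-1` F i))); last first.
  by apply/funext => k; rewrite ge0_sume_distrr.
apply: cvgeZl => //; rewrite preimage_bigcup.
apply: measure_semi_sigma_additive.
- by move=> n; exact: mpre.
- apply/trivIsetP => /= i j _ _ ij; rewrite -preimage_setI.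
  by move/trivIsetP : tF => /(_ _ _ _ _ ij) ->//; rewrite preimage_set0.
- by rewrite -preimage_bigcup; exact: mpre.
Qed.

HB.instance Definition _ := isMeasure.Build _ _ _ area
  area0 area_ge0 area_sigma_additive.

End area.

(* Euler's beta function for real arguments (the library's [beta_fun] only takes
   natural numbers). *)
Definition Beta (R : realType) (x y : R) : R :=
  \int[@lebesgue_measure R]_(t in `]0, 1[) (t `^ (x - 1) * (1 - t) `^ (y - 1)).

Section weighted_measure.
Context {R : realType}.
Variables a b : R.

Definition weight (z : R[i]) : R :=
  normc z `^ (2 * b) * (1 - normc z ^+ 2) `^ a / Beta (a + 1) (b + 1).

Local Open Scope ereal_scope.

Definition mu (A : set R[i]) : \bar R :=
  \int[area]_(z in A `&` disc) (weight z)%:E.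

Lemma weight_ge0 z : (0 <= weight z)%R.
Proof.
rewrite /weight divr_ge0 ?mulr_ge0 ?powR_ge0 //.
by apply: Rintegral_ge0 => // t _; rewrite mulr_ge0 ?powR_ge0.
Qed.

Lemma measurable_weight : measurable_fun [set: R[i]] weight.
Proof.
apply: measurable_funM => //; apply: measurable_funM.
  exact: (measurableT_comp (@measurable_powR R _) measurable_normc).
apply: (measurableT_comp (@measurable_powR R _)).
apply: measurable_funB => //.
by apply: measurable_funX; exact: measurable_normc.
Qed.

Lemma measurable_disc : measurable (@disc R).
Proof.
rewrite (_ : disc = @normc R @^-1` `]-oo, 1%R[); last first.
  by apply/seteqP; split => z; rewrite /disc /= in_itv.
by rewrite -[X in measurable X]setTI; exact: measurable_normc.
Qed.

Let mu0 : mu set0 = 0.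
Proof. by rewrite /mu set0I integral_set0. Qed.

Let mu_ge0 A : 0 <= mu A.
Proof. by apply: integral_ge0 => z _; rewrite lee_fin weight_ge0. Qed.

Let mu_sigma_additive : semi_sigma_additive mu.
Proof.
move=> F mF tF mUF; rewrite /mu setI_bigcupl.
rewrite ge0_integral_bigcup //=.
- by apply: is_cvg_nneseries => n _ _; exact: mu_ge0.
- by move=> n; apply: measurableI => //; exact: measurable_disc.
- apply: measurable_funTS; apply/measurable_EFinP; exact: measurable_weight.
- by move=> z _; rewrite lee_fin weight_ge0.
- exact: trivIset_setIr.
Qed.

HB.instance Definition _ := isMeasure.Build _ _ _ mu
  mu0 mu_ge0 mu_sigma_additive.

End weighted_measure.

Section integral.
Context {d : measure_display} {T : measurableType d} {R : realType}.
Variables (nu : {measure set T -> \bar R}) (D : set T) (f : T -> R[i]).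

Definition cintegrable : Prop :=
  nu.-integrable D (fun x => (complex.Re (f x))%:E) /\
  nu.-integrable D (fun x => (complex.Im (f x))%:E).

Definition cintegral : R[i] :=
  (\int[nu]_(x in D) complex.Re (f x)) +i* (\int[nu]_(x in D) complex.Im (f x)).

End integral.

(* Derivability over the field [R[i]] itself, i.e. complex differentiability. *)
Definition holomorphic (R : realType) (U : set R[i]) (f : R[i] -> R[i]) : Prop :=
  forall z : R[i], U z -> derivable (f : R[i]^o -> R[i]^o) z 1.

Section spaces.
Context {R : realType}.
Variables a b p : R.

Definition norm_p (f : R[i] -> R[i]) : \bar R :=
  ((\int[mu a b]_(z in disc) (normc (f z) `^ p)%:E) `^ p^-1)%E.

Definition Lp : set (R[i] -> R[i]) :=
  [set f | measurable_fun disc f /\ (norm_p f < +oo)%E].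

Definition Ap : set (R[i] -> R[i]) :=
  [set f | holomorphic pdisc f /\ (norm_p f < +oo)%E].

(* Elements of [Ap] whose singularity at 0 is at worst a pole of order [m]. When
   [p * m.+1 < 2 * b + 2] this is a proper subspace of [Ap], as [z ^- m.+1] is in
   [Ap]; otherwise it is [Ap]. The kernel of [bergman_proj] has a pole of order
   [m] in [z], so nothing outside [Ap_pole] can be in its range. *)
Definition Ap_pole (m : nat) : set (R[i] -> R[i]) :=
  [set f | Ap f /\ exists2 h, holomorphic disc h &
                     {in pdisc, forall z, h z = z ^+ m * f z}].

End spaces.

Section kernel.
Context {R : realType}.
Implicit Types (alpha beta s x : R) (xi z w : R[i]).

(* Principal branch of [w ^ s] on the half-plane [0 < Re w]; it is only applied
   to [w = 1 - xi] with [xi] in the disc. *)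
Definition cpow w s : R[i] :=
  let theta := atan (complex.Im w / complex.Re w) in
  (normc w `^ s)%:C * (cos (s * theta) +i* sin (s * theta)).

Definition gbinom x (n : nat) : R := (\prod_(k < n) (x - k%:R)) / n`!%:R.

(* For [-1 < beta], the decomposition [beta = frac_part beta + int_part beta] with
   [-1 < frac_part beta <= 0]. *)
Definition int_part beta : nat := `|Num.ceil beta|%N.
Definition frac_part beta : R := beta - (int_part beta)%:R.

Lemma int_partE (beta0 : R) (m : nat) :
  -1 < beta0 <= 0 -> int_part (beta0 + m%:R) = m.
Proof.
move=> /andP[h1 h2]; rewrite /int_part (@ceil_def _ _ (Posz m)) //.
rewrite intrB -pmulrn; apply/andP; split; first by rewrite addrC ltrD2r.
by rewrite gerDr.
Qed.

Lemma frac_partE (beta0 : R) (m : nat) :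
  -1 < beta0 <= 0 -> frac_part (beta0 + m%:R) = beta0.
Proof. by move=> h; rewrite /frac_part int_partE // addrK. Qed.

Definition Q alpha beta xi : R[i] :=
  let beta0 := frac_part beta in
  if beta \is a Num.nat then
    ((alpha + 1) * Beta (alpha + 1) (beta + 1))%:C
  else
    (Beta (alpha + 1) (beta + 1) / Beta (alpha + 1) (beta0 + 1))%:C *
    limn (series (fun n : nat =>
      ((beta0 / (n%:R + beta0) * gbinom (alpha + 1) n)%:C * (- xi) ^+ n
        : R[i]^o))).

Definition J alpha : set R :=
  [set beta0 | -1 < beta0 <= 0 /\ {in disc, forall xi, Q alpha beta0 xi != 0}].

Definition kernel_integrand alpha beta (f : R[i] -> R[i]) z w : R[i] :=
  let xi := z * w^* in
  f w * (Q alpha beta xi / (xi ^+ int_part beta * cpow (1 - xi) (2 + alpha))).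

Definition bergman_proj alpha beta (f : R[i] -> R[i]) z : R[i] :=
  cintegral (mu alpha beta) disc (kernel_integrand alpha beta f z).

(* The integral formula makes sense at every point of [pdisc] for every [f] in the
   domain. *)
Definition bergman_proj_defined alpha beta (L : set (R[i] -> R[i])) : Prop :=
  forall f z, L f -> pdisc z ->
    cintegrable (mu alpha beta) disc (kernel_integrand alpha beta f z).

(* [P] is a bounded linear projection of [L] onto [V], both normed by [N]; functions
   in [V] are identified when they agree on [pdisc]. *)
Definition bounded_projection (L V : set (R[i] -> R[i]))
    (N : (R[i] -> R[i]) -> \bar R) (P : (R[i] -> R[i]) -> R[i] -> R[i]) : Prop :=
  [/\ forall (c : R[i]) f g, L f -> L g ->
        {in pdisc, forall z, P (fun w => c * f w + g w) z = c * P f z + P g z},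
      forall f, L f -> V (P f),
      exists C : R, forall f, L f -> (N (P f) <= C%:E * N f)%E,
      forall f, L f -> {in pdisc, P (P f) =1 P f} &
      forall g, V g -> exists2 f, L f & {in pdisc, P f =1 g}].

End kernel.

(* Main.v *)
From HB Require Import structures.
From mathcomp Require Import all_boot all_order all_algebra.
From mathcomp Require Import all_classical all_reals all_analysis.
From mathcomp Require Import measurable_realfun complex ring lra.
Require Import Defs.

Set Implicit Arguments.
Unset Strict Implicit.
Unset Printing Implicit Defensive.

Import Order.TTheory GRing.Theory Num.Theory.
Import numFieldNormedType.Exports.
Import ComplexField.Normc.

Local Open Scope classical_set_scope.
Local Open Scope ring_scope.
Local Open Scope complex_scope.

(** Let [m] be the integer part and [beta0] the fractional part of [beta]. Up to a positive
    constant the kernel is [xi ^- m * D xi], where [D] is the power series whose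
    coefficients [dcoef] are the reciprocals of the normalized moments of the weight with
    exponents [alpha] and [beta0]. It also equals [xi ^- m * Qb xi / (1 - xi) ^ (alpha + 2)]
    with [Qb] bounded, Lipschitz and of real part at least 1 on the radius from 0 to 1
    ([pser_dcoef], [Qb_bounded], [Qb_lip], [Qb_ge1]): both descriptions of the coefficients
    obey the same recursion.

    Sufficiency. The modulus of the kernel is at most a constant times
    [|xi| ^ (- m) * |1 - xi| ^ (- (alpha + 2))], and Schur's test applies with a product of
    powers of [|w|] and [1 - |w| ^ 2] as weight ([schur_bound]). The integrals that it needs
    are the Forelli-Rudin integrals ([forelli_rudin]): [|1 - xi| ^ (- c)] is the squared
    modulus of a power series, so by Parseval its mean is a power series whose coefficients
    can be compared with those of a power of [1 - |w| ^ 2]. Admissible exponents for the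
    weight exist under the conditions of the theorem ([schur_exponents]). Integrating the
    series of the kernel term by term shows that [P f] is [z ^- m] times a power series
    ([proj_series]), hence lies in the target space. Conversely an element [g] of that space
    is [z ^- m * h] with [h] holomorphic on the disc, and [h] is a power series by Cauchy's
    formula ([taylor]), which is derived from Goursat's theorem in logarithmic coordinates
    ([goursat], [circle_mean]). The coefficients of the kernel cancel the moments that appear
    when [P] is applied to such a series ([pcoef_pole]), so [P g = g] off the origin. This
    gives both idempotence and surjectivity.

    Necessity. On the functions [rtest x y], that is
    [|w| ^ (2 x) * (1 - |w| ^ 2) ^ y * w ^ (- m)], the projection is an explicit quotient of
    beta values times [z ^- m]. That [P] is defined on them gives the two inequalities on
    [a] and [b] in a weak form ([cond_a], [cond_b]), that their images have finite norm gives
    the lower bound on [b] ([pole_Lp]), and the norm bound near the critical exponents, where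
    the beta function has simple poles, compares a blow-up of order [p] with one of order 1,
    which is absurd in the case of equality and [p > 1]. For [p = 1] the equality [a = alpha]
    remains to be excluded, and radial functions do not suffice. Indicator functions of small
    squares about a point [r] of the radius show that the mean of [|D (z r)|] is bounded
    uniformly in [r] ([kernel_mean_bounded]); since [Qb] does not vanish near 1, this
    contradicts the divergence of the limiting Forelli-Rudin integral ([forelli_rudin_log]).
*)

(** * Complex numbers: modulus and measurability *)

Section complex_basics.
Context {R : realType}.
Implicit Types z w : R[i].

Lemma normc_ge0 z : 0 <= normc z.
Proof. by case: z => x y; exact: sqrtr_ge0. Qed.

Lemma normcE z : normc z = Num.sqrt (complex.Re z ^+ 2 + complex.Im z ^+ 2).
Proof. by case: z. Qed.

Lemma sqr_normc z : normc z ^+ 2 = complex.Re z ^+ 2 + complex.Im z ^+ 2.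
Proof. by rewrite normcE sqr_sqrtr // addr_ge0 ?sqr_ge0. Qed.

Lemma normcX z n : normc (z ^+ n) = normc z ^+ n.
Proof. by elim: n => [|n IH]; rewrite ?expr0 ?normc1 // !exprS normcM IH. Qed.

Lemma normc_conj z : normc z^* = normc z.
Proof. by case: z => x y /=; rewrite sqrrN. Qed.

Lemma normc_real (x : R) : normc x%:C = `|x|.
Proof. by rewrite /= expr0n /= addr0 sqrtr_sqr. Qed.

Lemma normc_nng (x : R) : 0 <= x -> normc x%:C = x.
Proof. by move=> x0; rewrite normc_real ger0_norm. Qed.

Lemma normc_nat n : normc (n%:R : R[i]) = n%:R.
Proof.
have -> : (n%:R : R[i]) = (n%:R)%:C by rewrite rmorph_nat.
by rewrite normc_nng.
Qed.

Lemma normcB z w : normc (z - w) = normc (w - z).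
Proof. by rewrite -normcN opprB. Qed.

Lemma le_normc_Re z : `|complex.Re z| <= normc z.
Proof. by rewrite normcE -sqrtr_sqr ler_wsqrtr // lerDl sqr_ge0. Qed.

Lemma le_normc_Im z : `|complex.Im z| <= normc z.
Proof. by rewrite normcE -sqrtr_sqr ler_wsqrtr // lerDr sqr_ge0. Qed.

Lemma normc_le_ReIm z : normc z <= `|complex.Re z| + `|complex.Im z|.
Proof.
case: z => x y; rewrite [leRHS]/=.
have -> : x +i* y = x%:C + 'i * y%:C by apply/eqP; rewrite eq_complex /=; apply/andP; split; apply/eqP; ring.
have i1 : normc ('i : R[i]) = 1 by rewrite /= expr0n expr1n /= add0r sqrtr1.
by apply: le_trans (le_normcD _ _) _; rewrite normcM !normc_real i1 mul1r.
Qed.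

Lemma normc_gt0 z : (0 < normc z) = (z != 0).
Proof.
rewrite lt_neqAle normc_ge0 andbT eq_sym; congr (~~ _).
by apply/eqP/eqP => [/eq0_normc//|->]; rewrite normc0.
Qed.

Lemma mulc_conj z : z * z^* = (normc z ^+ 2)%:C.
Proof.
rewrite sqr_normc; case: z => x y; apply/eqP; rewrite eq_complex /=.
by apply/andP; split; apply/eqP; ring.
Qed.

Lemma le_normc_sum (I : Type) (s : seq I) (P : pred I) (F : I -> R[i]) :
  normc (\sum_(i <- s | P i) F i) <= \sum_(i <- s | P i) normc (F i).
Proof.
elim/big_rec2 : _ => [|i x y Pi h]; first by rewrite normc0.
by apply: le_trans (le_normcD _ _) _; rewrite lerD2l.
Qed.

Lemma ReD z w : complex.Re (z + w) = complex.Re z + complex.Re w.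
Proof. by case: z; case: w. Qed.
Lemma ImD z w : complex.Im (z + w) = complex.Im z + complex.Im w.
Proof. by case: z; case: w. Qed.
Lemma ReN z : complex.Re (- z) = - complex.Re z.
Proof. by case: z. Qed.
Lemma ImN z : complex.Im (- z) = - complex.Im z.
Proof. by case: z. Qed.
Lemma ReM z w : complex.Re (z * w) =
  complex.Re z * complex.Re w - complex.Im z * complex.Im w.
Proof. by case: z; case: w. Qed.
Lemma ImM z w : complex.Im (z * w) =
  complex.Re z * complex.Im w + complex.Im z * complex.Re w.
Proof. by case: z; case: w. Qed.

Lemma Re_sum (I : Type) (s : seq I) (P : pred I) (F : I -> R[i]) :
  complex.Re (\sum_(i <- s | P i) F i) = \sum_(i <- s | P i) complex.Re (F i).
Proof. by apply: (big_morph _ ReD). Qed.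

Lemma Im_sum (I : Type) (s : seq I) (P : pred I) (F : I -> R[i]) :
  complex.Im (\sum_(i <- s | P i) F i) = \sum_(i <- s | P i) complex.Im (F i).
Proof. by apply: (big_morph _ ImD). Qed.

Lemma complexP z w :
  complex.Re z = complex.Re w -> complex.Im z = complex.Im w -> z = w.
Proof. by case: z; case: w => ? ? ? ? /= -> ->. Qed.

Lemma real_complexM (x y : R) : (x * y)%:C = x%:C * y%:C.
Proof. exact: rmorphM. Qed.

Lemma realX (x : R) n : (x ^+ n)%:C = x%:C ^+ n.
Proof. exact: rmorphXn. Qed.

Lemma conjcX z n : (z ^+ n)^* = z^* ^+ n.
Proof. exact: rmorphXn. Qed.

End complex_basics.

Section complex_measurable_functions.
Context {d} {T : measurableType d} {R : realType}.
Implicit Types (D : set T) (f g : T -> R[i]).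

Lemma measurable_cE D f : measurable_fun D f <->
  measurable_fun D (fun x => complex.Re (f x)) /\
  measurable_fun D (fun x => complex.Im (f x)).
Proof.
split=> [mf|[mr mi]].
  by split; [exact: (measurableT_comp measurable_Re mf) |
    exact: (measurableT_comp measurable_Im mf)].
move=> mD; have {}mr := (measurable_restrictT _ mD).1 mr.
have {}mi := (measurable_restrictT _ mD).1 mi; move: (mD).
apply: (eq_measurable_fun (of_pair \o (fun x =>
  (((fun y => complex.Re (f y)) \_ D) x, ((fun y => complex.Im (f y)) \_ D) x)))).
  by move=> x /= xD; rewrite !patchE xD; case: (f x).
apply: measurable_funTS; apply: (measurableT_comp measurable_of_pair).
exact/measurable_fun_pair.
Qed.

Lemma measurable_cM D f g :
  measurable_fun D f -> measurable_fun D g -> measurable_fun D (f \* g).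
Proof.
move=> /measurable_cE[fr fi] /measurable_cE[gr gi]; apply/measurable_cE; split.
  rewrite (_ : (fun x => _) = fun x => complex.Re (f x) * complex.Re (g x) -
     complex.Im (f x) * complex.Im (g x)); last by apply/funext => x; rewrite ReM.
  by apply: measurable_funB; apply: measurable_funM.
rewrite (_ : (fun x => _) = fun x => complex.Re (f x) * complex.Im (g x) +
   complex.Im (f x) * complex.Re (g x)); last by apply/funext => x; rewrite ImM.
by apply: measurable_funD; apply: measurable_funM.
Qed.

Lemma measurable_cD D f g :
  measurable_fun D f -> measurable_fun D g -> measurable_fun D (f \+ g).
Proof.
move=> /measurable_cE[fr fi] /measurable_cE[gr gi]; apply/measurable_cE; split.
  rewrite (_ : (fun x => _) = fun x => complex.Re (f x) + complex.Re (g x)).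
    exact: measurable_funD.
  by apply/funext => x; rewrite ReD.
rewrite (_ : (fun x => _) = fun x => complex.Im (f x) + complex.Im (g x)).
  exact: measurable_funD.
by apply/funext => x; rewrite ImD.
Qed.

Lemma measurable_cX D f n :
  measurable_fun D f -> measurable_fun D (fun x => f x ^+ n).
Proof.
move=> mf; elim: n => [|n IH].
  by under eq_fun do rewrite expr0; exact: measurable_cst.
by under eq_fun do rewrite exprS; exact: measurable_cM.
Qed.

Lemma measurable_csum D (F : nat -> T -> R[i]) n :
  (forall k, measurable_fun D (F k)) ->
  measurable_fun D (fun x => \sum_(k < n) F k x).
Proof.
move=> mF; elim: n => [|n IH].
  by under eq_fun do rewrite big_ord0; exact: measurable_cst.
by under eq_fun do rewrite big_ord_recr /=; exact: measurable_cD.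
Qed.

Lemma measurable_cconj D f :
  measurable_fun D f -> measurable_fun D (fun x => (f x)^*).
Proof.
move=> /measurable_cE[fr fi]; apply/measurable_cE; split.
  by rewrite (_ : (fun x => _) = fun x => complex.Re (f x)) //; apply/funext => x; case: (f x).
rewrite (_ : (fun x => _) = \- (fun x => complex.Im (f x))); last by apply/funext => x /=; case: (f x).
exact: measurableT_comp fi.
Qed.

Lemma measurable_creal D (f : T -> R) :
  measurable_fun D f -> measurable_fun D (fun x => (f x)%:C).
Proof. by move=> mf; apply/measurable_cE; split => //=; exact: measurable_cst. Qed.

Lemma measurable_cnorm D f :
  measurable_fun D f -> measurable_fun D (fun x => normc (f x)).
Proof. by move=> mf; exact: (measurableT_comp measurable_normc mf). Qed.

Lemma measurable_cV D f :
  measurable_fun D f -> measurable_fun D (fun x => (f x)^-1).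
Proof.
move=> mf; rewrite (_ : (fun x => _) =
  ((fun x => (f x)^*) \* (fun x => ((normc (f x) ^+ 2)^-1)%:C))); last first.
  apply/funext => x /=; have [->|f0] := eqVneq (f x) 0.
    by rewrite invr0 conjc0 mul0r.
  apply: (mulfI f0); rewrite mulfV // mulrA mulc_conj -real_complexM mulfV //.
  by rewrite expf_neq0 // gt_eqF // normc_gt0.
apply: measurable_cM; first exact: measurable_cconj.
apply: measurable_creal; under eq_fun do rewrite -powR_inv1 ?sqr_ge0 //.
apply: (measurableT_comp (@measurable_powR R _)).
by apply: measurable_funX; exact: measurable_cnorm.
Qed.

End complex_measurable_functions.

(** * Complex sequences and integrals *)

Section complex_sequences.
Context {R : realType}.
Implicit Types (u v : nat -> R[i]) (l : R[i]).

(** Convergence in modulus, so that real estimates apply directly. *)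
Definition cto u l := (fun n => normc (u n - l)) @ \oo --> (0 : R).

Lemma cto_le u l (e : nat -> R) : (forall n, normc (u n - l) <= e n) ->
  e @ \oo --> 0 -> cto u l.
Proof.
move=> ue e0; apply: (squeeze_cvgr _ (@cvg_cst _ 0 _ _ _) e0).
by apply: nearW => n; rewrite normc_ge0 ue.
Qed.

Lemma cvg0_le (u e : nat -> R) (l : R) : (forall n, `|u n - l| <= e n) ->
  e @ \oo --> 0 -> u @ \oo --> l.
Proof.
move=> ue e0; apply/subr_cvg0; apply/norm_cvg0P.
apply: (squeeze_cvgr _ (@cvg_cst _ 0 _ _ _) e0).
by apply: nearW => n /=; rewrite normr_ge0 ue.
Qed.

Lemma cto_ReIm u l : cto u l <->
  (fun n => complex.Re (u n)) @ \oo --> complex.Re l /\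
  (fun n => complex.Im (u n)) @ \oo --> complex.Im l.
Proof.
split=> [ul|[ur ui]].
  by split; apply: cvg0_le ul => n;
    [rewrite -ReN -ReD le_normc_Re | rewrite -ImN -ImD le_normc_Im].
have h : (fun n => `|complex.Re (u n) - complex.Re l| +
                   `|complex.Im (u n) - complex.Im l|) @ \oo --> (0 : R).
  rewrite -[0 in X in _ --> X](addr0 0); apply: cvgD.
    by apply/norm_cvg0P; exact/subr_cvg0.
  by apply/norm_cvg0P; exact/subr_cvg0.
by apply: cto_le h => n; rewrite -ReN -ImN -ReD -ImD normc_le_ReIm.
Qed.

Lemma cto_unique u l1 l2 : cto u l1 -> cto u l2 -> l1 = l2.
Proof.
move=> /cto_ReIm[a b] /cto_ReIm[c d].
by apply: complexP; [apply: (cvg_unique _ a c) | apply: (cvg_unique _ b d)].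
Qed.

Lemma cto_cst l : cto (fun=> l) l.
Proof. by apply: (@cto_le _ _ (fun=> 0)); [move=> n; rewrite subrr normc0|exact: cvg_cst]. Qed.

Lemma cto_eq u v l : u =1 v -> cto u l -> cto v l.
Proof. by move=> uv; rewrite /cto; under eq_fun do rewrite uv. Qed.

Lemma ctoD u v l1 l2 : cto u l1 -> cto v l2 -> cto (fun n => u n + v n) (l1 + l2).
Proof.
move=> a b; apply: (@cto_le _ _ (fun n => normc (u n - l1) + normc (v n - l2))).
  by move=> n; rewrite opprD addrACA le_normcD.
by rewrite -[0 in X in _ --> X](addr0 0); exact: cvgD.
Qed.

Lemma cto_norm u l : cto u l -> (fun n => normc (u n)) @ \oo --> normc l.
Proof.
apply: cvg0_le => n.
have h a b : normc a - normc b <= normc (a - b).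
  by rewrite lerBlDr (le_trans _ (le_normcD _ _)) // subrK.
by rewrite ler_norml h andbT lerNl opprB normcB h.
Qed.

Lemma ctoM u v l1 l2 : cto u l1 -> cto v l2 -> cto (fun n => u n * v n) (l1 * l2).
Proof.
move=> a b; apply: (@cto_le _ _ (fun n => normc (u n - l1) * normc (v n) +
   normc l1 * normc (v n - l2))).
  move=> n; rewrite -!normcM; apply: le_trans (le_normcD _ _).
  by rewrite le_eqVlt; apply/orP; left; apply/eqP; congr normc; ring.
rewrite -[0 in X in _ --> X](addr0 0); apply: cvgD.
  by rewrite -(mul0r (normc l2)); apply: cvgM => //; exact: cto_norm.
by rewrite -(mulr0 (normc l1)); apply: cvgM => //; exact: cvg_cst.
Qed.

Lemma ctoZ u l c : cto u l -> cto (fun n => c * u n) (c * l).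
Proof. by apply: ctoM; exact: cto_cst. Qed.

End complex_sequences.

Section complex_integral.
Context {d} {T : measurableType d} {R : realType}.
Variables (nu : {measure set T -> \bar R}) (D : set T).
Hypothesis mD : measurable D.
Implicit Types f g : T -> R[i].

Lemma cintegrableP f : cintegrable nu D f <->
  measurable_fun D f /\ nu.-integrable D (EFin \o (fun x => normc (f x))).
Proof.
split=> [[fr fi]|[mf nf]].
  have mf : measurable_fun D f.
    by apply/measurable_cE; split; apply/measurable_EFinP;
       [exact: (measurable_int _ fr) | exact: (measurable_int _ fi)].
  split=> //; have := integrableD mD (integrable_abse fr) (integrable_abse fi).
  apply: le_integrable => //.
    by apply/measurable_EFinP; exact: measurable_cnorm.
  move=> x Dx /=; rewrite lee_fin ger0_norm ?normc_ge0 //.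
  by rewrite (le_trans (normc_le_ReIm _)) // ler_norm.
move/measurable_cE : (mf) => [mr mi].
split; (apply: le_integrable nf => //; first exact/measurable_EFinP);
  move=> x Dx /=; rewrite lee_fin (ger0_norm (normc_ge0 _)).
  exact: le_normc_Re.
exact: le_normc_Im.
Qed.

Lemma cintegrable_le f (g : T -> R) : measurable_fun D f ->
  nu.-integrable D (EFin \o g) -> (forall x, D x -> normc (f x) <= g x) ->
  cintegrable nu D f.
Proof.
move=> mf ig fg; apply/cintegrableP; split => //.
apply: le_integrable ig => //; first by apply/measurable_EFinP/measurable_cnorm.
move=> x Dx /=; rewrite lee_fin ger0_norm ?normc_ge0 //.
by rewrite (le_trans (fg _ Dx)) // ler_norm.
Qed.

Lemma eq_cintegral f g : {in D, f =1 g} -> cintegral nu D f = cintegral nu D g.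
Proof. by move=> fg; congr (_ +i* _); apply: eq_Rintegral => x xD; rewrite fg. Qed.

Lemma eq_cintegrable f g : {in D, f =1 g} -> cintegrable nu D f -> cintegrable nu D g.
Proof.
by move=> fg [a b]; split; [apply: eq_integrable a|apply: eq_integrable b] => //
  x xD; rewrite fg.
Qed.

Lemma cintegrableD f g : cintegrable nu D f -> cintegrable nu D g ->
  cintegrable nu D (f \+ g).
Proof.
move=> [a b] [c e]; split.
  by under eq_fun do rewrite ReD EFinD; exact: integrableD.
by under eq_fun do rewrite ImD EFinD; exact: integrableD.
Qed.

Lemma cintegrableZ c f : cintegrable nu D f -> cintegrable nu D (fun x => c * f x).
Proof.
move=> [a b]; split.
  under eq_fun do rewrite ReM EFinB !EFinM.
  by apply: integrableB => //; exact: integrableZl.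
under eq_fun do rewrite ImM EFinD !EFinM.
by apply: integrableD => //; exact: integrableZl.
Qed.

Lemma cintegralD f g : cintegrable nu D f -> cintegrable nu D g ->
  cintegral nu D (f \+ g) = cintegral nu D f + cintegral nu D g.
Proof.
move=> [a b] [c e]; rewrite /cintegral; apply: complexP => /=.
  by under eq_Rintegral do rewrite ReD; exact: RintegralD.
by under eq_Rintegral do rewrite ImD; exact: RintegralD.
Qed.

Lemma cintegralZ c f : cintegrable nu D f ->
  cintegral nu D (fun x => c * f x) = c * cintegral nu D f.
Proof.
move=> [a b]; rewrite /cintegral; apply: complexP => /=.
  under eq_Rintegral do rewrite ReM.
  rewrite RintegralB //; [|exact: (integrableZl mD _ a)|exact: (integrableZl mD _ b)].
  by rewrite !RintegralZl // ReM.
under eq_Rintegral do rewrite ImM.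
rewrite RintegralD //; [|exact: (integrableZl mD _ b)|exact: (integrableZl mD _ a)].
by rewrite !RintegralZl // ImM.
Qed.

Lemma cintegral0 : cintegral nu D (fun=> 0) = 0.
Proof.
by rewrite /cintegral; apply: complexP => /=; rewrite Rintegral_cst //= mul0r.
Qed.

Lemma cintegrable0 : cintegrable nu D (fun=> 0).
Proof. by split; exact: integrable0. Qed.

Lemma cintegrable_sum (F : nat -> T -> R[i]) n :
  (forall k, cintegrable nu D (F k)) ->
  cintegrable nu D (fun x => \sum_(k < n) F k x).
Proof.
move=> iF; elim: n => [|n IH].
  by under eq_fun do rewrite big_ord0; exact: cintegrable0.
by under eq_fun do rewrite big_ord_recr /=; exact: cintegrableD.
Qed.

Lemma cintegral_sum (F : nat -> T -> R[i]) n :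
  (forall k, cintegrable nu D (F k)) ->
  cintegral nu D (fun x => \sum_(k < n) F k x) = \sum_(k < n) cintegral nu D (F k).
Proof.
move=> iF; elim: n => [|n IH].
  by under eq_fun do rewrite big_ord0; rewrite cintegral0 big_ord0.
under eq_fun do rewrite big_ord_recr /=.
by rewrite cintegralD // ?IH ?big_ord_recr //; exact: cintegrable_sum.
Qed.

Lemma le_normc_cintegral f : cintegrable nu D f ->
  normc (cintegral nu D f) <= \int[nu]_(x in D) normc (f x).
Proof.
move=> fi; set I := cintegral nu D f.
have [I0|I0] := eqVneq (normc I) 0.
  by rewrite I0; apply: Rintegral_ge0 => x _; exact: normc_ge0.
have nI : 0 < normc I by rewrite lt_neqAle eq_sym I0 normc_ge0.
have [_ inf] := (cintegrableP f).1 fi.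
have key : normc I ^+ 2 <= normc I * \int[nu]_(x in D) normc (f x).
  have <- : \int[nu]_(x in D) complex.Re (I^* * f x) = normc I ^+ 2.
    have := cintegralZ I^* fi; rewrite -/I mulrC mulc_conj.
    by move/(congr1 (@complex.Re R)).
  have [ire _] := cintegrableZ I^* fi.
  rewrite -RintegralZl //; apply: le_Rintegral => //.
    exact: (integrableZl mD _ inf).
  move=> x Dx. rewrite -(normc_conj I) -normcM.
  by rewrite (le_trans _ (le_normc_Re _)) // ler_norm.
by rewrite -(ler_pM2l nI) -expr2.
Qed.

(** Dominated convergence, applied to the real and imaginary parts. *)
Lemma cintegral_cvg (F : nat -> T -> R[i]) f (g : T -> R) :
  (forall n, measurable_fun D (F n)) ->
  (forall x, D x -> cto (F ^~ x) (f x)) ->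
  nu.-integrable D (EFin \o g) ->
  (forall n x, D x -> normc (F n x) <= g x) ->
  [/\ cintegrable nu D f, (forall n, cintegrable nu D (F n)) &
     cto (fun n => cintegral nu D (F n)) (cintegral nu D f)].
Proof.
move=> mF Ff ig Fg.
have iF n : cintegrable nu D (F n) by apply: cintegrable_le ig _ => //; exact: Fg.
have h (P : R[i] -> R) : measurable_fun [set: R[i]] P ->
    (forall z, `|P z| <= normc z) ->
    (forall x, D x -> (fun n => P (F n x)) @ \oo --> P (f x)) ->
    nu.-integrable D (fun x => (P (f x))%:E) /\
    (fun n => \int[nu]_(x in D) P (F n x)) @ \oo --> \int[nu]_(x in D) P (f x).
  move=> mP Pn PF.
  have mPF n : measurable_fun D (fun x => (P (F n x))%:E).
    by apply/measurable_EFinP; exact: measurableT_comp mP (mF n).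
  have cPF x : D x -> (fun n => (P (F n x))%:E) @ \oo --> (P (f x))%:E.
    by move=> Dx; apply: cvg_EFin; [exact: nearW|exact: PF].
  have mPf : measurable_fun D (fun x => (P (f x))%:E).
    by apply: (emeasurable_fun_cvg (fun n x => (P (F n x))%:E)).
  have [] := @dominated_convergence _ _ _ nu D mD
    (fun n x => (P (F n x))%:E) (fun x => (P (f x))%:E) (EFin \o g) mPF mPf.
  - by apply: aeW => x Dx; exact: cPF.
  - by [].
  - by apply: aeW => x n Dx; rewrite lee_fin (le_trans (Pn _)) // Fg.
  move=> iPf _ cv; split => //.
  by apply: fine_cvg; rewrite fineK // integrable_fin_num.
have [ir cr] := h _ measurable_Re le_normc_Re (fun x Dx => ((cto_ReIm _ _).1 (Ff x Dx)).1).
have [ii ci] := h _ measurable_Im le_normc_Im (fun x Dx => ((cto_ReIm _ _).1 (Ff x Dx)).2).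
by split => //; apply/cto_ReIm.
Qed.

End complex_integral.

(** * Derivation rules and the area of a disc *)

Section derivative_rules.
Context {R : realType}.
Implicit Types (f g : R -> R) (x a b : R).

Lemma dcst (c x : R) : is_derive x 1 (fun=> c) 0.
Proof. exact: is_derive_cst. Qed.

Lemma did x : is_derive x 1 (fun y => y) 1.
Proof. exact: is_derive_id. Qed.

Lemma dD f g x a b : is_derive x 1 f a -> is_derive x 1 g b ->
  is_derive x 1 (fun y => f y + g y) (a + b).
Proof. by move=> ? ?; exact: is_deriveD. Qed.

Lemma dB f g x a b : is_derive x 1 f a -> is_derive x 1 g b ->
  is_derive x 1 (fun y => f y - g y) (a - b).
Proof. by move=> ? ?; exact: is_deriveB. Qed.

Lemma dM f g x a b : is_derive x 1 f a -> is_derive x 1 g b ->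
  is_derive x 1 (fun y => f y * g y) (f x * b + g x * a).
Proof. by move=> ? ?; exact: is_deriveM. Qed.

Lemma dcomp f g x a b : is_derive (f x) 1 g b -> is_derive x 1 f a ->
  is_derive x 1 (fun y => g (f y)) (b * a).
Proof. by move=> ? ?; exact: is_derive1_comp. Qed.

Lemma dV f x a : f x != 0 -> is_derive x 1 f a ->
  is_derive x 1 (fun y => (f y)^-1) (- a / f x ^+ 2).
Proof.
move=> fx fa; apply: (is_derive_eq (is_deriveV fx fa)).
by rewrite /GRing.scale /= mulrC mulrN mulNr.
Qed.

Lemma ccomp f g x : {for x, continuous f} -> {for f x, continuous g} ->
  {for x, continuous (fun y => g (f y))}.
Proof. exact: continuous_comp. Qed.

End derivative_rules.

Section disc_area.
Context {R : realType}.
Local Notation leb := (@lebesgue_measure R).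

(** A primitive that stays continuous at the end points is obtained by writing the
    arcsine as an arctangent of the half-angle. *)
Lemma integral_halfcircle (r : R) : 0 < r ->
  (\int[leb]_(x in `[(- r)%R, r]) (2 * Num.sqrt (r ^+ 2 - x ^+ 2))%:E =
    (pi * r ^+ 2)%:E)%E.
Proof.
move=> r0.
pose s (x : R) : R := Num.sqrt (r ^+ 2 - x ^+ 2).
pose F (x : R) : R := x * s x + 2 * r ^+ 2 * atan (x / (r + s x)).
have rs (x : R) : 0 < r + s x by rewrite ltr_pwDl // sqrtr_ge0.
have cs : continuous s.
  move=> x; apply: (@ccomp _ (fun x => r ^+ 2 - x ^+ 2) Num.sqrt).
    by apply: cvgB; [exact: cvg_cst|exact: exprn_continuous].
  exact: sqrt_continuous.
have cF : continuous F.
  move=> x; apply: cvgD; first by apply: cvgM => //; exact: cs.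
  apply: cvgM; first exact: cvg_cst.
  apply: (@ccomp _ (fun x => x / (r + s x)) atan); last exact: continuous_atan.
  apply: cvgM; first exact: cvg_id.
  apply: cvgV; first by rewrite gt_eqF.
  by apply: cvgD; [exact: cvg_cst|exact: cs].
have dF (x : R) : x \in `](- r), r[ -> is_derive x 1 F (2 * s x).
  rewrite in_itv /= => /andP[xl xr].
  have h : 0 < r ^+ 2 - x ^+ 2 by rewrite subr_sqr mulr_gt0 //; lra.
  have s0 : 0 < s x by rewrite sqrtr_gt0.
  have s2 : s x ^+ 2 = r ^+ 2 - x ^+ 2 by rewrite sqr_sqrtr // ltW.
  have ds : is_derive x 1 s (- x / s x).
    have d1 : is_derive x 1 (fun y : R => r ^+ 2 - y ^+ 2) (0 - (x * 1 + x * 1)).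
      exact: dB (dcst _ _) (dM (did _) (did _)).
    apply: (is_derive_eq (@dcomp _ (fun y => r ^+ 2 - y ^+ 2) Num.sqrt _ _ _
      (is_derive1_sqrt h) d1)).
    by rewrite -/(s x); field; rewrite gt_eqF.
  have d2 : is_derive x 1 (fun y : R => (r + s y)^-1) (- (0 + - x / s x) / (r + s x) ^+ 2).
    by apply: (@dV _ (fun y => r + s y)); rewrite gt_eqF.
  have d3 := @dcomp _ (fun y => y / (r + s y)) atan _ _ _ (is_derive1_atan _)
    (dM (did x) d2).
  apply: (is_derive_eq (dD (dM (did x) ds) (dM (dcst (2 * r ^+ 2) x) d3))).
  have e : 1 + (x / (r + s x)) ^+ 2 = 2 * r / (r + s x).
    have -> : 1 + (x / (r + s x)) ^+ 2 = ((r + s x) ^+ 2 + x ^+ 2) / (r + s x) ^+ 2.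
      by field; rewrite gt_eqF.
    have -> : (r + s x) ^+ 2 + x ^+ 2 = 2 * r * (r + s x) by rewrite sqrrD s2; ring.
    by field; rewrite gt_eqF.
  rewrite e.
  have x2 : x * x = r ^+ 2 - s x ^+ 2 by rewrite s2; ring.
  transitivity (s x - (x * x) / s x + r * (1 + (x * x) / (s x * (r + s x)))).
    by field; rewrite !gt_eqF.
  by rewrite x2; field; rewrite !gt_eqF.
rewrite (@continuous_FTC2 _ (fun x => 2 * s x) F).
- rewrite -EFinB /F /s sqrrN subrr sqrtr0 !mulr0 !addr0 !add0r mulNr divff ?gt_eqF //.
  by rewrite atanN atan1; congr (_%:E); field.
- by rewrite gtrN.
- by apply: continuous_subspaceT => x; apply: cvgM; [exact: cvg_cst|exact: cs].
- split.
  + by move=> x xr; have [] := dF x xr.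
  + by apply: cvg_at_right_filter; exact: cF.
  + by apply: cvg_at_left_filter; exact: cF.
- by move=> x xr; rewrite derive1E; have [] := dF x xr.
Qed.

Local Notation leb2 := (leb \x leb)%E.

(** The vertical section at [x] is a segment of length [2 * sqrt (t - x ^ 2)]. *)
Lemma lebesgue_closed_disc (t : R) : 0 < t ->
  leb2 [set x | x.1 ^+ 2 + x.2 ^+ 2 <= t] = (pi * t)%:E.
Proof.
move=> t0; have r0 : 0 < Num.sqrt t by rewrite sqrtr_gt0.
have t2 : Num.sqrt t ^+ 2 = t by rewrite sqr_sqrtr // ltW.
rewrite -{2}t2 -integral_halfcircle // t2 [RHS]integral_mkcond.
apply: eq_integral => x _; rewrite [LHS]/= /xsection.
rewrite patchE (_ : (x \in _) = (- Num.sqrt t <= x <= Num.sqrt t)); last first.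
  by apply/idP/idP; rewrite inE /= in_itv.
rewrite -ler_norml -ler_sqr ?nnegrE ?sqrtr_ge0 // t2.
rewrite -normrX (ger0_norm (sqr_ge0 _)); case: leP => xt.
  rewrite (_ : [set _ | _] = `[(- Num.sqrt (t - x ^+ 2))%R, Num.sqrt (t - x ^+ 2)]%classic).
    rewrite lebesgue_measure_itv /= lte_fin -EFinB; case: ltP => [_|h].
      by congr (_%:E); ring.
    have : Num.sqrt (t - x ^+ 2) = 0.
      by apply/eqP; rewrite eq_le sqrtr_ge0 andbT; move: h; set u := Num.sqrt _; lra.
    by move=> ->; rewrite mulr0.
  apply/seteqP; split => y /=; rewrite inE /= in_itv /= -ler_norml.
    move=> h; rewrite -ler_sqr ?nnegrE ?sqrtr_ge0 // sqr_sqrtr ?subr_ge0 //.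
    by rewrite -normrX (ger0_norm (sqr_ge0 _)) lerBrDl.
  rewrite -ler_sqr ?nnegrE ?sqrtr_ge0 // sqr_sqrtr ?subr_ge0 //.
  by rewrite -normrX (ger0_norm (sqr_ge0 _)) lerBrDl.
rewrite (_ : [set _ | _] = set0) ?measure0 // -subset0 => y /=; rewrite inE /=.
by rewrite leNgt (lt_le_trans xt) // lerDl sqr_ge0.
Qed.

End disc_area.

(** * Rotations and the radial law of the area *)

Section plane_invariance.
Context {R : realType}.
Local Notation leb := (@lebesgue_measure R).
Local Notation leb2 := (leb \x leb)%E.

Lemma lebesgue_translate (c : R) (A : set R) : measurable A ->
  leb ((fun y => y + c) @^-1` A) = leb A.
Proof.
have mc : measurable_fun [set: R] ((fun y => y + c) : R -> measurableTypeR R).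
  exact: measurable_funD.
move=> mA; suff : pushforward leb ((fun y => y + c) : R -> measurableTypeR R) A = leb A by [].
apply/esym/lebesgue_measure_unique => //= _ [[a b]] _ <-; rewrite /pushforward /=.
rewrite (_ : _ @^-1` _ = `]a - c, b - c]%classic); last first.
  by apply/seteqP; split => y /=; rewrite !in_itv /= ltrBlDr lerBrDr.
by rewrite !lebesgue_measure_itv /= !lte_fin ltrD2r -!EFinB opprB addrA subrK.
Qed.

Lemma leb2_shear2 (c : R) (A : set (R * R)) : measurable A ->
  leb2 ((fun p => (p.1, p.2 + c * p.1)) @^-1` A) = leb2 A.
Proof.
move=> mA; apply: eq_integral => x _; rewrite [LHS]/= [RHS]/=.
rewrite -[RHS](lebesgue_translate (c * x)); last exact: measurable_xsection.
by congr (leb _); apply/seteqP; split => y /=; rewrite /xsection /= !inE.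
Qed.

Lemma leb2_swap (A : set (R * R)) : measurable A -> leb2 A = (leb \x^ leb)%E A.
Proof.
move=> mA; apply: (@product_measure_unique _ _ _ _ _ leb leb (leb \x^ leb)%E) => //.
by move=> B C mB mC /=; rewrite product_measure2E.
Qed.

Lemma measurable_shear1 (c : R) :
  measurable_fun [set: R * R] (fun p : R * R => (p.1 + c * p.2, p.2)).
Proof.
apply: measurable_fun_pair; last exact: measurable_snd.
by apply: measurable_funD; [exact: measurable_fst|exact: measurable_funM measurable_snd].
Qed.

Lemma measurable_shear2 (c : R) :
  measurable_fun [set: R * R] (fun p : R * R => (p.1, p.2 + c * p.1)).
Proof.
apply: measurable_fun_pair; first exact: measurable_fst.
by apply: measurable_funD; [exact: measurable_snd|exact: measurable_funM measurable_fst].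
Qed.

Lemma leb2_shear1 (c : R) (A : set (R * R)) : measurable A ->
  leb2 ((fun p => (p.1 + c * p.2, p.2)) @^-1` A) = leb2 A.
Proof.
move=> mA; have mS : measurable ((fun p : R * R => (p.1 + c * p.2, p.2)) @^-1` A).
  by rewrite -[X in measurable X]setTI; exact: measurable_shear1.
rewrite !leb2_swap //.
apply: eq_integral => y _; rewrite [LHS]/= [RHS]/=.
rewrite -[RHS](lebesgue_translate (c * y)); last exact: measurable_ysection.
by congr (leb _); apply/seteqP; split => x /=; rewrite /ysection /= !inE.
Qed.

(** A rotation other than the half-turn is a product of three shears. *)
Lemma leb2_rotation (c s : R) (A : set (R * R)) : c ^+ 2 + s ^+ 2 = 1 ->
  1 + c != 0 -> measurable A ->
  leb2 ((fun p => (c * p.1 - s * p.2, s * p.1 + c * p.2)) @^-1` A) = leb2 A.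
Proof.
move=> cs c1 mA; pose k := s / (1 + c).
have mpre (f : R * R -> R * R) (B : set (R * R)) : measurable_fun setT f ->
    measurable B -> measurable (f @^-1` B).
  by move=> mf mB; rewrite -[X in measurable X]setTI; exact: mf.
have m1 := mpre _ _ (measurable_shear1 (- k)) mA.
have m2 := mpre _ _ (measurable_shear2 s) m1.
apply: etrans (leb2_shear1 (- k) mA); apply: etrans (leb2_shear2 s m1).
apply: etrans (leb2_shear1 (- k) m2); congr (leb2 _).
have s2 : s ^+ 2 = 1 - c ^+ 2 by rewrite -cs; ring.
have ks : k * s = 1 - c.
  by rewrite /k mulrAC -expr2 s2; field.
have kc : k * (1 + c) = s by rewrite /k mulfVK.
apply/funext => -[x y]; rewrite /preimage /mkset /=.
suff -> : (c * x - s * y, s * x + c * y) = 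
  (x + - k * y + - k * (y + s * (x + - k * y)), y + s * (x + - k * y)) by [].
congr pair.
  transitivity ((1 - k * s) * x + (- k - k + k * (k * s)) * y); last by ring.
  by rewrite ks; transitivity (c * x - (k * (1 + c)) * y); [rewrite kc|ring].
transitivity (s * x + (1 - k * s) * y); last by ring.
by rewrite ks; ring.
Qed.

End plane_invariance.

Section area_properties.
Context {R : realType}.
Local Notation leb := (@lebesgue_measure R).
Local Notation leb2 := (leb \x leb)%E.

Lemma measurable_preimage_of_pair (A : set R[i]) :
  measurable A -> measurable (of_pair @^-1` A).
Proof. by move=> mA; rewrite -[X in measurable X]setTI; exact: measurable_of_pair. Qed.

Lemma measurable_mulc (u : R[i]) : measurable_fun [set: R[i]] (fun z => u * z).
Proof. by apply: measurable_cM; [exact: measurable_cst|exact: measurable_id]. Qed.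

Lemma area_rotation (u : R[i]) (A : set R[i]) : normc u = 1 -> u != -1 ->
  measurable A -> area ((fun z => u * z) @^-1` A) = area A.
Proof.
case: u => c s u1 um1 mA; rewrite /area; congr (_ * _)%E.
have cs : c ^+ 2 + s ^+ 2 = 1.
  by have := sqr_normc (c +i* s); rewrite u1 expr1n => <-.
have c1 : 1 + c != 0; last first.
  apply: etrans (leb2_rotation cs c1 (measurable_preimage_of_pair mA)).
  congr (leb2 _); apply/funext => -[x y]; rewrite /preimage /mkset /of_pair /=.
  congr (A _); apply/eqP; rewrite eq_complex /=; apply/andP.
  by split; apply/eqP; ring.
apply/eqP => c1; have c1' : c = -1 by apply/eqP; rewrite -subr_eq0 opprK addrC; apply/eqP.
move: cs; rewrite c1' sqrrN expr1n => /eqP; rewrite -subr_eq0 addrAC subrr add0r.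
by rewrite expf_eq0 /= => /eqP s0; move: um1; rewrite c1' s0 eq_complex /= oppr0 !eqxx.
Qed.

Definition closed_disc (t : R) : set R[i] := [set z | normc z ^+ 2 <= t].

Lemma measurable_sqr_normc : measurable_fun [set: R[i]] (fun z : R[i] => normc z ^+ 2).
Proof. exact: measurable_funX measurable_normc. Qed.

Lemma measurable_closed_disc t : measurable (closed_disc t).
Proof.
rewrite (_ : closed_disc t = (fun z : R[i] => normc z ^+ 2) @^-1` `]-oo, t]).
  by rewrite -[X in measurable X]setTI; exact: measurable_sqr_normc.
by apply/seteqP; split => z /=; rewrite in_itv.
Qed.

Lemma area_closed_disc_gt0 (t : R) : 0 < t -> area (closed_disc t) = t%:E.
Proof.
move=> t0; rewrite /area (_ : _ @^-1` _ = [set x | x.1 ^+ 2 + x.2 ^+ 2 <= t]).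
  rewrite lebesgue_closed_disc // -EFinM mulrA mulVf ?mul1r // gt_eqF //.
  exact: pi_gt0.
by apply/funext => p; rewrite /preimage /closed_disc /mkset sqr_normc.
Qed.

Lemma area_closed_disc (t : R) : area (closed_disc t) = (Num.max 0 t)%:E.
Proof.
case: (ltP 0 t) => t0; first exact: area_closed_disc_gt0.
apply/eqP; rewrite eq_le measure_ge0 andbT; apply/lee_addgt0Pr => e e0.
rewrite add0e -(area_closed_disc_gt0 e0); apply: le_measure;
  rewrite ?inE; [exact: measurable_closed_disc..|].
by move=> z; rewrite /closed_disc /= => h; apply: le_trans h (le_trans t0 (ltW e0)).
Qed.

Lemma area_sigma_finite : sigma_finite setT (@area R).
Proof.
exists (fun n => closed_disc n.+1%:R).
  apply/seteqP; split => z // _.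
  have [n nz] : exists n, normc z ^+ 2 <= n.+1%:R.
    exists (Num.truncn (normc z ^+ 2)); apply: ltW; exact: truncnS_gt.
  by exists n.
move=> n; split; first exact: measurable_closed_disc.
by rewrite area_closed_disc ltry.
Qed.

HB.instance Definition _ := Measure_isSigmaFinite.Build _ _ _ (@area R)
  area_sigma_finite.

Let rho (z : R[i]) : measurableTypeR R := normc z ^+ 2.

Let mrho : measurable_fun [set: R[i]] rho.
Proof. exact: measurable_sqr_normc. Qed.

Let mNy0 : measurable (`]-oo, 0]%classic : set (measurableTypeR R)).
Proof. exact: measurable_itv. Qed.

(** The area of a disc is the square of its radius, so the law of [normc z ^+ 2]
    agrees with Lebesgue measure on the intervals of the positive half-line. Adding
    Lebesgue measure on the negative half-line gives a measure to which the uniqueness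
    of Lebesgue measure applies. *)
Lemma area_law (A : set R) : measurable A -> A `<=` `]0, +oo[%classic ->
  area (rho @^-1` A) = leb A.
Proof.
move=> mA A0.
have [nu1 nu1E] : exists nu1 : {measure set (measurableTypeR R) -> \bar R},
    forall A, nu1 A = area (rho @^-1` A).
  by unshelve (exists (pushforward area rho)).
pose nu := measure_add nu1 (mrestr leb mNy0).
have nuE B : nu B = (area (rho @^-1` B) + leb (B `&` `]-oo, 0%R]%classic))%E.
  by rewrite /nu measure_addE nu1E.
have -> : leb A = nu A.
  apply: lebesgue_measure_unique => // _ [[a b]] _ <-; apply: etrans (esym (nuE _)).
  have [ab|ba] := ltP a b; last first.
    have -> : `](a, b).1, (a, b).2]%classic = set0 :> set R.
      by rewrite set_itv_ge // bnd_simp -leNgt.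
    by rewrite preimage_set0 set0I !measure0 adde0.
  have aD : area (rho @^-1` `]a, b]) = (Num.max 0 b - Num.max 0 a)%:E.
    have -> : rho @^-1` `]a, b] = closed_disc b `\` closed_disc a.
      apply/seteqP; split => z; rewrite /closed_disc /= in_itv /=.
        by move=> /andP[h ->]; split => //; apply/negP; rewrite -ltNge.
      by move=> [-> /negP]; rewrite -ltNge => ->.
    rewrite EFinB -!area_closed_disc.
    transitivity (area (closed_disc b) - area (closed_disc b `&` closed_disc a))%E.
      apply: measureD; [exact: measurable_closed_disc..|].
      by apply: (@le_lt_trans _ _ (Num.max 0 b)%:E); rewrite ?ltry // -area_closed_disc.
    by congr (_ - area _)%E; apply: setIidr => z; rewrite /closed_disc /= => h;
      exact: le_trans h (ltW ab).
  have lD : leb (`]a, b]%classic `&` `]-oo, 0]%classic) = (Num.min b 0 - Num.min a 0)%:E.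
    rewrite (_ : _ `&` _ = `]a, Num.min b 0]%classic); last first.
      apply/seteqP; split => x /=; rewrite !in_itv /= le_min.
        by move=> [/andP[-> ->] ->].
      by move=> /andP[-> /andP[-> ->]].
    rewrite lebesgue_measure_itv /= lte_fin -EFinB lt_min ab /=.
    case: ifP => [a0|/negbT]; first by rewrite (min_l (ltW a0)).
    by rewrite -leNgt => a0; rewrite (min_r a0) (min_r (le_trans a0 (ltW ab))) subrr.
  rewrite aD lD lebesgue_measure_itv /= lte_fin ab -EFinB -EFinD; congr (_%:E).
  have h (x : R) : Num.max 0 x + Num.min x 0 = x.
    by rewrite maxC; case: (leP x 0); rewrite ?add0r ?addr0.
  by rewrite -{1}(h b) -{1}(h a); ring.
rewrite nuE (_ : A `&` _ = set0) ?measure0 ?adde0 // -subset0 => x [/A0] /=.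
by rewrite !in_itv /= andbT => x0; rewrite leNgt x0.
Qed.

Lemma pdiscE : pdisc = rho @^-1` `]0, 1[.
Proof.
apply/seteqP; split => z /=; rewrite /pdisc /disc /= in_itv /=.
  move=> [z1 /eqP z0]; rewrite exprn_gt0 ?normc_gt0 //=.
  by rewrite expr_lt1 ?normc_ge0.
move=> /andP[z0]; rewrite expr_lt1 ?normc_ge0 // => z1; split => // /eqP zz.
by move: z0; rewrite /rho (eqP zz) normc0 expr0n ltxx.
Qed.

Lemma measurable_pdisc : measurable (@pdisc R).
Proof.
by rewrite pdiscE -[X in measurable X]setTI; apply: mrho.
Qed.

(** Polar coordinates for radial functions, without the angular integral. *)
Lemma ge0_integral_area_radial (g : R -> \bar R) :
  measurable_fun (`]0, 1[%classic : set R) g -> (forall t, `]0, 1[%classic t -> (0 <= g t)%E) ->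
  (\int[area]_(z in pdisc) g (normc z ^+ 2)%R = \int[leb]_(t in `]0%R, 1%R[) g t)%E.
Proof.
move=> mg g0; rewrite pdiscE.
rewrite -[LHS](ge0_integral_pushforward mrho) //; last first.
  by move=> t; rewrite inE; exact: g0.
apply: eq_measure_integral => A mA A01; apply: area_law => // x /A01 /=.
by rewrite !in_itv /= => /andP[-> _].
Qed.

Lemma closed_disc0 : [set 0] = closed_disc 0.
Proof.
apply/seteqP; split => z; rewrite /closed_disc /=.
  by move=> ->; rewrite normc0 expr0n.
by rewrite exprn_even_le0 //= => /eqP; exact: eq0_normc.
Qed.

Lemma area_set1 : area [set (0 : R[i])] = 0%E.
Proof. by rewrite closed_disc0 area_closed_disc maxxx. Qed.

End area_properties.

(** * Densities and the beta function *)

Section density.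
Context d (T : measurableType d) (R : realType).
Variables (m nu : {measure set T -> \bar R}) (w : T -> R).
Hypothesis mw : measurable_fun setT w.
Hypothesis w0 : forall x, 0 <= w x.
Hypothesis nuE : forall A, measurable A -> nu A = (\int[m]_(x in A) (w x)%:E)%E.
Local Open Scope ereal_scope.

Import HBNNSimple.

(** Clear for simple functions; monotone convergence extends it. *)
Lemma ge0_integral_density (D : set T) (f : T -> \bar R) : measurable D ->
  measurable_fun D f -> (forall x, D x -> 0 <= f x) ->
  \int[nu]_(x in D) f x = \int[m]_(x in D) (f x * (w x)%:E).
Proof.
move=> mD mf f0; pose h := nnsfun_approx mD mf.
have mwE : measurable_fun D (EFin \o w) by exact/measurable_EFinP/measurable_funTS.
have -> : \int[nu]_(x in D) f x =
    lim (\int[nu]_(x in D) (EFin \o h n) x @[n --> \oo]).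
  have fE x : D x -> f x = lim ((EFin \o h n) x @[n --> \oo]).
    by move=> Dx; apply/esym/cvg_lim => //; exact: cvg_nnsfun_approx.
  under eq_integral => x /[!inE] /fE -> //.
  apply: monotone_convergence => //.
  - by move=> n; apply/measurable_EFinP/measurable_funTS.
  - by move=> n x Dx //=; rewrite lee_fin.
  - by move=> x Dx a b ab; rewrite lee_fin; exact/lefP/nd_nnsfun_approx.
have -> : \int[m]_(x in D) (f x * (w x)%:E) =
    lim (\int[m]_(x in D) ((EFin \o h n) x * (w x)%:E) @[n --> \oo]).
  have fg x : D x -> f x * (w x)%:E = lim (((EFin \o h n) x * (w x)%:E) @[n --> \oo]).
    move=> Dx; apply/esym/cvg_lim => //; apply: cvgeZr => //.
    exact: cvg_nnsfun_approx.
  under eq_integral => x /[!inE] /fg -> //.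
  apply: monotone_convergence => [//| | |].
  - move=> n; apply: emeasurable_funM => //.
    by apply/measurable_EFinP/measurable_funTS.
  - by move=> n x Dx; rewrite mule_ge0 ?lee_fin.
  - move=> x Dx a b ab; rewrite lee_wpmul2r ?lee_fin //.
    exact/lefP/nd_nnsfun_approx.
congr (lim (_ @ \oo)); apply/funext => n.
transitivity (\int[nu]_(x in D)
   (\sum_(y \in range (h n)) (y * \1_(h n @^-1` [set y]) x)%:E)).
  by apply: eq_integral => t tD; rewrite /= fimfunE -fsumEFin.
have indich r : measurable_fun D (fun x => (r * \1_(h n @^-1` [set r]) x)%:E).
  by apply/measurable_EFinP/measurable_funTS/measurable_funM.
rewrite ge0_integral_fsum//; last by move=> y x Dx; exact: nnfun_muleindic_ge0.
transitivity (\int[m]_(x in D) (\sum_(y \in range (h n))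
    (y * \1_(h n @^-1` [set y]) x)%:E * (w x)%:E)); last first.
  apply: eq_integral => x xD.
  rewrite -ge0_mule_fsuml => [|y]; last exact: nnfun_muleindic_ge0.
  by rewrite fsumEFin // -(fimfunE _ x).
rewrite ge0_integral_fsum//; last 2 first.
  - by move=> y; apply: emeasurable_funM.
  - by move=> y x Dx; apply: mule_ge0; [exact: nnfun_muleindic_ge0|rewrite lee_fin].
apply: eq_fsbigr => r rhn.
under [LHS]eq_integral do rewrite EFinM.
rewrite integralZl_indic_nnsfun => //.
under [RHS]eq_integral do rewrite EFinM -muleA.
rewrite ge0_integralZl//.
- under [in RHS]eq_integral do rewrite muleC.
  rewrite [in RHS](eq_integral ((EFin \o w) \_ (h n @^-1` [set r]))); last first.
    by move=> x xE; rewrite epatch_indic.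
  have mB : measurable (h n @^-1` [set r]) by [].
  have mDB : measurable (D `&` h n @^-1` [set r]) by exact: measurableI.
  rewrite -integral_mkcondr -(nuE mDB) setIC; congr (_ * _)%E.
  exact: integral_indic.
- apply: emeasurable_funM => //.
  by apply/measurable_EFinP/measurable_funTS.
- by move=> t Et; rewrite mule_ge0 ?lee_fin.
- by move: rhn; rewrite inE => -[t _ <-]; rewrite lee_fin.
Qed.

End density.

Section euler_beta.
Context {R : realType}.
Local Notation leb := (@lebesgue_measure R).
Local Notation I01 := (`]0%R, 1%R[%classic : set R).
Implicit Types p q s t x y : R.

Lemma lebesgue_reflect (c : R) (A : set R) : measurable A ->
  leb ((fun y => c - y) @^-1` A) = leb A.
Proof.
have mc : measurable_fun [set: R] ((fun y => c - y) : R -> measurableTypeR R).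
  exact: measurable_funB.
move=> mA; suff : pushforward leb ((fun y => c - y) : R -> measurableTypeR R) A = leb A by [].
apply/esym/lebesgue_measure_unique => //= _ [[a b]] _ <-; rewrite /pushforward /=.
rewrite (_ : _ @^-1` _ = `[c - b, c - a[%classic); last first.
  by apply/seteqP; split => y /=; rewrite !in_itv /= => /andP[h1 h2];
    apply/andP; split; lra.
rewrite !lebesgue_measure_itv /= !lte_fin ltrD2l ltrN2 -!EFinB.
by case: ifP => // _; congr (_%:E); ring.
Qed.

Lemma ge0_integral_reflect (c : R) (D : set R) (f : R -> \bar R) : measurable D ->
  measurable_fun D f -> (forall x, D x -> (0 <= f x)%E) ->
  (\int[leb]_(x in D) f x = \int[leb]_(x in (fun y => c - y)%R @^-1` D) f (c - x)%R)%E.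
Proof.
move=> mD mf f0.
have mc : measurable_fun [set: measurableTypeR R]
    ((fun y => c - y) : measurableTypeR R -> measurableTypeR R).
  exact: measurable_funB.
have f0' : {in D, forall y, (0 <= f y)%E} by move=> x; rewrite inE; exact: f0.
apply: etrans (ge0_integral_pushforward mc leb mD mf f0').
by apply: eq_measure_integral => A mA _; apply/esym; exact: lebesgue_reflect.
Qed.

Lemma le_powR_1D (c r e : R) : 0 < c -> c <= r <= 1 -> r `^ e <= 1 + c `^ e.
Proof.
move=> c0 /andP[cr r1]; have r0 := lt_le_trans c0 cr.
have [e0|e0] := leP 0 e.
  apply: (@le_trans _ _ 1); last by rewrite lerDl powR_ge0.
  by rewrite -(powRr0 r) ger_powR // r0.
apply: (@le_trans _ _ (c `^ e)); last by rewrite lerDr.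
rewrite -[e]opprK powRN [leRHS]powRN lef_pV2 ?posrE ?powR_gt0 //.
by apply: ge0_ler_powR => //; rewrite ?nnegrE ?oppr_ge0 ltW.
Qed.

Lemma integral_powR0 (y t : R) : 0 < y -> 0 < t ->
  (\int[leb]_(s in `]0%R, t[) (y * s `^ (y - 1))%:E = (t `^ y)%:E)%E.
Proof.
move=> y0 t0.
have mf (D : set R) : measurable_fun D (fun s => (y * s `^ (y - 1))%:E).
  apply/measurable_EFinP; apply: measurable_funTS; exact: measurable_funM.
pose F n : set R := `[t / n.+2%:R, t[%classic.
have FU : \bigcup_n F n = `]0, t[%classic.
  apply/seteqP; split => s /=.
    case=> n _; rewrite /F /= !in_itv /= => /andP[h ->]; rewrite andbT.
    by apply: lt_le_trans h; rewrite divr_gt0.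
  rewrite in_itv /= => /andP[s0 st].
  exists (Num.truncn (t / s)) => //=; rewrite /F /= in_itv /= st andbT.
  rewrite ler_pdivrMr // mulrC -ler_pdivrMr //.
  by rewrite ltW // (lt_trans (truncnS_gt _)) // ltr_nat.
have ndF : nondecreasing_seq F.
  move=> n k nk; apply/subsetPset => s /=; rewrite /F /= !in_itv /= => /andP[h ->].
  rewrite andbT; apply: le_trans h; rewrite ler_pM2l // lef_pV2 ?posrE //.
  by rewrite ler_nat.
have mF n : measurable (F n) by exact: measurable_itv.
have IF n : (\int[leb]_(s in F n) (y * s `^ (y - 1))%:E =
    (t `^ y - (t / n.+2%:R) `^ y)%:E)%E.
  have tn : t / n.+2%:R < t by rewrite ltr_pdivrMr // ltr_pMr // ltr1n.
  have tn0 : 0 < t / n.+2%:R by rewrite divr_gt0.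
  rewrite /F integral_itv_bndo_bndc //.
  have cp (e s : R) : 0 < s -> {for s, continuous (fun s => s `^ e)}.
    move=> s0; apply: differentiable_continuous.
    by apply/derivable1_diffP; have [] := is_derive1_powR e s0.
  rewrite (@continuous_FTC2 _ (fun s => y * s `^ (y - 1)) (fun s => s `^ y)) //.
  - apply: continuous_in_subspaceT => s; rewrite inE /= in_itv /= => /andP[h _].
    apply: cvgM; first exact: cvg_cst.
    exact: cp (lt_le_trans tn0 h).
  - split.
    + move=> s; rewrite in_itv /= => /andP[h _].
      by have [] := is_derive1_powR y (lt_trans tn0 h).
    + by apply: cvg_at_right_filter; exact: cp.
    + by apply: cvg_at_left_filter; exact: cp.
  - move=> s; rewrite in_itv /= => /andP[h _].
    by apply: powR_derive1; rewrite in_itv /= andbT (lt_trans tn0 h).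
rewrite -FU.
have := ge0_nondecreasing_set_cvg_integral (mu := leb) ndF mF
  (fun n => mf (F n)) (fun n s _ => mulr_ge0 (ltW y0) (powR_ge0 s (y - 1))).
under eq_fun do rewrite IF.
move=> cv; apply/esym; apply: cvg_unique cv => //.
apply: cvg_EFin; first exact: nearW.
rewrite -[X in _ --> X]subr0; apply: cvgB; first exact: cvg_cst.
have h0 : (fun n : nat => n.+2%:R^-1 : R) @ \oo --> (0 : R).
  by have := @cvg_harmonic R; rewrite -(cvg_shiftn 1); under eq_fun do rewrite addn1.
have hp : (fun n : nat => (n.+2%:R^-1 : R) `^ y) @ \oo --> (0 : R).
  apply: ((cvg_at_rightP (fun a : R => a `^ y) 0 0).1 (powR_cvg0 y0)).
  by split => // n; rewrite invr_gt0.
have : (fun n : nat => t `^ y * (n.+2%:R^-1 : R) `^ y) @ \oo --> t `^ y * 0.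
  by apply: cvgM => //; exact: cvg_cst.
by rewrite mulr0; under eq_fun do rewrite -powRM ?invr_ge0 // ?ltW //.
Qed.

(** The extended real value makes sense before integrability is known. *)
Definition eBeta p q : \bar R :=
  (\int[leb]_(t in I01) (t `^ (p - 1) * (1 - t) `^ (q - 1))%:E)%E.

Lemma BetaE p q : Beta p q = fine (eBeta p q).
Proof. by []. Qed.

Lemma measurable_powR_onem p q (D : set R) :
  measurable_fun D (fun t : R => t `^ p * (1 - t) `^ q).
Proof.
apply: measurable_funTS; apply: measurable_funM; first exact: measurable_powR.
apply: (measurableT_comp (@measurable_powR R _)); exact: measurable_funB.
Qed.

Lemma eBeta_ge0 p q : (0 <= eBeta p q)%E.
Proof. by apply: integral_ge0 => t _; rewrite lee_fin mulr_ge0 ?powR_ge0. Qed.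

Lemma onem_I01 : (fun y : R => 1 - y) @^-1` I01 = I01.
Proof.
by apply/seteqP; split => t /=; rewrite !in_itv /= => /andP[? ?]; apply/andP; split; lra.
Qed.

Lemma eBetaC p q : eBeta p q = eBeta q p.
Proof.
have mI : measurable I01 by exact: measurable_itv.
have mf : measurable_fun I01 (fun t => (t `^ (p - 1) * (1 - t) `^ (q - 1))%:E).
  by apply/measurable_EFinP; exact: measurable_powR_onem.
have f0 t : I01 t -> (0 <= (t `^ (p - 1) * (1 - t) `^ (q - 1))%:E)%E.
  by move=> _; rewrite lee_fin mulr_ge0 ?powR_ge0.
apply: etrans (ge0_integral_reflect 1 mI mf f0) _.
by rewrite onem_I01; apply: eq_integral => t _; rewrite subKr mulrC.
Qed.

(** Each factor of the integrand is bounded away from its own singularity, so the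
    integrand is dominated by a combination of the two powers. *)
Lemma eBeta_lty p q : 0 < p -> 0 < q -> (eBeta p q < +oo)%E.
Proof.
move=> p0 q0; pose A r : R := 1 + (2^-1) `^ (r - 1).
have A0 r : 0 <= A r by rewrite addr_ge0 ?powR_ge0.
pose g1 t : R := p * t `^ (p - 1); pose g2 t : R := q * (1 - t) `^ (q - 1).
have mg1 : measurable_fun I01 (EFin \o g1).
  apply/measurable_EFinP; apply: measurable_funTS; exact: measurable_funM.
have mg2 : measurable_fun I01 (EFin \o g2).
  apply/measurable_EFinP; apply: measurable_funTS; apply: measurable_funM => //.
  apply: (measurableT_comp (@measurable_powR R _)); exact: measurable_funB.
have g10 t : 0 <= g1 t by rewrite mulr_ge0 ?powR_ge0 // ltW.
have g20 t : 0 <= g2 t by rewrite mulr_ge0 ?powR_ge0 // ltW.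
have i1 : (\int[leb]_(t in I01) (g1 t)%:E = 1%:E)%E.
  by rewrite integral_powR0 // powR1.
have i2 : (\int[leb]_(t in I01) (g2 t)%:E = 1%:E)%E.
  have mI : measurable I01 by exact: measurable_itv.
  have g2E t : I01 t -> (0 <= (EFin \o g2) t)%E by move=> _; rewrite /= lee_fin.
  apply: etrans (ge0_integral_reflect 1 mI mg2 g2E) _.
  rewrite onem_I01; under eq_integral do rewrite /= /g2 subKr.
  by rewrite integral_powR0 // powR1.
apply: (@le_lt_trans _ _ (\int[leb]_(t in I01)
    ((A q / p)%:E * (g1 t)%:E + (A p / q)%:E * (g2 t)%:E))%E).
  apply: ge0_le_integral => //.
  - by move=> t _; rewrite lee_fin mulr_ge0 ?powR_ge0.
  - by apply/measurable_EFinP; exact: measurable_powR_onem.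
  - by apply: emeasurable_funD; apply: measurable_funeM.
  - move=> t /=; rewrite in_itv /= => /andP[t0 t1].
    rewrite -!EFinM -EFinD lee_fin /g1 /g2 !mulrA !divfK ?gt_eqF //.
    have u0 : 0 <= (1 - t) `^ (q - 1) by exact: powR_ge0.
    have v0 : 0 <= t `^ (p - 1) by exact: powR_ge0.
    have [h|h] := leP t 2^-1.
      apply: (@le_trans _ _ (A q * t `^ (p - 1))).
        rewrite mulrC ler_wpM2r // /A; apply: le_powR_1D => //.
        by apply/andP; split; lra.
      by rewrite lerDl mulr_ge0.
    apply: (@le_trans _ _ (A p * (1 - t) `^ (q - 1))).
      rewrite ler_wpM2r // /A; apply: le_powR_1D => //.
      by apply/andP; split; lra.
    by rewrite lerDr mulr_ge0.
rewrite ge0_integralD //; last 4 first.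
- by move=> t _; rewrite -EFinM lee_fin mulr_ge0 // divr_ge0 // ltW.
- exact: measurable_funeM.
- by move=> t _; rewrite -EFinM lee_fin mulr_ge0 // divr_ge0 // ltW.
- exact: measurable_funeM.
have mI : measurable I01 by exact: measurable_itv.
have h1 t : I01 t -> (0 <= (g1 t)%:E)%E by move=> _; rewrite lee_fin.
have h2 t : I01 t -> (0 <= (g2 t)%:E)%E by move=> _; rewrite lee_fin.
have hA r s : 0 < s -> 0 <= A r / s by move=> s0; rewrite divr_ge0 // ltW.
rewrite (ge0_integralZl_EFin leb mI h1 mg1 (hA q p p0)).
rewrite (ge0_integralZl_EFin leb mI h2 mg2 (hA p q q0)).
by rewrite i1 i2 -!EFinM -EFinD ltry.
Qed.

Lemma ge_powR_V1D (c r e : R) : 0 < c -> c <= r <= 1 -> (1 + c `^ (- e))^-1 <= r `^ e.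
Proof.
move=> c0 cr; have r0 : 0 < r by case/andP: cr => + _; exact: lt_le_trans.
have := le_powR_1D (- e) c0 cr; rewrite [X in X <= _]powRN => h.
rewrite -[leRHS]invrK lef_pV2 // posrE ?invr_gt0 ?powR_gt0 //.
by rewrite ltr_pwDl // powR_ge0.
Qed.

Lemma eBeta_gt0 p q : (0 < eBeta p q)%E.
Proof.
pose c r : R := (1 + 4^-1 `^ (- (r - 1)))^-1.
have c0 r : 0 < c r by rewrite invr_gt0 ltr_pwDl // powR_ge0.
apply: (@lt_le_trans _ _ (\int[leb]_(t in `[4^-1%R, 2^-1%R]) (c p * c q)%:E)%E).
  rewrite integral_cst //= lebesgue_measure_itv /= lte_fin.
  have -> : (4^-1 < 2^-1 :> R) by lra.
  by rewrite -EFinB -EFinM lte_fin !mulr_gt0 //; lra.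
apply: (@le_trans _ _ (\int[leb]_(t in `[4^-1%R, 2^-1%R]) (t `^ (p - 1) * (1 - t) `^ (q - 1))%:E)%E).
  apply: ge0_le_integral => //.
  - by move=> t _; rewrite lee_fin !mulr_ge0 // ltW.
  - by apply/measurable_EFinP; exact: measurable_powR_onem.
  - move=> t /=; rewrite in_itv /= => /andP[t0 t1]; rewrite lee_fin.
    by apply: ler_pM; rewrite ?(ltW (c0 _)) //; apply: ge_powR_V1D => //;
      apply/andP; split; lra.
apply: ge0_subset_integral => //.
- by apply/measurable_EFinP; exact: measurable_powR_onem.
- by move=> t _; rewrite lee_fin mulr_ge0 ?powR_ge0.
- by move=> t /=; rewrite !in_itv /= => /andP[? ?]; apply/andP; split; lra.
Qed.

Lemma Beta_gt0 p q : 0 < p -> 0 < q -> 0 < Beta p q.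
Proof. by move=> p0 q0; rewrite BetaE fine_gt0 // eBeta_gt0 eBeta_lty. Qed.

Lemma EFin_Beta p q : 0 < p -> 0 < q -> (Beta p q)%:E = eBeta p q.
Proof.
by move=> p0 q0; rewrite BetaE fineK // ge0_fin_numE ?eBeta_ge0 // eBeta_lty.
Qed.

Lemma BetaC p q : Beta p q = Beta q p.
Proof. by rewrite !BetaE eBetaC. Qed.

Lemma powR_addr1 (t e : R) : 0 < t -> t `^ (e + 1 - 1) = t * t `^ (e - 1).
Proof.
move=> t0; have -> : t `^ (e - 1) = t `^ e / t.
  by rewrite powRB ?(gt_eqF t0) ?implybT // powRr1 // ltW.
by rewrite addrK mulrC divfK // gt_eqF.
Qed.

(** Splitting [1 = t + (1 - t)] under the integral. *)
Lemma eBetaD p q : eBeta p q = (eBeta (p + 1) q + eBeta p (q + 1))%E.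
Proof.
have h t : 0 <= t `^ (p - 1) * (1 - t) `^ (q - 1) by rewrite mulr_ge0 ?powR_ge0.
rewrite /eBeta -ge0_integralD //; last 4 first.
- by move=> t _; rewrite lee_fin mulr_ge0 ?powR_ge0.
- by apply/measurable_EFinP; exact: measurable_powR_onem.
- by move=> t _; rewrite lee_fin mulr_ge0 ?powR_ge0.
- by apply/measurable_EFinP; exact: measurable_powR_onem.
apply: eq_integral => t; rewrite inE /= in_itv /= => /andP[t0 t1].
by rewrite -EFinD !powR_addr1 ?subr_gt0 //; congr (_%:E); ring.
Qed.

(** Both sides are the integral of [y s^(y-1) x (1-u)^(x-1)] over [0 < s < u < 1]. *)
Lemma eBeta_parts x y : 0 < x -> 0 < y ->
  (y%:E * eBeta y (x + 1) = x%:E * eBeta (y + 1) x)%E.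
Proof.
move=> x0 y0.
pose F (su : R * R) : \bar R := ((y * su.1 `^ (y - 1)) * (x * (1 - su.2) `^ (x - 1)) *
  (((0 < su.1) && (su.1 < su.2) && (su.2 < 1))%:R))%:E.
have mpow1 : measurable_fun [set: R * R] (fun su : R * R => y * su.1 `^ (y - 1)).
  apply: measurable_funM => //.
  exact: (measurableT_comp (@measurable_powR R _) measurable_fst).
have mpow2 : measurable_fun [set: R * R] (fun su : R * R => x * (1 - su.2) `^ (x - 1)).
  apply: measurable_funM => //.
  apply: (measurableT_comp (@measurable_powR R _)).
  exact: measurable_funB measurable_snd.
have mF : measurable_fun setT F.
  apply/measurable_EFinP; apply: measurable_funM; first exact: measurable_funM.
  rewrite (_ : (fun _ => _) = \1_[set su : R * R | (0 < su.1) && (su.1 < su.2) && (su.2 < 1)]).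
    apply: measurable_indic.
    have mb : measurable_fun setT
        (fun su : R * R => (0 < su.1) && (su.1 < su.2) && (su.2 < 1)).
      apply: measurable_and; last exact: measurable_fun_ltr measurable_snd _.
      apply: measurable_and; first exact: measurable_fun_ltr _ measurable_fst.
      exact: measurable_fun_ltr measurable_fst measurable_snd.
    rewrite (_ : [set _ | _] = (fun su : R * R => (0 < su.1) && (su.1 < su.2) && (su.2 < 1)) @^-1` [set true]) //.
    by rewrite -[X in measurable X]setTI; exact: mb.
  by apply/funext => su; rewrite indicE mem_setE.
have F0 su : (0 <= F su)%E.
  by rewrite lee_fin !mulr_ge0 ?powR_ge0 // ltW.
pose fy (s : R) : R := y * s `^ (y - 1); pose gx (u : R) : R := x * (1 - u) `^ (x - 1).
have fy0 s : 0 <= fy s by rewrite mulr_ge0 ?powR_ge0 // ltW.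
have gx0 u : 0 <= gx u by rewrite mulr_ge0 ?powR_ge0 // ltW.
have mfy (D : set R) : measurable_fun D (fun s => (fy s)%:E).
  by apply/measurable_EFinP; apply: measurable_funTS; exact: measurable_funM.
have mgx (D : set R) : measurable_fun D (fun s => (gx s)%:E).
  apply/measurable_EFinP; apply: measurable_funTS; apply: measurable_funM => //.
  apply: (measurableT_comp (@measurable_powR R _)); exact: measurable_funB.
have igx s : s < 1 -> (\int[leb]_(u in `]s, 1%R[) (gx u)%:E = ((1 - s) `^ x)%:E)%E.
  move=> s1; apply: etrans (ge0_integral_reflect 1 _ (mgx _) (fun t _ => _)) _.
  - exact: measurable_itv.
  - by move=> t _; rewrite lee_fin.
  rewrite (_ : _ @^-1` _ = `]0, 1 - s[%classic); last first.
    by apply/seteqP; split => t /=; rewrite !in_itv /= => /andP[? ?]; apply/andP; split; lra.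
  under eq_integral do rewrite /gx subKr.
  by rewrite integral_powR0 // subr_gt0.
have i1 s : (\int[leb]_u F (s, u) = ((fun s => (fy s * (1 - s) `^ x)%:E) \_ I01) s)%E.
  rewrite patchE; case: ifPn => [|]; rewrite ?inE ?notin_setE /= in_itv /=.
    move=> /andP[s0 s1].
    transitivity (\int[leb]_(u in `]s, 1%R[) ((fy s)%:E * (gx u)%:E))%E.
      rewrite [RHS]integral_mkcond; apply: eq_integral => u _; rewrite patchE /F /=.
      rewrite s0 /=; case: ifPn => [|]; rewrite ?inE ?notin_setE /= in_itv /=.
        by move=> ->; rewrite mulr1.
      by move=> /negP/negbTE ->; rewrite mulr0.
    apply: etrans (ge0_integralZl_EFin leb _ (fun t _ => _) (mgx _) (fy0 s)) _.
    - exact: measurable_itv.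
    - by move=> t _; rewrite lee_fin.
    by rewrite igx // -EFinM.
  move=> h; apply: integral0_eq => u _; rewrite /F /=.
  rewrite (_ : _ && _ = false) ?mulr0 //; apply/negbTE/negP.
  by move=> /andP[/andP[s0 su] u1]; apply: h; rewrite s0 (lt_trans su).
have i2 u : (\int[leb]_s F (s, u) = ((fun u => (gx u * u `^ y)%:E) \_ I01) u)%E.
  rewrite patchE; case: ifPn => [|]; rewrite ?inE ?notin_setE /= in_itv /=.
    move=> /andP[u0 u1].
    transitivity (\int[leb]_(s in `]0%R, u[) ((gx u)%:E * (fy s)%:E))%E.
      rewrite [RHS]integral_mkcond; apply: eq_integral => s _; rewrite patchE /F /=.
      rewrite u1 andbT; case: ifPn => [|]; rewrite ?inE ?notin_setE /= in_itv /=.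
        by move=> ->; rewrite mulr1 -EFinM mulrC.
      by move=> /negP/negbTE ->; rewrite mulr0.
    apply: etrans (ge0_integralZl_EFin leb _ (fun t _ => _) (mfy _) (gx0 u)) _.
    - exact: measurable_itv.
    - by move=> t _; rewrite lee_fin.
    by rewrite integral_powR0 // -EFinM.
  move=> h; apply: integral0_eq => s _; rewrite /F /=.
  rewrite (_ : _ && _ = false) ?mulr0 //; apply/negbTE/negP.
  by move=> /andP[/andP[s0 su] u1]; apply: h; rewrite u1 (lt_trans s0).
have := @fubini_tonelli _ _ _ _ _ leb leb F mF F0.
under [LHS]eq_integral do rewrite i1.
under [RHS]eq_integral do rewrite i2.
rewrite -!integral_mkcond => e.
have mI : measurable I01 by exact: measurable_itv.
have Z p q k : 0 < k ->
    (k%:E * eBeta p q = \int[leb]_(t in I01) (k * (t `^ (p - 1) * (1 - t) `^ (q - 1)))%:E)%E.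
  move=> k0; apply/esym.
  apply: etrans (ge0_integralZl_EFin leb mI (fun t _ => _) _ (ltW k0)).
  - by [].
  - by move=> t _; rewrite lee_fin mulr_ge0 ?powR_ge0.
  - by apply/measurable_EFinP; exact: measurable_powR_onem.
rewrite (Z _ _ _ y0) (Z _ _ _ x0); apply: etrans (etrans e _).
  by apply: eq_integral => s _; rewrite addrK /fy mulrA.
by apply: eq_integral => s _; rewrite addrK /gx; congr (_%:E); ring.
Qed.

(** Combines the additive relation [eBetaD] with the partial integration [eBeta_parts]. *)
Lemma BetaS x y : 0 < x -> 0 < y -> (x + y) * Beta (y + 1) x = y * Beta y x.
Proof.
move=> x0 y0; have y1 : 0 < y + 1 by rewrite addr_gt0.
have x1 : 0 < x + 1 by rewrite addr_gt0.
have := eBeta_parts x0 y0; have := eBetaD y x.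
rewrite -(EFin_Beta y0 x0) -(EFin_Beta y1 x0) -(EFin_Beta y0 x1) -EFinD -!EFinM.
move=> -[->] [e].
by rewrite mulrDr e; ring.
Qed.

End euler_beta.

(** * The weighted measures *)

Section mu_properties.
Context {R : realType}.
Local Notation leb := (@lebesgue_measure R).
Local Notation I01 := (`]0%R, 1%R[%classic : set R).
Implicit Types (a b c d x y t : R) (u z : R[i]).

(** The density of [mu a b] as a function of [normc z ^+ 2]. *)
Definition radial_weight a b t : R := t `^ b * (1 - t) `^ a / Beta (a + 1) (b + 1).

Lemma radial_weight_ge0 a b t : 0 <= radial_weight a b t.
Proof.
rewrite /radial_weight divr_ge0 ?mulr_ge0 ?powR_ge0 // BetaE.
by rewrite fine_ge0 // eBeta_ge0.
Qed.

Lemma measurable_radial_weight a b (D : set R) : measurable_fun D (radial_weight a b).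
Proof. by apply: measurable_funM => //; exact: measurable_powR_onem. Qed.

Lemma weightE a b z : weight a b z = radial_weight a b (normc z ^+ 2).
Proof. by rewrite /weight /radial_weight powRrM powR_mulrn // normc_ge0. Qed.

Lemma pdisc_disc : @pdisc R `<=` disc. Proof. by move=> z []. Qed.

Lemma pdisc_I01 z : pdisc z -> I01 (normc z ^+ 2).
Proof. by rewrite pdiscE. Qed.

Lemma disc_sqr z : disc z -> 0 <= normc z ^+ 2 < 1.
Proof.
by move=> z1; rewrite sqr_ge0 expr_lt1 ?normc_ge0.
Qed.

Lemma muE a b (A : set R[i]) : measurable A ->
  mu a b A = (\int[area]_(z in A) ((weight a b \_ disc) z)%:E)%E.
Proof.
move=> mA; rewrite /mu integral_mkcondr; apply: eq_integral => z _.
by rewrite !patchE; case: ifP.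
Qed.

Lemma measurable_weight_disc a b : measurable_fun setT (weight a b \_ disc).
Proof.
apply/(measurable_restrictT _ measurable_disc).
exact: measurable_funTS (measurable_weight a b).
Qed.

Lemma ge0_integral_mu a b (D : set R[i]) (f : R[i] -> \bar R) : measurable D ->
  D `<=` disc -> measurable_fun D f -> (forall z, D z -> (0 <= f z)%E) ->
  (\int[mu a b]_(z in D) f z =
   \int[area]_(z in D) (f z * (weight a b z)%:E))%E.
Proof.
move=> mD Dd mf f0.
have w0 z : 0 <= (weight a b \_ disc) z.
  by rewrite patchE; case: ifP => // _; exact: weight_ge0.
apply: etrans (ge0_integral_density (measurable_weight_disc a b) w0 (@muE a b) mD mf f0) _.
by apply: eq_integral => z; rewrite inE => /Dd zd; rewrite patchE mem_set.
Qed.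

Lemma pdisc_setD : @pdisc R = disc `\` [set 0]. Proof. by []. Qed.

Lemma measurable_radial (g : R -> R) : measurable_fun setT g ->
  measurable_fun setT (fun z : R[i] => g (normc z ^+ 2)).
Proof. by move=> mg; exact: (measurableT_comp mg measurable_sqr_normc). Qed.

Lemma measurable_set0c : measurable [set (0 : R[i])].
Proof. by rewrite closed_disc0; exact: measurable_closed_disc. Qed.

(** The origin is negligible and powers are exceptional there: everything is computed
    on the punctured disc. *)
Lemma ge0_integral_mu_pdisc a b (f : R[i] -> \bar R) :
  measurable_fun disc f -> (forall z, disc z -> (0 <= f z)%E) ->
  (\int[mu a b]_(z in disc) f z =
   \int[area]_(z in pdisc) (f z * (radial_weight a b (normc z ^+ 2)%R)%:E))%E.
Proof.
move=> mf f0; apply: etrans (ge0_integral_mu _ _ measurable_disc (@subset_refl _ _) mf f0) _.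
have mF : measurable_fun disc (fun z => (f z * (weight a b z)%:E)%E).
  apply: emeasurable_funM => //; apply/measurable_EFinP.
  exact: measurable_funTS (measurable_weight a b).
have F0 z : disc z -> (0 <= f z * (weight a b z)%:E)%E.
  by move=> zd; rewrite mule_ge0 ?f0 // lee_fin weight_ge0.
rewrite (ge0_negligible_integral measurable_set0c measurable_disc mF F0 area_set1).
by apply: eq_integral => z _; rewrite weightE.
Qed.

Lemma ge0_integral_mu_radial a b (g : R -> \bar R) : measurable_fun setT g ->
  (forall t, (0 <= g t)%E) ->
  (\int[mu a b]_(z in disc) g (normc z ^+ 2)%R =
   \int[leb]_(t in I01) (g t * (radial_weight a b t)%:E))%E.
Proof.
move=> mg g0; rewrite ge0_integral_mu_pdisc; last first.
- by move=> z _; exact: g0.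
- apply: measurable_funTS; apply: measurableT_comp => //.
  exact: measurable_sqr_normc.
have mG : measurable_fun I01 (fun t => (g t * (radial_weight a b t)%:E)%E).
  apply: emeasurable_funM; first exact: measurable_funTS.
  by apply/measurable_EFinP; exact: measurable_radial_weight.
have G0 t : I01 t -> (0 <= g t * (radial_weight a b t)%:E)%E.
  by move=> _; rewrite mule_ge0 ?g0 // lee_fin radial_weight_ge0.
exact: (ge0_integral_area_radial mG G0).
Qed.

Lemma mu_moment a b x : -1 < a -> -1 < b -> -1 < b + x ->
  (\int[mu a b]_(z in disc) ((normc z ^+ 2) `^ x)%:E =
    (Beta (a + 1) (b + x + 1) / Beta (a + 1) (b + 1))%:E)%E.
Proof.
move=> a1 b1 bx1; have a0 : 0 < a + 1 by lra.
have b0 : 0 < b + 1 by lra. have bx0 : 0 < b + x + 1 by lra.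
apply: etrans (ge0_integral_mu_radial a b (g := fun t => (t `^ x)%:E) _ _) _.
- by apply/measurable_EFinP; exact: measurable_powR.
- by move=> t; rewrite lee_fin powR_ge0.
transitivity (\int[leb]_(t in I01) ((Beta (a + 1) (b + 1))^-1%:E *
   (t `^ (b + x + 1 - 1) * (1 - t) `^ (a + 1 - 1))%:E))%E.
  apply: eq_integral => t; rewrite inE /= in_itv /= => /andP[t0 t1].
  rewrite -!EFinM !addrK /radial_weight powRD ?(gt_eqF t0) ?implybT //.
  by congr (_%:E); ring.
have mI : measurable I01 by exact: measurable_itv.
have k0 : 0 <= (Beta (a + 1) (b + 1))^-1 by rewrite invr_ge0 ltW // Beta_gt0.
have f0 t : I01 t -> (0 <= (t `^ (b + x + 1 - 1) * (1 - t) `^ (a + 1 - 1))%:E)%E.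
  by move=> _; rewrite lee_fin mulr_ge0 ?powR_ge0.
have mf : measurable_fun I01 (fun t => (t `^ (b + x + 1 - 1) * (1 - t) `^ (a + 1 - 1))%:E).
  by apply/measurable_EFinP; exact: measurable_powR_onem.
apply: (@etrans _ _ ((Beta (a + 1) (b + 1))^-1%:E * eBeta (b + x + 1) (a + 1))%E).
  exact: (ge0_integralZl_EFin leb mI f0 mf k0).
by rewrite -(EFin_Beta bx0 a0) -EFinM mulrC (BetaC (b + x + 1)).
Qed.

Lemma mu_disc a b : -1 < a -> -1 < b -> mu a b disc = 1%E.
Proof.
move=> a1 b1; have := @mu_moment a b 0 a1 b1; rewrite addr0 => /(_ b1).
under eq_integral do rewrite powRr0.
rewrite integral_cst; last exact: measurable_disc.
by rewrite mul1e divff // gt_eqF // Beta_gt0 //; lra.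
Qed.

Lemma mu_setC_disc a b : mu a b (~` disc) = 0%E.
Proof. by rewrite /mu setICl integral_set0. Qed.

Lemma mu_setT a b : -1 < a -> -1 < b -> mu a b setT = 1%E.
Proof. by move=> a1 b1; rewrite -(mu_disc a1 b1) /mu setTI setIid. Qed.

Lemma powR_weight_shift a b x y t B1 B2 : 0 < t -> t < 1 -> B1 != 0 -> B2 != 0 ->
  t `^ x * (1 - t) `^ y * (t `^ b * (1 - t) `^ a / B1) =
  B2 / B1 * (t `^ (b + x) * (1 - t) `^ (a + y) / B2).
Proof.
move=> t0 t1 B10 B20; have s0 : 0 < 1 - t by rewrite subr_gt0.
rewrite (powRD (x := t)) ?(gt_eqF t0) ?implybT //.
rewrite (powRD (x := 1 - t)) ?(gt_eqF s0) ?implybT //.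
by field; rewrite B10 B20.
Qed.

(** Multiplying by powers of [normc z ^+ 2] and [1 - normc z ^+ 2] only changes the
    parameters of the measure. *)
Lemma mu_shift a b x y (f : R[i] -> \bar R) :
  -1 < a -> -1 < b -> -1 < a + y -> -1 < b + x ->
  measurable_fun disc f -> (forall z, disc z -> (0 <= f z)%E) ->
  (\int[mu a b]_(z in disc) (f z * ((normc z ^+ 2) `^ x * (1 - normc z ^+ 2) `^ y)%:E) =
   (Beta (a + y + 1) (b + x + 1) / Beta (a + 1) (b + 1))%:E *
     \int[mu (a + y) (b + x)]_(z in disc) f z)%E.
Proof.
move=> a1 b1 ay bx mf f0.
have Bp c d : -1 < c -> -1 < d -> 0 < Beta (c + 1) (d + 1).
  by move=> ? ?; rewrite Beta_gt0 //; lra.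
have mw : measurable_fun disc (fun z : R[i] =>
    ((normc z ^+ 2) `^ x * (1 - normc z ^+ 2) `^ y)%:E).
  apply/measurable_EFinP; apply: measurable_funTS.
  apply: (@measurable_radial (fun t => t `^ x * (1 - t) `^ y)).
  exact: measurable_powR_onem.
rewrite [LHS]ge0_integral_mu_pdisc; last first.
- by move=> z zd; rewrite mule_ge0 ?f0 // lee_fin mulr_ge0 ?powR_ge0.
- exact: emeasurable_funM.
rewrite (ge0_integral_mu_pdisc _ _ mf f0).
have fw0 z : pdisc z -> (0 <= f z * (radial_weight (a + y) (b + x) (normc z ^+ 2))%:E)%E.
  by move=> /pdisc_disc zd; rewrite mule_ge0 ?f0 // lee_fin radial_weight_ge0.
have mfw : measurable_fun pdisc
    (fun z => f z * (radial_weight (a + y) (b + x) (normc z ^+ 2))%:E)%E.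
  apply: emeasurable_funM; first exact: measurable_funS measurable_disc pdisc_disc mf.
  apply/measurable_EFinP; apply: measurable_funTS.
  apply: (@measurable_radial (radial_weight (a + y) (b + x))).
  exact: measurable_radial_weight.
have k0 : 0 <= Beta (a + y + 1) (b + x + 1) / Beta (a + 1) (b + 1).
  by rewrite divr_ge0 // ltW // Bp.
rewrite -(ge0_integralZl_EFin area measurable_pdisc fw0 mfw k0).
apply: eq_integral => z; rewrite inE => /pdisc_I01; rewrite /= in_itv /= => /andP[t0 t1].
apply: etrans (esym (muleA _ _ _)) _; apply: etrans _ (muleCA _ _ _).
congr (f z * _)%E; apply: (congr1 EFin).
by apply: powR_weight_shift => //; apply: lt0r_neq0; exact: Bp.
Qed.

(** The half-turn is left out because the shear decomposition of a rotation fails for it;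
    the other rotations suffice for orthogonality. *)
Lemma mu_rotation a b u (A : set R[i]) : normc u = 1 -> u != -1 -> measurable A ->
  mu a b ((fun z => u * z) @^-1` A) = mu a b A.
Proof.
move=> u1 um1 mA; rewrite /mu.
have mAd : measurable (A `&` disc) by apply: measurableI => //; exact: measurable_disc.
have mw : measurable_fun (A `&` disc) (fun z => (weight a b z)%:E).
  by apply/measurable_EFinP; exact: measurable_funTS (measurable_weight a b).
have w0 : {in A `&` disc, forall z, (0 <= (weight a b z)%:E)%E}.
  by move=> z _; rewrite lee_fin weight_ge0.
transitivity (\int[area]_(z in (fun z => (u * z)%R) @^-1` (A `&` disc)) ((fun z => (weight a b z)%:E) \o (fun z => (u * z)%R)) z)%E.
  rewrite preimage_setI (_ : _ @^-1` disc = disc); last first.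
    by apply/funext => z; rewrite /preimage /disc /mkset normcM u1 mul1r.
  by apply: eq_integral => z _; rewrite /= !weightE normcM u1 mul1r.
rewrite -(ge0_integral_pushforward (measurable_mulc u) area mAd mw w0).
apply: eq_measure_integral; first exact: measurable_mulc.
by move=> mmu B mB _; exact: (area_rotation u1 um1 mB).
Qed.

Lemma integral_mu_rotation a b u (f : R[i] -> \bar R) : normc u = 1 -> u != -1 ->
  measurable_fun setT f ->
  (mu a b).-integrable disc (fun z => f (u * z)) ->
  (\int[mu a b]_(z in disc) f (u * z)%R = \int[mu a b]_(z in disc) f z)%E.
Proof.
move=> u1 um1 mf fi.
have ud : (fun z => u * z) @^-1` disc = disc.
  by apply/funext => z; rewrite /preimage /disc /mkset normcM u1 mul1r.
have := @integral_pushforward _ _ _ _ R _ (measurable_mulc u) (mu a b) disc f mf.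
rewrite ud => /(_ fi measurable_disc) /= <-.
apply: eq_measure_integral; first exact: measurable_mulc.
by move=> mmu B mB _; exact: (mu_rotation a b u1 um1 mB).
Qed.

Lemma cintegral_mu_rotation a b u (f : R[i] -> R[i]) : normc u = 1 -> u != -1 ->
  measurable_fun setT f ->
  cintegrable (mu a b) disc (fun z => f (u * z)) ->
  cintegral (mu a b) disc (fun z => f (u * z)) = cintegral (mu a b) disc f.
Proof.
move=> u1 um1 /measurable_cE[mr mi] [ir ii]; rewrite /cintegral /Rintegral.
have := integral_mu_rotation u1 um1 (f := fun z => (complex.Re (f z))%:E) _ ir.
have := integral_mu_rotation u1 um1 (f := fun z => (complex.Im (f z))%:E) _ ii.
by move=> -> ; [move=> -> //|]; exact/measurable_EFinP.
Qed.

Lemma mu_sigma_finite a b : -1 < a -> -1 < b -> sigma_finite setT (mu a b).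
Proof.
move=> a1 b1; exists (fun=> setT); first by rewrite bigcup_const.
by move=> _; split => //; rewrite mu_setT // ltry.
Qed.

(** Stated with iterated integrals over the disc: the complement of the disc is a null set. *)
Lemma mu_tonelli a b c d (G : R[i] * R[i] -> \bar R) :
  -1 < a -> -1 < b -> -1 < c -> -1 < d ->
  measurable_fun setT G -> (forall zw, (0 <= G zw)%E) ->
  (\int[mu a b]_(z in disc) \int[mu c d]_(w in disc) G (z, w) =
   \int[mu c d]_(w in disc) \int[mu a b]_(z in disc) G (z, w))%E.
Proof.
move=> a1 b1 c1 d1 mG G0.
pose m1 : {sigma_finite_measure set R[i] -> \bar R} :=
  HB.pack (mu a b) (Measure_isSigmaFinite.Build _ _ _ (mu a b) (mu_sigma_finite a1 b1)).
pose m2 : {sigma_finite_measure set R[i] -> \bar R} :=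
  HB.pack (mu c d) (Measure_isSigmaFinite.Build _ _ _ (mu c d) (mu_sigma_finite c1 d1)).
have disc_setT x y (f : R[i] -> \bar R) : measurable_fun setT f ->
    (forall z, (0 <= f z)%E) ->
    (\int[mu x y]_(z in disc) f z = \int[mu x y]_z f z)%E.
  move=> mf f0; apply/esym.
  have := ge0_negligible_integral (mu := mu x y) (measurableC measurable_disc) measurableT mf
    (fun z _ => f0 z) (mu_setC_disc x y).
  by rewrite setTD setCK.
have mG1 z : measurable_fun setT (fun w => G (z, w)).
  exact: (measurableT_comp mG (pair1_measurable z)).
have mG2 w : measurable_fun setT (fun z => G (z, w)).
  exact: (measurableT_comp mG (pair2_measurable w)).
have := @fubini_tonelli _ _ _ _ _ m1 m2 G mG G0.
have mF : measurable_fun setT (fun z => \int[mu c d]_w G (z, w))%E :=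
  @measurable_fun_fubini_tonelli_F _ _ _ _ _ m2 G mG G0.
have mH : measurable_fun setT (fun w => \int[mu a b]_z G (z, w))%E :=
  @measurable_fun_fubini_tonelli_G _ _ _ _ _ m1 G mG G0.
rewrite /m1 /m2 /= => e.
transitivity (\int[mu a b]_(z in disc) \int[mu c d]_w G (z, w))%E.
  by apply: eq_integral => z _; exact: (disc_setT _ _ _ (mG1 z) (fun w => G0 _)).
transitivity (\int[mu c d]_(w in disc) \int[mu a b]_z G (z, w))%E; last first.
  by apply: eq_integral => w _; exact/esym/(disc_setT _ _ _ (mG2 w) (fun z => G0 _)).
apply: etrans (disc_setT _ _ _ mF (fun z => integral_ge0 (mu c d) (fun w _ => G0 _))) _.
apply: etrans e _; apply/esym.
exact: (disc_setT _ _ _ mH (fun z => integral_ge0 (mu a b) (fun w _ => G0 _))).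
Qed.

End mu_properties.

(** * Absolutely convergent series *)

Section absolutely_summable.
Context {R : realType}.
Implicit Types (u v : nat -> R[i]).

(** A uniform bound on the partial sums of moduli, kept explicit so that it can serve as
    a dominating constant under integrals. *)
Definition asum_le u (B : R) := forall n, \sum_(k < n) normc (u k) <= B.

Definition csum u : R[i] :=
  limn (series (fun n => complex.Re (u n))) +i* limn (series (fun n => complex.Im (u n))).

Lemma bounded_series_cvg (x : nat -> R) B :
  (forall n, \sum_(k < n) `|x k| <= B) -> cvgn (series x).
Proof.
move=> xB; apply: normed_cvg; apply: nondecreasing_is_cvgn.
  by apply: nondecreasing_series => // n _ _; exact: normr_ge0.
exists B => _ [n _ <-]; rewrite /= seriesEord; exact: xB.
Qed.

Lemma csum_cvg u B : asum_le u B -> cto (fun n => \sum_(k < n) u k) (csum u).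
Proof.
move=> uB; apply/cto_ReIm; split.
  under eq_fun do rewrite Re_sum.
  have /cvg_ex[l h] : cvgn (series (fun n => complex.Re (u n))).
    apply: (@bounded_series_cvg _ B) => n; apply: le_trans (uB n).
    by apply: ler_sum => k _; exact: le_normc_Re.
  rewrite /= (cvg_lim _ h) //; move: h; apply: cvg_trans.
  by rewrite seriesEord.
under eq_fun do rewrite Im_sum.
have /cvg_ex[l h] : cvgn (series (fun n => complex.Im (u n))).
  apply: (@bounded_series_cvg _ B) => n; apply: le_trans (uB n).
  by apply: ler_sum => k _; exact: le_normc_Im.
rewrite /= (cvg_lim _ h) //; move: h; apply: cvg_trans.
by rewrite seriesEord.
Qed.

Lemma csum_unique u B S : asum_le u B -> cto (fun n => \sum_(k < n) u k) S -> csum u = S.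
Proof. by move=> uB; apply: cto_unique; exact: csum_cvg uB. Qed.

(** The tail of the series is at most the tail of the majorant, hence at most the
    unused part of the bound. *)
Lemma csum_tail u B N : asum_le u B ->
  normc (csum u - \sum_(k < N) u k) <= B - \sum_(k < N) normc (u k).
Proof.
move=> uB; have h : cto (fun n => \sum_(k < n) u k - \sum_(k < N) u k)
    (csum u - \sum_(k < N) u k).
  exact: ctoD (csum_cvg uB) (cto_cst _).
have := cto_norm h; set x := (fun n => _) => hx.
rewrite -(cvg_lim _ hx) //; apply: limr_le; first by apply/cvg_ex; eexists; exact: hx.
near=> n; rewrite /x.
have Nn : (N <= n)%N by near: n; exact: nbhs_infty_ge.
have e (T : zmodType) (f : nat -> T) :
    \sum_(k < n) f k = \sum_(k < N) f k + \sum_(N <= k < n) f k.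
  by rewrite -!(big_mkord xpredT f) -big_cat_nat.
rewrite lerBrDl (e _ u) addrAC subrr add0r; apply: le_trans (uB n).
by rewrite [leRHS](e _ (fun k => normc (u k))) lerD2l le_normc_sum.
Unshelve. all: by end_near. Qed.

Lemma csum_le u B : asum_le u B -> normc (csum u) <= B.
Proof. by move=> /(csum_tail 0); rewrite !big_ord0 !subr0. Qed.

Lemma asum_leZ c u B : asum_le u B -> asum_le (fun k => c * u k) (normc c * B).
Proof.
move=> uB n; under eq_bigr do rewrite normcM.
by rewrite -mulr_sumr ler_wpM2l ?normc_ge0.
Qed.

Lemma asum_leD u v A B : asum_le u A -> asum_le v B -> asum_le (fun k => u k + v k) (A + B).
Proof.
move=> uA vB n; apply: le_trans (lerD (uA n) (vB n)).
by rewrite -big_split /=; apply: ler_sum => k _; exact: le_normcD.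
Qed.

Lemma asum_le_dom u (x : nat -> R) B : (forall k, normc (u k) <= x k) ->
  (forall n, \sum_(k < n) x k <= B) -> asum_le u B.
Proof. by move=> ux xB n; apply: le_trans (xB n); apply: ler_sum => k _. Qed.

Lemma csumZ c u B : asum_le u B -> csum (fun k => c * u k) = c * csum u.
Proof.
move=> uB; apply: csum_unique (asum_leZ c uB) _.
by under eq_fun do rewrite -mulr_sumr; apply: ctoZ; exact: csum_cvg uB.
Qed.

Lemma csumD u v A B : asum_le u A -> asum_le v B ->
  csum (fun k => u k + v k) = csum u + csum v.
Proof.
move=> uA vB; apply: csum_unique (asum_leD uA vB) _.
under eq_fun do rewrite big_split /=.
exact: ctoD (csum_cvg uA) (csum_cvg vB).
Qed.

Lemma csum_dist u v A B C : asum_le u A -> asum_le v B ->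
  asum_le (fun k => u k - v k) C -> normc (csum u - csum v) <= C.
Proof.
move=> uA vB /csum_le; congr (normc _ <= _).
rewrite -[RHS]/(csum u + - csum v) -[X in _ + X]mulN1r -(csumZ _ vB).
rewrite -(csumD uA (asum_leZ (-1) vB)); congr csum.
by apply/funext => k; rewrite mulN1r.
Qed.

Lemma eq_csum u v : u =1 v -> csum u = csum v.
Proof. by move=> uv; congr csum; apply/funext. Qed.

(** Coefficients of the Cauchy product. *)
Definition conv (T : pzRingType) (u v : nat -> T) n : T := \sum_(j < n.+1) u j * v (n - j)%N.

(** Truncated products are computed as products of polynomials, whose coefficients are
    the truncated convolutions. *)
Lemma sum_prod_poly (T : nzRingType) (u v : nat -> T) N :
  (\sum_(i < N) u i) * (\sum_(i < N) v i) =
  \sum_(n < N + N) ((\poly_(i < N) u i) * (\poly_(i < N) v i))`_n.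
Proof.
set p := \poly_(i < N) u i; set q := \poly_(i < N) v i.
have sum1 (r : {poly T}) n : (size r <= n)%N -> \sum_(i < n) r`_i = r.[1].
  by move=> rn; rewrite (horner_coef_wide _ rn); apply: eq_bigr => i _; rewrite expr1n mulr1.
rewrite sum1; last first.
  apply: leq_trans (size_polyMleq _ _) _; apply: leq_trans (leq_pred _) _.
  by apply: leq_add; exact: size_poly.
have -> : (p * q).[1] = p.[1] * q.[1].
  by apply: hornerM_comm; rewrite /comm_poly mulr1 mul1r.
rewrite -(sum1 p N) ?size_poly // -(sum1 q N) ?size_poly //.
by congr (_ * _); apply: eq_bigr => i _; rewrite coef_poly ltn_ord.
Qed.

Lemma coef_conv (T : nzRingType) (u v : nat -> T) N n : (n < N)%N ->
  ((\poly_(i < N) u i) * (\poly_(i < N) v i))`_n = conv u v n.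
Proof.
move=> nN; rewrite coefM; apply: eq_bigr => j _.
by rewrite !coef_poly (leq_ltn_trans _ nN) ?(leq_ltn_trans (leq_subr _ _) nN) // -ltnS.
Qed.

Lemma conv_partial (x y : nat -> R) N : (forall n, 0 <= x n) -> (forall n, 0 <= y n) ->
  \sum_(n < N) conv x y n <= (\sum_(i < N) x i) * (\sum_(i < N) y i).
Proof.
move=> x0 y0; rewrite sum_prod_poly big_split_ord /= -[leLHS]addr0; apply: lerD.
  by apply: ler_sum => n _; rewrite coef_conv.
by apply: sumr_ge0 => n _; rewrite coefM; apply: sumr_ge0 => j _;
  rewrite !coef_poly mulr_ge0 //; case: ifP.
Qed.

(** The square of side [M] lies in the triangle of side [M + M]. *)
Lemma conv_partial2 (x y : nat -> R) M N : (forall n, 0 <= x n) -> (forall n, 0 <= y n) ->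
  (M + M <= N)%N ->
  (\sum_(i < M) x i) * (\sum_(i < M) y i) <= \sum_(n < N) conv x y n.
Proof.
move=> x0 y0 MN; rewrite sum_prod_poly.
have h0 n : 0 <= conv x y n by apply: sumr_ge0 => j _; rewrite mulr_ge0.
apply: (@le_trans _ _ (\sum_(n < M + M) conv x y n)).
  apply: ler_sum => n _; rewrite coefM; apply: ler_sum => j _; rewrite !coef_poly.
  by case: ifP => _; case: ifP => _; rewrite ?mul0r ?mulr0 // mulr_ge0.
rewrite -!(big_mkord xpredT (conv x y)) (big_cat_nat (leq0n _) MN) /= lerDl.
exact: sumr_ge0.
Qed.

Lemma asum_conv u v A B : asum_le u A -> asum_le v B -> asum_le (conv u v) (A * B).
Proof.
move=> uA vB n.
apply: (@le_trans _ _ (\sum_(k < n) conv (fun k => normc (u k)) (fun k => normc (v k)) k)).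
  apply: ler_sum => k _; apply: le_trans (le_normc_sum _ _ _) _.
  by apply: ler_sum => j _; rewrite normcM.
apply: le_trans (conv_partial _ (fun k => normc_ge0 _) (fun k => normc_ge0 _)) _.
by apply: ler_pM => //; apply: sumr_ge0 => k _; exact: normc_ge0.
Qed.

(** Mertens' argument: the partial sums of the convolution and the products of partial
    sums differ by at most the mass between the squares of side [N / 2] and [N]. *)
Lemma csum_conv u v A B : asum_le u A -> asum_le v B ->
  csum (conv u v) = csum u * csum v.
Proof.
move=> uA vB; pose a n := \sum_(k < n) normc (u k); pose b n := \sum_(k < n) normc (v k).
pose w := conv (fun k => normc (u k)) (fun k => normc (v k)).
have cab : (fun n => a n * b n) @ \oo --> limn a * limn b.
  have ca (z : nat -> R[i]) Z : asum_le z Z -> cvgn (fun n => \sum_(k < n) normc (z k)).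
    move=> zZ; have := @bounded_series_cvg (fun k => normc (z k)) Z.
    by rewrite seriesEord; apply => n; under eq_bigr do rewrite ger0_norm ?normc_ge0 //.
  by apply: cvgM; [exact: ca uA|exact: ca vB].
apply: csum_unique (asum_conv uA vB) _.
have h := ctoM (csum_cvg uA) (csum_cvg vB).
suff : cto (fun N => \sum_(n < N) conv u v n -
    (\sum_(k < N) u k) * (\sum_(k < N) v k)) 0.
  by move=> h0; have := ctoD h0 h; rewrite add0r; apply: cto_eq => n; rewrite subrK.
apply: (@cto_le _ _ _ (fun N => a N * b N - a N./2 * b N./2)).
  move=> N; rewrite subr0 normcB sum_prod_poly big_split_ord /=.
  under eq_bigr do rewrite coef_conv //.
  rewrite addrAC subrr add0r; apply: le_trans (le_normc_sum _ _ _) _.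
  apply: (@le_trans _ _ (a N * b N - \sum_(n < N) w n)); last first.
    rewrite lerD2l lerN2; apply: conv_partial2; try by move=> ?; exact: normc_ge0.
    by rewrite addnn -[leqRHS]odd_double_half leq_addl.
  have -> : a N * b N = _ := sum_prod_poly (fun k => normc (u k)) (fun k => normc (v k)) N.
  rewrite lerBrDl big_split_ord /=; apply: lerD.
    by apply: ler_sum => n _; rewrite coef_conv.
  apply: ler_sum => n _; rewrite !coefM; apply: le_trans (le_normc_sum _ _ _) _.
  apply: ler_sum => j _; rewrite normcM !coef_poly.
  by case: ifP => _; case: ifP => _; rewrite ?normc0.
rewrite -(subrr (limn a * limn b)); apply: cvgB => //.
have half : (fun N : nat => N./2) @ \oo --> \oo.
  move=> P [n _ nP]; exists (n.*2)%N => // k /=; rewrite -leq_double => h1.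
  apply: nP => /=; rewrite -leq_double (leq_trans _ (_ : (n.*2 <= k./2.*2)%N)) //.
  by rewrite -[n.*2]/(n.*2); rewrite leq_double -(doubleK n) half_leq // -leq_double.
exact: (cvg_comp _ _ half cab).
Qed.

End absolutely_summable.

(** * Complex differentiability and power series *)

Section complex_derivative.
Context {R : realType}.
Implicit Types F G : R[i] -> R[i].
Implicit Types z h : R[i].

(** The epsilon-delta form of complex differentiability, with real moduli. *)
Definition cdiff F z (D : R[i]) := forall e : R, 0 < e -> exists2 d : R, 0 < d &
  forall h, normc h < d -> normc (F (z + h) - F z - D * h) <= e * normc h.

Lemma gt0_complexP (e : R[i]) : 0 < e -> exists2 r : R, 0 < r & e = r%:C.
Proof.
by case: e => x y; rewrite ltcE /= => /andP[/eqP -> x0]; exists x.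
Qed.

Lemma normE (z : R[i]) : `|z| = (normc z)%:C.
Proof. by case: z. Qed.

Lemma cto_topological (u : nat -> R[i]) l : cto u l -> (u : nat -> R[i]^o) @ \oo --> (l : R[i]^o).
Proof.
rewrite /cto => ul; apply/cvgrPdist_lt => e /gt0_complexP[r r0 ->].
have [N _ hN] := cvgr0_norm_lt (fun n => normc (u n - l)) ul r r0.
exists N => // n /hN /=.
by rewrite ger0_norm ?normc_ge0 // normE ltcR normcB.
Qed.

Lemma limn_csum (u : nat -> R[i]) B : asum_le u B ->
  limn (series (u : nat -> R[i]^o)) = csum u :> R[i].
Proof.
move=> uB; apply: (cvg_lim (@norm_hausdorff _ R[i]^o)).
rewrite seriesEord; exact: (cto_topological (csum_cvg uB)).
Qed.

(** The bridge from real moduli to the order of [R[i]], whose positive elements are the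
    positive reals. *)
Lemma cdiff_derivable F z D : cdiff F z D -> derivable (F : R[i]^o -> R[i]^o) z 1.
Proof.
move=> FD; apply/cvg_ex; exists (D : R[i]^o); apply/cvgrPdist_le => e /gt0_complexP[r r0 ->].
have [d d0 hd] := FD _ r0.
have dC : 0 < d%:C :> R[i] by rewrite ltcR.
near=> h; have h0 : h != 0 :> R[i] by near: h; exact: nbhs_dnbhs_neq.
have hd' : normc (h : R[i]) < d.
  rewrite -ltcR -normE; near: h.
  by apply: dnbhs0_lt.
have {}hd := hd _ hd'.
rewrite normE lecR -(ler_pM2r (_ : 0 < normc (h : R[i]))) ?normc_gt0 //.
apply: le_trans hd; rewrite -normcM -normcN.
rewrite /GRing.scale /= mulr1 le_eqVlt; apply/orP; left; apply/eqP; congr normc.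
by rewrite [h + z]addrC; field.
Unshelve. all: by end_near. Qed.

Lemma derivable_cdiff F z : derivable (F : R[i]^o -> R[i]^o) z 1 -> exists D, cdiff F z D.
Proof.
move=> /cvg_ex[D FD]; exists (D : R[i]) => e e0.
have eC : 0 < e%:C :> R[i] by rewrite ltcR.
move/cvgrPdist_le : FD => /(_ _ eC) [d /gt0_complexP[r r0 ->] hd].
exists r => // h hr; have [->|h0] := eqVneq h 0.
  by rewrite addr0 mulr0 subrr subr0 normc0 mulr0.
have := hd h; rewrite /= sub0r normrN normE ltcR => /(_ hr h0).
rewrite /GRing.scale /= mulr1 normE lecR => {}hd.
rewrite -(ler_pM2r (_ : 0 < normc h)) ?normc_gt0 // -normcM in hd.
apply: le_trans hd; rewrite -normcN le_eqVlt; apply/orP; left; apply/eqP; congr normc.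
by rewrite [h + z]addrC; field.
Qed.

Lemma cdiff_lip F z D : cdiff F z D -> exists2 d : R, 0 < d &
  forall h, normc h < d -> normc (F (z + h) - F z) <= (1 + normc D) * normc h.
Proof.
move=> FD; have [d d0 hd] := FD 1 ltr01; exists d => // h /hd h1.
rewrite -[X in normc X](subrK (D * h)); apply: le_trans (le_normcD _ _) _.
by apply: le_trans (lerD h1 (lexx _)) _; rewrite normcM -mulrDl.
Qed.

Lemma cdiff_cts F z D : cdiff F z D -> forall e : R, 0 < e -> exists2 d : R, 0 < d &
  forall h, normc h < d -> normc (F (z + h) - F z) <= e.
Proof.
move=> /cdiff_lip[d d0 hd] e e0.
pose k := 1 + normc D; have k0 : 0 < k by rewrite ltr_pwDl ?normc_ge0.
exists (Num.min d (e / k)); first by rewrite lt_min d0 divr_gt0.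
move=> h; rewrite lt_min => /andP[/hd h1 h2]; apply: le_trans h1 _.
by rewrite -/k mulrC -ler_pdivlMr // ltW.
Qed.

End complex_derivative.

Section power_series.
Context {R : realType}.
Implicit Types c : nat -> R[i].
Implicit Types z w h : R[i].
Implicit Types r s : R.

(** Coefficients of a power series whose radius of convergence is at least 1. *)
Definition cps c := forall r, 0 <= r < 1 -> exists B, forall k, normc (c k) * r ^+ k <= B.

Definition pser c z := csum (fun k => c k * z ^+ k).

Lemma geom_le s n : 0 <= s < 1 -> \sum_(k < n) s ^+ k <= (1 - s)^-1.
Proof.
move=> /andP[s0 s1]; have h : 0 < 1 - s by rewrite subr_gt0.
rewrite -(ler_pM2l h) mulfV ?gt_eqF // -opprB mulNr -subrX1 opprB.
by rewrite gerBl exprn_ge0.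
Qed.

Lemma nat_geom_le s k : 0 <= s < 1 -> k.+1%:R * s ^+ k <= (1 - s)^-1.
Proof.
move=> s01; apply: le_trans (geom_le k.+1 s01).
rewrite mulr_natl -[X in s ^+ k *+ X](card_ord k.+1) -sumr_const.
apply: ler_sum => j _; case/andP: s01 => s0 s1.
by rewrite ler_wiXn2l // ?ltW // -ltnS.
Qed.

(** Geometric decay on a larger circle absorbs the square of the index. *)
Lemma cps_wsum c r : cps c -> 0 <= r < 1 -> exists B,
  forall n, \sum_(k < n) k.+1%:R ^+ 2 * normc (c k) * r ^+ k <= B.
Proof.
move=> hc /andP[r0 r1].
(* [s ^+ 4] is at least [r]: one power of [s] bounds the coefficients, two absorb
   the square of the index, and the last one is summed *)
pose s := 1 - (1 - r) / 4.
have s01 : 0 <= s < 1 by rewrite /s; apply/andP; split; lra.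
have s0 : 0 <= s by case/andP: s01.
have rs : r <= s ^+ 4.
  have : 0 <= (1 - r) / 4 <= 1 by apply/andP; split; lra.
  have -> : r = 1 - 4 * ((1 - r) / 4) by lra.
  rewrite /s; have -> : (1 - (1 - 4 * ((1 - r) / 4))) / 4 = (1 - r) / 4 by field.
  set x := (1 - r) / 4 => /andP[x0 x1].
  have -> : (1 - x) ^+ 4 = 1 - 4 * x + x ^+ 2 * ((2 - x) ^+ 2 + 2) by ring.
  by rewrite lerDl mulr_ge0 ?sqr_ge0 // addr_ge0 ?sqr_ge0.
have [B hB] := hc _ s01; pose T := (1 - s)^-1.
have T0 : 0 <= T by rewrite invr_ge0 subr_ge0 ltW //; case/andP: s01.
have B0 : 0 <= B by apply: le_trans (hB 0%N); rewrite mulr_ge0 ?normc_ge0 ?exprn_ge0.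
exists (B * T ^+ 2 * T) => n.
apply: (@le_trans _ _ (\sum_(k < n) B * T ^+ 2 * s ^+ k)); last first.
  by rewrite -mulr_sumr ler_wpM2l ?mulr_ge0 ?exprn_ge0 // geom_le.
apply: ler_sum => k _.
apply: (@le_trans _ _ ((normc (c k) * s ^+ k) * (k.+1%:R * s ^+ k) ^+ 2 * s ^+ k)).
  have -> : normc (c k) * s ^+ k * (k.+1%:R * s ^+ k) ^+ 2 * s ^+ k =
    k.+1%:R ^+ 2 * normc (c k) * (s ^+ 4) ^+ k.
    by rewrite -exprM mulnC exprM; ring.
  apply: ler_wpM2l; first by rewrite mulr_ge0 ?sqr_ge0 ?normc_ge0.
  by apply: lerXn2r; rewrite ?nnegrE ?exprn_ge0.
apply: ler_wpM2r; first exact: exprn_ge0.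
apply: ler_pM; rewrite ?sqr_ge0 ?mulr_ge0 ?normc_ge0 ?exprn_ge0 ?hB //.
by apply: lerXn2r; rewrite ?nnegrE ?mulr_ge0 ?exprn_ge0 //; exact: nat_geom_le.
Qed.

Lemma asum_wle c r z B : normc z <= r ->
  (forall n, \sum_(k < n) k.+1%:R ^+ 2 * normc (c k) * r ^+ k <= B) ->
  asum_le (fun k => c k * z ^+ k) B.
Proof.
move=> zr hB; apply: (@asum_le_dom _ _ (fun k => k.+1%:R ^+ 2 * normc (c k) * r ^+ k) _ _ hB) => k.
rewrite normcM normcX.
have r0 : 0 <= r := le_trans (normc_ge0 z) zr.
apply: (@le_trans _ _ (normc (c k) * r ^+ k)).
  by apply: ler_wpM2l; rewrite ?normc_ge0 // lerXn2r ?nnegrE ?normc_ge0.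
rewrite -[leLHS]mul1r -mulrA ler_wpM2r ?mulr_ge0 ?normc_ge0 ?exprn_ge0 //.
by rewrite exprn_ege1 // ler1n.
Qed.

Lemma pser_asum c z : cps c -> disc z -> exists B, asum_le (fun k => c k * z ^+ k) B.
Proof.
move=> hc zd; have [|B hB] := @cps_wsum c (normc z) hc; first by rewrite normc_ge0.
by exists B; exact: (asum_wle (lexx _) hB).
Qed.

Lemma pser_cvg c z : cps c -> disc z ->
  cto (fun n => \sum_(k < n) c k * z ^+ k) (pser c z).
Proof. by move=> hc /(pser_asum hc)[B]; exact: csum_cvg. Qed.

(** Second order Taylor estimate for a monomial, by induction on the exponent. The
    factor [r ^+ 2] on the left avoids the exponent [k - 2]. *)
Lemma expr_diff2 z h r k : 0 <= r -> normc (z + h) <= r -> normc z <= r ->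
  r ^+ 2 * normc ((z + h) ^+ k - z ^+ k - k%:R * z ^+ k.-1 * h) <=
    k%:R ^+ 2 * normc h ^+ 2 * r ^+ k.
Proof.
move=> r0 zhr zr; elim: k => [|k IH].
  by rewrite !expr0 subrr !mul0r subr0 normc0 mulr0 expr0n /= !mul0r.
have -> : (z + h) ^+ k.+1 - z ^+ k.+1 - k.+1%:R * z ^+ k.+1.-1 * h =
  (z + h) * ((z + h) ^+ k - z ^+ k - k%:R * z ^+ k.-1 * h) + k%:R * z ^+ k.-1 * h ^+ 2.
  case: k {IH} => [|k]; rewrite !exprS ?expr0 -?natr1; first by ring.
  by rewrite /=; ring.
apply: le_trans (ler_wpM2l (exprn_ge0 2 r0) (le_normcD _ _)) _.
rewrite mulrDr !normcM !normcX -expr2.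
have h1 : r ^+ 2 * (normc (z + h) * normc ((z + h) ^+ k - z ^+ k - k%:R * z ^+ k.-1 * h)) <=
    k%:R ^+ 2 * normc h ^+ 2 * r ^+ k.+1.
  have -> : k%:R ^+ 2 * normc h ^+ 2 * r ^+ k.+1 =
      r * (k%:R ^+ 2 * normc h ^+ 2 * r ^+ k) by rewrite [r ^+ _.+1]exprS; ring.
    rewrite mulrCA; apply: ler_pM => //; rewrite ?normc_ge0 //.
  by rewrite mulr_ge0 ?exprn_ge0 ?normc_ge0.
have h2 : r ^+ 2 * (normc (k%:R : R[i]) * normc z ^+ k.-1 * normc h ^+ 2) <=
    k%:R * normc h ^+ 2 * r ^+ k.+1.
  case: k {IH h1} => [|k]; first by rewrite normc0 !mul0r mulr0.
  rewrite normc_nat /=.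
  have -> : r ^+ 2 * (k.+1%:R * normc z ^+ k * normc h ^+ 2) =
    k.+1%:R * normc h ^+ 2 * (r ^+ 2 * normc z ^+ k) by ring.
  apply: ler_wpM2l; first by rewrite mulr_ge0 ?sqr_ge0.
  rewrite -[k.+2]/(2 + k)%N exprD; apply: ler_wpM2l; first exact: sqr_ge0.
  by rewrite lerXn2r ?nnegrE ?normc_ge0.
apply: le_trans (lerD h1 h2) _; rewrite -!mulrDl; apply: ler_wpM2r; first exact: exprn_ge0.
apply: ler_wpM2r; first exact: sqr_ge0.
by rewrite -natr1; have := ler0n R k; nra.
Qed.

Lemma expr_lip z w r k : 0 <= r -> normc z <= r -> normc w <= r ->
  r * normc (z ^+ k - w ^+ k) <= k%:R * r ^+ k * normc (z - w).
Proof.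
move=> r0 zr wr; elim: k => [|k IH]; first by rewrite !expr0 subrr normc0 mulr0 !mul0r.
have -> : z ^+ k.+1 - w ^+ k.+1 = z * (z ^+ k - w ^+ k) + (z - w) * w ^+ k.
  by rewrite !exprS; ring.
apply: le_trans (ler_wpM2l r0 (le_normcD _ _)) _; rewrite mulrDr !normcM normcX.
have h1 : r * (normc z * normc (z ^+ k - w ^+ k)) <= k%:R * r ^+ k.+1 * normc (z - w).
  rewrite mulrCA exprS [k%:R * _]mulrCA -mulrA; apply: ler_pM => //; rewrite ?normc_ge0 //.
  by rewrite mulr_ge0 ?normc_ge0.
have h2 : r * (normc (z - w) * normc w ^+ k) <= r ^+ k.+1 * normc (z - w).
  rewrite mulrCA mulrC exprS; apply: ler_wpM2r; first exact: normc_ge0.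
  by apply: ler_wpM2l => //; rewrite lerXn2r ?nnegrE ?normc_ge0.
apply: le_trans (lerD h1 h2) _; rewrite -mulrDl; apply: ler_wpM2r; first exact: normc_ge0.
by rewrite -natr1 mulrDl mul1r.
Qed.

(** The coefficients of the derivative. *)
Definition dser c : nat -> R[i] := fun k => k.+1%:R * c k.+1.

Lemma csum_shift (u : nat -> R[i]) B : asum_le u B -> csum u = u 0%N + csum (fun k => u k.+1).
Proof.
move=> uB; have uB' : asum_le (fun k => u k.+1) B.
  move=> n; apply: le_trans (uB n.+1); rewrite big_ord_recl lerDr normc_ge0.
  by [].
apply: (csum_unique uB); have h := ctoD (cto_cst (u 0%N)) (csum_cvg uB').
rewrite /cto -(cvg_shiftn 1) /=; apply: cvg_trans h; apply: near_eq_cvg.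
by apply: nearW => n; rewrite addn1 big_ord_recl.
Qed.

(** The second order estimates of the monomials sum up to a quadratic remainder. *)
Lemma pser_cdiff c z : cps c -> disc z -> cdiff (pser c) z (pser (dser c) z).
Proof.
move=> hc zd; pose r := (1 + normc z) / 2.
have z1 : normc z < 1 by [].
have z0 := normc_ge0 z.
have r01 : 0 <= r < 1 by rewrite /r; apply/andP; split; lra.
have r0 : 0 < r by rewrite /r; lra.
have zr : normc z < r by rewrite /r; lra.
have [B hB] := cps_wsum hc r01.
have B0 : 0 <= B by have := hB 0%N; rewrite big_ord0.
have az w : normc w <= r -> asum_le (fun k => c k * w ^+ k) B.
  by move=> wr; exact: asum_wle wr hB.
pose u k := k%:R * c k * z ^+ k.-1.
have au : asum_le u (B / r).
  apply: (@asum_le_dom _ _ (fun k => (k.+1%:R ^+ 2 * normc (c k) * r ^+ k) / r)); last first.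
    by move=> n; rewrite -mulr_suml ler_pM2r ?invr_gt0.
  move=> [|k]; rewrite /u.
    by rewrite !mul0r normc0 !mulr_ge0 ?normc_ge0 ?invr_ge0 ?exprn_ge0 // ltW.
  rewrite !normcM normc_nat normcX /=.
  have -> : k.+2%:R ^+ 2 * normc (c k.+1) * r ^+ k.+1 / r =
    k.+2%:R ^+ 2 * normc (c k.+1) * r ^+ k.
    by rewrite [r ^+ _.+1]exprS; field; rewrite gt_eqF.
  apply: ler_pM; rewrite ?mulr_ge0 ?normc_ge0 ?exprn_ge0 ?normc_ge0 //.
    apply: ler_wpM2r; first exact: normc_ge0.
    apply: (@le_trans _ _ k.+2%:R); first by rewrite ler_nat.
    by rewrite expr2 ler_peMr // ler1n.
  by rewrite lerXn2r ?nnegrE ?normc_ge0 // ltW.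
have Du : pser (dser c) z = csum u.
  rewrite (csum_shift au) /u !mul0r add0r; apply: eq_csum => k.
  by rewrite /dser.
rewrite Du => e e0.
exists (Num.min (r - normc z) (e * r ^+ 2 / (B + 1))).
  rewrite lt_min subr_gt0 zr /=; apply: divr_gt0; last by rewrite ltr_wpDl.
  by rewrite mulr_gt0 ?exprn_gt0.
move=> h; rewrite lt_min => /andP[h1 h2].
have zhr : normc (z + h) <= r.
  by apply: le_trans (le_normcD _ _) _; rewrite -lerBrDl ltW.
have e1 : pser c (z + h) - pser c z - csum u * h =
    csum (fun k => c k * ((z + h) ^+ k - z ^+ k - k%:R * z ^+ k.-1 * h)).
  have a1 := az _ zhr; have a2 := asum_leZ (-1) (az _ (ltW zr)).
  have a3 := asum_leZ (- h) au.
  rewrite -[X in _ + X - _]mulN1r [csum u * h]mulrC -[- (h * csum u)]mulNr.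
  rewrite /pser -(csumZ (-1) (az _ (ltW zr))) -(csumZ (- h) au) -(csumD a1 a2).
  rewrite -(csumD (asum_leD a1 a2) a3); apply: eq_csum => k.
  by rewrite /u; ring.
rewrite e1.
have a4 : asum_le (fun k => c k * ((z + h) ^+ k - z ^+ k - k%:R * z ^+ k.-1 * h))
    (normc h ^+ 2 / r ^+ 2 * B).
  apply: (@asum_le_dom _ _ (fun k => normc h ^+ 2 / r ^+ 2 * (k.+1%:R ^+ 2 * normc (c k) * r ^+ k))).
    move=> k; rewrite normcM.
    have := expr_diff2 k (ltW r0) zhr (ltW zr) => hk.
    set x := normc (_ - _) in hk *.
    have hk' : x <= k%:R ^+ 2 * normc h ^+ 2 * r ^+ k / r ^+ 2.
      by rewrite ler_pdivlMr ?exprn_gt0 // mulrC.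
    apply: le_trans (ler_wpM2l (normc_ge0 _) hk') _.
    have -> : normc h ^+ 2 / r ^+ 2 * (k.+1%:R ^+ 2 * normc (c k) * r ^+ k) =
      k.+1%:R ^+ 2 * (normc (c k) * normc h ^+ 2 * r ^+ k / r ^+ 2) by ring.
    have -> : normc (c k) * (k%:R ^+ 2 * normc h ^+ 2 * r ^+ k / r ^+ 2) =
      k%:R ^+ 2 * (normc (c k) * normc h ^+ 2 * r ^+ k / r ^+ 2) by ring.
    apply: ler_wpM2r.
      by rewrite !mulr_ge0 ?normc_ge0 ?exprn_ge0 ?invr_ge0 ?exprn_ge0 ?normc_ge0 // ltW.
    by rewrite lerXn2r ?nnegrE // ler_nat.
  by move=> n; rewrite -mulr_sumr ler_wpM2l // divr_ge0 ?sqr_ge0.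
apply: le_trans (csum_le a4) _.
have : normc h * (B + 1) <= e * r ^+ 2 by rewrite -ler_pdivlMr ?ltr_wpDl // ltW.
move=> h3; have r2 : 0 < r ^+ 2 by rewrite exprn_gt0.
rewrite mulrAC ler_pdivrMr //.
have := normc_ge0 h; set x := normc h in h3 *; move=> x0.
have : x * (x * B) <= x * (e * r ^+ 2) by rewrite ler_wpM2l // (le_trans _ h3) // ler_wpM2l // lerDl.
by rewrite expr2 -!mulrA [e * (x * _)]mulrCA.
Qed.

Lemma pser_lip c r : cps c -> 0 < r < 1 -> exists2 L : R, 0 <= L & forall z w,
  normc z <= r -> normc w <= r -> normc (pser c z - pser c w) <= L * normc (z - w).
Proof.
move=> hc /andP[r0 r1]; have r01 : 0 <= r < 1 by rewrite ltW.
have [B hB] := cps_wsum hc r01.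
have B0 : 0 <= B by have := hB 0%N; rewrite big_ord0.
exists (B / r); first by rewrite divr_ge0 // ltW.
move=> z w zr wr; apply: (csum_dist (asum_wle zr hB) (asum_wle wr hB)).
have -> : B / r * normc (z - w) = normc (z - w) / r * B by ring.
apply: (@asum_le_dom _ _ (fun k => normc (z - w) / r * (k.+1%:R ^+ 2 * normc (c k) * r ^+ k))).
  move=> k; rewrite -mulrBr normcM.
  have hk := expr_lip k (ltW r0) zr wr.
  have hk' : normc (z ^+ k - w ^+ k) <= k%:R * r ^+ k * normc (z - w) / r.
    by rewrite ler_pdivlMr // mulrC.
  apply: le_trans (ler_wpM2l (normc_ge0 _) hk') _.
  have -> : normc (z - w) / r * (k.+1%:R ^+ 2 * normc (c k) * r ^+ k) =
    k.+1%:R ^+ 2 * (normc (c k) * (r ^+ k * normc (z - w) / r)) by ring.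
  have -> : normc (c k) * (k%:R * r ^+ k * normc (z - w) / r) =
    k%:R * (normc (c k) * (r ^+ k * normc (z - w) / r)) by ring.
  apply: ler_wpM2r.
    by rewrite !mulr_ge0 ?normc_ge0 ?exprn_ge0 ?invr_ge0 // ltW.
  apply: (@le_trans _ _ k.+1%:R); first by rewrite ler_nat.
  by rewrite expr2 ler_peMr // ler1n.
by move=> n; rewrite -mulr_sumr ler_wpM2l // divr_ge0 ?normc_ge0 // ltW.
Qed.

(** Ratio test, with ratios [(n + K) / (n + eta)]. *)
Lemma ratio_cps c (eta K : R) : 0 < eta -> 0 <= K ->
  (forall n, normc (c n.+1) * (n%:R + eta) <= normc (c n) * (n%:R + K)) -> cps c.
Proof.
move=> eta0 K0 hc r /andP[r0 r1].
have [N hN] : exists N : nat, K <= N%:R * (1 - r).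
  exists (Num.truncn (K / (1 - r))).+1.
  by rewrite -ler_pdivrMr ?subr_gt0 // ltW // truncnS_gt.
have step n : (N <= n)%N -> normc (c n.+1) * r ^+ n.+1 <= normc (c n) * r ^+ n.
  move=> Nn; have n0 : 0 < n%:R + eta by rewrite ltr_wpDl.
  rewrite -(ler_pM2r n0) exprS.
  apply: (@le_trans _ _ (normc (c n) * (n%:R + K) * (r * r ^+ n))).
    rewrite mulrAC; apply: ler_wpM2r; [by rewrite mulr_ge0 ?exprn_ge0 | exact: hc].
  have -> : normc (c n) * (n%:R + K) * (r * r ^+ n) =
    normc (c n) * r ^+ n * ((n%:R + K) * r) by ring.
  apply: ler_wpM2l; first by rewrite mulr_ge0 ?normc_ge0 ?exprn_ge0.
  have : N%:R * (1 - r) <= n%:R * (1 - r) by rewrite ler_wpM2r ?subr_ge0 ?(ltW r1) // ler_nat.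
  have : (n%:R + K) * r <= n%:R * r + K by rewrite mulrDl lerD2l ler_piMr // ltW.
  by move: hN; rewrite !mulrBr !mulr1; lra.
exists (\sum_(k < N.+1) normc (c k) * r ^+ k) => k.
have t0 j : 0 <= normc (c j) * r ^+ j by rewrite mulr_ge0 ?normc_ge0 ?exprn_ge0.
have le1 j : (j <= N)%N -> normc (c j) * r ^+ j <= \sum_(k < N.+1) normc (c k) * r ^+ k.
  move=> jN; rewrite (bigD1 (Ordinal (jN : (j < N.+1)%N))) //= lerDl.
  by apply: sumr_ge0 => i _; exact: t0.
have [kN|Nk] := leqP k N; first exact: le1.
rewrite -(subnK (ltnW Nk)); elim: (k - N)%N => [|j IH]; first by rewrite add0n le1.
by apply: le_trans IH; rewrite addSn step // leq_addl.
Qed.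

End power_series.

(** * Binomial series and the coefficients of the kernel *)

Section curve_derivative.
Context {R : realType}.
Implicit Types (f g : R -> R[i]) (F : R[i] -> R[i]) (t : R).

Lemma is_derive_eps (f : R -> R) t (D : R) : is_derive t 1 f D ->
  forall e : R, 0 < e -> exists2 d : R, 0 < d &
  forall h, `|h| < d -> `|f (t + h) - f t - D * h| <= e * `|h|.
Proof.
move=> [/cvg_ex[l fl] fD] e e0.
have lD : l = D by rewrite -fD; apply/esym/cvg_lim.
move: fl; rewrite lD => /cvgrPdist_le /(_ _ e0) [d d0 hd].
exists d => // h hr; have [->|h0] := eqVneq h 0.
  by rewrite addr0 mulr0 subrr subr0 normr0 mulr0.
have := hd h; rewrite /= sub0r normrN => /(_ hr h0).
rewrite /GRing.scale /= mulr1 => {}hd.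
rewrite -(ler_pM2r (_ : 0 < `|h|)) ?normr_gt0 // -normrM in hd.
apply: le_trans hd; rewrite -normrN le_eqVlt; apply/orP; left; apply/eqP; congr `|_|.
by rewrite [h + t]addrC; field.
Qed.

Lemma eps_is_derive (f : R -> R) t (D : R) : (forall e : R, 0 < e -> exists2 d : R, 0 < d &
  forall h, `|h| < d -> `|f (t + h) - f t - D * h| <= e * `|h|) -> is_derive t 1 f D.
Proof.
move=> FD; have fl : h^-1 *: (f (h *: (1 : R) + t) - f t) @[h --> 0^'] --> D.
  apply/cvgrPdist_le => r r0.
  have [d d0 hd] := FD _ r0.
  near=> h; have h0 : h != 0 by near: h; exact: nbhs_dnbhs_neq.
  have hd' : `|h| < d by near: h; apply: dnbhs0_lt.
  have {}hd := hd _ hd'.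
  rewrite -(ler_pM2r (_ : 0 < `|h|)) ?normr_gt0 //.
  apply: le_trans hd; rewrite -normrM -normrN.
  rewrite /GRing.scale /= mulr1 le_eqVlt; apply/orP; left; apply/eqP; congr `|_|.
  by rewrite [h + t]addrC; field.
split; first by apply/cvg_ex; exists D.
exact/cvg_lim.
Unshelve. all: by end_near. Qed.

(** Derivatives along real lines are taken componentwise, to reuse real calculus. *)
Definition cderiv f t (D : R[i]) :=
  is_derive t 1 (fun s => complex.Re (f s)) (complex.Re D) /\
  is_derive t 1 (fun s => complex.Im (f s)) (complex.Im D).

Lemma cderivM f g t D E : cderiv f t D -> cderiv g t E ->
  cderiv (fun s => f s * g s) t (f t * E + g t * D).
Proof.
move=> [fr fi] [gr gi]; split.
  under eq_fun do rewrite ReM; rewrite ReD !ReM.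
  by apply: (is_derive_eq (dB (dM fr gr) (dM fi gi))); ring.
under eq_fun do rewrite ImM; rewrite ImD !ImM.
by apply: (is_derive_eq (dD (dM fr gi) (dM fi gr))); ring.
Qed.

Lemma cderiv_line (z w : R[i]) t : cderiv (fun s => z + s%:C * w) t w.
Proof.
split.
  under eq_fun do rewrite ReD ReM /= mul0r subr0.
  by apply: (is_derive_eq (dD (dcst _ _) (dM (did _) (dcst _ _)))); ring.
under eq_fun do rewrite ImD ImM /= mul0r addr0.
by apply: (is_derive_eq (dD (dcst _ _) (dM (did _) (dcst _ _)))); ring.
Qed.

Lemma cdiff_cderiv_line F (z w : R[i]) t D : cdiff F (z + t%:C * w) D ->
  cderiv (fun s => F (z + s%:C * w)) t (D * w).
Proof.
move=> FD.
have key (e : R) : 0 < e -> exists2 d : R, 0 < d & forall h : R, `|h| < d ->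
   normc (F (z + (t + h)%:C * w) - F (z + t%:C * w) - D * w * h%:C) <= e * `|h|.
  move=> e0; have w0 := normc_ge0 w.
  have k0 : 0 < normc w + 1 by rewrite ltr_wpDl.
  have [d d0 hd] := FD _ (divr_gt0 e0 k0).
  exists (d / (normc w + 1)); first exact: divr_gt0.
  move=> h; rewrite ltr_pdivlMr // => hlt.
  have hwd : normc (h%:C * w) < d.
    rewrite normcM normc_real; apply: le_lt_trans hlt.
    by rewrite ler_wpM2l // lerDl.
  have := hd _ hwd; rewrite rmorphD /= mulrDl addrA -mulrA [w * _]mulrC.
  move=> h1; apply: le_trans h1 _; rewrite normcM normc_real.
  have -> : e / (normc w + 1) * (`|h| * normc w) = (e * `|h|) * (normc w / (normc w + 1)) by ring.
  apply: ler_piMr; first by rewrite mulr_ge0 // ltW.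
  by rewrite ler_pdivrMr // mul1r lerDl.
split; apply: eps_is_derive => e /key[d d0 hd]; exists d => // h /hd;
  apply: le_trans.
  apply: le_trans (le_normc_Re _); rewrite !(ReD, ReN) [complex.Re (_ * h%:C)]ReM /=.
  by rewrite mulr0 subr0.
apply: le_trans (le_normc_Im _); rewrite !(ImD, ImN) [complex.Im (_ * h%:C)]ImM /=.
by rewrite mulr0 add0r.
Qed.

Lemma cderiv0_eq f : (forall t, 0 <= t <= 1 -> cderiv f t 0) -> f 1 = f 0.
Proof.
move=> fD.
have key (g : R -> R) : (forall t, 0 <= t <= 1 -> is_derive t 1 g 0) -> g 1 = g 0.
  move=> gD.
  have [||c _] := @MVT_segment R g (fun=> 0) 0 1 ler01.
  - by move=> t; rewrite in_itv /= => /andP[t0 t1]; apply: gD; rewrite !ltW.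
  - apply: derivable_within_continuous => t; rewrite in_itv /= => t01.
    by have [] := gD t t01.
  by rewrite mul0r => /eqP; rewrite subr_eq0 => /eqP.
by apply: complexP; [apply: (key (fun s => complex.Re (f s)))|
  apply: (key (fun s => complex.Im (f s)))] => t /fD[].
Qed.

End curve_derivative.

Section complex_powers.
Context {R : realType}.
Implicit Types (w xi : R[i]) (s t x : R).

Definition carg w : R := atan (complex.Im w / complex.Re w).

Lemma cpowE w s : cpow w s = (normc w `^ s)%:C * (cos (s * carg w) +i* sin (s * carg w)).
Proof. by []. Qed.

Lemma normc_cis x : normc (cos x +i* sin x) = 1.
Proof. by rewrite normcE /= cos2Dsin2 sqrtr1. Qed.

Lemma normc_cpow w s : normc (cpow w s) = normc w `^ s.
Proof. by rewrite cpowE normcM normc_cis mulr1 normc_nng ?powR_ge0. Qed.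

Lemma cisD x y : (cos (x + y) +i* sin (x + y)) =
  (cos x +i* sin x) * (cos y +i* sin y).
Proof. by apply: complexP; rewrite ?ReM ?ImM /= ?cosD ?sinD //; ring. Qed.

Lemma cpowD w s t : w != 0 -> cpow w (s + t) = cpow w s * cpow w t.
Proof.
move=> w0; rewrite !cpowE powRD ?normc_gt0; last first.
  by apply/implyP => _; rewrite gt_eqF // normc_gt0.
by rewrite mulrDl cisD real_complexM; ring.
Qed.

Lemma cpow0 w : cpow w 0 = 1.
Proof.
by rewrite cpowE powRr0 mul0r cos0 sin0 mul1r; apply: complexP.
Qed.

Lemma cpow1 s : cpow 1 s = 1.
Proof.
rewrite cpowE /carg /= mul0r atan0 mulr0 cos0 sin0.
by rewrite expr1n expr0n /= addr0 sqrtr1 powR1 mul1r; apply: complexP.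
Qed.

Lemma cpow_neq0 w s : w != 0 -> cpow w s != 0.
Proof. by move=> w0; rewrite -normc_gt0 normc_cpow powR_gt0 // normc_gt0. Qed.

Lemma cpowN w s : w != 0 -> cpow w (- s) = (cpow w s)^-1.
Proof.
move=> w0; apply: (mulfI (cpow_neq0 s w0)).
by rewrite mulfV ?cpow_neq0 // -cpowD // subrr cpow0.
Qed.

Lemma disc_onem xi : disc xi -> 0 < complex.Re (1 - xi).
Proof.
move=> d; rewrite ReD ReN /= subr_gt0.
by apply: le_lt_trans d; apply: le_trans (le_normc_Re _); exact: ler_norm.
Qed.

Lemma onem_neq0 xi : disc xi -> 1 - xi != 0.
Proof. by move=> /disc_onem; apply: contraTneq => ->; rewrite ltxx. Qed.

Lemma normc_powR w s : normc w `^ s = (complex.Re w ^+ 2 + complex.Im w ^+ 2) `^ (s / 2).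
Proof.
rewrite -sqr_normc -[normc w ^+ 2]powR_mulrn ?normc_ge0 // -powRrM.
by congr (_ `^ _); field.
Qed.

Lemma divc_ReIm (z w : R[i]) : w != 0 -> z / w =
  ((complex.Re z * complex.Re w + complex.Im z * complex.Im w) /
     (complex.Re w ^+ 2 + complex.Im w ^+ 2)) +i*
  ((complex.Im z * complex.Re w - complex.Re z * complex.Im w) /
     (complex.Re w ^+ 2 + complex.Im w ^+ 2)).
Proof.
move=> w0; have N0 : complex.Re w ^+ 2 + complex.Im w ^+ 2 != 0.
  by rewrite -sqr_normc expf_neq0 // gt_eqF // normc_gt0.
apply: (mulIf w0); rewrite divfK //.
by apply: complexP; rewrite ?ReM ?ImM /=; field.
Qed.

(** Only the restriction of the power to a line inside the half-plane is differentiated;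
    this suffices to identify it with its power series along a ray. *)
Lemma cderiv_cpow_line (z w : R[i]) s t : 0 < complex.Re (z + t%:C * w) ->
  cderiv (fun y => cpow (z + y%:C * w) s) t
    (s%:C * (w / (z + t%:C * w)) * cpow (z + t%:C * w) s).
Proof.
move=> h; have w0 : z + t%:C * w != 0 by apply: contraTneq h => ->; rewrite ltxx.
rewrite (divc_ReIm _ w0).
have [du dv] := cderiv_line z w t.
under [X in cderiv X](_ : _ = _) do idtac.
set u := (fun y => complex.Re (z + y%:C * w)) in du.
set v := (fun y => complex.Im (z + y%:C * w)) in dv.
rewrite -/(u t) -/(v t) in h *.
have u0 : u t != 0 by rewrite gt_eqF.
have N0 : 0 < u t ^+ 2 + v t ^+ 2 by rewrite ltr_pwDl ?exprn_gt0 ?sqr_ge0.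
have dN : is_derive t 1 (fun y => u y ^+ 2 + v y ^+ 2)
    (2 * (u t * complex.Re w + v t * complex.Im w)).
  by apply: (is_derive_eq (dD (dM du du) (dM dv dv))); ring.
have dP : is_derive t 1 (fun y => (u y ^+ 2 + v y ^+ 2) `^ (s / 2))
    (s * ((u t * complex.Re w + v t * complex.Im w) / (u t ^+ 2 + v t ^+ 2)) *
      (u t ^+ 2 + v t ^+ 2) `^ (s / 2)).
  apply: (is_derive_eq (@dcomp _ (fun y => u y ^+ 2 + v y ^+ 2) (fun r => r `^ (s / 2)) t _ _
    (is_derive1_powR (s / 2) N0) dN)).
  rewrite powRB; last by apply/implyP => _; rewrite gt_eqF.
  rewrite powRr1 ?ltW //; move: (u t) (v t) N0 => U V N0.
  by field; rewrite gt_eqF.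
have dA : is_derive t 1 (fun y => s * atan (v y / u y))
    (s * ((complex.Im w * u t - complex.Re w * v t) / (u t ^+ 2 + v t ^+ 2))).
  apply: (is_derive_eq (dM (dcst _ _) (dcomp (is_derive1_atan _) (dM dv (dV u0 du))))).
  move: (u t) (v t) u0 N0 => U V U0 N0; field; rewrite U0 /= gt_eqF //.
have dc := dcomp (is_derive_cos _) dA.
have ds := dcomp (is_derive_sin _) dA.
have E y : cpow (z + y%:C * w) s = ((u y ^+ 2 + v y ^+ 2) `^ (s / 2))%:C *
   (cos (s * atan (v y / u y)) +i* sin (s * atan (v y / u y))).
  by rewrite cpowE normc_powR.
split.
  under eq_fun do rewrite E ReM /= mul0r subr0.
  apply: (is_derive_eq (dM dP dc)); rewrite E !(ReM, ImM) /=; ring.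
under eq_fun do rewrite E ImM /= mul0r addr0.
apply: (is_derive_eq (dM dP ds)); rewrite E !(ReM, ImM) /=; ring.
Qed.

End complex_powers.

Section binomial_series.
Context {R : realType}.
Implicit Types (w xi : R[i]) (s t x y : R).

(** Coefficients of the power series of [(1 - xi) ^ s]. *)
Definition bcoef s (n : nat) : R := (-1) ^+ n * gbinom s n.

Lemma bcoef0 s : bcoef s 0 = 1.
Proof. by rewrite /bcoef /gbinom big_ord0 fact0 divr1 mulr1. Qed.

Lemma bcoefS s n : n.+1%:R * bcoef s n.+1 = (n%:R - s) * bcoef s n.
Proof.
rewrite /bcoef /gbinom big_ord_recr /= factS natrM exprS.
have f0 : n`!%:R != 0 :> R by rewrite pnatr_eq0 -lt0n fact_gt0.
by field; rewrite f0 /= addrC natr1 pnatr_eq0.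
Qed.

Lemma cps_bcoef s : cps (fun n => (bcoef s n)%:C).
Proof.
apply: (@ratio_cps _ _ 1 `|s|) => // n; rewrite !normc_real natr1.
rewrite -[n.+1%:R]normr_nat -normrM mulrC bcoefS normrM mulrC ler_wpM2l //.
by apply: le_trans (ler_normB _ _) _; rewrite normr_nat.
Qed.

Lemma cps_le (c c' : nat -> R[i]) : cps c ->
  (forall n, normc (c' n) <= n.+1%:R ^+ 2 * normc (c n)) -> cps c'.
Proof.
move=> hc h r r01; have [B hB] := cps_wsum hc r01; exists B => k.
apply: le_trans (hB k.+1); rewrite big_ord_recr /= ler_wpDl //.
  apply: sumr_ge0 => j _; case/andP: r01 => r0 _.
  by rewrite mulr_ge0 ?mulr_ge0 ?sqr_ge0 ?normc_ge0 ?exprn_ge0.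
by apply: ler_wpM2r => //; apply: exprn_ge0; case/andP: r01.
Qed.

Lemma pserD (c c' : nat -> R[i]) xi : cps c -> cps c' -> disc xi ->
  pser (fun n => c n + c' n) xi = pser c xi + pser c' xi.
Proof.
move=> hc hc' xid; have [B hB] := pser_asum hc xid; have [B' hB'] := pser_asum hc' xid.
by rewrite /pser -(csumD hB hB'); apply: eq_csum => n; rewrite mulrDl.
Qed.

Lemma pserZ (c : nat -> R[i]) a xi : cps c -> disc xi ->
  pser (fun n => a * c n) xi = a * pser c xi.
Proof.
move=> hc xid; have [B hB] := pser_asum hc xid.
by rewrite /pser -(csumZ _ hB); apply: eq_csum => n; rewrite mulrA.
Qed.

Lemma cpsS (c : nat -> R[i]) : cps c -> cps (fun n => c n.+1).
Proof.
move=> hc r /andP[r0 r1]; pose r' := (1 + r) / 2.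
have r'0 : 0 < r' by rewrite /r'; lra.
have [|B hB] := hc r'; first by rewrite /r'; apply/andP; split; lra.
exists (B / r') => k; rewrite ler_pdivlMr //.
apply: le_trans (hB k.+1); rewrite -mulrA; apply: ler_wpM2l; first exact: normc_ge0.
rewrite exprSr; apply: ler_wpM2r; first exact: ltW.
by rewrite lerXn2r ?nnegrE // ?(ltW r'0) // /r'; lra.
Qed.

Lemma pser_shift (c : nat -> R[i]) xi : cps c -> disc xi ->
  pser c xi = c 0%N + xi * pser (fun n => c n.+1) xi.
Proof.
move=> hc xid; have [B hB] := pser_asum hc xid.
have [B' hB'] := pser_asum (cpsS hc) xid.
rewrite /pser (csum_shift hB) expr0 mulr1 -(csumZ _ hB'); congr (_ + _).
by apply: eq_csum => n; rewrite exprS; ring.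
Qed.

Lemma disc0 : disc (0 : R[i]).
Proof. by rewrite /disc /= expr0n /= addr0 sqrtr0. Qed.

Lemma pser0 (c : nat -> R[i]) : cps c -> pser c 0 = c 0%N.
Proof. by move=> hc; rewrite (pser_shift hc disc0) mul0r addr0. Qed.

Lemma dser_bcoef s xi : disc xi ->
  (1 - xi) * pser (dser (fun n => (bcoef s n)%:C)) xi =
  - s%:C * pser (fun n => (bcoef s n)%:C) xi.
Proof.
move=> xid; have hb := cps_bcoef s; set b := (fun n => (bcoef s n)%:C) in hb *.
have hEb : cps (fun n => n%:R * b n).
  apply: (cps_le hb) => n; rewrite normcM normc_nat ler_wpM2r ?normc_ge0 //.
  apply: (@le_trans _ _ n.+1%:R); first by rewrite ler_nat.
  by rewrite expr2 ler_peMr // ler1n.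
have hsb : cps (fun n => - s%:C * b n).
  by move=> r r01; have [B hB] := hb r r01; exists (`|s| * B) => k;
    rewrite normcM normcN normc_real -mulrA ler_wpM2l.
have e1 : pser (dser b) xi = pser (fun n => n%:R * b n) xi - s%:C * pser b xi.
  rewrite -mulNr -(pserZ _ hb xid) -(pserD hEb hsb xid); apply: eq_csum => n.
  congr (_ * _); rewrite /dser /b -mulrDl -[n.+1%:R]/(n.+1%:R : R[i]).
  rewrite -!(rmorph_nat (real_complex R)) -rmorphN -rmorphD -!rmorphM.
  by rewrite bcoefS.
have e2 : pser (fun n => n%:R * b n) xi = xi * pser (dser b) xi.
  by rewrite (pser_shift hEb xid) mul0r add0r.
by rewrite mulrBl mul1r {1}e1 e2; ring.
Qed.

(** The binomial series: along a ray, the quotient of both sides is constant. *)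
Lemma pser_bcoef s xi : disc xi -> pser (fun n => (bcoef s n)%:C) xi = cpow (1 - xi) s.
Proof.
move=> xid; pose b n := (bcoef s n)%:C; have hb : cps b := cps_bcoef s.
pose f t := pser b (0 + t%:C * xi) * cpow (1 + t%:C * (- xi)) (- s).
have td t : 0 <= t <= 1 -> disc (0 + t%:C * xi).
  move=> /andP[t0 t1]; rewrite add0r /disc /= normcM normc_nng //.
  by apply: le_lt_trans xid; rewrite ler_piMl ?normc_ge0.
have : f 1 = f 0.
  apply: cderiv0_eq => t /td ht.
  have r0 : 0 < complex.Re (1 + t%:C * (- xi)) by rewrite mulrN; move: ht; rewrite add0r => /disc_onem.
  have d1 := cdiff_cderiv_line (pser_cdiff hb ht).
  have d2 := cderiv_cpow_line (- s) r0.
  have := cderivM d1 d2.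
  have w0 : 1 + t%:C * - xi != 0 by apply: contraTneq r0 => ->; rewrite ltxx.
  have := dser_bcoef s ht; rewrite -/b.
  set S := pser b _; set S' := pser (dser b) _; set P := cpow _ _.
  rewrite {1}add0r -mulrN => e.
  have -> : S' = - s%:C * S / (1 + t%:C * - xi) by rewrite -e mulrC mulKf.
  rewrite (_ : S * _ + _ = 0) //; rewrite rmorphN; field => //.
have -> : f 1 = pser b xi * cpow (1 - xi) (- s) by rewrite /f rmorph1 add0r !mul1r.
have -> : f 0 = 1 by rewrite /f rmorph0 !mul0r !addr0 (pser0 hb) cpow1 mulr1 /b bcoef0.
have h0 := onem_neq0 xid; rewrite cpowN // => e.
by rewrite -[LHS](divfK (cpow_neq0 s h0)) -/b e mul1r.
Qed.

(** The Euler operator is a derivation for Cauchy products. *)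
Lemma conv_euler (u v : nat -> R) n :
  conv (fun k => k%:R * u k) v n + conv u (fun k => k%:R * v k) n = n%:R * conv u v n.
Proof.
rewrite /conv -big_split mulr_sumr; apply: eq_bigr => j _ /=.
have jn : (j <= n)%N by rewrite -ltnS.
by rewrite natrB //; ring.
Qed.

Lemma conv_shift (u v : nat -> R) n :
  conv (fun k => u k.+1) v n = conv u v n.+1 - u 0%N * v n.+1.
Proof.
by rewrite /conv [in RHS]big_ord_recl /= subn0 addrAC subrr add0r.
Qed.

Lemma conv_shiftr (u v : nat -> R) n :
  conv u (fun k => v k.+1) n = conv u v n.+1 - u n.+1 * v 0%N.
Proof.
rewrite /conv [in RHS]big_ord_recr /= subnn addrK; apply: eq_bigr => j _.
by rewrite subSn // -ltnS.
Qed.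

Lemma convDl (u u' v : nat -> R) n :
  conv (fun k => u k + u' k) v n = conv u v n + conv u' v n.
Proof. by rewrite /conv -big_split; apply: eq_bigr => j _; rewrite mulrDl. Qed.

Lemma convDr (u v v' : nat -> R) n :
  conv u (fun k => v k + v' k) n = conv u v n + conv u v' n.
Proof. by rewrite /conv -big_split; apply: eq_bigr => j _; rewrite mulrDr. Qed.

Lemma convZl a (u v : nat -> R) n : conv (fun k => a * u k) v n = a * conv u v n.
Proof. by rewrite /conv mulr_sumr; apply: eq_bigr => j _; rewrite mulrA. Qed.

Lemma convZr a (u v : nat -> R) n : conv u (fun k => a * v k) n = a * conv u v n.
Proof. by rewrite /conv mulr_sumr; apply: eq_bigr => j _; rewrite mulrCA. Qed.

Lemma eq_conv (u u' v v' : nat -> R) n : u =1 u' -> v =1 v' -> conv u v n = conv u' v' n.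
Proof. by move=> uu vv; apply: eq_bigr => j _; rewrite uu vv. Qed.

Lemma conv_dser (u v : nat -> R) n :
  conv (fun k => k.+1%:R * u k.+1) v n + conv u (fun k => k.+1%:R * v k.+1) n =
  n.+1%:R * conv u v n.+1.
Proof.
rewrite -conv_euler (conv_shift (fun k => k%:R * u k)) (conv_shiftr u (fun k => k%:R * v k)).
by rewrite !mul0r mulr0 !subr0.
Qed.

(** This is [(1 - xi) ^ x * (1 - xi) ^ (- (x + 1)) = (1 - xi) ^ -1] on coefficients. Both
    factors satisfy first order recursions, hence so does their convolution. *)
Lemma conv_bcoef x n : conv (bcoef x) (bcoef (- (x + 1))) n = 1.
Proof.
elim: n => [|n IH]; first by rewrite /conv big_ord1 !bcoef0 mulr1.
set e := bcoef (- (x + 1)) in IH *; set b := bcoef x in IH *.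
have n0 : n.+1%:R != 0 :> R by rewrite pnatr_eq0.
apply: (mulfI n0); rewrite -conv_dser.
rewrite (@eq_conv _ (fun k => k%:R * b k + (- x) * b k) _ e) //; last first.
  by move=> k; rewrite bcoefS -/b; ring.
rewrite (@eq_conv b b _ (fun k => k%:R * e k + (x + 1) * e k)) //; last first.
  by move=> k; rewrite bcoefS /e; ring.
rewrite convDl convDr convZl convZr IH addrACA conv_euler IH -natr1; ring.
Qed.

End binomial_series.

Section kernel_coefficients.
Context {R : realType}.
Implicit Types (xi : R[i]) (x y : R).

(** Taylor coefficients of [xi ^ m K xi], up to a constant factor; the reciprocals
    of the normalized moments of the measure. *)
Definition dcoef x y (k : nat) : R := Beta x y / Beta x (k%:R + y).

(** The coefficients of the sum that defines [Q], normalized to start with 1; with [y - 1]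
    for [beta0], the case [y = 1] gives the constant 1, as in the definition. *)
Definition qcoef x y (k : nat) : R :=
  if k is 0 then 1 else (y - 1) / (k%:R + (y - 1)) * bcoef x k.

Lemma dcoef_gt0 x y k : 0 < x -> 0 < y -> 0 < dcoef x y k.
Proof. by move=> x0 y0; rewrite divr_gt0 // Beta_gt0 // ltr_wpDl. Qed.

Lemma dcoef0 x y : 0 < x -> 0 < y -> dcoef x y 0 = 1.
Proof. by move=> x0 y0; rewrite /dcoef add0r divff // gt_eqF // Beta_gt0. Qed.

Lemma dcoefS x y k : 0 < x -> 0 < y ->
  (k%:R + y) * dcoef x y k.+1 = (k%:R + x + y) * dcoef x y k.
Proof.
move=> x0 y0; have ky : 0 < k%:R + y by rewrite ltr_wpDl.
have b1 := Beta_gt0 x0 ky.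
have ky1 : 0 < k.+1%:R + y by rewrite ltr_wpDl.
have b2 := Beta_gt0 x0 ky1.
have := BetaS x0 ky; rewrite ![Beta _ x]BetaC.
have -> : k%:R + y + 1 = k.+1%:R + y by rewrite -natr1; ring.
rewrite /dcoef => e.
have -> : Beta x (k%:R + y) = (k%:R + x + y) * Beta x (k.+1%:R + y) / (k%:R + y).
  rewrite (_ : k%:R + x + y = x + (k%:R + y)); last by ring.
  by rewrite e mulrAC mulfV ?mul1r // gt_eqF.
have h3 : 0 < k%:R + x + y by rewrite addrAC addr_gt0.
move: (Beta x y) (Beta x _) (k%:R + x + y) (k%:R + y) b2 h3 ky {e b1 ky1} => B1 B2 u v b2 h3 ky.
by field; rewrite !gt_eqF.
Qed.

(** The Euler operator turns [qcoef] into the binomial coefficients, so the convolution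
    satisfies the recursion [dcoefS]. *)
Lemma conv_qcoef x y n : 0 < x -> 0 < y <= 1 ->
  conv (qcoef x y) (bcoef (- (x + 1))) n = dcoef x y n.
Proof.
move=> x0 /andP[y0 y1]; elim: n => [|n IH].
  by rewrite /conv big_ord1 bcoef0 mulr1 dcoef0.
set q := qcoef x y in IH *; set e := bcoef (- (x + 1)) in IH *; set b := bcoef x.
pose z := y - 1; have ny : 0 < n%:R + y by rewrite ltr_wpDl.
have qb k : k%:R * q k + z * q k = z * b k.
  case: k => [|k]; first by rewrite mul0r add0r /b bcoef0.
  have k0 : k.+1%:R + z != 0 by rewrite -natr1 /z addrACA subrr addr0 gt_eqF // ltr_wpDl.
  rewrite /q /qcoef -/z -/b; move: (k.+1%:R) k0 => K K0.
  by field.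
have u k : conv b e k = 1 := conv_bcoef x k.
have h1 : conv (fun k => k.+1%:R * q k.+1) e n =
   conv (fun k => k%:R * q k) e n + z * (conv q e n - conv q e n.+1).
  have -> : conv (fun k => k.+1%:R * q k.+1) e n = conv (fun k => z * b k.+1 + (- z) * q k.+1) e n.
    by apply: eq_conv => // k; rewrite -qb; ring.
  have -> : conv (fun k => k%:R * q k) e n = conv (fun k => z * b k + (- z) * q k) e n.
    by apply: eq_conv => // k; rewrite -qb; ring.
  rewrite !convDl !convZl conv_shift (conv_shift q) !u /q /b bcoef0 /=; ring.
have h2 : conv q (fun k => k.+1%:R * e k.+1) n =
  n%:R * conv q e n - conv (fun k => k%:R * q k) e n + (x + 1) * conv q e n.
  have -> : conv q (fun k => k.+1%:R * e k.+1) n =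
      conv q (fun k => k%:R * e k + (x + 1) * e k) n.
    by apply: eq_conv => // k; rewrite bcoefS -/e; ring.
  by rewrite convDr convZr -(conv_euler q e n); ring.
have := conv_dser q e n; rewrite h1 h2 IH => h3.
apply: (mulfI (lt0r_neq0 ny)); rewrite dcoefS //.
by move: h3; rewrite -natr1 /z; set C := conv q e n.+1; set D := dcoef x y n => h3; lra.
Qed.

Lemma cps_dcoef x y : 0 < x -> 0 < y -> cps (fun n => (dcoef x y n)%:C).
Proof.
move=> x0 y0; apply: (@ratio_cps _ _ y (x + y)) => //; first by rewrite addr_ge0 ?ltW.
have d0 k : 0 <= dcoef x y k by rewrite ltW // dcoef_gt0.
by move=> n; rewrite (normc_nng (d0 _)) (normc_nng (d0 n)) [leLHS]mulrC (dcoefS _ x0 y0) mulrC addrA; exact: lexx.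
Qed.

(** Beyond the index [x] the sign of [bcoef x] is constant and the recursion makes the
    sum telescope. *)
Lemma bcoef_asum x : 0 < x -> exists B, forall n, \sum_(k < n) `|bcoef x k| <= B.
Proof.
move=> x0; pose N := (Num.truncn x).+1.
have Nx : x <= N%:R by rewrite ltW // truncnS_gt.
pose A n := \sum_(k < n) `|bcoef x k|.
have An n : A n.+1 = A n + `|bcoef x n| by rewrite /A big_ord_recr.
have key n : x * (A (N + n)%N - A N) = N%:R * `|bcoef x N| - (N + n)%:R * `|bcoef x (N + n)|.
  elim: n => [|n IH]; first by rewrite addn0 !subrr mulr0.
  rewrite addnS An addrAC mulrDr IH.
  have -> : (N + n).+1%:R * `|bcoef x (N + n).+1| = ((N + n)%:R - x) * `|bcoef x (N + n)|.
    rewrite -[X in X * _]normr_nat -normrM bcoefS normrM ger0_norm //.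
    by rewrite subr_ge0 (le_trans Nx) // ler_nat leq_addr.
  by ring.
exists (A N + N%:R * `|bcoef x N| / x) => n.
apply: (@le_trans _ _ (A (N + n)%N)).
  rewrite /A addnC big_split_ord /= lerDl.
  by apply: sumr_ge0 => k _; exact: normr_ge0.
rewrite -lerBlDl ler_pdivlMr // mulrC key gerBl.
by rewrite mulr_ge0.
Qed.

(** The denominator of [qcoef] gains a factor [1 / k] over [bcoef]. *)
Lemma qcoef_le x y : 0 < y <= 1 -> exists2 c : R, 0 <= c &
  forall k, k.+1%:R * `|qcoef x y k| <= c * `|bcoef x k|.
Proof.
move=> /andP[y0 y1]; exists (2 / y); first by rewrite divr_ge0 // ltW.
have i0 : 1 <= y^-1 by rewrite invf_ge1.
case=> [|k].
  by rewrite /qcoef bcoef0 normr1 !mulr1; lra.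
have k0 : (0 : R) <= k%:R by [].
have kz : k.+1%:R + (y - 1) = k%:R + y by rewrite -natr1; ring.
rewrite /qcoef normrM mulrA ler_wpM2r // kz.
have ky : 0 < k%:R + y by rewrite ltr_wpDl.
rewrite normrM normfV (gtr0_norm ky) mulrA ler_pdivrMr // mulrAC ler_pdivlMr //.
have : `|y - 1| <= 1 by rewrite ler_norml; lra.
have := normr_ge0 (y - 1); rewrite -natr1 -natr1.
move: `|y - 1| (k%:R) k0 => u K K0 u0 u1.
have uy : u * y <= y by rewrite ler_piMl // ltW.
have : K * (u * y) <= K * 1 by rewrite ler_wpM2l // (le_trans uy).
nra.
Qed.

(** The factor of the kernel that is bounded on the disc. *)
Definition Qb x y xi := pser (fun k => (qcoef x y k)%:C) xi.

Lemma qcoef_asum x y : 0 < x -> 0 < y <= 1 -> exists B, forall n,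
  \sum_(k < n) k.+1%:R * `|qcoef x y k| <= B.
Proof.
move=> x0 y01; have [B hB] := bcoef_asum x0; have [c c0 hc] := @qcoef_le x y y01.
exists (c * B) => n; apply: (@le_trans _ _ (\sum_(k < n) c * `|bcoef x k|)).
  by apply: ler_sum => k _; exact: hc.
by rewrite -mulr_sumr ler_wpM2l.
Qed.

Lemma qcoef_asum_le x y xi : 0 < x -> 0 < y <= 1 -> normc xi <= 1 ->
  forall B, (forall n, \sum_(k < n) k.+1%:R * `|qcoef x y k| <= B) ->
  asum_le (fun k => (qcoef x y k)%:C * xi ^+ k) B.
Proof.
move=> x0 y01 xi1 B hB; apply: (@asum_le_dom _ _ (fun k => k.+1%:R * `|qcoef x y k|) _ _ hB) => k.
rewrite normcM normcX normc_real [leRHS]mulrC; apply: ler_wpM2l => //.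
apply: (@le_trans _ _ 1); last by rewrite ler1n.
by rewrite exprn_ile1 // normc_ge0.
Qed.

Lemma cps_qcoef x y : 0 < x -> 0 < y <= 1 -> cps (fun n => (qcoef x y n)%:C).
Proof.
move=> x0 y01 r /andP[r0 r1]; have [B hB] := qcoef_asum x0 y01; exists B => k.
apply: le_trans (hB k.+1); rewrite big_ord_recr /= ler_wpDl //.
  by apply: sumr_ge0 => j _; rewrite mulr_ge0.
rewrite -[X in X * _]/(normc (qcoef x y k)%:C) normc_real mulrC; apply: ler_wpM2r => //.
by apply: (@le_trans _ _ 1); [rewrite exprn_ile1 // ltW|rewrite ler1n].
Qed.

Lemma Qb_bounded x y : 0 < x -> 0 < y <= 1 -> exists2 B, 0 < B & forall xi,
  disc xi -> normc (Qb x y xi) <= B.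
Proof.
move=> x0 y01; have [B hB] := qcoef_asum x0 y01.
have B0 : 0 <= B by have := hB 0%N; rewrite big_ord0.
exists (B + 1); first by rewrite ltr_wpDl.
move=> xi xid; apply: (@le_trans _ _ B); last by rewrite lerDl.
exact: (csum_le (qcoef_asum_le x0 y01 (ltW xid) hB)).
Qed.

(** The gain of [qcoef_le] makes the differentiated series converge up to the boundary. *)
Lemma Qb_lip x y : 0 < x -> 0 < y <= 1 -> exists2 B, 0 < B & forall z w,
  disc z -> disc w -> normc (Qb x y z - Qb x y w) <= B * normc (z - w).
Proof.
move=> x0 y01; have [B hB] := qcoef_asum x0 y01.
have B0 : 0 <= B by have := hB 0%N; rewrite big_ord0.
exists (B + 1); first by rewrite ltr_wpDl.
move=> z w zd wd; apply: (@le_trans _ _ (normc (z - w) * B)); last first.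
  by rewrite mulrC ler_wpM2r ?normc_ge0 // lerDl.
apply: (csum_dist (qcoef_asum_le x0 y01 (ltW zd) hB) (qcoef_asum_le x0 y01 (ltW wd) hB)).
apply: (@asum_le_dom _ _ (fun k => normc (z - w) * (k.+1%:R * `|qcoef x y k|))); last first.
  by move=> n; rewrite -mulr_sumr ler_wpM2l ?normc_ge0.
move=> k; rewrite -mulrBr normcM normc_real.
have := expr_lip k ler01 (ltW zd) (ltW wd); rewrite mul1r expr1n mulr1 => h.
apply: le_trans (ler_wpM2l (normr_ge0 _) h) _.
have -> : `|qcoef x y k| * (k%:R * normc (z - w)) = normc (z - w) * (k%:R * `|qcoef x y k|).
  by ring.
apply: ler_wpM2l; first exact: normc_ge0.
by apply: ler_wpM2r => //; rewrite ler_nat.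
Qed.

Lemma conv_real (u v : nat -> R) n :
  conv (fun k => (u k)%:C) (fun k => (v k)%:C) n = (conv u v n)%:C.
Proof. by rewrite /conv rmorph_sum; apply: eq_bigr => j _; rewrite rmorphM. Qed.

Lemma pser_conv (u v : nat -> R[i]) xi : cps u -> cps v -> disc xi ->
  pser (conv u v) xi = pser u xi * pser v xi.
Proof.
move=> hu hv xid; have [A hA] := pser_asum hu xid; have [B hB] := pser_asum hv xid.
rewrite /pser -(csum_conv hA hB); apply: eq_csum => n.
rewrite /conv mulr_suml; apply: eq_bigr => j _.
have jn : (j <= n)%N by rewrite -ltnS.
rewrite -[X in _ * xi ^+ X = _](subnKC jn) exprD; ring.
Qed.

(** By [conv_qcoef] and the binomial series: this is the factor of the kernel other than
    [xi ^- m], up to a constant. *)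
Lemma pser_dcoef x y xi : 0 < x -> 0 < y <= 1 -> disc xi ->
  pser (fun k => (dcoef x y k)%:C) xi = Qb x y xi / cpow (1 - xi) (x + 1).
Proof.
move=> x0 y01 xid; rewrite -cpowN ?onem_neq0 // -(pser_bcoef _ xid) /Qb.
rewrite -(pser_conv (cps_qcoef x0 y01) (cps_bcoef _) xid).
by apply: eq_csum => n; rewrite conv_real (conv_qcoef _ x0 y01).
Qed.

Lemma Re_pser_le (u v : nat -> R) (r : R) : cps (fun k => (u k)%:C) ->
  cps (fun k => (v k)%:C) -> (forall k, u k <= v k) -> 0 <= r -> disc r%:C ->
  complex.Re (pser (fun k => (u k)%:C) r%:C) <= complex.Re (pser (fun k => (v k)%:C) r%:C).
Proof.
move=> hu hv uv r0 rd.
have /cto_ReIm[+ _] := pser_cvg hu rd; have /cto_ReIm[+ _] := pser_cvg hv rd.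
move=> vl ul; rewrite -(cvg_lim _ vl) // -(cvg_lim _ ul) //; apply: ler_lim.
- by apply/cvg_ex; exists (complex.Re (pser (fun k => (u k)%:C) r%:C)).
- by apply/cvg_ex; exists (complex.Re (pser (fun k => (v k)%:C) r%:C)).
apply: nearW => n; rewrite !Re_sum; apply: ler_sum => k _.
rewrite -realX -!real_complexM /=; apply: ler_wpM2r => //; exact: exprn_ge0.
Qed.

(** On the radius, the coefficients of the kernel dominate those of
    [(1 - xi) ^ (- (x + 1))], the factor that [Qb] multiplies. *)
Lemma Qb_ge1 x y (r : R) : 0 < x -> 0 < y <= 1 -> 0 <= r < 1 -> 1 <= complex.Re (Qb x y r%:C).
Proof.
move=> x0 y01 /andP[r0 r1]; have /andP[y0 y1] := y01.
have rd : disc r%:C by rewrite /disc /= expr0n /= addr0 sqrtr_sqr ger0_norm.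
have e1 := pser_dcoef x0 y01 rd.
have e2 := pser_bcoef (- (x + 1)) rd.
have w0 := onem_neq0 rd.
have b0 k : 0 <= bcoef (- (x + 1)) k.
  elim: k => [|k IH]; first by rewrite bcoef0.
  have : 0 <= k.+1%:R * bcoef (- (x + 1)) k.+1.
    by rewrite bcoefS mulr_ge0 // opprK !addr_ge0 // ltW.
  by rewrite pmulr_rge0.
have bd k : bcoef (- (x + 1)) k <= dcoef x y k.
  elim: k => [|k IH]; first by rewrite bcoef0 dcoef0.
  have ky : 0 < k%:R + y by rewrite ltr_wpDl.
  rewrite -(ler_pM2l ky) dcoefS //.
  have k1 : (0 : R) < k.+1%:R by [].
  have -> : bcoef (- (x + 1)) k.+1 = (k%:R + (x + 1)) * bcoef (- (x + 1)) k / k.+1%:R.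
    apply: (mulfI (lt0r_neq0 k1)); rewrite bcoefS opprK.
    by rewrite [RHS]mulrC divfK // gt_eqF.
  rewrite mulrA ler_pdivrMr // [leRHS]mulrAC mulrA.
  apply: ler_pM => //; first by rewrite mulr_ge0 ?addr_ge0 // ltW.
  have k0 : (0 : R) <= k%:R by [].
  by rewrite -natr1; nra.
have p0 : 0 < normc (1 - r%:C) `^ (x + 1) by rewrite powR_gt0 // normc_gt0.
have cE s : cpow (1 - r%:C) s = (normc (1 - r%:C) `^ s)%:C.
  by rewrite cpowE /carg ImD ImN /= subrr mul0r atan0 mulr0 cos0 sin0 -[RHS]mulr1.
have le := Re_pser_le (cps_bcoef _) (cps_dcoef x0 y0) bd r0 rd.
move: le; rewrite e1 e2 !cE powRN -fmorphV.
rewrite [X in _ <= X]ReM; move: (normc _ `^ _) p0 => P P0 /=.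
rewrite mulr0 subr0 => h.
by move: h; rewrite ler_pdivlMr // mulVf // gt_eqF.
Qed.

End kernel_coefficients.

(** * Orthogonality of monomials *)

Section series_integrals.
Context {d : measure_display} {T : measurableType d} {R : realType}.
Variables (nu : {measure set T -> \bar R}) (D : set T) (mD : measurable D).
Implicit Types (F : nat -> T -> R[i]) (f : T -> R[i]) (g : T -> R).

Lemma measurable_cto F f : (forall n, measurable_fun D (F n)) ->
  (forall x, D x -> cto (F ^~ x) (f x)) -> measurable_fun D f.
Proof.
move=> mF Ff; apply/measurable_cE.
have h (P : R[i] -> R) : measurable_fun [set: R[i]] P ->
    (forall x, D x -> (fun n => P (F n x)) @ \oo --> P (f x)) ->
    measurable_fun D (fun x => P (f x)).
  move=> mP PF; apply/measurable_EFinP.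
  apply: (emeasurable_fun_cvg (fun n x => (P (F n x))%:E)).
    by move=> n; apply/measurable_EFinP; exact: measurableT_comp mP (mF n).
  by move=> x Dx; apply: cvg_EFin; [exact: nearW|exact: PF].
split; first by apply: h measurable_Re _ => x /Ff /cto_ReIm[].
by apply: h measurable_Im _ => x /Ff /cto_ReIm[].
Qed.

(** Term by term integration under an integrable bound on the sum of moduli. *)
Lemma cintegral_csum F g : (forall k, measurable_fun D (F k)) ->
  nu.-integrable D (EFin \o g) -> (forall x, D x -> asum_le (F ^~ x) (g x)) ->
  [/\ cintegrable nu D (fun x => csum (F ^~ x)),
      (forall k, cintegrable nu D (F k)),
      asum_le (fun k => cintegral nu D (F k)) (\int[nu]_(x in D) g x) &
      cintegral nu D (fun x => csum (F ^~ x)) = csum (fun k => cintegral nu D (F k))].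
Proof.
move=> mF ig Fg.
have Fgk k x : D x -> normc (F k x) <= g x.
  move=> Dx; apply: le_trans (Fg x Dx k.+1); rewrite big_ord_recr /= ler_wpDl //.
  by apply: sumr_ge0 => i _; exact: normc_ge0.
have iF k : cintegrable nu D (F k) by apply: (cintegrable_le mD (mF k) ig) => x Dx; exact: Fgk.
have [] := @cintegral_cvg _ _ _ nu D mD (fun n x => \sum_(k < n) F k x) (fun x => csum (F ^~ x)) g.
- by move=> n; exact: measurable_csum.
- by move=> x Dx; exact: csum_cvg (Fg x Dx).
- exact: ig.
- by move=> n x Dx; apply: le_trans (le_normc_sum _ _ _) (Fg x Dx n).
move=> i1 _ c1.
have a1 : asum_le (fun k => cintegral nu D (F k)) (\int[nu]_(x in D) g x).
  move=> n; apply: (@le_trans _ _ (\sum_(k < n) \int[nu]_(x in D) normc (F k x))).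
    by apply: ler_sum => k _; exact: (le_normc_cintegral mD (iF k)).
  have in1 k : nu.-integrable D (EFin \o (fun x => normc (F k x))).
    by have [] := (@cintegrableP _ _ _ nu D mD (F k)).1 (iF k).
  have in2 m : nu.-integrable D (EFin \o (fun x => \sum_(k < m) normc (F k x))).
    elim: m => [|m IH].
      rewrite (_ : _ \o _ = cst 0%E); first exact: integrable0.
      by apply/funext => x /=; rewrite big_ord0.
    apply: (eq_integrable mD (fun x => (\sum_(k < m) normc (F k x))%:E + (normc (F m x))%:E)%E).
      by move=> x _ /=; rewrite big_ord_recr.
    exact: (integrableD mD IH (in1 m)).
  have -> : \sum_(k < n) \int[nu]_(x in D) normc (F k x) =
      \int[nu]_(x in D) (\sum_(k < n) normc (F k x)).
    elim: n => [|n IH].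
      rewrite big_ord0; under eq_Rintegral do rewrite big_ord0.
      by rewrite Rintegral_cst // mul0r.
    rewrite big_ord_recr /= IH -RintegralD //.
    by apply: eq_Rintegral => x _; rewrite big_ord_recr.
  by apply: le_Rintegral => // x Dx; exact: Fg.
split => //; apply/esym/(csum_unique a1); apply: cto_eq c1 => n.
by rewrite cintegral_sum.
Qed.

End series_integrals.

Section orthogonality.
Context {R : realType}.
Implicit Types (a b x t : R) (z w xi : R[i]) (c : nat -> R[i]).

Lemma cconjM z w : Num.conj (z * w) = Num.conj z * Num.conj w.
Proof. exact: rmorphM. Qed.

Lemma cconjX z n : Num.conj (z ^+ n) = Num.conj z ^+ n.
Proof. exact: rmorphXn. Qed.

Lemma mu_integrable_cst a b (B : R) : -1 < a -> -1 < b ->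
  (mu a b).-integrable disc (EFin \o (fun=> B)).
Proof.
move=> a1 b1; apply/integrableP; split.
  by apply/measurable_EFinP; exact: measurable_cst.
rewrite /= integral_cst; last exact: measurable_disc.
by rewrite [X in (_ * X)%E](mu_disc a1 b1) mule1 ltry.
Qed.

Lemma bounded_cintegrable a b (f : R[i] -> R[i]) (B : R) : -1 < a -> -1 < b ->
  measurable_fun disc f -> (forall z, disc z -> normc (f z) <= B) ->
  cintegrable (mu a b) disc f.
Proof.
move=> a1 b1 mf fB; apply: (cintegrable_le measurable_disc mf (mu_integrable_cst B a1 b1)).
exact: fB.
Qed.

Lemma cisX x n : (cos x +i* sin x) ^+ n = (cos (n%:R * x) +i* sin (n%:R * x)).
Proof.
elim: n => [|n IH]; first by rewrite mul0r cos0 sin0.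
by rewrite exprS IH -cisD; congr (cos _ +i* sin _); rewrite -natr1; ring.
Qed.

(** A rotation that acts on the monomial of degree [n] by a quarter turn. *)
Lemma quarter_root n : (0 < n)%N -> exists u : R[i], [/\ normc u = 1, u != -1 & u ^+ n != 1].
Proof.
move=> n0; pose x : R := pi / 2 / n%:R.
have nR : (0 : R) < n%:R by rewrite ltr0n.
have p0 := @pi_gt0 R.
exists (cos x +i* sin x); split; first exact: normc_cis.
  apply/eqP => /(congr1 (@complex.Re R)) /= h.
  have : 0 <= cos x.
    apply: cos_ge0_pihalf; rewrite /x; apply/andP; split.
      by apply: (@le_trans _ _ 0); rewrite ?oppr_le0 ?divr_ge0 // ltW.
    by rewrite ler_pdivrMr // ler_peMr ?ler1n // divr_ge0 // ltW.
  by rewrite h; lra.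
rewrite cisX; have -> : n%:R * x = pi / 2 by rewrite /x; field; rewrite gt_eqF.
rewrite cos_pihalf sin_pihalf; apply/eqP => /(congr1 (@complex.Re R)) /= h.
by move/eqP : h; rewrite eq_sym oner_eq0.
Qed.

Lemma measurable_monomial j k (phi : R -> R) : measurable_fun setT phi ->
  measurable_fun setT (fun z : R[i] => z ^+ j * z^* ^+ k * (phi (normc z ^+ 2))%:C).
Proof.
move=> mphi; apply: measurable_cM; last exact: measurable_creal (measurable_radial mphi).
apply: measurable_cM; first by apply: measurable_cX; exact: measurable_id.
by apply: measurable_cX; apply: measurable_cconj; exact: measurable_id.
Qed.

(** A rotation preserves the measure and multiplies the integrand by a constant other
    than 1. *)
Lemma cintegral_monomial_neq a b j k (phi : R -> R) : measurable_fun setT phi ->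
  cintegrable (mu a b) disc (fun z => z ^+ j * z^* ^+ k * (phi (normc z ^+ 2))%:C) ->
  j != k -> cintegral (mu a b) disc (fun z => z ^+ j * z^* ^+ k * (phi (normc z ^+ 2))%:C) = 0.
Proof.
move=> mphi fi jk; set f := (fun z => _) in fi *.
have mf : measurable_fun setT f := measurable_monomial j k mphi.
have [u [u1 um1 ujk]] : exists u : R[i], [/\ normc u = 1, u != -1 & u ^+ j * u^* ^+ k != 1].
  have uu (u : R[i]) : normc u = 1 -> u * u^* = 1 by move=> h; rewrite mulc_conj h expr1n.
  have [kj|kj] := leqP k j.
    have [|u [u1 um1 un]] := @quarter_root (j - k); first by rewrite subn_gt0 ltn_neqAle eq_sym jk.
    by exists u; split => //; rewrite -(subnK kj) exprD -mulrA -exprMn (uu _ u1) expr1n mulr1.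
  have [|u [u1 um1 un]] := @quarter_root (k - j); first by rewrite subn_gt0.
  exists u; split => //; rewrite -(subnK (ltnW kj)) exprD mulrCA -exprMn (uu _ u1) expr1n mulr1.
  apply: contra_neq un => /(congr1 Num.conj).
  by rewrite -!cconjX conjCK rmorph1.
have fu z : f (u * z) = (u ^+ j * u^* ^+ k) * f z.
  by rewrite /f cconjM !exprMn normcM u1 mul1r; ring.
have fui : cintegrable (mu a b) disc (fun z => f (u * z)).
  under [X in cintegrable _ _ X]funext do rewrite fu.
  exact: (cintegrableZ measurable_disc).
have := cintegral_mu_rotation u1 um1 mf fui.
under [X in cintegral _ _ X]funext do rewrite fu.
rewrite (cintegralZ measurable_disc _ fi) => /eqP.
rewrite -subr_eq0 -{2}[cintegral _ _ _]mul1r -mulrBl mulf_eq0 subr_eq0 (negbTE ujk) /=.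
by move/eqP.
Qed.

Lemma Rintegral_real a b (f : R[i] -> R) :
  cintegral (mu a b) disc (fun z => (f z)%:C) = (\int[mu a b]_(z in disc) f z)%:C.
Proof.
rewrite /cintegral; apply: complexP => //=; rewrite Rintegral_cst; last exact: measurable_disc.
by rewrite mul0r.
Qed.

Lemma cintegral_monomial_eq a b k (phi : R -> R) :
  cintegral (mu a b) disc (fun z => z ^+ k * z^* ^+ k * (phi (normc z ^+ 2))%:C) =
  (\int[mu a b]_(z in disc) ((normc z ^+ 2) ^+ k * phi (normc z ^+ 2)))%:C.
Proof.
rewrite -Rintegral_real; apply: eq_cintegral => z _.
by rewrite -exprMn mulc_conj -realX -real_complexM.
Qed.

(** Taylor coefficients of a power series are read off by integrating against
    conjugate monomials. *)
Lemma coef_extract a b c k (phi : R -> R) (B : R) : -1 < a -> -1 < b ->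
  measurable_fun setT phi ->
  (forall z, disc z -> asum_le (fun j => c j * z ^+ j * (phi (normc z ^+ 2))%:C) B) ->
  (forall t, 0 <= t < 1 -> `|phi t| <= B) ->
  cintegral (mu a b) disc
    (fun z => csum (fun j => c j * z ^+ j * (phi (normc z ^+ 2))%:C) * z^* ^+ k) =
  c k * (\int[mu a b]_(z in disc) ((normc z ^+ 2) ^+ k * phi (normc z ^+ 2)))%:C.
Proof.
move=> a1 b1 mphi hB phiB.
pose F j z := c j * (z ^+ j * z^* ^+ k * (phi (normc z ^+ 2))%:C).
have FE z : disc z -> csum (fun j => c j * z ^+ j * (phi (normc z ^+ 2))%:C) * z^* ^+ k =
    csum (F ^~ z).
  move=> zd; rewrite mulrC -(csumZ _ (hB z zd)); apply: eq_csum => j; rewrite /F; ring.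
have mm j := measurable_monomial j k mphi.
have mF j : measurable_fun disc (F j).
  by apply: measurable_funTS; apply: measurable_cM => //; exact: measurable_cst.
have im j : cintegrable (mu a b) disc (fun z => z ^+ j * z^* ^+ k * (phi (normc z ^+ 2))%:C).
  apply: (bounded_cintegrable a1 b1 (measurable_funTS (mm j)) (B := B)) => z zd.
  rewrite !normcM !normcX normc_conj normc_real.
  apply: le_trans (phiB _ (disc_sqr zd)); rewrite -[leRHS]mul1r.
  apply: ler_wpM2r => //; rewrite -exprD exprn_ile1 // ?normc_ge0 //; exact: ltW.
have aF z : disc z -> asum_le (F ^~ z) B.
  move=> zd; apply: (@asum_le_dom _ _ (fun j => normc (c j * z ^+ j * (phi (normc z ^+ 2))%:C)) _ _ (hB z zd)) => j.
  rewrite /F !normcM !normcX normc_conj mulrA -mulrA -[in leRHS]mulrA ler_wpM2l ?normc_ge0 //.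
  rewrite -mulrA ler_wpM2l ?exprn_ge0 ?normc_ge0 //.
  by rewrite ler_piMl ?normc_ge0 // exprn_ile1 // ?normc_ge0 //; exact: ltW.
rewrite (eq_cintegral _ (g := fun z => csum (F ^~ z))); last first.
  by move=> z /set_mem zd; exact: FE.
have [_ iF aI ->] := cintegral_csum measurable_disc mF (mu_integrable_cst B a1 b1) aF.
apply: (csum_unique aI).
have IE j : cintegral (mu a b) disc (F j) = if j == k then
    c k * (\int[mu a b]_(z in disc) ((normc z ^+ 2) ^+ k * phi (normc z ^+ 2)))%:C else 0.
  rewrite /F (cintegralZ measurable_disc _ (im j)); case: eqVneq => [->|jk].
    by rewrite cintegral_monomial_eq.
  by rewrite (cintegral_monomial_neq mphi (im j) jk) mulr0.
apply: (@cto_le _ _ _ (fun n => if (k < n)%N then 0 else normc (c k * (\int[mu a b]_(z in disc) ((normc z ^+ 2) ^+ k * phi (normc z ^+ 2)))%:C))).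
  move=> n; under eq_bigr do rewrite IE.
  case: ltnP => kn.
    rewrite (bigD1 (Ordinal kn)) //= eqxx big1 ?addr0 ?subrr ?normc0 // => i.
    by rewrite -val_eqE /= => /negbTE ->.
  rewrite big1 ?sub0r ?normcN // => i _; rewrite ifN //.
  by rewrite neq_ltn (leq_trans (ltn_ord i) kn).
apply/cvgrPdist_le => e e0; exists k.+1 => // n /= kn.
by rewrite kn subrr normr0 ltW.
Qed.

(** The mean of [normc z ^+ (2 * n)]. *)
Definition moment a b (n : nat) : R := Beta (a + 1) (b + n%:R + 1) / Beta (a + 1) (b + 1).

Lemma moment_gt0 a b n : -1 < a -> -1 < b -> 0 < moment a b n.
Proof.
move=> a1 b1; have n0 : (0 : R) <= n%:R by [].
by rewrite divr_gt0 // Beta_gt0 //; lra.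
Qed.

Lemma Rintegral_moment a b n : -1 < a -> -1 < b ->
  \int[mu a b]_(z in disc) ((normc z ^+ 2) ^+ n) = moment a b n.
Proof.
move=> a1 b1; have n0 : (0 : R) <= n%:R by [].
have bn : -1 < b + n%:R by lra.
have := mu_moment a1 b1 bn; move=> /(congr1 (@fine R)); rewrite -[fine _%:E]/(moment a b n) => <-.
by rewrite /Rintegral; congr fine; apply: eq_integral => z _; rewrite powR_mulrn ?sqr_ge0.
Qed.

Lemma momentS a b n : -1 < a -> -1 < b ->
  (n%:R + (a + b + 2)) * moment a b n.+1 = (n%:R + (b + 1)) * moment a b n.
Proof.
move=> a1 b1; have n0 : (0 : R) <= n%:R by [].
have x0 : 0 < a + 1 by lra.
have y0 : 0 < b + n%:R + 1 by lra.
have := BetaS x0 y0; rewrite ![Beta _ (a + 1)]BetaC => e.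
have -> : moment a b n.+1 = Beta (a + 1) (b + n%:R + 1 + 1) / Beta (a + 1) (b + 1).
  by rewrite /moment -natr1 (addrA b).
have -> : n%:R + (a + b + 2) = a + 1 + (b + n%:R + 1) by ring.
by rewrite /moment !mulrA e; congr (_ * _ / _); ring.
Qed.

Lemma mulr_conj_disc z w : disc z -> disc w -> disc (z * w^*).
Proof.
move=> zd wd; rewrite /disc /= normcM normc_conj.
apply: le_lt_trans zd; rewrite ler_piMr ?normc_ge0 //; exact: ltW.
Qed.

Lemma cps_mulX c w : cps c -> disc w -> exists B, forall z, disc z ->
  asum_le (fun j => c j * w ^+ j * z ^+ j) B.
Proof.
move=> hc wd; have [|B hB] := @cps_wsum _ c (normc w) hc; first by rewrite normc_ge0.
exists B => z zd n; apply: le_trans ((asum_wle _ hB) n); last exact: lexx.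
apply: ler_sum => k _; rewrite !normcM !normcX.
by rewrite ler_piMr ?mulr_ge0 ?exprn_ge0 ?normc_ge0 // exprn_ile1 ?normc_ge0 // ltW.
Qed.

Lemma measurable_pser_mul c w : cps c -> disc w ->
  measurable_fun disc (fun z => pser c (z * w^*)).
Proof.
move=> hc wd.
apply: (@measurable_cto _ _ _ _ (fun n z => \sum_(k < n) c k * (z * w^*) ^+ k)).
  move=> n; apply: measurable_funTS; apply: (@measurable_csum _ _ _ _ (fun k z => c k * (z * w^*) ^+ k)) => k.
  apply: measurable_cM; first exact: measurable_cst.
  by apply: measurable_cX; apply: measurable_cM; [exact: measurable_id|exact: measurable_cst].
by move=> z zd; apply: pser_cvg => //; exact: mulr_conj_disc.
Qed.

(** Expanding one of the two factors and integrating term by term with [coef_extract]. *)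
Lemma parseval a b c w : -1 < a -> -1 < b -> cps c -> disc w ->
  (fun n => \sum_(k < n) normc (c k) ^+ 2 * (normc w ^+ 2) ^+ k * moment a b k) @ \oo -->
  \int[mu a b]_(z in disc) (normc (pser c (z * w^*)) ^+ 2).
Proof.
move=> a1 b1 hc wd.
have wcd : disc w^* by rewrite /disc /= normc_conj.
have [B hB] := cps_mulX hc wcd.
pose v k := c k * w^* ^+ k.
have pE z : pser c (z * w^*) = csum (fun k => v k * z ^+ k * 1%:C).
  by apply: eq_csum => k; rewrite /v exprMn; ring.
have hB1 z : disc z -> asum_le (fun j => v j * z ^+ j * 1%:C) (B + 1).
  move=> zd n; apply: (@le_trans _ _ B); last by rewrite lerDl.
  by under eq_bigr do rewrite mulr1; exact: hB.
have B1 t : 0 <= t < 1 -> `|1 : R| <= B + 1.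
  by move=> _; rewrite normr1 lerDr; have := hB _ disc0 0%N; rewrite big_ord0.
have ex k := coef_extract k a1 b1 (measurable_cst (1 : R)) hB1 B1.
pose F k z := pser c (z * w^*) * (v k * z ^+ k)^*.
have mF k : measurable_fun disc (F k).
  apply: measurable_cM; first exact: measurable_pser_mul.
  apply: measurable_funTS; apply: measurable_cconj.
  apply: measurable_cM; first exact: measurable_cst.
  by apply: measurable_cX; exact: measurable_id.
have pB z : disc z -> normc (pser c (z * w^*)) <= B + 1.
  by move=> zd; rewrite pE; exact: csum_le (hB1 z zd).
have aF z : disc z -> asum_le (F ^~ z) ((B + 1) ^+ 2).
  move=> zd n; under eq_bigr do rewrite normcM normc_conj.
  rewrite -mulr_sumr expr2; apply: ler_pM; rewrite ?normc_ge0 ?pB //.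
    by apply: sumr_ge0 => i _; exact: normc_ge0.
  by apply: (@le_trans _ _ B); [exact: hB|rewrite lerDl].
have [i1 _ a2 e2] := cintegral_csum measurable_disc mF (mu_integrable_cst ((B + 1) ^+ 2) a1 b1) aF.
have IE k : cintegral (mu a b) disc (F k) =
    (normc (c k) ^+ 2 * (normc w ^+ 2) ^+ k * moment a b k)%:C.
  transitivity ((v k)^* * cintegral (mu a b) disc
      (fun z => csum (fun j => v j * z ^+ j * 1%:C) * z^* ^+ k)).
    rewrite -(cintegralZ measurable_disc); last first.
      apply: (bounded_cintegrable a1 b1 (B := B + 1)).
        apply: measurable_cM; last first.
          by apply: measurable_funTS; apply: measurable_cX; apply: measurable_cconj; exact: measurable_id.
        apply: (eq_measurable_fun (fun z => pser c (z * w^*))) => //.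
        exact: measurable_pser_mul.
      move=> z zd; rewrite normcM -pE normcX normc_conj.
      rewrite -[leRHS]mulr1; apply: ler_pM; rewrite ?normc_ge0 ?exprn_ge0 ?pB ?normc_ge0 //.
      by rewrite exprn_ile1 ?normc_ge0 // ltW.
    by apply: eq_cintegral => z _; rewrite /F pE cconjM cconjX; ring.
  rewrite ex; under eq_Rintegral do rewrite mulr1.
  rewrite Rintegral_moment // mulrA [_ * v k]mulrC mulc_conj -real_complexM.
  by rewrite /v normcM normcX normc_conj exprMn exprAC.
have := csum_cvg a2; rewrite -e2 => /cto_ReIm[+ _].
rewrite (eq_cintegral _ (g := fun z => (normc (pser c (z * w^*)) ^+ 2)%:C)); last first.
  move=> z /set_mem zd; rewrite -mulc_conj /F.
  have hv : asum_le (fun k => (v k * z ^+ k)^*) B.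
    by move=> n; under eq_bigr do rewrite normc_conj; exact: hB.
  rewrite (csumZ _ hv); congr (_ * _).
  apply: (csum_unique hv); apply: (@cto_le _ _ _ (fun n => normc (\sum_(k < n) v k * z ^+ k - pser c (z * w^*)))).
    move=> n; rewrite -[in leRHS]normc_conj rmorphB rmorph_sum /=; exact: lexx.
  apply: (cto_eq _ (pser_cvg hc (mulr_conj_disc zd wd))) => n.
  by apply: eq_bigr => k _; rewrite /v exprMn; ring.
rewrite Rintegral_real /=; apply: cvg_trans; apply: near_eq_cvg; apply: nearW => n.
by rewrite Re_sum; apply: eq_bigr => k _; rewrite IE.
Qed.

End orthogonality.

(** * Forelli-Rudin estimates *)

Section ratio_asymptotics.
Context {R : realType}.

(** The product of the factors [1 + K / n ^ 2] converges; the exponent [1 - 1 / n] makes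
    the induction work. *)
Lemma ratio_bounded (x : nat -> R) (K : R) : 0 <= K -> (forall n, 0 <= x n) ->
  (forall n, x n.+1 <= x n * (1 + K / n.+1%:R ^+ 2)) -> forall n, x n <= x 0%N * expR (2 * K).
Proof.
move=> K0 x0 hx n.
have n1 m : (0 : R) < m.+1%:R by [].
apply: (@le_trans _ _ (x 0%N * expR (2 * K * (1 - n.+1%:R^-1)))); last first.
  by rewrite ler_wpM2l // ler_expR ler_piMr ?mulr_ge0 // gerBl invr_ge0.
elim: n => [|n IH]; first by rewrite invr1 subrr mulr0 expR0 mulr1.
apply: le_trans (hx n) _.
have D : K / n.+1%:R ^+ 2 <= 2 * K * (1 - n.+2%:R^-1) - 2 * K * (1 - n.+1%:R^-1).
  have -> : 2 * K * (1 - n.+2%:R^-1) - 2 * K * (1 - n.+1%:R^-1) =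
     K * (2 / (n.+1%:R * n.+2%:R)).
    have := n1 n; have := n1 n.+1; rewrite -[n.+2%:R]natr1.
    by move: (n.+1%:R : R) => N h1 h2; field; rewrite !gt_eqF.
  apply: ler_wpM2l => //.
  rewrite ler_pdivlMr ?mulr_gt0 // mulrC ler_pdivrMr ?exprn_gt0 //.
  have : (1 : R) <= n.+1%:R by rewrite ler1n.
  by rewrite -[n.+2%:R]natr1; nra.
have {}D := le_trans (lerD (lexx 1) D) (expR_ge1Dx _).
apply: le_trans (ler_wpM2l (x0 n) D) _.
have -> : expR (2 * K * (1 - n.+2%:R^-1)) = expR (2 * K * (1 - n.+1%:R^-1)) *
    expR (2 * K * (1 - n.+2%:R^-1) - 2 * K * (1 - n.+1%:R^-1)) by rewrite -expRD subrKC.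
by rewrite mulrA; apply: ler_wpM2r => //; exact: expR_ge0.
Qed.

(** Ratios of consecutive coefficients are quotients of such products. *)
Definition cubic (a b c : R) (n : nat) : R := (n%:R + a) * (n%:R + b) * (n%:R + c).

(** The cubic and quadratic coefficients agree, so that the difference is linear in [n]. *)
Lemma cubic_ratio a1 a2 a3 b1 b2 b3 : 0 < b1 -> 0 < b2 -> 0 < b3 ->
  a1 + a2 + a3 = b1 + b2 + b3 -> exists2 K, 0 <= K &
  forall n, cubic a1 a2 a3 n <= cubic b1 b2 b3 n * (1 + K / n.+1%:R ^+ 2).
Proof.
move=> b10 b20 b30 e.
pose A := a1 * a2 + a1 * a3 + a2 * a3 - (b1 * b2 + b1 * b3 + b2 * b3).
pose B := a1 * a2 * a3 - b1 * b2 * b3.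
pose m (b : R) := Num.min b 1.
have m0 b : 0 < b -> 0 < m b by move=> b0; rewrite lt_min b0 ltr01.
have mle b n : m b * n.+1%:R <= n%:R + b.
  have n0 : (0 : R) <= n%:R by [].
  have h1 : m b <= b by rewrite ge_min lexx.
  have h2 : m b <= 1 by rewrite ge_min lexx orbT.
  by rewrite -natr1; move: (m b) h1 h2 => M h1 h2; nra.
pose d := m b1 * m b2 * m b3.
have d0 : 0 < d by rewrite !mulr_gt0 // m0.
exists ((`|A| + `|B|) / d); first by rewrite divr_ge0 ?addr_ge0 // ltW.
move=> n; have n1 : (0 : R) < n.+1%:R by [].
have q : d * n.+1%:R ^+ 3 <= cubic b1 b2 b3 n.
  have -> : d * n.+1%:R ^+ 3 = (m b1 * n.+1%:R) * (m b2 * n.+1%:R) * (m b3 * n.+1%:R).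
    by rewrite /d; ring.
  have p b : 0 < b -> 0 <= m b * n.+1%:R by move=> /m0 h; rewrite mulr_ge0 // ltW.
  apply: ler_pM; [|exact: p|apply: ler_pM|]; rewrite ?mle ?p //.
  by apply: mulr_ge0; exact: p.
have -> : cubic a1 a2 a3 n = cubic b1 b2 b3 n + (A * n%:R + B).
  rewrite /cubic /A /B; have -> : a3 = b1 + b2 + b3 - a1 - a2 by rewrite -e; ring.
  by ring.
rewrite mulrDr mulr1 lerD2l.
apply: (@le_trans _ _ ((`|A| + `|B|) * n.+1%:R)).
  rewrite [leRHS]mulrDl; apply: lerD.
    apply: (@le_trans _ _ (`|A| * n%:R)); first by rewrite ler_wpM2r // ler_norm.
    by rewrite ler_wpM2l // ler_nat.
  apply: (@le_trans _ _ `|B|); first exact: ler_norm.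
  by rewrite ler_peMr // ler1n.
have -> : (`|A| + `|B|) * n.+1%:R = d * n.+1%:R ^+ 3 * ((`|A| + `|B|) / d / n.+1%:R ^+ 2).
  by move: (n.+1%:R : R) n1 => N N0; field; rewrite !gt_eqF.
apply: ler_wpM2r => //; by rewrite !divr_ge0 ?addr_ge0 ?sqr_ge0 // ltW.
Qed.

Lemma cubic_bounded (x : nat -> R) a1 a2 a3 b1 b2 b3 : 0 < b1 -> 0 < b2 -> 0 < b3 ->
  a1 + a2 + a3 = b1 + b2 + b3 -> (forall n, 0 < x n) ->
  (forall n, x n.+1 * cubic b1 b2 b3 n = x n * cubic a1 a2 a3 n) ->
  exists2 C, 0 < C & forall n, x n <= C.
Proof.
move=> b10 b20 b30 e x0 hx; have [K K0 hK] := cubic_ratio b10 b20 b30 e.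
exists (x 0%N * expR (2 * K)); first by rewrite mulr_gt0 ?expR_gt0.
apply: ratio_bounded => // n; first exact: ltW.
have c0 : 0 < cubic b1 b2 b3 n by rewrite /cubic !mulr_gt0 // ltr_wpDl.
rewrite -(ler_pM2r c0) hx -mulrA; apply: ler_wpM2l; first exact: ltW.
by rewrite mulrC.
Qed.

Lemma harmonic_unbounded (A : R) : exists n, A <= \sum_(k < n) k.+1%:R^-1.
Proof.
pose n := (Num.truncn (expR A)).+1; exists n.
have h m : ln m.+1%:R <= \sum_(k < m) (k.+1%:R : R)^-1.
  elim: m => [|m IH]; first by rewrite big_ord0 ln1.
  rewrite big_ord_recr /=; apply: le_trans (lerD IH (lexx _)).
  have m0 : (0 : R) < m.+1%:R by [].
  have -> : m.+2%:R = m.+1%:R * (1 + m.+1%:R^-1) :> R.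
    by rewrite mulrDr mulr1 mulfV ?gt_eqF // natr1.
  rewrite lnM ?posrE ?ltr_wpDr ?invr_ge0 ?addr_gt0 ?invr_gt0 // lerD2l.
  by apply: le_ln1Dx; apply: lt_trans (ltrN10 R) _; rewrite invr_gt0.
apply: le_trans (h n); rewrite -[leLHS]expRK ler_ln ?posrE ?expR_gt0 //.
by apply: (@le_trans _ _ n%:R); [rewrite ltW // truncnS_gt|rewrite ler_nat].
Qed.

End ratio_asymptotics.

Section forelli_rudin.
Context {R : realType}.
Implicit Types (s t c x : R) (z w xi : R[i]).

Lemma bcoef_gt0 s n : 0 < s -> 0 < bcoef (- s) n.
Proof.
move=> s0; elim: n => [|n IH]; first by rewrite bcoef0.
have : 0 < n.+1%:R * bcoef (- s) n.+1 by rewrite bcoefS opprK mulr_gt0 // ltr_wpDl.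
by rewrite pmulr_rgt0.
Qed.

Lemma bcoefS_div s n : bcoef (- s) n.+1 = (n%:R + s) / (n%:R + 1) * bcoef (- s) n.
Proof.
have n0 : n.+1%:R != 0 :> R by rewrite pnatr_eq0.
apply: (mulfI n0); rewrite bcoefS opprK -natr1; field.
by rewrite natr1.
Qed.

Lemma momentS_div t s n : -1 < t -> -1 < s ->
  moment t s n.+1 = (n%:R + (s + 1)) / (n%:R + (t + s + 2)) * moment t s n.
Proof.
move=> t1 s1; have n0 : (0 : R) <= n%:R by [].
have h : n%:R + (t + s + 2) != 0 by rewrite gt_eqF //; lra.
apply: (mulfI h); rewrite momentS //; move: (n%:R + (t + s + 2)) h => u u0.
by field.
Qed.

(** A negative power of the modulus is the squared modulus of a power series. *)
Lemma sqr_pser_bcoef c xi : disc xi ->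
  normc (pser (fun n => (bcoef (- (c / 2)) n)%:C) xi) ^+ 2 = normc (1 - xi) `^ (- c).
Proof.
move=> xid; rewrite pser_bcoef // normc_cpow -powR_mulrn ?powR_ge0 // -powRrM.
by congr (_ `^ _); field.
Qed.

Lemma onem_disc_ge z w : disc z -> disc w -> 1 - normc w <= normc (1 - z * w^*).
Proof.
move=> zd wd; have h := le_normcD (1 - z * w^*) (z * w^*).
move: h; rewrite subrK -[X in normc X](rmorph1 (real_complex R)) normc_real normr1 => h.
rewrite lerBlDr; apply: le_trans h _; rewrite lerD2l normcM normc_conj.
by rewrite ler_piMl ?normc_ge0 // ltW.
Qed.

Lemma measurable_onem_powR w c :
  measurable_fun setT (fun z => normc (1 - z * w^*) `^ c).
Proof.
apply: (measurableT_comp (@measurable_powR R _)); apply: measurable_cnorm.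
apply: (measurable_cD (measurable_cst _)).
under eq_fun do rewrite -mulrN.
by apply: measurable_cM; [exact: measurable_id|exact: measurable_cst].
Qed.

Lemma powR_neg_le (x y c : R) : 0 < x -> x <= y -> 0 <= c -> y `^ (- c) <= x `^ (- c).
Proof.
move=> x0 xy c0; have y0 := lt_le_trans x0 xy.
by rewrite !powRN lef_pV2 ?posrE ?powR_gt0 // ge0_ler_powR // nnegrE ltW.
Qed.

Lemma integral_onem_powR t s c w : -1 < t -> -1 < s -> 0 <= c -> disc w ->
  (\int[mu t s]_(z in disc) (normc (1 - z * w^*) `^ (- c))%:E =
   (\int[mu t s]_(z in disc) normc (1 - z * w^*) `^ (- c))%:E)%E.
Proof.
move=> t1 s1 c0 wd; rewrite /Rintegral fineK //; apply: integrable_fin_num; first exact: measurable_disc.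
have w1 : 0 < 1 - normc w by rewrite subr_gt0.
have [] := @bounded_cintegrable _ t s (fun z => (normc (1 - z * w^*) `^ (- c))%:C)
  ((1 - normc w) `^ (- c)) t1 s1.
- by apply: measurable_creal; exact: measurable_funTS (measurable_onem_powR w _).
- move=> z zd; rewrite normc_nng ?powR_ge0 //.
  by apply: powR_neg_le => //; exact: onem_disc_ge.
by [].
Qed.

Lemma parseval_onem t s c w : -1 < t -> -1 < s -> disc w ->
  (fun n => \sum_(k < n) bcoef (- (c / 2)) k ^+ 2 * (normc w ^+ 2) ^+ k * moment t s k) @ \oo -->
  \int[mu t s]_(z in disc) normc (1 - z * w^*) `^ (- c).
Proof.
move=> t1 s1 wd; have := parseval t1 s1 (cps_bcoef (- (c / 2))) wd.
rewrite (_ : Rintegral _ _ _ = \int[mu t s]_(z in disc) normc (1 - z * w^*) `^ (- c)).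
  apply: cvg_trans; apply: near_eq_cvg; apply: nearW => n.
  by apply: eq_bigr => k _; rewrite normc_real real_normK ?num_real.
by apply: eq_Rintegral => z /set_mem zd; rewrite sqr_pser_bcoef //; exact: mulr_conj_disc.
Qed.

(** By [parseval_onem] the left side is a power series in [normc w ^+ 2]; its coefficients
    are compared, through the ratios of consecutive ones, with those of the right side. *)
Lemma forelli_rudin t s c : -1 < t -> -1 < s -> t + 2 < c -> exists2 C, 0 < C & forall w, disc w ->
  (\int[mu t s]_(z in disc) (normc (1 - z * w^*) `^ (- c))%:E <=
   (C * (1 - normc w ^+ 2) `^ (t + 2 - c))%:E)%E.
Proof.
move=> t1 s1 tc; pose g := c - t - 2; have g0 : 0 < g by rewrite /g; lra.
have c0 : 0 < c / 2 by lra.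
have [||||||C C0 hC] := @cubic_bounded R
   (fun n => bcoef (- (c / 2)) n ^+ 2 * moment t s n / bcoef (- g) n)
   (c / 2) (c / 2) (s + 1) 1 (t + s + 2) g.
- by [].
- by lra.
- by [].
- by rewrite /g; field.
- move=> n; apply: divr_gt0; last exact: bcoef_gt0.
  by apply: mulr_gt0; [apply: exprn_gt0; exact: bcoef_gt0|exact: moment_gt0].
- move=> n; rewrite !bcoefS_div momentS_div // /cubic.
  have := bcoef_gt0 n g0; set G := bcoef (- g) n; set E := bcoef _ n; set M := moment t s n.
  have n0 : (0 : R) <= n%:R by [].
  have h1 : n%:R + 1 != 0 :> R by rewrite natr1 pnatr_eq0.
  have h2 : n%:R + (t + s + 2) != 0 by rewrite gt_eqF //; lra.
  have h3 : n%:R + g != 0 by rewrite gt_eqF // ltr_wpDl.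
  move: h1 h2 h3; move: (n%:R + 1 : R) (n%:R + (t + s + 2)) (n%:R + g) (n%:R + c / 2) (n%:R + (s + 1)).
  move=> u1 u2 u3 u4 u5 h1 h2 h3 G0; field; by rewrite h1 h2 h3 gt_eqF.
exists C => // w wd; rewrite integral_onem_powR //; last by lra.
rewrite lee_fin; set r := normc w ^+ 2.
have /andP[r0 r1] : 0 <= r < 1 := disc_sqr wd.
have rd : disc r%:C by rewrite /disc /= expr0n /= addr0 sqrtr_sqr ger0_norm.
have -> : (1 - r) `^ (t + 2 - c) = complex.Re (pser (fun n => (bcoef (- g) n)%:C) r%:C).
  rewrite pser_bcoef // cpowE /carg ImD ImN /= subrr mul0r atan0 mulr0 cos0 sin0 !mul0r subr0 mulr1.
  rewrite expr0n /= addr0 sqrtr_sqr ger0_norm ?subr_ge0 ?(ltW r1) //.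
  by congr (_ `^ _); rewrite /g; ring.
have pc : (fun n => \sum_(k < n) bcoef (- (c / 2)) k ^+ 2 * (normc w ^+ 2) ^+ k * moment t s k) @ \oo -->
  \int[mu t s]_(z in disc) normc (1 - z * w^*) `^ (- c) by exact: parseval_onem.
have /cto_ReIm[qc0 _] := pser_cvg (cps_bcoef (- g)) rd.
have qc : (fun n => C * complex.Re (\sum_(k < n) (bcoef (- g) k)%:C * r%:C ^+ k)) @ \oo -->
   C * complex.Re (pser (fun n => (bcoef (- g) n)%:C) r%:C).
  by apply: cvgM => //; exact: cvg_cst.
rewrite -(cvg_lim _ pc) // -(cvg_lim _ qc) //; apply: ler_lim.
- by apply/cvg_ex; eexists; exact: pc.
- by apply/cvg_ex; eexists; exact: qc.
apply: nearW => n; rewrite Re_sum mulr_sumr; apply: ler_sum => k _.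
rewrite -realX -real_complexM /= [leLHS]mulrAC [leRHS]mulrA; apply: ler_wpM2r; first exact: exprn_ge0.
by have := hC k; rewrite ler_pdivrMr // bcoef_gt0.
Qed.

(** At this exponent the Parseval coefficients are at least of order [1 / n], by the same
    comparison of ratios, and the harmonic series diverges. *)
Lemma forelli_rudin_log t s (A : R) : -1 < t -> -1 < s -> exists r : R, [/\ 0 <= r, r < 1 &
  A <= \int[mu t s]_(z in disc) normc (1 - z * r%:C^*) `^ (- (t + 2))].
Proof.
move=> t1 s1; pose c := t + 2; have c0 : 0 < c / 2 by rewrite /c; lra.
pose x n := (n.+1%:R * (bcoef (- (c / 2)) n.+1 ^+ 2 * moment t s n.+1))^-1.
have [||||||C C0 hC] := @cubic_bounded R x 1 (t + s + 3) 2 (1 + c / 2) (1 + c / 2) (s + 2).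
- by lra.
- by lra.
- by lra.
- by rewrite /c; field.
- by move=> n; rewrite invr_gt0 mulr_gt0 // mulr_gt0 ?exprn_gt0 ?bcoef_gt0 ?moment_gt0.
- move=> n; rewrite /x (bcoefS_div _ n.+1) (momentS_div n.+1 t1 s1) /cubic.
  have := bcoef_gt0 n.+1 c0; have := moment_gt0 n.+1 t1 s1.
  set E := bcoef _ n.+1; set M := moment t s n.+1.
  rewrite -[n.+2%:R]natr1 -[n.+1%:R]natr1; have : (0 : R) <= n%:R by [].
  move: (n%:R : R) => N N0 M0 E0; field.
  by rewrite !gt_eqF //= ; lra.
have [n hn] := harmonic_unbounded (2 * C * A).
(* by Bernoulli's inequality the first [n.+1] powers of [r ^+ 2 = 1 - d] are at least
   one half *)
pose d : R := (2 * n.+1%:R)^-1; pose r := Num.sqrt (1 - d).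
have n1 : (1 : R) <= n.+1%:R by rewrite ler1n.
have d0 : 0 < d by rewrite invr_gt0; lra.
have d1 : d <= 2^-1 by rewrite lef_pV2 ?posrE; lra.
have rE : r ^+ 2 = 1 - d by rewrite sqr_sqrtr //; lra.
have r0 : 0 <= r by exact: sqrtr_ge0.
have r1 : r < 1 by rewrite -(@expr_lt1 _ 2) // rE; lra.
have bern m : 1 - m%:R * d <= (r ^+ 2) ^+ m.
  elim: m => [|m IH]; first by rewrite mul0r subr0.
  rewrite exprSr; apply: (@le_trans _ _ ((1 - m%:R * d) * r ^+ 2)); last by rewrite ler_wpM2r ?sqr_ge0.
  have m0 : (0 : R) <= m%:R by []; rewrite rE -natr1; nra.
have rk m : (m <= n)%N -> 2^-1 <= (r ^+ 2) ^+ m.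
  move=> mn; apply: le_trans (bern m).
  have : (m%:R : R) <= n.+1%:R by rewrite ler_nat leqW.
  have : n.+1%:R * d = 2^-1 by rewrite /d; move: (n.+1%:R : R) n1 => N N1; field; rewrite gt_eqF //; lra.
  by nra.
exists r; split => //.
have q0 v k : 0 <= v -> 0 <= bcoef (- (c / 2)) k ^+ 2 * v ^+ k * moment t s k.
  move=> v0; apply: mulr_ge0; last by apply: ltW; exact: moment_gt0.
  by apply: mulr_ge0; [exact: sqr_ge0|exact: exprn_ge0].
have rd : disc r%:C by rewrite /disc /= expr0n /= addr0 sqrtr_sqr ger0_norm.
have pc : (fun n => \sum_(k < n) bcoef (- (c / 2)) k ^+ 2 * (normc r%:C ^+ 2) ^+ k * moment t s k) @ \oo -->
  \int[mu t s]_(z in disc) normc (1 - z * r%:C^*) `^ (- c) by exact: parseval_onem.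
rewrite -/c -(cvg_lim _ pc) //.
apply: (@le_trans _ _ (\sum_(k < n.+1) bcoef (- (c / 2)) k ^+ 2 * (normc r%:C ^+ 2) ^+ k * moment t s k)).
  rewrite big_ord_recl normc_nng // ler_wpDl //.
    by apply: q0; exact: sqr_ge0.
  apply: (@le_trans _ _ (\sum_(k < n) (2 * C)^-1 * k.+1%:R^-1)).
    by rewrite -mulr_sumr ler_pdivlMl ?mulr_gt0.
  apply: ler_sum => k _ /=; rewrite /bump /= add1n mulrAC.
  have := hC k; rewrite /x => hk.
  set E := bcoef _ k.+1 ^+ 2 * moment t s k.+1 in hk *.
  have E0 : 0 < E by rewrite mulr_gt0 ?exprn_gt0 ?bcoef_gt0 ?moment_gt0.
  have k0 : (0 : R) < k.+1%:R by [].
  have : (C * k.+1%:R)^-1 <= E.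
    rewrite -[leRHS]invrK lef_pV2 ?posrE ?mulr_gt0 ?invr_gt0 //.
    by move: hk; rewrite invfM mulrC ler_pdivrMr.
  have := rk k.+1 (ltn_ord k); rewrite !invfM.
  set u := (_ ^+ _); set v := _^-1 * _^-1 => h1 h2.
  have v0 : 0 <= v by rewrite mulr_ge0 // invr_ge0 ltW.
  rewrite -mulrA -/v [E * u]mulrC; apply: ler_pM => //.
have nd : {homo (fun n => \sum_(k < n) bcoef (- (c / 2)) k ^+ 2 * (normc r%:C ^+ 2) ^+ k * moment t s k) :
    n m / (n <= m)%N >-> n <= m}.
  apply/nondecreasing_seqP => m; rewrite big_ord_recr /= lerDl.
  by apply: q0; exact: sqr_ge0.
apply: (nondecreasing_cvgn_le nd); apply/cvg_ex; eexists; exact: pc.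
Qed.

End forelli_rudin.

(** * The kernel as a power series and Jensen's inequality *)

Section kernel.
Context {R : realType}.
Implicit Types (alpha : R) (z w xi : R[i]).

Lemma Beta_x1 (x : R) : 0 < x -> Beta x 1 = x^-1.
Proof.
move=> x0; have h := integral_powR0 x0 (@ltr01 R).
have x1 : 0 <= x by exact: ltW.
have e : (x%:E * eBeta x 1 = 1)%E.
  have h' : (\int[@lebesgue_measure R]_(s in `]0%R, 1%R[) (x * s `^ (x - 1))%:E = 1)%E by rewrite h powR1.
  rewrite -h' /eBeta.
  have mf : measurable_fun (`]0, 1[%classic : set R) (fun t : R => (t `^ (x - 1) * (1 - t) `^ (1 - 1))%:E).
    by apply/measurable_EFinP; exact: measurable_powR_onem.
  have f0 (t : R) : `]0, 1[%classic t -> (0 <= (t `^ (x - 1) * (1 - t) `^ (1 - 1))%:E)%E.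
    by move=> _; rewrite lee_fin mulr_ge0 ?powR_ge0.
  apply: etrans (esym (ge0_integralZl_EFin (@lebesgue_measure R) (measurable_itv _) f0 mf x1)) _.
  by apply: eq_integral => t _; rewrite subrr powRr0 mulr1.
rewrite -(EFin_Beta x0 ltr01) -EFinM in e; move: e => [e].
by apply: (mulfI (lt0r_neq0 x0)); rewrite mulfV ?gt_eqF.
Qed.

(** The constant between the kernel and the series of [dcoef]. *)
Definition kconst alpha beta0 m : R :=
  Beta (alpha + 1) (beta0 + m%:R + 1) / Beta (alpha + 1) (beta0 + 1).

Lemma kconst_gt0 alpha beta0 m : -1 < alpha -> -1 < beta0 -> 0 < kconst alpha beta0 m.
Proof.
move=> a1 b1; have m0 : (0 : R) <= m%:R by [].
by rewrite divr_gt0 // Beta_gt0 //; lra.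
Qed.

Lemma Q_Qb alpha beta0 m xi : -1 < alpha -> -1 < beta0 <= 0 -> disc xi ->
  Q alpha (beta0 + m%:R) xi = (kconst alpha beta0 m)%:C * Qb (alpha + 1) (beta0 + 1) xi.
Proof.
move=> a1 /[dup] b01 /andP[b1 b0] xid; rewrite /Q frac_partE //.
have a0 : 0 < alpha + 1 by lra.
have y01 : 0 < beta0 + 1 <= 1 by apply/andP; split; lra.
case: ifPn => [/natrP[n hn]|nn].
  have bz : beta0 = 0.
    have nm : (n <= m)%N by rewrite -(ler_nat R) -hn; lra.
    have mn : (m <= n)%N by rewrite -ltnS -(ltr_nat R) -natr1 -hn; lra.
    have nE : n = m by apply/eqP; rewrite eqn_leq nm mn.
    by move: hn; rewrite nE; lra.
  rewrite /kconst bz !add0r Beta_x1 // invrK [_ * (alpha + 1)]mulrC.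
  rewrite -[LHS]mulr1; congr (_ * _); rewrite bz add0r in y01.
  have hc := cps_qcoef a0 y01; rewrite /Qb (pser_shift hc xid).
  rewrite (_ : pser _ xi = pser (fun n => 0 * (qcoef (alpha + 1) 1 n.+1)%:C) xi); last first.
    by apply: eq_csum => k; rewrite /qcoef subrr !mul0r.
  by rewrite (pserZ _ (cpsS hc) xid) mul0r mulr0 addr0.
rewrite /kconst; congr (_ * _).
have [B hB] := qcoef_asum a0 y01.
have hB' := qcoef_asum_le a0 y01 (ltW xid) hB.
have bn : beta0 != 0 by apply: contraNneq nn => ->; rewrite add0r natr_nat.
rewrite /Qb /pser -(limn_csum hB').
suff -> : (fun n : nat => (beta0 / (n%:R + beta0) * gbinom (alpha + 1) n)%:C * (- xi) ^+ n) =
  (fun k => (qcoef (alpha + 1) (beta0 + 1) k)%:C * xi ^+ k) by [].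
apply/funext => -[|n]; rewrite /qcoef.
  by rewrite add0r divff // mul1r /gbinom big_ord0 fact0 divr1 !expr0.
rewrite addrK /bcoef (exprNn xi n.+1).
have -> : (-1) ^+ n.+1 = ((-1) ^+ n.+1)%:C :> R[i] by rewrite rmorphXn rmorphN1.
by rewrite mulrA -!rmorphM; congr ((_)%:C * _); ring.
Qed.

Definition kfun alpha beta0 m xi : R[i] := (kconst alpha beta0 m)%:C / xi ^+ m *
  pser (fun k => (dcoef (alpha + 1) (beta0 + 1) k)%:C) xi.

Lemma kernelE alpha beta0 m f z w : -1 < alpha -> -1 < beta0 <= 0 -> disc z -> disc w ->
  kernel_integrand alpha (beta0 + m%:R) f z w = f w * kfun alpha beta0 m (z * w^*).
Proof.
move=> a1 b01 zd wd; have zw := mulr_conj_disc zd wd.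
have /andP[b1 b0] := b01.
have a0 : 0 < alpha + 1 by lra.
have y01 : 0 < beta0 + 1 <= 1 by apply/andP; split; lra.
rewrite /kernel_integrand /kfun int_partE // (Q_Qb _ a1 b01 zw) (pser_dcoef a0 y01 zw).
rewrite invfM (_ : 2 + alpha = alpha + 1 + 1); last by ring.
by congr (f w * _); ring.
Qed.

End kernel.

Section jensen.
Context {d : measure_display} {T : measurableType d} {R : realType}.
Variables (nu : {measure set T -> \bar R}) (D : set T) (mD : measurable D).

(** The tangent to [x `^ p] at [l]. *)
Lemma young_tangent (p x l : R) : 1 <= p -> 0 <= x -> 0 <= l ->
  p * l `^ (p - 1) * x <= x `^ p + (p - 1) * l `^ p.
Proof.
move=> p1 x0 l0; have [->|pn] := eqVneq p 1.
  by rewrite subrr powRr0 mul0r addr0 !mul1r powRr1.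
have {}p1 : 1 < p by rewrite lt_neqAle eq_sym pn.
have p0 : 0 < p by lra.
have q0 : 0 < p / (p - 1) by rewrite divr_gt0 //; lra.
have e : p^-1 + (p / (p - 1))^-1 = 1 by field; rewrite !gt_eqF //; lra.
have := conjugate_powR x0 (powR_ge0 l (p - 1)) p0 q0 e.
rewrite -powRrM (_ : (p - 1) * (p / (p - 1)) = p); last by field; rewrite gt_eqF //; lra.
rewrite invf_div -(ler_pM2l p0) => h.
have -> : p * l `^ (p - 1) * x = p * (x * l `^ (p - 1)) by ring.
apply: le_trans h _; rewrite le_eqVlt; apply/orP; left; apply/eqP.
by field; rewrite gt_eqF.
Qed.

(** Jensen's inequality for a weight of total mass at most [A], by integrating the
    tangent inequality at the mean. *)
Lemma jensen_weighted (p A x : R) (g v : T -> R) : 1 <= p -> 0 < A -> 0 <= x ->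
  measurable_fun D g -> measurable_fun D v -> (forall t, 0 <= g t) -> (forall t, 0 <= v t) ->
  (\int[nu]_(t in D) (v t)%:E <= A%:E)%E ->
  (x%:E <= \int[nu]_(t in D) (g t * v t)%:E)%E ->
  ((x `^ p)%:E <= (A `^ (p - 1))%:E * \int[nu]_(t in D) (g t `^ p * v t)%:E)%E.
Proof.
move=> p1 A0 x0 mg mv g0 v0 vA xI.
have p0 : 0 < p by lra.
have mgp : measurable_fun D (fun t => g t `^ p).
  exact: (measurableT_comp (@measurable_powR R _)).
have mgpv : measurable_fun D (fun t => (g t `^ p * v t)%:E).
  by apply/measurable_EFinP; exact: measurable_funM.
have gpv0 t : D t -> (0 <= (g t `^ p * v t)%:E)%E by rewrite lee_fin mulr_ge0 ?powR_ge0.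
have G0 : (0 <= \int[nu]_(t in D) (g t `^ p * v t)%:E)%E by exact: integral_ge0.
have Ap : 0 < A `^ (p - 1) by rewrite powR_gt0.
case GE : (\int[nu]_(t in D) (g t `^ p * v t)%:E)%E G0 => [G||//] G0; last first.
  by rewrite gt0_muley ?lte_fin // leey.
pose l := x / A; have l0 : 0 <= l by rewrite divr_ge0 // ltW.
have k0 : 0 <= p * l `^ (p - 1) by rewrite mulr_ge0 ?powR_ge0 // ltW.
have k1 : 0 <= (p - 1) * l `^ p by rewrite mulr_ge0 ?powR_ge0 //; lra.
have mvE : measurable_fun D (fun t => (v t)%:E) by apply/measurable_EFinP.
have vE0 t : D t -> (0 <= (v t)%:E)%E by rewrite lee_fin.
have mgv : measurable_fun D (fun t => (g t * v t)%:E).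
  by apply/measurable_EFinP; exact: measurable_funM.
have gv0 t : D t -> (0 <= (g t * v t)%:E)%E by rewrite lee_fin mulr_ge0.
have h1 : ((p * l `^ (p - 1) * x)%:E <= G%:E + ((p - 1) * l `^ p * A)%:E)%E.
  apply: (@le_trans _ _ ((p * l `^ (p - 1))%:E * \int[nu]_(t in D) (g t * v t)%:E)%E).
    by rewrite EFinM lee_wpmul2l // lee_fin.
  rewrite -(ge0_integralZl_EFin nu mD gv0 mgv k0) -GE [X in (_ <= _ + X)%E]EFinM.
  apply: (@le_trans _ _ (\int[nu]_(t in D) (g t `^ p * v t)%:E +
     ((p - 1) * l `^ p)%:E * \int[nu]_(t in D) (v t)%:E)%E); last first.
    by rewrite leeD2l // lee_wpmul2l // lee_fin.
  have mkv : measurable_fun D (fun t => (((p - 1) * l `^ p)%:E * (v t)%:E)%E).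
    by apply: emeasurable_funM => //; exact: measurable_cst.
  have kv0 t : D t -> (0 <= ((p - 1) * l `^ p)%:E * (v t)%:E)%E.
    by move=> Dt; rewrite mule_ge0 ?vE0 // lee_fin.
  rewrite -(ge0_integralZl_EFin nu mD vE0 mvE k1) -(ge0_integralD nu mD gpv0 mgpv kv0 mkv).
  apply: ge0_le_integral => //.
  - by move=> t Dt; rewrite mule_ge0 ?gv0 // lee_fin.
  - by apply: emeasurable_funM => //; exact: measurable_cst.
  - exact: emeasurable_funD.
  move=> t Dt; rewrite -!EFinM -EFinD lee_fin mulrA -mulrDl ler_wpM2r //.
  exact: young_tangent.
rewrite -EFinD lee_fin in h1; rewrite -EFinM lee_fin.
have lA : x = l * A by rewrite divfK // gt_eqF.
have [xz|xn] := eqVneq x 0.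
  rewrite xz powR0 ?gt_eqF // mulr_ge0 ?powR_ge0 //.
have xp : 0 < x by rewrite lt_neqAle eq_sym xn.
have lp : 0 < l by rewrite divr_gt0.
have pS y : 0 < y -> y `^ p = y `^ (p - 1) * y.
  move=> y0; rewrite -{3}[y]powRr1 ?ltW // -powRD ?subrK //.
  by apply/implyP => _; rewrite gt_eqF.
rewrite {1}lA (powRM _ l0 (ltW A0)) (pS _ A0) (pS _ lp).
have -> : l `^ (p - 1) * l * (A `^ (p - 1) * A) = A `^ (p - 1) * (l `^ (p - 1) * x).
  by rewrite lA; ring.
apply: ler_wpM2l; first exact: ltW.
move: h1; rewrite (pS _ lp) lA; lra.
Qed.

End jensen.

(** * Schur's test *)

Section schur.
Context {R : realType}.
Implicit Types (a b x y s t c : R) (z w : R[i]) (f : R[i] -> R[i]).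

Definition rho z : R := normc z ^+ 2.

Lemma rho_ge0 z : 0 <= rho z. Proof. exact: sqr_ge0. Qed.

Lemma rho_disc z : disc z -> 0 < 1 - rho z.
Proof. by move=> /disc_sqr /andP[_ h]; rewrite subr_gt0. Qed.

Lemma rho_pdisc z : pdisc z -> 0 < rho z.
Proof. by move=> [_ /eqP z0]; rewrite exprn_gt0 // normc_gt0. Qed.

Lemma rho_powR z x : rho z `^ (x / 2) = normc z `^ x.
Proof.
by rewrite /rho -powR_mulrn ?normc_ge0 // -powRrM; congr (_ `^ _); field.
Qed.

Lemma normc_onem_conj z w : normc (1 - z * w^*) = normc (1 - w * z^*).
Proof.
rewrite -[LHS]normc_conj; congr normc.
rewrite -[X in X = _]/(Num.conj (1 - z * w^*)) rmorphB rmorph1 rmorphM /= conjCK.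
by rewrite mulrC.
Qed.

(** Powers of [normc z ^+ 2] and of the defining function of the circle: the weights of
    Schur's test, and later the moduli of the test functions. *)
Definition rpow x y z : R := rho z `^ x * (1 - rho z) `^ y.

Lemma rpow_ge0 x y z : 0 <= rpow x y z.
Proof. by rewrite mulr_ge0 ?powR_ge0. Qed.

Lemma measurable_rpow x y (D : set R[i]) : measurable_fun D (rpow x y).
Proof.
apply: measurable_funTS; apply: (@measurable_radial _ (fun t => t `^ x * (1 - t) `^ y)).
exact: measurable_powR_onem.
Qed.

(** On the punctured disc only: at 0 the exponent law for powers fails. *)
Lemma rpowD x y x' y' z : pdisc z -> rpow x y z * rpow x' y' z = rpow (x + x') (y + y') z.
Proof.
move=> zd; have h1 := rho_pdisc zd; have h2 := rho_disc (pdisc_disc zd).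
rewrite /rpow !powRD; first by ring.
  by apply/implyP => _; rewrite gt_eqF.
by apply/implyP => _; rewrite gt_eqF.
Qed.

Lemma rpowX x y p z : rpow x y z `^ p = rpow (x * p) (y * p) z.
Proof. by rewrite /rpow powRM ?powR_ge0 // -!powRrM. Qed.

Lemma le_integral_mu_pdisc a b (f1 f2 : R[i] -> \bar R) :
  measurable_fun disc f1 -> measurable_fun disc f2 ->
  (forall z, disc z -> (0 <= f1 z)%E) -> (forall z, disc z -> (0 <= f2 z)%E) ->
  (forall z, pdisc z -> (f1 z <= f2 z)%E) ->
  (\int[mu a b]_(z in disc) f1 z <= \int[mu a b]_(z in disc) f2 z)%E.
Proof.
move=> m1 m2 p1 p2 h.
rewrite (ge0_integral_mu_pdisc a b m1 p1) (ge0_integral_mu_pdisc a b m2 p2).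
have mw : measurable_fun pdisc (fun z : R[i] => (radial_weight a b (normc z ^+ 2))%:E).
  apply/measurable_EFinP; apply: measurable_funTS.
  by apply: (@measurable_radial _ (radial_weight a b)); exact: measurable_radial_weight.
have mp (f : R[i] -> \bar R) : measurable_fun disc f ->
    measurable_fun pdisc (fun z => (f z * (radial_weight a b (normc z ^+ 2))%:E)%E).
  by move=> mf; apply: emeasurable_funM => //; exact: measurable_funS measurable_disc pdisc_disc mf.
apply: ge0_le_integral.
- exact: measurable_pdisc.
- by move=> z /pdisc_disc zd; rewrite mule_ge0 ?p1 // lee_fin radial_weight_ge0.
- exact: mp.
- exact: mp.
- by move=> z zd; rewrite lee_wpmul2r ?h // lee_fin radial_weight_ge0.
Qed.

Lemma measurable_kernel_power c :
  measurable_fun setT (fun zw : R[i] * R[i] => normc (1 - zw.1 * zw.2^*) `^ c).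
Proof.
apply: (measurableT_comp (@measurable_powR R _)); apply: measurable_cnorm.
apply: (measurable_cD (measurable_cst _)).
under eq_fun do rewrite -mulrN -mulN1r mulrCA.
apply: measurable_cM; first exact: measurable_cst.
apply: measurable_cM; first exact: measurable_fst.
by apply: measurable_cconj; exact: measurable_snd.
Qed.

Lemma forelli_rudin_weighted a b x y c : -1 < a -> -1 < b -> -1 < a + y -> -1 < b + x ->
  a + y + 2 < c -> exists2 C, 0 < C & forall w, disc w ->
  (\int[mu a b]_(z in disc) (normc (1 - z * w^*) `^ (- c) * rpow x y z)%:E <=
   (C * (1 - rho w) `^ (a + y + 2 - c))%:E)%E.
Proof.
move=> a1 b1 ay bx h; have [C C0 hC] := forelli_rudin ay bx h.
pose k := Beta (a + y + 1) (b + x + 1) / Beta (a + 1) (b + 1).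
have k0 : 0 < k by rewrite divr_gt0 // Beta_gt0 //; lra.
exists (k * C); first exact: mulr_gt0.
move=> w wd; have mf : measurable_fun disc (fun z => (normc (1 - z * w^*) `^ (- c))%:E).
  by apply/measurable_EFinP; exact: measurable_funTS (measurable_onem_powR w _).
have f0 z : disc z -> (0 <= (normc (1 - z * w^*) `^ (- c))%:E)%E by rewrite lee_fin powR_ge0.
have := mu_shift a1 b1 ay bx mf f0; rewrite -/k => e.
apply: (@le_trans _ _ (k%:E * \int[mu (a + y) (b + x)]_(z in disc) (normc (1 - z * w^*) `^ (- c))%:E)%E).
  by rewrite -e le_eqVlt; apply/orP; left; apply/eqP; apply: eq_integral => z _; rewrite EFinM.
by rewrite -mulrA [leRHS]EFinM lee_wpmul2l ?hC // lee_fin ltW.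
Qed.

Context (a b alpha beta p sigma tau q : R).
Hypotheses (a1 : -1 < a) (b1 : -1 < b) (al1 : -1 < alpha) (be1 : -1 < beta) (p1 : 1 <= p).
Hypotheses (t0 : 0 < tau) (t1 : tau < alpha + 1) (hs : -1 < beta - (sigma + q)).
Hypotheses (hsb : b - beta <= sigma * (p - 1) - q) (hta : -1 < a - tau * (p - 1)).
Hypotheses (htal : a - alpha < tau * (p - 1)) (hq : -1 < b - q * p).

Let K z w : R := normc (1 - w * z^*) `^ (- (alpha + 2)).

(** Jensen's inequality for the weight [v], whose mass is controlled by the Forelli-Rudin
    estimate; [sigma] and [tau] are the exponents of the test function. *)
Lemma schur_pointwise : exists2 C, 0 < C & forall f z x,
  measurable_fun disc f -> disc z -> 0 <= x ->
  (x%:E <= \int[mu alpha beta]_(w in disc) (normc (f w) * rpow (- q) 0 w * K z w)%:E)%E ->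
  ((x `^ p)%:E <= (C * (1 - rho z) `^ (- tau * (p - 1)))%:E * \int[mu alpha beta]_(w in disc)
     (normc (f w) `^ p * rpow (b - beta) (tau * (p - 1)) w * K z w)%:E)%E.
Proof.
have [|||C C0 hC] := @forelli_rudin_weighted alpha beta (- (sigma + q)) (- tau) (alpha + 2) al1 be1.
- by move: t1; lra.
- by [].
- by move: t0; lra.
exists (C `^ (p - 1)); first by rewrite powR_gt0.
move=> f z x mf zd x0 hx.
pose g w := normc (f w) * rpow sigma tau w.
pose v w := rpow (- (sigma + q)) (- tau) w * K z w.
have mK : measurable_fun disc (K z) by exact: measurable_funTS (measurable_onem_powR z _).
have mfn : measurable_fun disc (fun w => normc (f w)) by exact: measurable_cnorm.
have mg : measurable_fun disc g by apply: measurable_funM => //; exact: measurable_rpow.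
have mv : measurable_fun disc v by apply: measurable_funM => //; exact: measurable_rpow.
have K0 w : 0 <= K z w by exact: powR_ge0.
have g0 w : 0 <= g w by rewrite mulr_ge0 ?normc_ge0 ?rpow_ge0.
have v0 w : 0 <= v w by rewrite mulr_ge0 ?rpow_ge0.
have z1 := rho_disc zd.
pose A := C * (1 - rho z) `^ (- tau).
have A0 : 0 < A by rewrite mulr_gt0 ?powR_gt0.
have vA : (\int[mu alpha beta]_(w in disc) (v w)%:E <= A%:E)%E.
  have := hC z zd; rewrite (_ : alpha + - tau + 2 - (alpha + 2) = - tau); last by ring.
  by apply: le_trans; under eq_integral do rewrite /v mulrC.
have xI : (x%:E <= \int[mu alpha beta]_(w in disc) (g w * v w)%:E)%E.
  apply: le_trans hx _; apply: le_integral_mu_pdisc.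
  - apply/measurable_EFinP; apply: measurable_funM => //; apply: measurable_funM => //.
    exact: measurable_rpow.
  - by apply/measurable_EFinP; exact: measurable_funM.
  - move=> w _; rewrite lee_fin; apply: mulr_ge0; last exact: K0.
    by rewrite mulr_ge0 ?normc_ge0 ?rpow_ge0.
  - by move=> w _; rewrite lee_fin mulr_ge0.
  move=> w wd; rewrite lee_fin /g /v le_eqVlt; apply/orP; left; apply/eqP.
  have := rpowD sigma tau (- (sigma + q)) (- tau) wd.
  rewrite (_ : sigma + - (sigma + q) = - q) ?subrr; last by ring.
  by move=> <-; ring.
have := jensen_weighted measurable_disc p1 A0 x0 mg mv g0 v0 vA xI.
move=> h; apply: le_trans h _.
have -> : A `^ (p - 1) = C `^ (p - 1) * (1 - rho z) `^ (- tau * (p - 1)).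
  by rewrite /A powRM ?powR_ge0 ?(ltW C0) // -powRrM.
apply: lee_wpmul2l; first by rewrite lee_fin mulr_ge0 ?powR_ge0.
apply: le_integral_mu_pdisc.
- apply/measurable_EFinP; apply: measurable_funM => //.
  exact: (measurableT_comp (@measurable_powR R _)).
- apply/measurable_EFinP; apply: measurable_funM => //; apply: measurable_funM.
    exact: (measurableT_comp (@measurable_powR R _)).
  exact: measurable_rpow.
- by move=> w _; rewrite lee_fin mulr_ge0 ?powR_ge0.
- by move=> w _; rewrite lee_fin !mulr_ge0 ?powR_ge0 ?rpow_ge0.
move=> w wd; rewrite lee_fin /g /v powRM ?normc_ge0 ?rpow_ge0 // rpowX.
rewrite mulrA -[_ `^ p * _ * rpow _ _ _]mulrA (rpowD _ _ _ _ wd).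
apply: ler_wpM2r => //; apply: ler_wpM2l; first exact: powR_ge0.
have w0 := rho_pdisc wd; have w1 := rho_disc (pdisc_disc wd).
rewrite /rpow (_ : tau * p + - tau = tau * (p - 1)); last by ring.
apply: ler_wpM2r; first exact: powR_ge0.
apply: ger_powR; first by rewrite w0 /= -subr_ge0 ltW.
by apply: le_trans hsb _; rewrite le_eqVlt; apply/orP; left; apply/eqP; ring.
Qed.

Let phi f w : R := normc (f w) `^ p * rpow (b - beta) (tau * (p - 1)) w.

Lemma schur_shift : exists2 C, 0 < C & forall f, measurable_fun disc f ->
  (\int[mu alpha beta]_(w in disc) (normc (f w) `^ p * rpow (b - beta) (a - alpha) w)%:E =
   C%:E * \int[mu a b]_(w in disc) (normc (f w) `^ p)%:E)%E.
Proof.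
pose k := Beta (a + 1) (b + 1) / Beta (alpha + 1) (beta + 1).
exists k; first by rewrite divr_gt0 // Beta_gt0 //; move: a1 b1 al1 be1; lra.
move=> f mf.
have mfp : measurable_fun disc (fun w => (normc (f w) `^ p)%:E).
  apply/measurable_EFinP; apply: (measurableT_comp (@measurable_powR R _)).
  exact: measurable_cnorm.
have fp0 w : disc w -> (0 <= (normc (f w) `^ p)%:E)%E by rewrite lee_fin powR_ge0.
have h1 : alpha + (a - alpha) = a by ring.
have h2 : beta + (b - beta) = b by ring.
have := @mu_shift R alpha beta (b - beta) (a - alpha) (fun w => (normc (f w) `^ p)%:E) al1 be1.
rewrite h1 h2 => /(_ a1 b1 mfp fp0); rewrite -/k => <-.
by apply: eq_integral => w _; rewrite EFinM.
Qed.

(** The pointwise bound at [z = 0], where [K] is 1. *)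
Lemma schur_integrable f : measurable_fun disc f ->
  (\int[mu a b]_(w in disc) (normc (f w) `^ p)%:E < +oo)%E ->
  (\int[mu alpha beta]_(w in disc) (normc (f w) * rpow (- q) 0 w)%:E < +oo)%E.
Proof.
move=> mf ffin; have [C C0 hC] := schur_pointwise; have [k k0 hk] := schur_shift.
have mfn : measurable_fun disc (fun w => normc (f w)) by exact: measurable_cnorm.
have mfp : measurable_fun disc (fun w => normc (f w) `^ p).
  exact: (measurableT_comp (@measurable_powR R _)).
have K1 w : K 0 w = 1.
  by rewrite /K conjC0 mulr0 subr0 -[X in normc X](rmorph1 (real_complex R)) normc_real normr1 powR1.
have r0 : rho 0 = 0 :> R by rewrite /rho normc0 expr0n.
pose G := (\int[mu alpha beta]_(w in disc) (phi f w * K 0 w)%:E)%E.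
have Gfin : (G < +oo)%E.
  apply: (@le_lt_trans _ _ (k%:E * \int[mu a b]_(w in disc) (normc (f w) `^ p)%:E)%E); last first.
    by rewrite lte_mul_pinfty // ?lee_fin // ltW.
  rewrite -(hk f mf); apply: ge0_le_integral.
  - exact: measurable_disc.
  - by move=> w _; rewrite lee_fin !mulr_ge0 ?powR_ge0 ?rpow_ge0.
  - under eq_fun do rewrite K1 mulr1.
    apply/measurable_EFinP; apply: measurable_funM => //; exact: measurable_rpow.
  - apply/measurable_EFinP; apply: measurable_funM => //; exact: measurable_rpow.
  move=> w wd; rewrite lee_fin K1 mulr1; apply: ler_wpM2l; first exact: powR_ge0.
  apply: ler_wpM2l; first exact: powR_ge0.
  apply: ger_powR; last exact: ltW.
  by rewrite (rho_disc wd) /= gerBl rho_ge0.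
have G0 : (0 <= G)%E.
  by apply: integral_ge0 => w _; rewrite lee_fin !mulr_ge0 ?powR_ge0 ?rpow_ge0.
rewrite ltNge leye_eq; apply/negP => /eqP I.
pose g := fine G; have GE : G = g%:E by rewrite fineK // ge0_fin_numE.
have g0 : 0 <= g by rewrite -lee_fin -GE.
have x1 : 1 <= C * g + 1 by rewrite lerDr mulr_ge0 // ltW.
have := hC f 0 (C * g + 1) mf disc0 (le_trans ler01 x1).
rewrite -/G r0 subr0 powR1 mulr1 GE -EFinM lee_fin.
have -> : (\int[mu alpha beta]_(w in disc) (normc (f w) * rpow (- q) 0 w * K 0 w)%:E = +oo)%E.
  by rewrite -I; apply: eq_integral => w _; rewrite K1 mulr1.
rewrite leey => /(_ isT); apply/negP; rewrite -ltNge.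
apply: (@lt_le_trans _ _ (C * g + 1)); first by rewrite ltrDl.
by rewrite -{1}[C * g + 1]powRr1 ?(le_trans ler01 x1) // ler_powR.
Qed.

(** Integrating the pointwise bound and exchanging the integrals, the inner integral is
    again a Forelli-Rudin integral. *)
Lemma schur_bound : exists2 C, 0 < C & forall f (F : R[i] -> R),
  measurable_fun disc f -> measurable_fun disc F -> (forall z, 0 <= F z) ->
  (forall z, disc z ->
    ((F z)%:E <= \int[mu alpha beta]_(w in disc) (normc (f w) * rpow (- q) 0 w * K z w)%:E)%E) ->
  (\int[mu a b]_(z in disc) ((F z * rpow (- q) 0 z) `^ p)%:E <=
    C%:E * \int[mu a b]_(w in disc) (normc (f w) `^ p)%:E)%E.
Proof.
have [C C0 hC] := schur_pointwise; have [k k0 hk] := schur_shift.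
have [|||C2 C20 hC2] := @forelli_rudin_weighted a b (- q * p) (- tau * (p - 1)) (alpha + 2) a1 b1.
- by move: hta; rewrite mulNr.
- by move: hq; rewrite mulNr.
- by move: htal; rewrite mulNr; lra.
exists (C * C2 * k); first by rewrite !mulr_gt0.
move=> f F mf mF F0 hF.
pose f0 := f \_ disc.
have mf0 : measurable_fun setT f0 by apply/(measurable_restrictT _ measurable_disc).1.
have f0E w : disc w -> f0 w = f w by move=> wd; rewrite /f0 patchE mem_set.
pose Ph w := phi f0 w.
have mPh (D : set R[i]) : measurable_fun D Ph.
  apply: measurable_funTS; apply: measurable_funM; last exact: measurable_rpow.
  by apply: (measurableT_comp (@measurable_powR R _)); exact: measurable_cnorm.
have Ph0 w : 0 <= Ph w by rewrite mulr_ge0 ?powR_ge0 ?rpow_ge0.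
pose W z := C * rpow (- q * p) (- tau * (p - 1)) z.
have W0 z : 0 <= W z by rewrite mulr_ge0 ?rpow_ge0 // ltW.
have mW (D : set R[i]) : measurable_fun D W by apply: measurable_funM => //; exact: measurable_rpow.
pose G (zw : R[i] * R[i]) : \bar R := (W zw.1 * (Ph zw.2 * normc (1 - zw.1 * zw.2^*) `^ (- (alpha + 2))))%:E.
have mG : measurable_fun setT G.
  apply/measurable_EFinP; apply: measurable_funM; first exact: (measurableT_comp (mW _) measurable_fst).
  apply: measurable_funM; first exact: (measurableT_comp (mPh _) measurable_snd).
  exact: measurable_kernel_power.
have G0 zw : (0 <= G zw)%E.
  rewrite lee_fin; apply: mulr_ge0; first exact: W0.
  by apply: mulr_ge0; [exact: Ph0|exact: powR_ge0].
have mFr : measurable_fun disc (fun z => F z * rpow (- q) 0 z).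
  by apply: measurable_funM => //; exact: measurable_rpow.
pose m2 : {sigma_finite_measure set R[i] -> \bar R} :=
  HB.pack (mu alpha beta) (Measure_isSigmaFinite.Build _ _ _ (mu alpha beta) (mu_sigma_finite al1 be1)).
have disc_setT x y (h : R[i] -> \bar R) : measurable_fun setT h ->
    (forall z, (0 <= h z)%E) ->
    (\int[mu x y]_(z in disc) h z = \int[mu x y]_z h z)%E.
  move=> mh h0; apply/esym.
  have := ge0_negligible_integral (mu := mu x y) (measurableC measurable_disc) measurableT mh
    (fun z _ => h0 z) (mu_setC_disc x y).
  by rewrite setTD setCK.
have mGz z : measurable_fun setT (fun w => G (z, w)).
  exact: (measurableT_comp mG (pair1_measurable z)).
have mI : measurable_fun setT (fun z => \int[mu alpha beta]_(w in disc) G (z, w))%E.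
  rewrite (_ : (fun z => _) = (fun z => \int[mu alpha beta]_w G (z, w))%E).
    exact: (@measurable_fun_fubini_tonelli_F _ _ _ _ _ m2 G mG G0).
  by apply/funext => z; exact: (disc_setT _ _ _ (mGz z) (fun w => G0 _)).
apply: (@le_trans _ _ (\int[mu a b]_(z in disc) \int[mu alpha beta]_(w in disc) G (z, w))%E).
  apply: le_integral_mu_pdisc.
  - apply/measurable_EFinP; exact: (measurableT_comp (@measurable_powR R _)).
  - exact: measurable_funTS.
  - by move=> z _; rewrite lee_fin powR_ge0.
  - by move=> z _; apply: integral_ge0 => w _; exact: G0.
  move=> z zd; have zd' := pdisc_disc zd.
  have mKz : measurable_fun disc (fun w => (Ph w * K z w)%:E).
    apply/measurable_EFinP; apply: measurable_funM => //.
    exact: measurable_funTS (measurable_onem_powR z _).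
  have PK0 w : disc w -> (0 <= (Ph w * K z w)%:E)%E by rewrite lee_fin mulr_ge0 ?powR_ge0.
  have e1 : (\int[mu alpha beta]_(w in disc) G (z, w) =
     (W z)%:E * \int[mu alpha beta]_(w in disc) (Ph w * K z w)%:E)%E.
    rewrite -(ge0_integralZl_EFin (mu alpha beta) measurable_disc PK0 mKz (W0 z)).
    by apply: eq_integral => w _; rewrite /G /= /K (normc_onem_conj z w).
  have e2 : (\int[mu alpha beta]_(w in disc) (Ph w * K z w)%:E =
      \int[mu alpha beta]_(w in disc) (normc (f w) `^ p * rpow (b - beta) (tau * (p - 1)) w * K z w)%:E)%E.
    by apply: eq_integral => w /set_mem wd; rewrite /Ph /phi f0E.
  rewrite e1 e2 (powRM _ (F0 z) (rpow_ge0 _ _ _)) rpowX mul0r.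
  have := hC f z (F z) mf zd' (F0 z) (hF z zd'); set I := (\int[_]_(w in disc) _)%E => h.
  have Wz : W z = rpow (- q * p) 0 z * (C * (1 - rho z) `^ (- tau * (p - 1))).
    by rewrite /W /rpow powRr0; ring.
  rewrite Wz mulrC [leLHS]EFinM [(rpow _ _ _ * _)%:E]EFinM -muleA.
  by apply: lee_wpmul2l; [rewrite lee_fin; exact: rpow_ge0|exact: h].
rewrite (mu_tonelli a1 b1 al1 be1 mG G0).
have mPE : measurable_fun disc (fun w => (normc (f w) `^ p * rpow (b - beta) (a - alpha) w)%:E).
  apply/measurable_EFinP; apply: measurable_funM; last exact: measurable_rpow.
  by apply: (measurableT_comp (@measurable_powR R _)); exact: measurable_cnorm.
have PE0 w : disc w -> (0 <= (normc (f w) `^ p * rpow (b - beta) (a - alpha) w)%:E)%E.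
  by rewrite lee_fin mulr_ge0 ?powR_ge0 ?rpow_ge0.
have CC0 : 0 <= C * C2 by rewrite mulr_ge0 // ltW.
apply: (@le_trans _ _ ((C * C2)%:E * \int[mu alpha beta]_(w in disc)
   (normc (f w) `^ p * rpow (b - beta) (a - alpha) w)%:E)%E); last first.
  rewrite [X in (_ * X <= _)%E](hk f mf).
  by rewrite [X in (_ <= X * _)%E](EFinM (C * C2) k) [leLHS]muleA.
rewrite -(ge0_integralZl_EFin (mu alpha beta) measurable_disc PE0 mPE CC0).
apply: ge0_le_integral.
- exact: measurable_disc.
- by move=> w _; apply: integral_ge0 => z _; exact: G0.
- pose m1 : {sigma_finite_measure set R[i] -> \bar R} :=
    HB.pack (mu a b) (Measure_isSigmaFinite.Build _ _ _ (mu a b) (mu_sigma_finite a1 b1)).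
  apply: measurable_funTS.
  rewrite (_ : (fun w => _) = (fun w => \int[mu a b]_z G (z, w))%E).
    exact: (@measurable_fun_fubini_tonelli_G _ _ _ _ _ m1 G mG G0).
  apply/funext => w; apply: disc_setT => [|z]; last exact: G0.
  exact: (measurableT_comp mG (pair2_measurable w)).
- by apply: emeasurable_funM => //; exact: measurable_cst.
move=> w wd.
have mKw : measurable_fun disc (fun z => (normc (1 - z * w^*) `^ (- (alpha + 2)) * rpow (- q * p) (- tau * (p - 1)) z)%:E).
  apply/measurable_EFinP; apply: measurable_funM; last exact: measurable_rpow.
  exact: measurable_funTS (measurable_onem_powR w _).
have Kw0 z : disc z -> (0 <= (normc (1 - z * w^*) `^ (- (alpha + 2)) * rpow (- q * p) (- tau * (p - 1)) z)%:E)%E.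
  by rewrite lee_fin mulr_ge0 ?powR_ge0 ?rpow_ge0.
have CP0 : 0 <= C * Ph w by rewrite mulr_ge0 // ltW.
have -> : (\int[mu a b]_(z in disc) G (z, w) = (C * Ph w)%:E *
   \int[mu a b]_(z in disc) (normc (1 - z * w^*) `^ (- (alpha + 2)) * rpow (- q * p) (- tau * (p - 1)) z)%:E)%E.
  rewrite -(ge0_integralZl_EFin (mu a b) measurable_disc Kw0 mKw CP0).
  by apply: eq_integral => z _; rewrite /G /W /= -EFinM; congr EFin; ring.
apply: le_trans (lee_wpmul2l _ (hC2 w wd)) _; first by rewrite lee_fin.
rewrite -!EFinM lee_fin /Ph /phi f0E // le_eqVlt; apply/orP; left; apply/eqP.
have w1 := rho_disc wd.
have -> : (1 - rho w) `^ (a + - tau * (p - 1) + 2 - (alpha + 2)) =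
   (1 - rho w) `^ (a - alpha) / (1 - rho w) `^ (tau * (p - 1)).
  rewrite -powRB; last by apply/implyP => _; rewrite gt_eqF.
  by congr (_ `^ _); ring.
have : 0 < (1 - rho w) `^ (tau * (p - 1)) by rewrite powR_gt0.
rewrite /rpow; move: ((1 - rho w) `^ (tau * (p - 1))) => u u0; field.
by rewrite gt_eqF.
Qed.

End schur.

(** * The projection as a power series *)

Section projection_series.
Context {R : realType}.
Implicit Types (z w xi : R[i]) (f g : R[i] -> R[i]) (c : nat -> R[i]).

Lemma measurable_pser c : cps c -> measurable_fun disc (pser c).
Proof.
move=> hc; apply: (@measurable_cto _ _ _ _ (fun n z => \sum_(k < n) c k * z ^+ k)).
  move=> n; apply: measurable_funTS; apply: (@measurable_csum _ _ _ _ (fun k z => c k * z ^+ k)) => k.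
  apply: measurable_cM; first exact: measurable_cst.
  by apply: measurable_cX; exact: measurable_id.
by move=> z zd; exact: pser_cvg.
Qed.

Lemma cdiff_near f g z D d : 0 < d -> (forall h, normc h < d -> f (z + h) = g (z + h)) ->
  cdiff f z D -> cdiff g z D.
Proof.
move=> d0 fg fD e /fD[r r0 hr]; exists (Num.min r d); first by rewrite lt_min r0.
move=> h; rewrite lt_min => /andP[/hr h1 /fg h2]; rewrite -h2.
suff <- : f z = g z by [].
by have := fg 0; rewrite normc0 addr0; apply.
Qed.

Lemma disc_near z : disc z -> exists2 d : R, 0 < d & forall h, normc h < d -> disc (z + h).
Proof.
move=> zd; exists (1 - normc z); first by rewrite subr_gt0.
by move=> h hd; rewrite /disc /=; apply: le_lt_trans (le_normcD _ _) _; rewrite -ltrBrDl.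
Qed.

Lemma derivable_eq_disc f g z : {in disc, f =1 g} -> disc z ->
  derivable (f : R[i]^o -> R[i]^o) z 1 -> derivable (g : R[i]^o -> R[i]^o) z 1.
Proof.
move=> fg zd /derivable_cdiff[D fD]; have [d d0 hd] := disc_near zd.
apply: (@cdiff_derivable _ _ _ D); apply: (cdiff_near d0 _ fD) => h /hd hz.
by apply: fg; rewrite inE.
Qed.

Lemma holomorphic_pser c : cps c -> holomorphic disc (pser c).
Proof. by move=> hc z zd; apply: cdiff_derivable; exact: pser_cdiff. Qed.

Lemma derivable_monomial k z : derivable ((fun w => w ^+ k) : R[i]^o -> R[i]^o) z 1.
Proof.
elim: k => [|k IH]; first by under eq_fun do rewrite expr0; exact: derivable_cst.
under eq_fun do rewrite exprS.
have di : derivable ((fun z => z) : R[i]^o -> R[i]^o) z 1 by exact: derivable_id.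
exact: (@derivableM R[i] R[i]^o _ _ z 1 di IH).
Qed.

Lemma derivable_laurent c a m z : cps c -> pdisc z ->
  derivable ((fun z => a / z ^+ m * pser c z) : R[i]^o -> R[i]^o) z 1.
Proof.
move=> hc zd; have [zd' z0] := zd.
have z0' : z != 0 by apply/eqP.
have d1 := @derivable_monomial m z.
have d2 := @derivableV R[i] R[i]^o _ z 1 (expf_neq0 m z0') d1.
have da : derivable ((fun=> a) : R[i]^o -> R[i]^o) z 1 by exact: derivable_cst.
have d3 := @derivableM R[i] R[i]^o _ _ z 1 da d2.
exact: (@derivableM R[i] R[i]^o _ _ z 1 d3 (holomorphic_pser hc zd')).
Qed.

Context (alpha beta0 : R) (m : nat).
Hypotheses (al1 : -1 < alpha) (be01 : -1 < beta0 <= 0).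

Let beta := beta0 + m%:R.
Let x0 : 0 < alpha + 1. Proof. by move: al1; lra. Qed.
Let y01 : 0 < beta0 + 1 <= 1. Proof. by case/andP: be01 => ? ?; apply/andP; split; lra. Qed.
Let be1 : -1 < beta.
Proof. by case/andP: be01 => h _; rewrite /beta; apply: lt_le_trans h _; rewrite lerDl. Qed.

(** Expanding the kernel [xi ^- m * D xi] in powers of [z] leaves these integrals. *)
Definition pcoef f k : R[i] := (dcoef (alpha + 1) (beta0 + 1) k)%:C *
  cintegral (mu alpha beta) disc (fun w => f w * (w^* ^+ k / w^* ^+ m)).

(** Integrability against the singular factor of the kernel. *)
Definition wint f := (mu alpha beta).-integrable disc (EFin \o (fun w => normc (f w) * normc w ^- m)).

(** The series of the kernel is integrated term by term: for fixed [z] the series of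
    [D] converges uniformly in [w]. *)
Lemma proj_series f : measurable_fun disc f -> wint f ->
  [/\ cps (pcoef f),
      forall z, disc z -> cintegrable (mu alpha beta) disc (kernel_integrand alpha beta f z),
      forall z, disc z ->
        bergman_proj alpha beta f z = (kconst alpha beta0 m)%:C / z ^+ m * pser (pcoef f) z &
      forall z, disc z -> cintegrable (mu alpha beta) disc
        (fun w => f w / w^* ^+ m * pser (fun k => (dcoef (alpha + 1) (beta0 + 1) k)%:C) (z * w^*)) /\
        pser (pcoef f) z = cintegral (mu alpha beta) disc
        (fun w => f w / w^* ^+ m * pser (fun k => (dcoef (alpha + 1) (beta0 + 1) k)%:C) (z * w^*))].
Proof.
move=> mf wf; have /andP[y0 y1] := y01.
pose d k := (dcoef (alpha + 1) (beta0 + 1) k)%:C : R[i].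
have hd : cps d by exact: cps_dcoef.
pose M := \int[mu alpha beta]_(w in disc) (normc (f w) * normc w ^- m).
have mfk k : measurable_fun disc (fun w => f w * (w^* ^+ k / w^* ^+ m)).
  apply: measurable_cM => //; apply: measurable_funTS; apply: measurable_cM.
    by apply: measurable_cX; apply: measurable_cconj; exact: measurable_id.
  by apply: measurable_cV; apply: measurable_cX; apply: measurable_cconj; exact: measurable_id.
have nfk k w : disc w -> normc (f w * (w^* ^+ k / w^* ^+ m)) <= normc (f w) * normc w ^- m.
  move=> wd; rewrite normcM; apply: ler_wpM2l; first exact: normc_ge0.
  rewrite normcM normcV !normcX normc_conj ler_piMl ?invr_ge0 ?exprn_ge0 ?normc_ge0 //.
  by rewrite exprn_ile1 ?normc_ge0 // ltW.
have ifk k : cintegrable (mu alpha beta) disc (fun w => f w * (w^* ^+ k / w^* ^+ m)).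
  by apply: (cintegrable_le measurable_disc (mfk k) wf) => w wd; exact: nfk.
have hc : cps (pcoef f).
  move=> r r01; have [B hB] := hd r r01; exists (B * M) => k.
  rewrite normcM mulrAC; apply: ler_pM.
  - by rewrite mulr_ge0 ?normc_ge0 ?exprn_ge0 //; case/andP: r01.
  - exact: normc_ge0.
  - exact: hB.
  apply: le_trans (le_normc_cintegral measurable_disc (ifk k)) _.
  apply: le_Rintegral; first exact: measurable_disc.
  - by have [] := (@cintegrableP _ _ _ (mu alpha beta) disc measurable_disc _).1 (ifk k).
  - exact: wf.
  by move=> w wd; exact: nfk.
have key z : disc z -> cintegrable (mu alpha beta) disc (fun w => f w / w^* ^+ m * pser d (z * w^*)) /\
    pser (pcoef f) z = cintegral (mu alpha beta) disc (fun w => f w / w^* ^+ m * pser d (z * w^*)).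
  move=> zd; have [|B hB] := @cps_wsum _ d (normc z) hd; first by rewrite normc_ge0.
  have B0 : 0 <= B by have := hB 0%N; rewrite big_ord0.
  pose F k w := d k * z ^+ k * (f w * (w^* ^+ k / w^* ^+ m)).
  have FE w : disc w -> f w / w^* ^+ m * pser d (z * w^*) = csum (F ^~ w).
    move=> wd; have [B' hB'] := pser_asum hd (mulr_conj_disc zd wd).
    rewrite -(csumZ _ hB'); apply: eq_csum => k; rewrite /F exprMn; ring.
  have aF w : disc w -> asum_le (F ^~ w) (B * (normc (f w) * normc w ^- m)).
    move=> wd; apply: (@asum_le_dom _ _ (fun k => normc (d k * z ^+ k) * (normc (f w) * normc w ^- m))).
      by move=> k; rewrite /F normcM; apply: ler_wpM2l; [exact: normc_ge0|exact: nfk].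
    move=> n; rewrite -mulr_suml; apply: ler_wpM2r.
      by rewrite mulr_ge0 ?invr_ge0 ?exprn_ge0 ?normc_ge0.
    exact: (asum_wle (lexx _) hB).
  have mF k : measurable_fun disc (F k).
    by apply: measurable_cM => //; exact: measurable_cst.
  have iB : (mu alpha beta).-integrable disc (EFin \o (fun w => B * (normc (f w) * normc w ^- m))).
    apply: (eq_integrable measurable_disc (fun w => B%:E * (EFin \o (fun w => normc (f w) * normc w ^- m)%R) w)%E).
      by move=> w _; rewrite /= EFinM.
    by apply: integrableZl => //; exact: measurable_disc.
  have [i1 _ _ e1] := cintegral_csum measurable_disc mF iB aF.
  split.
    by apply: (eq_cintegrable measurable_disc _ i1) => w /set_mem wd; rewrite FE.
  rewrite (eq_cintegral _ (g := fun w => csum (F ^~ w))); last by move=> w /set_mem wd; rewrite FE.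
  rewrite e1; apply: eq_csum => k.
  by rewrite (cintegralZ measurable_disc _ (ifk k)) /pcoef -/(d k); ring.
have kE z w : disc z -> disc w -> kernel_integrand alpha beta f z w =
    (kconst alpha beta0 m)%:C / z ^+ m * (f w / w^* ^+ m * pser d (z * w^*)).
  by move=> zd wd; rewrite (kernelE _ _ al1 be01 zd wd) /kfun -/d exprMn invfM; ring.
split => //.
- move=> z zd; have [i1 _] := key z zd.
  apply: (eq_cintegrable measurable_disc _ (cintegrableZ measurable_disc ((kconst alpha beta0 m)%:C / z ^+ m) i1)).
  by move=> w /set_mem wd; rewrite kE.
- move=> z zd; have [i1 ->] := key z zd.
  rewrite -(cintegralZ measurable_disc _ i1); apply: eq_cintegral => w /set_mem wd.
  by rewrite kE.
Qed.

End projection_series.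

(** * Boundedness of the projection *)

Section bounded.
Context {R : realType}.
Implicit Types (z w xi : R[i]) (f g : R[i] -> R[i]) (c : nat -> R[i]).

(** The constraints of Schur's test on the exponents of its weight leave a nonempty range
    for each of them. *)
Lemma schur_exponents (a b alpha beta p q : R) : -1 < a -> -1 < alpha -> -1 < beta -> 1 <= p ->
  a + 1 < p * (alpha + 1) -> -1 < b - q * p ->
  (if p == 1 then b <= beta - q else b + 1 < p * (beta + 1 - q)) ->
  exists sigma tau, [/\ 0 < tau, tau < alpha + 1, -1 < beta - (sigma + q),
     b - beta <= sigma * (p - 1) - q &
     -1 < a - tau * (p - 1) /\ a - alpha < tau * (p - 1)].
Proof.
move=> a1 al1 be1 p1 h1 h2; case: eqP => [pE h3|/eqP pn h3].
  exists (beta - q), ((alpha + 1) / 2); rewrite pE subrr !mulr0 !subr0 subrK subrr.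
  move: h1 h2; rewrite pE mul1r mulr1 => h1 h2.
  split; [by rewrite divr_gt0 //; lra|lra|exact: ltrN10|lra|split; lra].
have {}p1 : 0 < p - 1 by rewrite subr_gt0 lt_neqAle eq_sym pn.
pose L := Num.max 0 ((a - alpha) / (p - 1)); pose U := Num.min (alpha + 1) ((a + 1) / (p - 1)).
have LU : L < U.
  rewrite lt_min !gt_max; apply/andP; split; apply/andP; split.
  - lra.
  - by rewrite ltr_pdivrMr //; lra.
  - by rewrite divr_gt0 //; lra.
  - by rewrite ltr_pM2r ?invr_gt0 //; lra.
have L1 : 0 <= L by rewrite le_max lexx.
have L2 : (a - alpha) / (p - 1) <= L by rewrite le_max lexx orbT.
have U1 : U <= alpha + 1 by rewrite ge_min lexx.
have U2 : U <= (a + 1) / (p - 1) by rewrite ge_min lexx orbT.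
exists ((b - beta + q) / (p - 1)), ((L + U) / 2).
rewrite (divfK (lt0r_neq0 p1)); split.
- lra.
- lra.
- have : (b - beta + q) / (p - 1) < beta + 1 - q by rewrite ltr_pdivrMr //; nra.
  by lra.
- lra.
have h4 : (L + U) / 2 < (a + 1) / (p - 1) by lra.
have h5 : (a - alpha) / (p - 1) < (L + U) / 2 by lra.
move: h4 h5; rewrite ltr_pdivlMr // ltr_pdivrMr //; lra.
Qed.

Context (a b alpha beta0 p : R) (m : nat).
Hypotheses (a1 : -1 < a) (b1 : -1 < b) (al1 : -1 < alpha) (be01 : -1 < beta0 <= 0) (p1 : 1 <= p).
Let beta := beta0 + m%:R.
Hypotheses (h1 : a + 1 < p * (alpha + 1)) (h2 : -1 < b - m%:R / 2 * p).
Hypothesis (h3 : if p == 1 then b <= beta - m%:R / 2 else b + 1 < p * (beta + 1 - m%:R / 2)).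

Let be1 : -1 < beta.
Proof. by case/andP: be01 => h _; rewrite /beta; apply: lt_le_trans h _; rewrite lerDl. Qed.
Let x0 : 0 < alpha + 1. Proof. by move: al1; lra. Qed.
Let y01 : 0 < beta0 + 1 <= 1. Proof. by case/andP: be01 => ? ?; apply/andP; split; lra. Qed.

Lemma rpow_normc w : rpow (- (m%:R / 2)) 0 w = normc w ^- m.
Proof. by rewrite /rpow powRr0 mulr1 -mulNr rho_powR powR_invn ?normc_ge0. Qed.

Definition Ip f : \bar R := (\int[mu a b]_(z in disc) (normc (f z) `^ p)%:E)%E.

Lemma Ip_ge0 f : (0 <= Ip f)%E.
Proof. by apply: integral_ge0 => z _; rewrite lee_fin powR_ge0. Qed.

Lemma norm_p_lty f : (norm_p a b p f < +oo)%E = (Ip f < +oo)%E.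
Proof.
have p0 : 0 < p by move: p1; lra.
apply/idP/idP => [|h]; last exact: poweR_lty.
by apply: lty_poweRy; rewrite invr_eq0 gt_eqF.
Qed.

Lemma Lp_wint f : Lp a b p f -> wint alpha beta0 m f.
Proof.
move=> [mf]; rewrite norm_p_lty => nf.
have [sigma [tau [e1 e2 e3 e4 [e5 e6]]]] := schur_exponents a1 al1 be1 p1 h1 h2 h3.
have h := schur_integrable a1 b1 al1 be1 p1 e1 e2 e3 e4 e6 mf nf.
have mfn : measurable_fun disc (fun w => normc (f w) * rpow (- (m%:R / 2)) 0 w).
  by apply: measurable_funM; [exact: measurable_cnorm|exact: measurable_rpow].
apply: (eq_integrable measurable_disc (EFin \o (fun w => normc (f w) * rpow (- (m%:R / 2)) 0 w))).
  by move=> w _; rewrite /= rpow_normc.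
apply/integrableP; split; first exact/measurable_EFinP.
apply: le_lt_trans h; rewrite le_eqVlt; apply/orP; left; apply/eqP.
apply: eq_integral => w _; rewrite /= ger0_norm // mulr_ge0 ?normc_ge0 ?rpow_ge0 //.
Qed.

Lemma measurable_proj f : Lp a b p f -> measurable_fun disc (bergman_proj alpha beta f).
Proof.
move=> Lf; have [hc _ e _] := proj_series al1 be01 Lf.1 (Lp_wint Lf).
apply: (eq_measurable_fun (fun z => (kconst alpha beta0 m)%:C / z ^+ m * pser (pcoef alpha beta0 m f) z)).
  by move=> z /set_mem zd; rewrite e.
apply: measurable_cM; last exact: measurable_pser.
apply: measurable_cM; first exact: measurable_cst.
by apply: measurable_cV; apply: measurable_cX; exact: measurable_id.
Qed.

Lemma proj_bounded : exists C : R, 0 <= C /\ forall f, Lp a b p f ->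
  (norm_p a b p (bergman_proj alpha beta f) <= C%:E * norm_p a b p f)%E.
Proof.
have p0 : 0 < p by move: p1; lra.
have [sigma [tau [e1 e2 e3 e4 [e5 e6]]]] := schur_exponents a1 al1 be1 p1 h1 h2 h3.
have [C C0 hC] := schur_bound a1 b1 al1 be1 p1 e1 e2 e3 e4 e5 e6 h2.
have [B B0 hB] := Qb_bounded x0 y01.
have k0 := @kconst_gt0 R alpha beta0 m al1 (andP be01).1.
pose k := kconst alpha beta0 m * B.
have kp : 0 < k by exact: mulr_gt0.
pose D := k `^ p * C; have D0 : 0 <= D by rewrite mulr_ge0 ?powR_ge0 // ltW.
exists (D `^ p^-1); split; first exact: powR_ge0.
move=> f Lf; have wf := Lp_wint Lf; have mf := Lf.1.
have [hc _ eP eh] := proj_series al1 be01 mf wf.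
pose h := pser (pcoef alpha beta0 m f).
have mh : measurable_fun disc h by exact: measurable_pser.
pose F z := normc (h z) / B.
have F0 z : 0 <= F z by rewrite divr_ge0 ?normc_ge0 // ltW.
have mF : measurable_fun disc F by apply: measurable_funM => //; exact: measurable_cnorm.
have hF z : disc z -> ((F z)%:E <= \int[mu alpha beta]_(w in disc)
    (normc (f w) * rpow (- (m%:R / 2)) 0 w * normc (1 - w * z^*) `^ (- (alpha + 2)))%:E)%E.
  move=> zd; have [i1 e] := eh z zd.
  have [mi ii] := (@cintegrableP _ _ _ (mu alpha beta) disc measurable_disc _).1 i1.
  pose J w := normc (f w / w^* ^+ m * pser (fun k => (dcoef (alpha + 1) (beta0 + 1) k)%:C) (z * w^*)).
  have mJ : measurable_fun disc (fun w => (J w)%:E) by apply/measurable_EFinP; exact: measurable_cnorm.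
  have J0 w : disc w -> (0 <= (J w)%:E)%E by move=> _; rewrite lee_fin normc_ge0.
  have hJ : ((normc (h z))%:E <= \int[mu alpha beta]_(w in disc) (J w)%:E)%E.
    rewrite /h e; apply: (@le_trans _ _ (\int[mu alpha beta]_(w in disc) J w)%:E).
      by rewrite lee_fin; exact: (le_normc_cintegral measurable_disc i1).
    rewrite /Rintegral fineK //; apply: integrable_fin_num; [exact: measurable_disc|exact: ii].
  have B1 : 0 <= B^-1 by rewrite invr_ge0 ltW.
  rewrite /F mulrC EFinM; apply: le_trans (lee_wpmul2l _ hJ) _; first by rewrite lee_fin.
  rewrite -(ge0_integralZl_EFin (mu alpha beta) measurable_disc J0 mJ B1).
  apply: ge0_le_integral.
  - exact: measurable_disc.
  - by move=> w wd; apply: mule_ge0; [rewrite lee_fin|exact: J0].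
  - by apply: emeasurable_funM => //; exact: measurable_cst.
  - apply/measurable_EFinP; apply: measurable_funM.
      by apply: measurable_funM; [exact: measurable_cnorm|exact: measurable_rpow].
    exact: measurable_funTS (measurable_onem_powR z _).
  move=> w wd; rewrite -EFinM lee_fin ler_pdivrMl //.
  have zw := mulr_conj_disc zd wd.
  rewrite /J (pser_dcoef x0 y01 zw) -cpowN ?onem_neq0 //.
  rewrite normcM [normc (f w / _)]normcM normcV normcX normc_conj rpow_normc.
  rewrite [normc (Qb _ _ _ * _)]normcM normc_cpow normc_onem_conj.
  rewrite (_ : - (alpha + 1 + 1) = - (alpha + 2)); last by ring.
  rewrite [leRHS]mulrCA; apply: ler_wpM2l.
    by rewrite mulr_ge0 ?normc_ge0 // invr_ge0 exprn_ge0 // normc_ge0.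
  by apply: ler_wpM2r; [exact: powR_ge0|exact: hB].
have := hC f F mf mF F0 hF.
move=> main.
have main2 : (Ip (bergman_proj alpha beta f) <= D%:E * Ip f)%E.
  apply: (@le_trans _ _ ((k `^ p)%:E * \int[mu a b]_(z in disc) ((F z * rpow (- (m%:R / 2)) 0 z) `^ p)%:E)%E).
    have mFr : measurable_fun disc (fun z => ((F z * rpow (- (m%:R / 2)) 0 z) `^ p)%:E).
      apply/measurable_EFinP; apply: (measurableT_comp (@measurable_powR R _)).
      by apply: measurable_funM => //; exact: measurable_rpow.
    have Fr0 z : disc z -> (0 <= ((F z * rpow (- (m%:R / 2)) 0 z) `^ p)%:E)%E.
      by rewrite lee_fin powR_ge0.
    rewrite -(ge0_integralZl_EFin (mu a b) measurable_disc Fr0 mFr (powR_ge0 k p)).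
    rewrite le_eqVlt; apply/orP; left; apply/eqP; apply: eq_integral => z /set_mem zd.
    have Frz : 0 <= F z * rpow (- (m%:R / 2)) 0 z by rewrite mulr_ge0 ?rpow_ge0.
    rewrite -EFinM -(powRM _ (ltW kp) Frz); congr (EFin (_ `^ _)).
    rewrite (eP z zd) rpow_normc normcM [normc (_ / z ^+ m)]normcM normcV normcX (normc_nng (ltW k0)).
    rewrite /F /k /h; move: (kconst _ _ _) ((normc z ^+ m)^-1) => K Z.
    by field; rewrite gt_eqF.
  apply: le_trans (lee_wpmul2l _ main) _; first by rewrite lee_fin powR_ge0.
  by rewrite /D EFinM -muleA.
have ip0 : 0 <= p^-1 by rewrite invr_ge0 ltW.
have DI0 : (0 <= D%:E * Ip f)%E by apply: mule_ge0; [rewrite lee_fin|exact: Ip_ge0].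
have := gt0_ler_poweR ip0 _ _ main2.
rewrite poweRM ?lee_fin ?Ip_ge0 // poweR_EFin; apply.
  by rewrite in_itv /= Ip_ge0 leey.
by rewrite in_itv /= DI0 leey.
Qed.

Lemma proj_linear (c : R[i]) f g : Lp a b p f -> Lp a b p g ->
  {in pdisc, forall z, bergman_proj alpha beta (fun w => c * f w + g w) z =
    c * bergman_proj alpha beta f z + bergman_proj alpha beta g z}.
Proof.
move=> Lf Lg z /set_mem /pdisc_disc zd.
have [_ /(_ z zd) i1 _ _] := proj_series al1 be01 Lf.1 (Lp_wint Lf).
have [_ /(_ z zd) i2 _ _] := proj_series al1 be01 Lg.1 (Lp_wint Lg).
rewrite /bergman_proj -(cintegralZ measurable_disc _ i1).
rewrite -(cintegralD measurable_disc (cintegrableZ measurable_disc c i1) i2).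
by apply: eq_cintegral => w _; rewrite /kernel_integrand /=; ring.
Qed.

(** By [proj_series] the projection is [z ^- m] times a power series. *)
Lemma proj_Ap_pole f : Lp a b p f -> Ap_pole a b p m (bergman_proj alpha beta f).
Proof.
move=> Lf; have [C [C0 hC]] := proj_bounded.
have [hc _ eP _] := proj_series al1 be01 Lf.1 (Lp_wint Lf).
split.
  split.
    move=> z zd; have d1 := derivable_laurent (a := (kconst alpha beta0 m)%:C) (m := m) hc zd.
    apply: (derivable_eq_disc _ (pdisc_disc zd) d1) => w /set_mem wd.
    by rewrite eP.
  apply: le_lt_trans (hC f Lf) _; apply: lte_mul_pinfty; rewrite ?lee_fin //.
  exact: Lf.2.
pose K := (kconst alpha beta0 m)%:C : R[i].
exists (fun z => K * pser (pcoef alpha beta0 m f) z).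
  move=> z zd; have dK : derivable ((fun=> K) : R[i]^o -> R[i]^o) z 1 by exact: derivable_cst.
  exact: (@derivableM R[i] R[i]^o _ _ z 1 dK (holomorphic_pser hc zd)).
move=> z /set_mem [zd /eqP z0]; rewrite eP // -/K.
have zm := expf_neq0 m z0; by field.
Qed.

End bounded.

(** * Goursat's theorem on rectangles *)

Section primitives.
Context {R : realType}.
Implicit Types (g : R -> R) (f G : R -> R[i]) (a b t : R).
Local Notation leb := (@lebesgue_measure R).

(** Integration over a closed interval, away from its end points. *)
Lemma primitive g a b : continuous g -> exists G : R -> R, forall t, a < t -> t < b -> is_derive t 1 G (g t).
Proof.
move=> gc; exists (fun x => \int[leb]_(s in [set` `[a, x]]) g s) => t at1 tb.
have ig : leb.-integrable `[a, b] (EFin \o g).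
  apply: continuous_compact_integrable; first exact: segment_compact.
  exact: continuous_subspaceT.
have [d1 d2] := continuous_FTC1_closed tb ig at1 (gc t).
by split; [exact: d1|rewrite -derive1E; exact: d2].
Qed.

Definition ccont f t := forall e : R, 0 < e -> exists2 d : R, 0 < d &
  forall h, `|h| < d -> normc (f (t + h) - f t) <= e.

Lemma eps_continuous g t : (forall e : R, 0 < e -> exists2 d : R, 0 < d &
  forall h, `|h| < d -> `|g (t + h) - g t| <= e) -> {for t, continuous g}.
Proof.
move=> h; apply/cvgrPdist_le => e /h[d d0 hd]; exists d => // s /= sd.
by rewrite distrC -[s in g s](subrKC t); apply: hd; rewrite distrC.
Qed.

Lemma ccont_ReIm f t : ccont f t -> {for t, continuous (fun s => complex.Re (f s))} /\
  {for t, continuous (fun s => complex.Im (f s))}.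
Proof.
move=> fc; split; apply: eps_continuous => e /fc[d d0 hd]; exists d => // h /hd;
  apply: le_trans.
  by rewrite -ReN -ReD; exact: le_normc_Re.
by rewrite -ImN -ImD; exact: le_normc_Im.
Qed.

Lemma cprimitive f a b : (forall t, ccont f t) ->
  exists G, forall t, a < t -> t < b -> cderiv G t (f t).
Proof.
move=> fc.
have [G1 h1] := @primitive (fun s => complex.Re (f s)) a b (fun t => (ccont_ReIm (fc t)).1).
have [G2 h2] := @primitive (fun s => complex.Im (f s)) a b (fun t => (ccont_ReIm (fc t)).2).
by exists (fun t => G1 t +i* G2 t) => t ta tb; split; [exact: h1|exact: h2].
Qed.

Lemma is_derive_cts (g : R -> R) t D : is_derive t 1 g D -> {for t, continuous g}.
Proof. by move=> [d _]; apply: differentiable_continuous; apply/derivable1_diffP. Qed.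

(** Mean value inequality relative to an affine comparison function. *)
Lemma cmvt G f a b (p q : R[i]) (M : R) : a <= b ->
  (forall t, a <= t <= b -> cderiv G t (f t)) ->
  (forall t, a <= t <= b -> normc (f t - (p + t%:C * q)) <= M) ->
  normc (G b - G a - ((b - a)%:C * p + ((b ^+ 2 - a ^+ 2) / 2)%:C * q)) <= 2 * M * (b - a).
Proof.
move=> ab Gf fM.
have key (g df : R -> R) (u v : R) : (forall t, a <= t <= b -> is_derive t 1 g (df t)) ->
    (forall t, a <= t <= b -> `|df t - (u + t * v)| <= M) ->
    `|g b - g a - ((b - a) * u + (b ^+ 2 - a ^+ 2) / 2 * v)| <= M * (b - a).
  move=> gd hM.
  pose k (t : R) := g t - (t * u + (t * t) / 2 * v).
  have kd t : a <= t <= b -> is_derive t 1 k (df t - (u + t * v)).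
    move=> tab; have d1 := gd t tab.
    have d2 := dM (dM (dM (did t) (did t)) (dcst (2^-1) t)) (dcst v t).
    by apply: (is_derive_eq (dB d1 (dD (dM (did t) (dcst u t)) d2))); field.
  have [||c cab] := @MVT_segment R k (fun t => df t - (u + t * v)) a b ab.
  - by move=> t; rewrite in_itv /= => /andP[t0 t1]; apply: kd; rewrite !ltW.
  - apply: derivable_within_continuous => t; rewrite in_itv /= => tab.
    by have [] := kd t tab.
  move=> e; have -> : g b - g a - ((b - a) * u + (b ^+ 2 - a ^+ 2) / 2 * v) = k b - k a.
    by rewrite /k; field.
  rewrite e normrM [`|b - a|]ger0_norm ?subr_ge0 // ler_wpM2r ?subr_ge0 //.
  by apply: hM; move: cab; rewrite in_itv.
apply: le_trans (normc_le_ReIm _) _; rewrite -mulrA mulr_natl mulr2n; apply: lerD.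
  rewrite !(ReD, ReN, ReM) /= !mul0r !subr0.
  apply: (key (fun t => complex.Re (G t)) (fun t => complex.Re (f t))) => t tab; first by have [] := Gf t tab.
  have := fM t tab; apply: le_trans.
  have := le_normc_Re (f t - (p + t%:C * q)).
  by rewrite !(ReD, ReN, ReM) /= !mul0r !subr0.
rewrite !(ImD, ImN, ImM) /= !mul0r !addr0.
apply: (key (fun t => complex.Im (G t)) (fun t => complex.Im (f t))) => t tab; first by have [] := Gf t tab.
have := fM t tab; apply: le_trans.
have := le_normc_Im (f t - (p + t%:C * q)).
by rewrite !(ImD, ImN, ImM) /= !mul0r !addr0.
Qed.

End primitives.

Section cousin.
Context {R : realType}.

Lemma nested_point (u e : nat -> R) : (forall n, u n <= u n.+1) ->
  (forall n, u n.+1 + e n.+1 <= u n + e n) -> (forall n, 0 <= e n) ->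
  exists p, forall n, u n <= p <= u n + e n.
Proof.
move=> u1 u2 e0.
have um n m : (n <= m)%N -> u n <= u m.
  by move=> /subnK <-; elim: (m - n)%N => [//|k IH]; apply: le_trans IH _; rewrite addSn.
have em n m : (n <= m)%N -> u m + e m <= u n + e n.
  by move=> /subnK <-; elim: (m - n)%N => [//|k IH]; apply: le_trans _ IH; rewrite addSn.
have ub n m : u m <= u n + e n.
  have [nm|mn] := leqP n m.
    by apply: le_trans (em n m nm); rewrite lerDl.
  by apply: le_trans (um m n (ltnW mn)) _; rewrite lerDl.
exists (sup (range u)) => n; apply/andP; split.
  by apply: ub_le_sup; [exists (u 0%N + e 0%N) => _ [m _ <-]|exists n].
by apply: ge_sup; [exists (u 0%N); exists 0%N|move=> _ [m _ <-]].
Qed.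

Lemma half_pow (s : R) n : s / 2 ^+ n = s / 2 ^+ n.+1 + s / 2 ^+ n.+1.
Proof.
have h : (2 ^+ n : R) != 0 by rewrite expf_neq0.
by rewrite exprS; field.
Qed.

Section rectangles.
Context (x0 y0 s t : R) (P : nat -> R -> R -> Prop).
Let sn n : R := s / 2 ^+ n.
Let tn n : R := t / 2 ^+ n.

Definition subrect n x y := [/\ x0 <= x, x + sn n <= x0 + s, y0 <= y & y + tn n <= y0 + t].

(** A property of dyadic rectangles that passes from the four quarters to the whole
    and holds locally holds globally. *)
Lemma cousin2 : 0 <= s -> 0 <= t ->
  (forall n x y, subrect n x y -> P n.+1 x y -> P n.+1 (x + sn n.+1) y ->
     P n.+1 x (y + tn n.+1) -> P n.+1 (x + sn n.+1) (y + tn n.+1) -> P n x y) ->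
  (forall px py, x0 <= px <= x0 + s -> y0 <= py <= y0 + t -> exists N, forall n x y,
     (N <= n)%N -> subrect n x y -> x <= px <= x + sn n -> y <= py <= y + tn n -> P n x y) ->
  P 0%N x0 y0.
Proof.
move=> s0 t0 hq hl; apply: contrapT => nP.
pose next n (xy : R * R) : R * R :=
  if ~~ `[< P n.+1 xy.1 xy.2 >] then xy
  else if ~~ `[< P n.+1 (xy.1 + sn n.+1) xy.2 >] then (xy.1 + sn n.+1, xy.2)
  else if ~~ `[< P n.+1 xy.1 (xy.2 + tn n.+1) >] then (xy.1, xy.2 + tn n.+1)
  else (xy.1 + sn n.+1, xy.2 + tn n.+1).
pose r := fix r n := if n is k.+1 then next k (r k) else (x0, y0).
have sE n : sn n = sn n.+1 + sn n.+1.
  exact: half_pow.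
have tE n : tn n = tn n.+1 + tn n.+1.
  exact: half_pow.
have sn0 n : 0 <= sn n by rewrite divr_ge0 ?exprn_ge0.
have tn0 n : 0 <= tn n by rewrite divr_ge0 ?exprn_ge0.
have inv n : subrect n (r n).1 (r n).2 /\ ~ P n (r n).1 (r n).2.
  elim: n => [|n [IH1 IH2]].
    by split => //; rewrite /subrect /sn /tn expr0 !divr1 /=; split.
  have [i1 i2 i3 i4] := IH1; rewrite (sE n) in i2; rewrite (tE n) in i4.
  have := sn0 n.+1; have := tn0 n.+1 => q1 q2.
  rewrite [r _]/= /next; case: asboolP => [p1|p1] /=; last first.
    by split => //; split => //; lra.
  case: asboolP => [p2|p2] /=; last by split => //; split => //; lra.
  case: asboolP => [p3|p3] /=; last by split => //; split => //; lra.
  split; first by split; lra.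
  by move=> p4; apply: IH2; apply: hq.
have mono n : [/\ (r n).1 <= (r n.+1).1, (r n.+1).1 + sn n.+1 <= (r n).1 + sn n,
    (r n).2 <= (r n.+1).2 & (r n.+1).2 + tn n.+1 <= (r n).2 + tn n].
  have := sn0 n.+1; have := tn0 n.+1; have := sE n; have := tE n => q1 q2 q3 q4.
  by rewrite [r n.+1]/= /next; do 3?[case: asboolP => _ /=]; split; lra.
have [px hx] := @nested_point (fun n => (r n).1) sn (fun n => let: And4 h _ _ _ := mono n in h)
  (fun n => let: And4 _ h _ _ := mono n in h) sn0.
have [py hy] := @nested_point (fun n => (r n).2) tn (fun n => let: And4 _ _ h _ := mono n in h)
  (fun n => let: And4 _ _ _ h := mono n in h) tn0.
have h0x := hx 0%N; have h0y := hy 0%N; rewrite /sn expr0 divr1 /= in h0x; rewrite /tn expr0 divr1 /= in h0y.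
have [N hN] := hl px py h0x h0y.
by have [i1 i2] := inv N; apply: i2; exact: hN.
Qed.

End rectangles.
End cousin.

Section goursat.
Context {R : realType}.
Implicit Types (x y : R).
Context (f H V : R -> R -> R[i]).

(** The integral of [f] around a rectangle, when [H] and [V] are horizontal and vertical
    primitives of [f]. Additivity in rectangles is then an identity. *)
Definition loop x1 x2 y1 y2 : R[i] := (H x2 y1 - H x1 y1) + 'i * (V x2 y2 - V x2 y1)
  - (H x2 y2 - H x1 y2) - 'i * (V x1 y2 - V x1 y1).

(** Near a point of differentiability the affine part of [f] contributes nothing to
    [loop], and the remainder contributes [e] times the square of the perimeter, a bound
    that adds up over the four quarters of a rectangle. *)
Lemma goursat x1 x2 y1 y2 : x1 <= x2 -> y1 <= y2 ->
  (forall x y, x1 <= x <= x2 -> y1 <= y <= y2 ->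
    [/\ cderiv (fun u => H u y) x (f x y), cderiv (fun u => V x u) y (f x y) &
      exists D, forall e : R, 0 < e -> exists2 d : R, 0 < d & forall u v, x1 <= u <= x2 -> y1 <= v <= y2 ->
        `|u - x| < d -> `|v - y| < d ->
        normc (f u v - f x y - D * ((u - x)%:C + 'i * (v - y)%:C)) <= e * (`|u - x| + `|v - y|)]) ->
  loop x1 x2 y1 y2 = 0.
Proof.
move=> x12 y12 hf.
pose s := x2 - x1; pose t := y2 - y1.
have s0 : 0 <= s by rewrite subr_ge0.
have t0 : 0 <= t by rewrite subr_ge0.
have xE : x1 + s = x2 by rewrite subrKC.
have yE : y1 + t = y2 by rewrite subrKC.
have i1 : normc ('i : R[i]) = 1 by rewrite /= expr0n /= add0r expr1n sqrtr1.
suff key (e : R) : 0 < e -> normc (loop x1 x2 y1 y2) <= 8 * e * (s + t) ^+ 2.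
  apply: eq0_normc; apply/eqP; rewrite eq_le normc_ge0 andbT; apply/ler_addgt0Pr => e e0.
  rewrite add0r; have k0 : 0 < 8 * ((s + t) ^+ 2 + 1) by rewrite mulr_gt0 // ltr_wpDl ?sqr_ge0.
  apply: le_trans (key _ (divr_gt0 e0 k0)) _.
  have -> : 8 * (e / (8 * ((s + t) ^+ 2 + 1))) * (s + t) ^+ 2 = e * ((s + t) ^+ 2 / ((s + t) ^+ 2 + 1)).
    by field; rewrite gt_eqF // ltr_wpDl ?sqr_ge0.
  by rewrite ler_piMr ?(ltW e0) // ler_pdivrMr ?ltr_wpDl ?sqr_ge0 // mul1r lerDl.
move=> e0.
pose sn n := s / 2 ^+ n; pose tn n := t / 2 ^+ n.
pose P n x y := normc (loop x (x + sn n) y (y + tn n)) <= 8 * e * (sn n + tn n) ^+ 2.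
suff : P 0%N x1 y1 by rewrite /P /sn /tn expr0 !divr1 xE yE.
apply: (@cousin2 R x1 y1 s t P s0 t0).
  move=> n x y _; rewrite /P.
  have sE : sn n = sn n.+1 + sn n.+1.
    exact: half_pow.
  have tE : tn n = tn n.+1 + tn n.+1.
    exact: half_pow.
  rewrite sE tE !addrA; set u := sn n.+1; set v := tn n.+1 => q1 q2 q3 q4.
  have -> : loop x (x + u + u) y (y + v + v) = (loop x (x + u) y (y + v) +
     loop (x + u) (x + u + u) y (y + v)) + (loop x (x + u) (y + v) (y + v + v) +
     loop (x + u) (x + u + u) (y + v) (y + v + v)) by rewrite /loop; ring.
  apply: le_trans (le_normcD _ _) _.
  apply: le_trans (lerD (le_trans (le_normcD _ _) (lerD q1 q2)) (le_trans (le_normcD _ _) (lerD q3 q4))) _.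
  by rewrite le_eqVlt; apply/orP; left; apply/eqP; ring.
rewrite xE yE => px py hpx hpy.
have [_ _ [D hD]] := hf px py hpx hpy; have [d d0 hd] := hD e e0.
have [N hN] : exists N, forall n, (N <= n)%N -> sn n < d /\ tn n < d.
  exists (Num.truncn ((s + t) / d)).+1 => n Nn.
  have h2 : (s + t) / d < 2 ^+ n.
    apply: (@lt_le_trans _ _ (Num.truncn ((s + t) / d)).+1%:R); first exact: truncnS_gt.
    apply: (@le_trans _ _ n%:R); first by rewrite ler_nat.
    by rewrite -natrX ler_nat ltnW // ltn_expl.
  have p0 : 0 < (2 ^+ n : R) by rewrite exprn_gt0.
  move: h2; rewrite ltr_pdivrMr // mulrC => h2.
  by rewrite /sn /tn !ltr_pdivrMr //; split; apply: le_lt_trans h2; rewrite ?lerDl ?lerDr.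
exists N => n x y /hN[sd td] [r1 r2 r3 r4] hx hy.
rewrite -/(sn n) -/(tn n) in r2 r4 hx hy *; rewrite xE in r2; rewrite yE in r4.
rewrite /P; set u := sn n in sd r2 hx *; set v := tn n in td r4 hy *.
have u0 : 0 <= u by rewrite divr_ge0 ?exprn_ge0.
have v0 : 0 <= v by rewrite divr_ge0 ?exprn_ge0.
have near x' y' : x <= x' <= x + u -> y <= y' <= y + v ->
    normc (f x' y' - (f px py + D * ((x' - px)%:C + 'i * (y' - py)%:C))) <= e * (u + v).
  move=> /andP[a1 a2] /andP[b1 b2]; case/andP: hx => c1 c2; case/andP: hy => d1 d2.
  have hux : `|x' - px| <= u by rewrite ler_norml; lra.
  have hvy : `|y' - py| <= v by rewrite ler_norml; lra.
  rewrite opprD addrA; apply: le_trans (hd x' y' _ _ _ _) _.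
  - by apply/andP; split; lra.
  - by apply/andP; split; lra.
  - exact: le_lt_trans hux sd.
  - exact: le_lt_trans hvy td.
  by rewrite ler_pM2l // lerD.
have inx x' : x <= x' <= x + u -> x1 <= x' <= x2 by move=> /andP[? ?]; apply/andP; split; lra.
have iny y' : y <= y' <= y + v -> y1 <= y' <= y2 by move=> /andP[? ?]; apply/andP; split; lra.
have xu : x <= x + u by rewrite lerDl.
have yv : y <= y + v by rewrite lerDl.
have hor y' : y <= y' <= y + v -> normc (H (x + u) y' - H x y' -
    ((x + u - x)%:C * (f px py - D * px%:C + D * ('i * (y' - py)%:C)) + (((x + u) ^+ 2 - x ^+ 2) / 2)%:C * D))
    <= 2 * (e * (u + v)) * (x + u - x).
  move=> hy'; apply: (@cmvt R (fun z => H z y') (fun z => f z y')) => // x' hx'.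
    by have [] := hf x' y' (inx _ hx') (iny _ hy').
  have := near x' y' hx' hy'; congr (normc (_ - _) <= _); rewrite rmorphB /=; ring.
have ver x' : x <= x' <= x + u -> normc (V x' (y + v) - V x' y -
    ((y + v - y)%:C * (f px py + D * (x' - px)%:C - D * 'i * py%:C) + (((y + v) ^+ 2 - y ^+ 2) / 2)%:C * (D * 'i)))
    <= 2 * (e * (u + v)) * (y + v - y).
  move=> hx'; apply: (@cmvt R (fun z => V x' z) (fun z => f x' z)) => // y' hy'.
    by have [] := hf x' y' (inx _ hx') (iny _ hy').
  have := near x' y' hx' hy'; congr (normc (_ - _) <= _); rewrite [(y' - py)%:C]rmorphB /=; ring.
have yy : y <= y <= y + v by rewrite lexx.
have yy' : y <= y + v <= y + v by rewrite lexx andbT.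
have xx : x <= x <= x + u by rewrite lexx.
have xx' : x <= x + u <= x + u by rewrite lexx andbT.
have e1 := hor _ yy; have e2 := hor _ yy'; have e3 := ver _ xx; have e4 := ver _ xx'.
have -> : 8 * e * (u + v) ^+ 2 = (2 * (e * (u + v)) * (x + u - x) + 2 * (e * (u + v)) * (y + v - y) +
   2 * (e * (u + v)) * (x + u - x) + 2 * (e * (u + v)) * (y + v - y)) + 4 * e * (u + v) ^+ 2 by ring.
rewrite ler_wpDr; [by []|by rewrite mulr_ge0 ?sqr_ge0 // mulr_ge0 // ltW|].
have n4 (A B C E : R[i]) : normc (A + 'i * E - B - 'i * C) <= normc A + normc E + normc B + normc C.
  do 3?[apply: le_trans (le_normcD _ _) _; rewrite ?normcN ?normcM ?i1 ?mul1r; apply: lerD => //].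
apply: le_trans _ (lerD (lerD (lerD e1 e4) e2) e3).
apply: le_trans _ (n4 _ _ _ _).
rewrite le_eqVlt; apply/orP; left; apply/eqP; congr normc; rewrite /loop !rmorphB !rmorphD /=; ring.
Qed.

End goursat.

(** * Means over circles *)

Section circle_mean.
Context {R : realType}.
Implicit Types (x y s t : R) (z w : R[i]) (u : R[i] -> R[i]) (g G : R -> R[i]).
Local Notation leb := (@lebesgue_measure R).

Lemma cderivB G1 G2 t D1 D2 : cderiv G1 t D1 -> cderiv G2 t D2 ->
  cderiv (fun s => G1 s - G2 s) t (D1 - D2) :> Prop.
Proof.
move=> [r1 i1] [r2 i2]; split.
  by under eq_fun do rewrite ReD ReN; rewrite ReD ReN; exact: (dB r1 r2).
by under eq_fun do rewrite ImD ImN; rewrite ImD ImN; exact: (dB i1 i2).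
Qed.

(** Increments over a horizontal side and over its translate by a period agree, although
    their primitives are chosen independently. *)
Lemma cprimitive_unique G1 G2 g (a b : R) : a <= b ->
  (forall t, a <= t <= b -> cderiv G1 t (g t)) -> (forall t, a <= t <= b -> cderiv G2 t (g t)) ->
  G1 b - G1 a = G2 b - G2 a.
Proof.
move=> ab h1 h2; have := @cmvt R (fun s => G1 s - G2 s) (fun=> 0) a b 0 0 0 ab.
rewrite !mulr0 addr0 subr0 mul0r => h.
have : normc (G1 b - G2 b - (G1 a - G2 a)) <= 0.
  apply: h => t tab; last by rewrite mulr0 addr0 subr0 normc0.
  by rewrite -[0](subrr (g t)); apply: cderivB; [exact: h1|exact: h2].
move=> h0; apply/eqP; rewrite -subr_eq0; apply/eqP; apply: eq0_normc.
apply/eqP; rewrite eq_le normc_ge0 andbT; move: h0; congr (normc _ <= _); ring.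
Qed.

Lemma cintegral_FTC G g (a b : R) : a < b -> (forall t, ccont g t) ->
  (forall t, a <= t <= b -> cderiv G t (g t)) ->
  cintegral leb `[a, b] g = G b - G a.
Proof.
move=> ab gc hG.
have key (k K : R -> R) : continuous k -> (forall t, a <= t <= b -> is_derive t 1 K (k t)) ->
    \int[leb]_(t in `[a, b]) k t = K b - K a.
  move=> kc hK; rewrite /Rintegral (@continuous_FTC2 R k K a b ab) //.
  - exact: continuous_subspaceT.
  - split.
    + by move=> t; rewrite in_itv /= => /andP[ta tb]; have [] := hK t (ltac:(by rewrite !ltW)).
    + by apply: cvg_at_right_filter; apply: is_derive_cts (hK a _); rewrite lexx ltW.
    + by apply: cvg_at_left_filter; apply: is_derive_cts (hK b _); rewrite lexx ltW.
  by move=> t; rewrite in_itv /= => /andP[ta tb]; rewrite derive1E; have [] := hK t (ltac:(by rewrite !ltW)).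
rewrite /cintegral; apply: complexP => /=.
  rewrite ReD ReN; apply: (key (fun t => complex.Re (g t)) (fun t => complex.Re (G t))).
    by move=> t; exact: (ccont_ReIm (gc t)).1.
  by move=> t /hG[].
rewrite ImD ImN; apply: (key (fun t => complex.Im (g t)) (fun t => complex.Im (G t))).
  by move=> t; exact: (ccont_ReIm (gc t)).2.
by move=> t /hG[].
Qed.

(** The exponential of [x + i y]. *)
Definition pexp x y : R[i] := (expR x)%:C * (cos y +i* sin y).

Lemma normc_pexp x y : normc (pexp x y) = expR x.
Proof. by rewrite /pexp normcM normc_cis mulr1 normc_nng // expR_ge0. Qed.

Lemma pexpD x y s t : pexp (x + s) (y + t) = pexp x y * pexp s t.
Proof. by rewrite /pexp expRD cisD real_complexM; ring. Qed.

Lemma pexp2pi x y : pexp x (y + 2 * pi) = pexp x y.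
Proof.
rewrite /pexp; congr (_ * (_ +i* _)).
  by rewrite mulr_natl cosD cos2pi sin2pi mulr1 mulr0 subr0.
by rewrite mulr_natl sinD cos2pi sin2pi mulr1 mulr0 addr0.
Qed.

Lemma pexp_diff0 (e : R) : 0 < e -> exists2 d : R, 0 < d & forall s t, `|s| < d -> `|t| < d ->
  normc (pexp s t - 1 - (s%:C + 'i * t%:C)) <= e * (`|s| + `|t|).
Proof.
move=> e0.
have [r r0 [r1 re]] : exists2 r : R, 0 < r & r <= 1 /\ r <= e / 20.
  exists (Num.min 1 (e / 20)); first by rewrite lt_min ltr01 divr_gt0.
  by rewrite !ge_min !lexx orbT.
have [d1 d10 h1] := is_derive_eps (is_derive_expR (0 : R)) r0.
have [d2 d20 h2] := is_derive_eps (is_derive_cos (0 : R)) r0.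
have [d3 d30 h3] := is_derive_eps (is_derive_sin (0 : R)) r0.
exists (Num.min r (Num.min d1 (Num.min d2 d3))); first by rewrite !lt_min r0 d10 d20 d30.
move=> s t; rewrite !lt_min => /andP[sr /andP[/h1 s1 _]] /andP[tr /andP[_ /andP[/h2 t2 /h3 t3]]].
rewrite add0r expR0 mul1r in s1; rewrite add0r cos0 sin0 oppr0 mul0r subr0 in t2.
rewrite add0r sin0 cos0 mul1r subr0 in t3.
pose E := expR s - 1 - s; pose C := cos t - 1; pose S := sin t - t.
have rew : pexp s t - 1 - (s%:C + 'i * t%:C) =
   (E + (1 + s + E) * C) +i* ((1 + s + E) * S + (s + E) * t).
  apply: complexP; rewrite /pexp /E /C /S !(ReD, ReN, ReM, ImD, ImN, ImM) /=; ring.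
rewrite rew; apply: le_trans (normc_le_ReIm _) _ => /=.
have sa : 0 <= `|s| by []. have ta : 0 <= `|t| by [].
have eE : `|E| <= r * `|s| by [].
have eC : `|C| <= r * `|t| by [].
have eS : `|S| <= r * `|t| by [].
have k3 : `|1 + s + E| <= 3.
  apply: le_trans (ler_normD _ _) _; apply: le_trans (lerD (ler_normD _ _) eE) _.
  rewrite normr1; have : r * `|s| <= 1 * 1 by apply: ler_pM => //; rewrite ?ltW // (lt_le_trans sr).
  have : `|s| <= 1 by rewrite ltW // (lt_le_trans sr).
  by lra.
have k2 : `|s + E| <= 2 * r.
  apply: le_trans (ler_normD _ _) _; apply: le_trans (lerD (ltW sr) eE) _.
  rewrite mulr_natl mulr2n lerD2l; rewrite -[leRHS]mulr1 ler_wpM2l ?(ltW r0) //.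
  by rewrite ltW // (lt_le_trans sr).
have b1 : `|E + (1 + s + E) * C| <= r * `|s| + 3 * (r * `|t|).
  apply: le_trans (ler_normD _ _) _; apply: lerD => //; rewrite normrM; apply: ler_pM => //.
have b2 : `|(1 + s + E) * S + (s + E) * t| <= 3 * (r * `|t|) + 2 * r * `|t|.
  apply: le_trans (ler_normD _ _) _; apply: lerD; rewrite normrM; apply: ler_pM => //.
apply: le_trans (lerD b1 b2) _.
apply: (@le_trans _ _ (8 * r * (`|s| + `|t|))).
  have rs0 : 0 <= r * `|s| by rewrite mulr_ge0 // ltW.
  by move: (`|s|) (`|t|) rs0 => S' T' rs0; lra.
by apply: ler_wpM2r; [rewrite addr_ge0|lra].
Qed.

Definition ccontinuous u z := forall e : R, 0 < e -> exists2 d : R, 0 < d &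
  forall h, normc h < d -> normc (u (z + h) - u z) <= e.

Lemma pexp_near x y (e : R) : 0 < e -> exists2 d : R, 0 < d & forall s t, `|s| < d -> `|t| < d ->
  normc (pexp (x + s) (y + t) - pexp x y - pexp x y * (s%:C + 'i * t%:C)) <= e * (`|s| + `|t|) /\
  normc (pexp (x + s) (y + t) - pexp x y) <= (e + expR x) * (`|s| + `|t|).
Proof.
move=> e0; have ex := expR_gt0 x.
have [d d0 hd] := pexp_diff0 (divr_gt0 e0 ex); exists d => // s t sd td.
have h1 : normc (pexp (x + s) (y + t) - pexp x y - pexp x y * (s%:C + 'i * t%:C)) <= e * (`|s| + `|t|).
  have -> : pexp (x + s) (y + t) - pexp x y - pexp x y * (s%:C + 'i * t%:C) =
    pexp x y * (pexp s t - 1 - (s%:C + 'i * t%:C)) by rewrite pexpD; ring.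
  rewrite normcM normc_pexp; apply: le_trans (ler_wpM2l (ltW ex) (hd s t sd td)) _.
  by rewrite mulrA mulrCA divff ?mulr1 // gt_eqF.
split => //; rewrite -[X in normc X](subrK (pexp x y * (s%:C + 'i * t%:C))).
apply: le_trans (le_normcD _ _) _; rewrite mulrDl; apply: lerD => //.
rewrite normcM normc_pexp; apply: ler_wpM2l; first exact: ltW.
apply: le_trans (le_normcD _ _) _; rewrite normcM normc_real.
have -> : normc ('i : R[i]) = 1 by rewrite /= expr0n /= add0r expr1n sqrtr1.
by rewrite mul1r normc_real.
Qed.

Lemma pexp_cont x y (e : R) : 0 < e -> exists2 d : R, 0 < d & forall s t, `|s| < d -> `|t| < d ->
  normc (pexp (x + s) (y + t) - pexp x y) < e.
Proof.
move=> e0; have [d d0 hd] := @pexp_near x y 1 ltr01; have ex := expR_gt0 x.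
pose k := 1 + expR x; have k0 : 0 < k by rewrite /k; lra.
exists (Num.min d (e / (2 * k))); first by rewrite lt_min d0 divr_gt0 // mulr_gt0.
move=> s t; rewrite !lt_min => /andP[sd s2] /andP[td t2].
have [_ h] := hd s t sd td; apply: le_lt_trans h _; rewrite -/k.
have -> : e = k * (e / (2 * k) + e / (2 * k)) by field; rewrite gt_eqF.
by rewrite ltr_pM2l // ltrD.
Qed.

Lemma polar_form z : z != 0 -> exists y, - pi <= y <= pi /\ z = pexp (ln (normc z)) y.
Proof.
move=> z0; have n0 : 0 < normc z by rewrite normc_gt0.
pose c := complex.Re z / normc z.
have c1 : -1 <= c <= 1.
  have := le_normc_Re z; rewrite ler_norml => /andP[h1 h2].
  by rewrite /c ler_pdivlMr // ler_pdivrMr // mulN1r mul1r h1 h2.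
have s2 : (complex.Im z / normc z) ^+ 2 = 1 - c ^+ 2.
  have := sqr_normc z => e; rewrite /c !expr_div_n -[1](divff (lt0r_neq0 (exprn_gt0 2 n0))).
  by rewrite -mulrBl e; congr (_ / _); ring.
have sE : Num.sqrt (1 - c ^+ 2) = `|complex.Im z / normc z| by rewrite -s2 sqrtr_sqr.
have a0 := acos_ge0 c1; have api := acos_lepi c1.
have p0 := @pi_ge0 R.
have [i0|i0] := leP 0 (complex.Im z).
  exists (acos c); split; first by apply/andP; split; [lra|].
  rewrite /pexp lnK ?posrE // acosK ?in_itv //= sin_acos // sE ger0_norm ?divr_ge0 ?normc_ge0 //.
  by apply: complexP; rewrite ?ReM ?ImM /= /c; field; rewrite gt_eqF.
exists (- acos c); split; first by apply/andP; split; lra.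
rewrite /pexp lnK ?posrE // cosN sinN acosK ?in_itv //= sin_acos // sE ler0_norm; last first.
  by rewrite ler_pdivrMr // mul0r ltW.
by apply: complexP; rewrite ?ReM ?ImM /= /c; field; rewrite gt_eqF.
Qed.

Lemma pexp_inj x y x' y' : pexp x y = pexp x' y' -> `|y - y'| <= pi -> x = x' /\ y = y'.
Proof.
move=> e hy; have := congr1 (@normc R) e; rewrite !normc_pexp => /expR_inj xx; split => //.
have ex := expR_gt0 x.
have e1 : (cos y +i* sin y) = (cos y' +i* sin y').
  apply: (mulfI (_ : (expR x)%:C != 0)); first by rewrite -normc_gt0 normc_nng // ltW.
  by move: e; rewrite /pexp -xx.
move: e1 => [c1 s1].
have : cos (y - y') = 1 by rewrite cosB c1 s1 -!expr2 cos2Dsin2.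
have -> : cos (y - y') = cos `|y - y'|.
  by have [h|h] := ger0P (y - y') => //; rewrite cosN.
rewrite -cos0 => /cos_inj; rewrite !in_itv /= normr_ge0 hy lexx pi_ge0 => /(_ isT isT).
by move=> /eqP; rewrite normr_eq0 subr_eq0 => /eqP.
Qed.

Section exceptional.
Context (H V : R -> R -> R[i]).
Local Notation lp := (loop H V).

(** An isolated exceptional point is surrounded by a small rectangle. *)
Lemma loop_exceptional (x1 x2 y1 y2 x0 y0 B r : R) : x1 <= x0 <= x2 -> y1 < y0 < y2 -> 0 <= B -> 0 < r ->
  (forall xa xb ya yb, x1 <= xa -> xa <= xb -> xb <= x2 -> y1 <= ya -> ya <= yb -> yb <= y2 ->
    ~ (xa <= x0 <= xb /\ ya <= y0 <= yb) -> lp xa xb ya yb = 0) ->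
  (forall y xa xb, `|y - y0| < r -> x1 <= xa -> xa <= xb -> xb <= x2 -> x0 - r < xa -> xb < x0 + r ->
    normc (H xb y - H xa y) <= 2 * B * (xb - xa)) ->
  (forall x ya yb, `|x - x0| < r -> x <= x2 -> ya <= yb -> y0 - r < ya -> yb < y0 + r -> y1 <= ya -> yb <= y2 ->
    normc (V x yb - V x ya) <= 2 * B * (yb - ya)) ->
  lp x1 x2 y1 y2 = 0.
Proof.
move=> /andP[x01 x02] /andP[y01 y02] B0 r0 nb hH hV.
have loopD xa xb xc ya yb : lp xa xc ya yb = lp xa xb ya yb + lp xb xc ya yb by rewrite /loop; ring.
have loopD2 xa xb ya yb yc : lp xa xb ya yc = lp xa xb ya yb + lp xa xb yb yc by rewrite /loop; ring.
have loop0 xa ya yb : lp xa xa ya yb = 0 by rewrite /loop !subrr; ring.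
apply: eq0_normc; apply/eqP; rewrite eq_le normc_ge0 andbT; apply/ler_addgt0Pr => e e0; rewrite add0r.
have [d [d0 dr dy1 dy2 de]] : exists d, [/\ 0 < d, d < r, d < y0 - y1, d < y2 - y0 & d * (16 * B) <= e].
  pose k := 16 * B + 1; have k0 : 0 < k by rewrite /k; clear - B0; lra.
  exists (Num.min (Num.min r (e / k)) (Num.min (y0 - y1) (y2 - y0)) / 2).
  set q := Num.min _ _.
  have q0 : 0 < q by rewrite !lt_min r0 divr_gt0 // !subr_gt0 y01.
  have q1 : q <= r by rewrite !ge_min lexx.
  have q2 : q <= e / k by rewrite !ge_min lexx orbT.
  have q3 : q <= y0 - y1 by rewrite !ge_min lexx !orbT.
  have q4 : q <= y2 - y0 by rewrite !ge_min lexx !orbT.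
  rewrite ler_pdivlMr // /k in q2; clearbody q; clear - q0 q1 q2 q3 q4 B0 e0.
  split; [lra|lra|lra|lra|nra].
have [xa [xa1 xa4 xa5 xa3]] : exists xa, [/\ x1 <= xa, x0 - d <= xa, xa <= x0 & xa = x1 \/ xa < x0].
  clear - x01 d0; have [h|h] := leP x1 (x0 - d).
    by exists (x0 - d); split; [lra|lra|lra|right; lra].
  by exists x1; split; [lra|lra|lra|left].
have [xb [xb1 xb4 xb5 xb3]] : exists xb, [/\ xb <= x2, x0 <= xb, xb <= x0 + d & xb = x2 \/ x0 < xb].
  clear - x02 d0; have [h|h] := leP (x0 + d) x2.
    by exists (x0 + d); split; [lra|lra|lra|right; lra].
  by exists x2; split; [lra|lra|lra|left].
have y12 : y1 <= y2 by apply: ltW; exact: lt_trans y01 y02.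
have ab : xa <= xb by exact: le_trans xa5 xb4.
have m1 : y1 <= y0 - d by clear - dy1; lra.
have m2 : y0 + d <= y2 by clear - dy2; lra.
have m3 : y0 - d <= y2 by clear - y02 d0; lra.
have m4 : y1 <= y0 + d by clear - y01 d0; lra.
have xa2 : xa <= x2 by exact: le_trans xa5 x02.
have xb2 : x1 <= xb by exact: le_trans x01 xb4.
have L1 : lp x1 xa y1 y2 = 0.
  case: xa3 => [->|xlt]; first exact: loop0.
  by apply: nb => // -[/andP[_ c] _]; move: xlt; rewrite ltNge c.
have L2 : lp xb x2 y1 y2 = 0.
  case: xb3 => [->|xlt]; first exact: loop0.
  by apply: nb => // -[/andP[c _] _]; move: xlt; rewrite ltNge c.
have L3 : lp xa xb y1 (y0 - d) = 0.
  by apply: nb => // -[_ /andP[_ c]]; clear - c d0; lra.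
have L4 : lp xa xb (y0 + d) y2 = 0.
  by apply: nb => // -[_ /andP[c _]]; clear - c d0; lra.
rewrite (loopD x1 xa) L1 add0r (loopD xa xb) L2 addr0 (loopD2 xa xb _ (y0 - d)) L3 add0r.
rewrite (loopD2 xa xb _ (y0 + d)) L4 addr0.
have i1 : normc ('i : R[i]) = 1 by rewrite /= expr0n /= add0r expr1n sqrtr1.
have n4 (A1 B1 C1 E1 : R[i]) : normc (A1 + 'i * E1 - B1 - 'i * C1) <= normc A1 + normc E1 + normc B1 + normc C1.
  do 3?[apply: le_trans (le_normcD _ _) _; rewrite ?normcN ?normcM ?i1 ?mul1r; apply: lerD => //].
rewrite /loop; apply: le_trans (n4 _ _ _ _) _.
have c1 : x0 - r < xa by clear - xa4 dr; lra.
have c2 : xb < x0 + r by clear - xb5 dr; lra.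
have hor y : `|y - y0| <= d -> normc (H xb y - H xa y) <= 2 * B * (xb - xa).
  by move=> hy; apply: hH => //; exact: le_lt_trans hy dr.
have ver x : `|x - x0| <= d -> x <= x2 -> normc (V x (y0 + d) - V x (y0 - d)) <= 2 * B * (y0 + d - (y0 - d)).
  move=> hx hx2; apply: hV => //; first exact: le_lt_trans hx dr.
  - by clear - d0; lra.
  - by clear - dr; lra.
  - by clear - dr; lra.
have v1 : _ := ver xb _ xb1.
have v2 : _ := ver xa _ xa2.
have v3 := hor (y0 - d); have v4 := hor (y0 + d).
apply: le_trans (lerD (lerD (lerD (v3 _) (v1 _)) (v4 _)) (v2 _)) _.
- by rewrite addrAC subrr add0r normrN ger0_norm // ltW.
- by rewrite ler_norml; apply/andP; split; clear - xb4 xb5 d0; lra.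
- by rewrite addrAC subrr add0r ger0_norm // ltW.
- by rewrite ler_norml; apply/andP; split; clear - xa4 xa5 d0; lra.
have : 2 * B * (xb - xa) <= 2 * B * (2 * d).
  by rewrite ler_wpM2l ?mulr_ge0 //; clear - xa4 xb5; lra.
by clear - de; lra.
Qed.

End exceptional.

Section constancy.
Context (u : R[i] -> R[i]) (z0 : R[i]).
Hypotheses (uc : forall w, disc w -> ccontinuous u w).
Hypotheses (ud : forall w, disc w -> w != z0 -> exists D, cdiff u w D).

Lemma pexp_disc x y : x < 0 -> disc (pexp x y).
Proof. by move=> x0; rewrite /disc /mkset normc_pexp -expR0 ltr_expR. Qed.

Lemma ccont_circle x : x < 0 -> forall y, ccont (fun t => u (pexp x t)) y.
Proof.
move=> x0 y e e0; have [d d0 hd] := uc (pexp_disc y x0) e0.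
have [d' d'0 hd'] := pexp_cont x y d0; exists d' => // h hh.
have := hd' 0 h; rewrite normr0 addr0 => /(_ d'0 hh) /hd.
by rewrite subrKC.
Qed.

Definition circ x : R[i] := cintegral leb `[0, 2 * pi] (fun y => u (pexp x y)).

(** Goursat's theorem in the logarithmic coordinates of [pexp]: the vertical sides of the
    rectangle are the circles and the horizontal sides cancel by periodicity. *)
Lemma circ_const x1 x2 : x1 < x2 -> x2 < 0 -> circ x1 = circ x2.
Proof.
move=> x12 x20; have p0 := @pi_gt0 R.
have [X X0 xX] : exists2 X, X < 0 & x2 < X by exists (x2 / 2); lra.
(* capping [x] keeps the curve inside the disc, so that [f] is continuous everywhere *)
pose f x y := u (pexp (Num.min x X) y).
have mX x : Num.min x X < 0 by rewrite gt_min X0 orbT.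
have fy x y : ccont (fun t => f x t) y by exact: ccont_circle.
have fx x y : ccont (fun t => f t y) x.
  move=> e e0; have [d d0 hd] := uc (pexp_disc y (mX x)) e0.
  have [d' d'0 hd'] := pexp_cont (Num.min x X) y d0; exists d' => // h hh.
  pose k := Num.min (x + h) X - Num.min x X.
  have hk : `|k| < d'.
    apply: le_lt_trans hh; rewrite /k /Order.min; case: ltP => a1; case: ltP => a2.
    - by rewrite addrAC subrr add0r.
    - by rewrite ler_norml; have := ler_norm h; have := ler_norm (- h); rewrite normrN; lra.
    - by rewrite ler_norml; have := ler_norm h; have := ler_norm (- h); rewrite normrN; lra.
    - by rewrite subrr normr0.
  have := hd' k 0; rewrite normr0 addr0 => /(_ hk d'0) /hd.
  by rewrite subrKC /k subrKC.
have [H hH] : exists H : R -> R -> R[i], forall y x, x1 - 1 < x -> x < 0 -> cderiv (fun t => H t y) x (f x y).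
  have h y := @cprimitive R (fun t => f t y) (x1 - 1) 0 (fx ^~ y).
  exists (fun x y => projT1 (cid (h y)) x) => y x; exact: (projT2 (cid (h y))).
have [V hV] : exists V : R -> R -> R[i], forall x y, - (4 * pi) < y -> y < 4 * pi -> cderiv (fun t => V x t) y (f x y).
  have h x := @cprimitive R (fun t => f x t) (- (4 * pi)) (4 * pi) (fy x).
  exists (fun x y => projT1 (cid (h x)) y) => x y; exact: (projT2 (cid (h x))).
have fX x y : x < X -> f x y = u (pexp x y) by move=> xlt; rewrite /f min_l // ltW.
have f2 x y : f x (y + 2 * pi) = f x y by rewrite /f pexp2pi.
have circE x : x < X -> circ x = V x (2 * pi) - V x 0.
  move=> xlt; transitivity (cintegral leb `[0, 2 * pi] (fun y => f x y)).
    by apply: eq_cintegral => y _; rewrite fX.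
  apply: cintegral_FTC; [lra|exact: fy|].
  by move=> t /andP[ta tb]; apply: hV; lra.
have diffle x y : x < X -> pexp x y != z0 -> exists D, forall e : R, 0 < e -> exists2 d : R, 0 < d & forall s t,
    `|s - x| < d -> `|t - y| < d ->
    normc (f s t - f x y - D * ((s - x)%:C + 'i * (t - y)%:C)) <= e * (`|s - x| + `|t - y|).
  move=> xlt wz; have x0 : x < 0 by apply: lt_trans xlt X0.
  set w := pexp x y in wz.
  have [D hD] := ud (pexp_disc y x0) wz; exists (D * w) => e e0.
  have ex := expR_gt0 x.
  have k0 : 0 < 2 * (1 + expR x) by lra.
  have D1 : 0 < 2 * (normc D + 1) by have := normc_ge0 D; lra.
  have [d1 d10 h1] := hD _ (divr_gt0 e0 k0).
  have [d2 d20 h2] := pexp_near x y (divr_gt0 e0 D1).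
  have [d3 d30 h3] := pexp_near x y (@ltr01 R).
  have [d4 d40 h4] := pexp_cont x y d10.
  exists (Num.min d2 (Num.min d3 (Num.min d4 (X - x)))).
    by rewrite !lt_min d20 d30 d40 subr_gt0.
  move=> s t; rewrite !lt_min => /and4P[s2 s3 s4 s5] /and4P[t2 t3 t4 t5].
  have := h2 _ _ s2 t2; have := h3 _ _ s3 t3; have := h4 _ _ s4 t4; rewrite !subrKC.
  have sX : s < X by have := ler_norm (s - x); lra.
  rewrite (fX s t sX) (fX x y xlt) -/w => n4 [_ n3] [n2 _].
  set S := `|s - x| + `|t - y| in n2 n3 *.
  set Q := pexp s t - w in n4 n3 n2.
  have := h1 _ n4; rewrite /Q subrKC -/Q => n1.
  have -> : u (pexp s t) - u w - D * w * ((s - x)%:C + 'i * (t - y)%:C) =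
    (u (pexp s t) - u w - D * Q) + D * (Q - w * ((s - x)%:C + 'i * (t - y)%:C)) by ring.
  apply: le_trans (le_normcD _ _) _; rewrite [normc (D * _)]normcM.
  have S0 : 0 <= S by rewrite addr_ge0.
  have b1 : e / (2 * (1 + expR x)) * normc Q <= e / 2 * S.
    apply: le_trans (ler_wpM2l _ n3) _; first by rewrite divr_ge0 // ltW.
    by rewrite le_eqVlt; apply/orP; left; apply/eqP; field; rewrite gt_eqF //; lra.
  have b2 : normc D * normc (Q - w * ((s - x)%:C + 'i * (t - y)%:C)) <= e / 2 * S.
    apply: le_trans (ler_wpM2l (normc_ge0 D) n2) _.
    have -> : normc D * (e / (2 * (normc D + 1)) * S) = e / 2 * S * (normc D / (normc D + 1)).
      by field; have := normc_ge0 D; rewrite gt_eqF //; lra.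
    apply: ler_piMr; first by rewrite mulr_ge0 ?divr_ge0 // ltW.
    by rewrite ler_pdivrMr ?mul1r ?lerDl // ltr_wpDl ?normc_ge0.
  apply: le_trans (lerD (le_trans n1 b1) b2) _.
  by rewrite -mulrDl; apply: ler_wpM2r => //; lra.
(* rectangles without the exceptional point *)
have nobad xa xb ya yb : x1 <= xa -> xa <= xb -> xb <= x2 -> - (3 * pi) <= ya -> ya <= yb -> yb <= 3 * pi ->
    (forall x y, xa <= x <= xb -> ya <= y <= yb -> pexp x y != z0) -> loop H V xa xb ya yb = 0.
  move=> a1 a2 a3 b1 b2 b3 nb; apply: (@goursat R f H V) => // x y xab yab.
  have /andP[xa' xb'] := xab; have /andP[ya' yb'] := yab.
  split; [apply: hH; lra|apply: hV; lra|].
  have [D hD] := diffle x y (ltac:(lra)) (nb x y xab yab).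
  by exists D => e /hD[d d0 hd]; exists d => // s t _ _; exact: hd.
have loopD xa xb xc ya yb : loop H V xa xc ya yb = loop H V xa xb ya yb + loop H V xb xc ya yb.
  by rewrite /loop; ring.
have loopD2 xa xb ya yb yc : loop H V xa xb ya yc = loop H V xa xb ya yb + loop H V xa xb yb yc.
  by rewrite /loop; ring.
have loop0 xa ya yb : loop H V xa xa ya yb = 0 by rewrite /loop !subrr; ring.
(* every full turn gives the same conclusion *)
have turn y0 : - pi <= y0 <= pi -> loop H V x1 x2 (y0 - pi) (y0 + pi) = 0 -> circ x1 = circ x2.
  move=> /andP[ya yb].
  have Vper x : V x (y0 + pi) - V x (y0 - pi) = V x (2 * pi) - V x 0.
    have [h|h] := leP (y0 - pi) 0.
      have := @cprimitive_unique (fun t => V x (t + 2 * pi)) (fun t => V x t) (fun t => f x t) (y0 - pi) 0 h.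
      rewrite (_ : y0 - pi + 2 * pi = y0 + pi); last by ring.
      rewrite add0r => e.
      have {}e : V x (2 * pi) - V x (y0 + pi) = V x 0 - V x (y0 - pi).
        apply: e => t /andP[ta tb]; last by apply: hV; lra.
        rewrite -f2; have := hV x (t + 2 * pi) (ltac:(lra)) (ltac:(lra)) => -[dr di].
        split.
          by apply: (is_derive_eq (@dcomp _ (fun t => t + 2 * pi) (fun s => complex.Re (V x s)) t _ _ dr (dD (did t) (dcst _ _)))); ring.
        by apply: (is_derive_eq (@dcomp _ (fun t => t + 2 * pi) (fun s => complex.Im (V x s)) t _ _ di (dD (did t) (dcst _ _)))); ring.
      have -> : V x (2 * pi) = V x 0 - V x (y0 - pi) + V x (y0 + pi) by rewrite -e subrK.
      by ring.
    have : y0 - pi <= 0 by lra.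
    by rewrite leNgt h.
  have Hper : H x2 (y0 + pi) - H x1 (y0 + pi) = H x2 (y0 - pi) - H x1 (y0 - pi).
    apply: (@cprimitive_unique (fun t => H t (y0 + pi)) (fun t => H t (y0 - pi)) (fun t => f t (y0 - pi)) x1 x2 (ltW x12)).
      move=> t /andP[ta tb]; rewrite -f2 (_ : y0 - pi + 2 * pi = y0 + pi); last by ring.
      by apply: hH; lra.
    by move=> t /andP[ta tb]; apply: hH; lra.
  rewrite /loop Hper !Vper (circE x1) ?(circE x2); [|lra|lra].
  set h := H x2 _ - _; set v1 := V x1 _ - _; set v2 := V x2 _ - _ => e.
  have : 'i * (v2 - v1) = 0 by rewrite -e; ring.
  move/eqP; rewrite mulf_eq0 => /orP[/eqP i0|/eqP].
    by move: i0 => /(congr1 (@complex.Im R)) /= /eqP; rewrite oner_eq0.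
  by move/eqP; rewrite subr_eq0 => /eqP.
have [z00|z0n] := eqVneq z0 0.
  apply: (turn 0); first by apply/andP; split; lra.
  apply: nobad; try lra.
  move=> x y _ _; rewrite z00 -normc_gt0 normc_pexp; exact: expR_gt0.
have [y0 [y0pi zE]] := polar_form z0n.
set x0 := ln (normc z0) in zE.
have /andP[y01 y02] := y0pi.
apply: (turn y0 y0pi).
have [out|inn] := boolP ((x0 < x1) || (x2 < x0)).
  apply: nobad; try lra.
  move=> x y /andP[xa xb] _; apply/eqP => e.
  have : expR x = expR x0 by rewrite -(normc_pexp x y) e zE normc_pexp.
  by move/expR_inj => xx; case/orP: out; lra.
move: inn; rewrite negb_or -!leNgt => /andP[x01 x02].
have x00 : x0 < 0 by lra.
have zd : disc z0 by rewrite zE; exact: pexp_disc.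
have [d1 d10 h1] := uc zd (@ltr01 R).
have [d2 d20 h2] := pexp_cont x0 y0 d10.
pose B := normc (u z0) + 1; have B0 : 0 <= B by have := normc_ge0 (u z0); rewrite /B; lra.
have fB x y : `|x - x0| < d2 -> `|y - y0| < d2 -> x <= x2 -> normc (f x y) <= B.
  move=> hx hy hx2; rewrite fX; last exact: le_lt_trans hx2 xX.
  have := h2 _ _ hx hy; rewrite !subrKC -zE => /h1; rewrite subrKC => h.
  rewrite -[u (pexp x y)](subrK (u z0)) /B addrC; apply: le_trans (le_normcD _ _) _.
  by rewrite lerD2l.
apply: (@loop_exceptional H V x1 x2 (y0 - pi) (y0 + pi) x0 y0 B d2) => //.
- by rewrite x01.
- by rewrite gtrBl ltrDl p0.
- move=> xa xb ya yb a1 a2 a3 b1 b2 b3 nb.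
  have b1' : - (3 * pi) <= ya by clear - b1 y01 p0; lra.
  have b3' : yb <= 3 * pi by clear - b3 y02 p0; lra.
  apply: nobad => // x y xab yab; apply/eqP => e; apply: nb.
  have hy : `|y - y0| <= pi.
    by case/andP: yab => c1 c2; rewrite ler_norml; apply/andP; split; clear - b1 b3 c1 c2; lra.
  by move: e; rewrite zE => /pexp_inj /(_ hy)[<- <-].
- move=> y xa xb hy a1 a2 a3 c1 c2.
  have := @cmvt R (fun t => H t y) (fun t => f t y) xa xb 0 0 B a2.
  rewrite !mulr0 addr0 subr0; apply => t /andP[ta tb].
    by apply: hH; [clear - a1 ta; lra|clear - a3 tb x20; lra].
  rewrite mulr0 addr0 subr0; apply: fB => //; last exact: le_trans tb a3.
  by rewrite ltr_norml; apply/andP; split; clear - c1 c2 ta tb; lra.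
move=> x ya yb hx hx2 a2 c1 c2 c3 c4.
have := @cmvt R (fun t => V x t) (fun t => f x t) ya yb 0 0 B a2.
rewrite !mulr0 addr0 subr0; apply => t /andP[ta tb].
  by apply: hV; [clear - c3 y01 ta p0; lra|clear - c4 y02 tb p0; lra].
rewrite mulr0 addr0 subr0; apply: fB => //.
by rewrite ltr_norml; apply/andP; split; clear - c1 c2 ta tb; lra.
Qed.

(** By [circ_const] the circle can be shrunk to 0. The point where [u] is merely
    continuous is the one of Cauchy's formula. *)
Lemma circle_mean x : x < 0 -> circ x = (2 * pi)%:C * u 0.
Proof.
move=> x0; have p0 := @pi_gt0 R.
apply/eqP; rewrite -subr_eq0; apply/eqP; apply: eq0_normc; apply/eqP; rewrite eq_le normc_ge0 andbT.
apply/ler_addgt0Pr => e' e'0; rewrite add0r.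
have fe (q r : R) : q != 0 -> r = 2 * (r / (2 * (2 * q))) * (2 * q) by move=> q0; field.
pose e : R := e'; have e0 : 0 < e := e'0; rewrite -/e.
have k0 : 0 < 2 * (2 * (pi : R)) by rewrite mulr_gt0 ?ltr0n // mulr_gt0 ?ltr0n.
have [d d0 hd] := uc disc0 (divr_gt0 e0 k0).
have [x' [x'x x'd]] : exists x', x' < x /\ expR x' < d.
  exists (Num.min (x - 1) (ln d - 1)); split; first by rewrite gt_min gtrBl ltr01.
  apply: (@le_lt_trans _ _ (expR (ln d - 1))); first by rewrite ler_expR ge_min lexx orbT.
  by rewrite -[ltRHS](lnK d0) ltr_expR gtrBl.
rewrite -(circ_const x'x x0).
have x'0 : x' < 0 := lt_trans x'x x0.
have [G hG] := @cprimitive R (fun t => u (pexp x' t)) (-1) (2 * pi + 1) (ccont_circle x'0).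
have hG' t : 0 <= t <= 2 * pi -> cderiv G t (u (pexp x' t)).
  by move=> /andP[ta tb]; apply: hG; [apply: lt_le_trans ta; rewrite ltrN10|apply: le_lt_trans tb _; rewrite ltrDl ltr01].
have p2 : 0 < 2 * (pi : R) by rewrite mulr_gt0.
rewrite /circ (cintegral_FTC p2 (ccont_circle x'0) hG').
have := @cmvt R G (fun t => u (pexp x' t)) 0 (2 * pi) (u 0) 0 (e / (2 * (2 * pi))) (ltW p2) hG'.
rewrite mulr0 addr0 !subr0 => h.
have -> : e = 2 * (e / (2 * (2 * pi))) * (2 * pi).
  have pn : (pi : R) != 0 by rewrite gt_eqF.
  by apply: fe.
apply: h => t _; rewrite mulr0 addr0.
have := hd (pexp x' t); rewrite normc_pexp add0r; exact.
Qed.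

End constancy.

End circle_mean.

(** * Cauchy's formula and power series *)

Section cauchy.
Context {R : realType}.
Implicit Types (z w q : R[i]) (c : nat -> R[i]) (g : R -> R[i]).
Local Notation leb := (@lebesgue_measure R).

Lemma csum_geom q : disc q ->
  asum_le (fun k => q ^+ k) (1 - normc q)^-1 /\ csum (fun k => q ^+ k) = (1 - q)^-1.
Proof.
move=> qd; have ha : asum_le (fun k => q ^+ k) (1 - normc q)^-1.
  move=> n; under eq_bigr do rewrite normcX; apply: geom_le.
  by rewrite normc_ge0.
split=> //; have := csum_shift ha.
rewrite expr0 (_ : csum (fun k => q ^+ k.+1) = csum (fun k => q * q ^+ k)); last first.
  by apply: eq_csum => k; rewrite exprS.
rewrite (csumZ q ha) => e; apply: (mulfI (onem_neq0 qd)).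
by rewrite divff ?onem_neq0 // mulrBl mul1r {1}e addrK.
Qed.

Lemma bounded_cps c B : (forall k, normc (c k) <= B) -> cps c.
Proof.
move=> hB s /andP[s0 s1]; exists B => k; apply: le_trans (hB k).
by rewrite ler_piMr ?normc_ge0 // exprn_ile1 // ltW.
Qed.

(** Dividing by [z] after removing the constant term; the value at 0 follows by
    continuity. *)
Lemma pser_inj c c' : cps c -> cps c' -> {in disc, pser c =1 pser c'} -> c =1 c'.
Proof.
move=> hc hc' e k; elim: k c c' hc hc' e => [|k IH] c c' hc hc' e.
  by rewrite -(pser0 hc) -(pser0 hc') e // inE; exact: disc0.
apply: (IH (fun n => c n.+1) (fun n => c' n.+1)) (cpsS hc) (cpsS hc') _.
have c0 : c 0%N = c' 0%N by rewrite -(pser0 hc) -(pser0 hc') e // inE; exact: disc0.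
have ne z : disc z -> z != 0 -> pser (fun n => c n.+1) z = pser (fun n => c' n.+1) z.
  move=> zd z0; apply: (mulfI z0); have := e z (mem_set zd).
  by rewrite (pser_shift hc zd) (pser_shift hc' zd) c0 => /addrI.
move=> z; rewrite inE => zd; have [z0|] := eqVneq z 0; last exact: ne.
rewrite z0; have r12 : 0 < (2^-1 : R) < 1 by apply/andP; split; lra.
have [L L0 hL] := pser_lip (cpsS hc) r12.
have [L' L'0 hL'] := pser_lip (cpsS hc') r12.
apply/eqP; rewrite -subr_eq0; apply/eqP; apply: eq0_normc; apply/eqP; rewrite eq_le normc_ge0 andbT.
apply/ler_addgt0Pr => d d0; rewrite add0r.
pose s : R := Num.min 2^-1 (d / (L + L' + 1)).
have LL0 : 0 < L + L' + 1 by clear - L0 L'0; lra.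
have s0 : 0 < s by rewrite lt_min divr_gt0 // andbT; lra.
have s1 : s <= 2^-1 by rewrite ge_min lexx.
have s2 : s * (L + L' + 1) <= d by rewrite -ler_pdivlMr // ge_min lexx orbT.
have ns : normc s%:C = s by rewrite normc_nng // ltW.
have sd : disc (s%:C : R[i]).
  by move: ns; rewrite /disc /= => ->; clear - s1; lra.
have sn : s%:C != 0 by rewrite -normc_gt0 ns.
have n0 : normc (0 : R[i]) <= 2^-1 by rewrite (normc_nng (lexx 0)); lra.
have ns2 : normc s%:C <= 2^-1 by rewrite ns.
have h1 := hL 0 s%:C n0 ns2; have h2 := hL' s%:C 0 ns2 n0.
rewrite -(ne _ sd sn) in h2.
rewrite -[X in X - _](subrK (pser (fun n => c n.+1) s%:C)) -addrA.
apply: le_trans (le_normcD _ _) _.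
apply: le_trans (lerD h1 h2) _.
rewrite sub0r subr0 normcN ns -mulrDl; apply: le_trans s2.
by rewrite mulrC ler_wpM2l ?(ltW s0) // lerDl.
Qed.

Lemma cintegral_conj d (T : measurableType d) (nu : {measure set T -> \bar R}) (D : set T)
  (f : T -> R[i]) : measurable D -> cintegrable nu D f ->
  cintegral nu D (fun x => conjc (f x)) = conjc (cintegral nu D f).
Proof.
move=> mD [i1 i2]; rewrite /cintegral; apply: complexP => /=.
  by apply: eq_Rintegral => x _; case: (f x).
rewrite -mulN1r -RintegralZl //; apply: eq_Rintegral => x _.
by case: (f x) => /= p q; rewrite mulN1r.
Qed.

Lemma cintegrable_conj d (T : measurableType d) (nu : {measure set T -> \bar R}) (D : set T)
  (f : T -> R[i]) : measurable D -> cintegrable nu D f -> cintegrable nu D (fun x => conjc (f x)).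
Proof.
move=> mD [i1 i2]; split.
  rewrite (_ : (fun x => _) = (fun x => (complex.Re (f x))%:E)) //.
  by apply/funext => x; case: (f x).
rewrite (_ : (fun x => _) = (fun x => (-1)%:E * (complex.Im (f x))%:E)%E).
  exact: (integrableZl mD (-1) i2).
by apply/funext => x; rewrite -EFinM mulN1r; case: (f x).
Qed.

Lemma ccont_cintegrable g (a b : R) : (forall t, ccont g t) -> cintegrable leb `[a, b] g.
Proof.
move=> gc; split; apply: continuous_compact_integrable; try exact: segment_compact.
  by apply: continuous_subspaceT => t; exact: (ccont_ReIm (gc t)).1.
by apply: continuous_subspaceT => t; exact: (ccont_ReIm (gc t)).2.
Qed.

Lemma ccont_pexpN y : ccont (fun t => pexp 0 (- t) : R[i]) y.
Proof.
move=> e e0; have [d d0 hd] := pexp_cont 0 (- y) e0; exists d => // h hh.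
rewrite opprD; have := hd 0 (- h); rewrite normr0 normrN addr0 => /(_ d0 hh); exact: ltW.
Qed.

Lemma normc_pexp0 (y : R) : normc (pexp 0 y) = 1.
Proof. by rewrite normc_pexp expR0. Qed.

Definition circ_coef g k : R[i] := cintegral leb `[0, 2 * pi] (fun y => g y * pexp 0 (- y) ^+ k).

(** The integral against [1 / (1 - z / w)] on a circle is a power series, by the
    geometric expansion. *)
Lemma circ_coefP g : (forall t, ccont g t) ->
  (exists B, forall k, normc (circ_coef g k) <= B) /\
  forall z, disc z ->
   cintegrable leb `[0, 2 * pi] (fun y => g y * (1 - z * pexp 0 (- y))^-1) /\
   cintegral leb `[0, 2 * pi] (fun y => g y * (1 - z * pexp 0 (- y))^-1) = pser (circ_coef g) z.
Proof.
move=> gc; have mI : measurable (`[0, 2 * pi]%classic : set (g_sigma_algebraType R.-ocitv.-measurable)) by [].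
have ig : cintegrable leb `[0, 2 * pi] g := @ccont_cintegrable g 0 (2 * pi) gc.
have [mg ing] := (@cintegrableP _ _ _ leb _ mI _).1 ig.
have [me _] := (@cintegrableP _ _ _ leb _ mI _).1 (@ccont_cintegrable _ 0 (2 * pi) ccont_pexpN).
have mF k : measurable_fun `[0, 2 * pi] (fun y => g y * pexp 0 (- y) ^+ k).
  by apply: measurable_cM mg _; exact: measurable_cX.
have nF k y : normc (g y * pexp 0 (- y) ^+ k) = normc (g y).
  by rewrite normcM normcX normc_pexp0 expr1n mulr1.
have iF k : cintegrable leb `[0, 2 * pi] (fun y => g y * pexp 0 (- y) ^+ k).
  by apply: (cintegrable_le mI (mF k) ing) => y _; rewrite nF.
split.
  exists (\int[leb]_(y in `[0, 2 * pi]) normc (g y)) => k.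
  apply: le_trans (le_normc_cintegral mI (iF k)) _.
  by under eq_Rintegral do rewrite nF.
move=> z zd.
have G y : csum (fun k => z ^+ k * (g y * pexp 0 (- y) ^+ k)) = g y * (1 - z * pexp 0 (- y))^-1.
  have qd : disc (z * pexp 0 (- y)) by rewrite /disc /= normcM normc_pexp0 mulr1.
  have [qa <-] := csum_geom qd; rewrite -(csumZ _ qa); apply: eq_csum => k.
  by rewrite [in RHS]exprMn; exact: mulrCA.
have [] := @cintegral_csum _ _ _ leb `[0, 2 * pi] mI (fun k y => z ^+ k * (g y * pexp 0 (- y) ^+ k))
  (fun y => (1 - normc z)^-1 * normc (g y)).
- move=> k; apply: measurable_cM (mF k); apply/measurable_cE; split; exact: measurable_cst.
- exact: (integrableZl mI _ ing).
- move=> y _ n; under eq_bigr do rewrite normcM normcX nF.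
  rewrite -mulr_suml ler_wpM2r ?normc_ge0 //; apply: geom_le.
  by rewrite normc_ge0.
move=> i1 _ _ e.
have e' : (fun y => csum (fun k => z ^+ k * (g y * pexp 0 (- y) ^+ k))) = (fun y => g y * (1 - z * pexp 0 (- y))^-1) := funext G.
rewrite -e'; split=> //; rewrite e; apply: eq_csum => k; rewrite (cintegralZ mI _ (iF k)) mulrC; exact: erefl.
Qed.

Lemma conj_pexp (x y : R) : conjc (pexp x y) = pexp x (- y).
Proof. by rewrite /pexp cosN sinN; apply: complexP => /=; rewrite ?mul0r ?mulr0 ?oppr0 ?addr0 ?subr0 ?add0r // mulrN. Qed.

(** The mean of a positive power vanishes by [circle_mean]; negative powers are conjugate
    to positive ones on a circle. *)
Lemma circ_coef1 k : circ_coef (fun=> 1) k = if k is 0 then (2 * pi)%:C else 0.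
Proof.
have p0 := @pi_gt0 R; have mI : measurable (`[0, 2 * pi]%classic : set (g_sigma_algebraType R.-ocitv.-measurable)) by [].
rewrite /circ_coef.
have um z : exists D, cdiff (fun w => w ^+ k : R[i]) z D.
  exact: (derivable_cdiff (@derivable_monomial R k z)).
have uc z : disc z -> ccontinuous (fun w => w ^+ k : R[i]) z.
  by move=> _ e e0; have [D hD] := um z; exact: cdiff_cts hD e e0.
have x0 : -1 < 0 :> R by exact: ltrN10.
have := @circle_mean R (fun w => w ^+ k) 0 uc (fun w _ _ => um w) (-1) x0.
rewrite /circ => e.
have i1 : cintegrable leb `[0, 2 * pi] (fun y => pexp (-1) y ^+ k : R[i]).
  by apply: ccont_cintegrable; exact: ccont_circle uc _ x0.
have := cintegral_conj mI i1; rewrite e => e'.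
pose A : R[i] := (expR 1)%:C ^+ k.
have pe y : A * conjc (pexp (-1) y ^+ k) = 1 * pexp 0 (- y) ^+ k.
  have cX (w : R[i]) n : conjc (w ^+ n) = conjc w ^+ n by exact: conjcX.
  rewrite mul1r /A cX conj_pexp /pexp -exprMn mulrA -real_complexM -expRD subrr.
  by [].
have i2 : cintegrable leb `[0, 2 * pi] (fun y => conjc (pexp (-1) y ^+ k) : R[i]) := cintegrable_conj mI i1.
rewrite -(funext pe : (fun y => _) = (fun y => _)).
rewrite (cintegralZ mI _ i2) e' /A; case: k {um uc e i1 e' A pe i2} => [|k].
  by rewrite !expr0 mul1r mulr1; apply: complexP => /=; rewrite ?oppr0.
have c0 : conjc ((2 * pi)%:C * 0 ^+ k.+1 : R[i]) = 0.
  by rewrite exprS mul0r mulr0; apply: complexP => /=; rewrite ?oppr0.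
by rewrite c0 mulr0.
Qed.

Section taylor.
Context (h : R[i] -> R[i]).
Hypothesis hd : forall z, disc z -> exists D, cdiff h z D.

(** The quotient in Cauchy's formula, filled in by continuity at [z]. The factor [w]
    makes its value at 0 vanish, also when [z = 0]. *)
Lemma quotient_ccontinuous z D : cdiff h z D ->
  ccontinuous (fun w => if w == z then D * z else (h w - h z) * (w / (w - z))) z.
Proof.
move=> hD e e0; have nz0 := normc_ge0 z; have nD0 := normc_ge0 D.
have A0 : 0 < 2 * (normc z + 1) by clear - nz0; lra.
have B0 : 0 < 2 * (normc D + 1) by clear - nD0; lra.
have [d d0 hd'] := hD _ (divr_gt0 e0 A0).
exists (Num.min d (Num.min 1 (e / (2 * (normc D + 1))))).
  by rewrite !lt_min d0 ltr01 divr_gt0.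
move=> k; rewrite !lt_min => /and3P[k1 k2 k3]; rewrite eqxx.
have [->|k0] := eqVneq k 0.
  by rewrite addr0 eqxx subrr (normc_nng (lexx 0)) ltW.
have -> : (z + k == z) = false by apply/negbTE; rewrite -subr_eq0 addrAC subrr add0r.
have -> : (h (z + k) - h z) * ((z + k) / (z + k - z)) - D * z =
    (h (z + k) - h z - D * k) / k * (z + k) + D * k.
  have -> : z + k - z = k by ring.
  by field.
apply: le_trans (le_normcD _ _) _.
have nk : 0 < normc k by rewrite normc_gt0.
have E1 : normc ((h (z + k) - h z - D * k) / k * (z + k)) <= e / 2.
  rewrite normcM (normcM _ k^-1) normcV.
  have := hd' k k1; rewrite -ler_pdivrMr // => h1.
  have h2 : normc (z + k) <= normc z + 1.
    by apply: le_trans (le_normcD _ _) _; rewrite lerD2l ltW.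
  apply: le_trans (ler_pM (divr_ge0 (normc_ge0 _) (normc_ge0 _)) (normc_ge0 _) h1 h2) _.
  have nz1 : normc z + 1 != 0 by rewrite gt_eqF // ltr_wpDl.
  by rewrite le_eqVlt; apply/orP; left; apply/eqP; field.
have E2 : normc (D * k) <= e / 2.
  rewrite normcM; move: k3; rewrite ltr_pdivlMr // => k3.
  rewrite ler_pdivlMr ?ltr0n //; apply: le_trans (ltW k3).
  by rewrite mulrC mulrA [X in _ <= X]mulrC ler_wpM2r ?normc_ge0 // ler_wpM2l ?ler0n // lerDl.
by have := lerD E1 E2; rewrite -splitr.
Qed.

Lemma quotient_cdiff z w (a : R[i]) : w != z -> (exists D, cdiff h w D) -> 
  exists D, cdiff (fun w => if w == z then a else (h w - h z) * (w / (w - z))) w D.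
Proof.
move=> wz [E hE]; have wz' : w - z != 0 by rewrite subr_eq0.
have dh := cdiff_derivable hE.
have di : derivable ((fun w => w) : R[i]^o -> R[i]^o) w 1 by exact: derivable_id.
have dc (v : R[i]) : derivable ((fun=> v) : R[i]^o -> R[i]^o) w 1 by exact: derivable_cst.
have d1 := @derivableV R[i] R[i]^o (fun w => w - z) w 1 wz' (derivableB di (dc z)).
have d2 := @derivableM R[i] R[i]^o _ _ w 1 di d1.
have d3 := @derivableM R[i] R[i]^o _ _ w 1 (derivableB dh (dc (h z))) d2.
have [D hD] := derivable_cdiff d3; exists D.
apply: (@cdiff_near R (fun w => (h w - h z) * (w / (w - z))) _ w D (normc (w - z))) => //.
  by rewrite normc_gt0.
move=> k kz /=; case: eqP => // e; move: kz; rewrite -e opprD addrA subrr add0r normcN ltxx.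
by [].
Qed.

(** Cauchy's formula on the circle of radius [expR x], expanded as a geometric
    series. *)
Lemma cauchy_circle x : x < 0 -> exists2 c, (exists B, forall k, normc (c k) <= B) &
  forall z, disc z -> h ((expR x)%:C * z) = pser c z.
Proof.
move=> x0; have p0 := @pi_gt0 R.
have hc w : disc w -> ccontinuous h w.
  by move=> /hd[D hD] e e0; exact: cdiff_cts hD e e0.
have gc := ccont_circle hc x0.
have [[B hB] hI] := circ_coefP gc.
have p2 : (2 * pi)%:C != 0 :> R[i].
  by rewrite -normc_gt0 normc_nng ?mulr_ge0 ?ltW // ?mulr_gt0.
exists (fun k => (2 * pi)%:C^-1 * circ_coef (fun y => h (pexp x y)) k).
  exists (normc (2 * pi)%:C^-1 * B) => k; rewrite normcM ler_wpM2l ?normc_ge0 //.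
move=> z zd; pose r : R[i] := (expR x)%:C.
have nr : normc r = expR x by rewrite normc_nng // expR_ge0.
have r0 : r != 0 by rewrite -normc_gt0 nr expR_gt0.
have rd : disc (r * z).
  rewrite /disc /= normcM nr; apply: le_lt_trans zd.
  by rewrite ler_piMl ?normc_ge0 // -expR0 ler_expR ltW.
have [D hD] := hd rd.
pose u w := if w == r * z then D * (r * z) else (h w - h (r * z)) * (w / (w - r * z)).
have uc w : disc w -> ccontinuous u w.
  move=> wd; have [->|wz] := eqVneq w (r * z); first exact: quotient_ccontinuous.
  have [E hE] := @quotient_cdiff (r * z) w (D * (r * z)) wz (hd wd).
  by move=> e e0; exact: cdiff_cts hE e e0.
have ud w : disc w -> w != r * z -> exists D, cdiff u w D.
  by move=> wd wz; exact: (quotient_cdiff _ wz (hd wd)).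
have := circle_mean uc ud x0.
have -> : u 0 = 0.
  by rewrite /u; case: eqP => [<-|_]; rewrite ?mulr0 // mul0r mulr0.
rewrite mulr0 /circ.
have [[B1 hB1] hI1] := circ_coefP (fun y => ltac:(move=> e e0; exists 1 => // k _; rewrite subrr (normc_nng (lexx 0)) ltW //) : ccont (fun=> 1 : R[i]) y).
have [i1 e1] := hI z zd; have [i2 e2] := hI1 z zd.
have mI : measurable (`[0, 2 * pi]%classic : set (g_sigma_algebraType R.-ocitv.-measurable)) by [].
rewrite (@eq_cintegral _ _ _ leb `[0, 2 * pi] _ ((fun y => h (pexp x y) * (1 - z * pexp 0 (- y))^-1) \+
   (fun y => - h (r * z) * (1 * (1 - z * pexp 0 (- y))^-1)))); last first.
  move=> y _; have pd : pexp x y = r * pexp 0 y by rewrite /r /pexp expR0 mul1r.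
  have pz : pexp 0 y * pexp 0 (- y) = 1 :> R[i].
    by rewrite -pexpD addr0 subrr /pexp expR0 cos0 sin0 mul1r.
  have n1 : pexp 0 y - z != 0.
    apply: contraTneq zd => /eqP; rewrite subr_eq0 => /eqP <-.
    by apply/negP => zd'; move/eqP: (normc_pexp0 y); apply/negP; exact: (negbT (lt_eqF zd')).
  have pn : pexp 0 y != 0 :> R[i] by rewrite -normc_gt0 normc_pexp0 ltr01.
  have -> : u (pexp x y) = (h (pexp x y) - h (r * z)) * (pexp x y / (pexp x y - r * z)).
    rewrite /u; case: eqP => // e; move: n1; rewrite subr_eq0.
    by move: e; rewrite pd => /(mulfI r0) ->; rewrite eqxx.
  have -> : pexp x y / (pexp x y - r * z) = (1 - z * pexp 0 (- y))^-1.
    rewrite pd -mulrBr -mulf_div divff // mul1r.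
    have -> : 1 - z * pexp 0 (- y) = (pexp 0 y - z) / pexp 0 y.
      have -> : pexp 0 (- y) = (pexp 0 y)^-1 by apply: (mulfI pn); rewrite pz divff.
      by field.
    by rewrite invf_div.
  by rewrite /= mulrBl mul1r mulNr.
rewrite (cintegralD mI i1 (cintegrableZ mI _ i2)) e1 (cintegralZ mI _ i2) e2.
have -> : pser (circ_coef (fun=> 1)) z = (2 * pi)%:C.
  have bc := bounded_cps hB1.
  rewrite (pser_shift bc zd) circ_coef1; rewrite [X in _ + z * X](_ : _ = 0) ?mulr0 ?addr0 //.
  apply: eq0_normc; apply/eqP; rewrite eq_le normc_ge0 andbT; apply: csum_le => n.
  rewrite big1 // => k _; rewrite circ_coef1 mul0r; exact: (normc_nng (lexx 0)).
rewrite mulNr => /eqP; rewrite subr_eq0 => /eqP e.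
have cc := bounded_cps hB.
by rewrite (pserZ _ cc zd) e [RHS]mulrC mulfK.
Qed.

(** The expansions on different circles agree by uniqueness of coefficients. *)
Lemma taylor : exists2 c, cps c & {in disc, h =1 pser c}.
Proof.
have hr (s : R) : 0 < s < 1 -> exists2 c, (exists B, forall k, normc (c k) <= B) &
    forall z, disc z -> h (s%:C * z) = pser c z.
  move=> /andP[s0 s1]; have := @cauchy_circle (ln s) (ltac:(by rewrite ln_lt0 // s0 s1)).
  by rewrite lnK.
have r12 : 0 < (2^-1 : R) < 1 by apply/andP; split; lra.
have [c0 [B0 hB0] e0] := hr _ r12.
pose c k := 2%:C ^+ k * c0 k.
have key (s : R) : 2^-1 <= s -> s < 1 -> exists2 B, (forall k, normc (c k) * s ^+ k <= B) &
    forall z, disc z -> h (s%:C * z) = pser (fun k => c k * s%:C ^+ k) z.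
  move=> s12 s1; have s0 : 0 < s by apply: lt_le_trans s12; lra.
  have [c' [B' hB'] e'] := hr s (ltac:(by rewrite s0)).
  have q1 : (2 * s)^-1 <= 1 by rewrite invf_le1; [lra|rewrite mulr_gt0].
  have q0 : 0 <= (2 * s)^-1 by rewrite invr_ge0 mulr_ge0 // ltW.
  have ec : c0 =1 (fun k => c' k * (2 * s)^-1%:C ^+ k).
    apply: pser_inj (bounded_cps hB0) _ _.
      apply: (@bounded_cps _ B') => k; rewrite normcM normcX normc_nng //.
      by apply: le_trans (hB' k); rewrite ler_piMr ?normc_ge0 // exprn_ile1.
    move=> z; rewrite inE => zd; rewrite -e0 //.
    have qd : disc ((2 * s)^-1%:C * z).
      by rewrite /disc /= normcM normc_nng //; apply: le_lt_trans zd; rewrite ler_piMl ?normc_ge0.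
    have -> : 2^-1%:C * z = s%:C * ((2 * s)^-1%:C * z).
      rewrite mulrA -real_complexM; congr (_%:C * _); have sn : s != 0 by rewrite gt_eqF.
      by field.
    rewrite (e' _ qd); apply: eq_csum => k; by rewrite exprMn mulrA.
  have ec' k : c k * s%:C ^+ k = c' k.
    have e1 : 2%:C * (2 * s)^-1%:C * s%:C = 1 :> R[i].
      rewrite -!real_complexM (_ : 2 * (2 * s)^-1 * s = 1) //; have sn : s != 0 by rewrite gt_eqF.
      by field.
    by rewrite /c ec (mulrC (c' k)) mulrA -exprMn mulrAC -exprMn e1 expr1n mul1r.
  exists B' => [k|z zd]; first by have := hB' k; rewrite -ec' normcM normcX normc_nng // ltW.
  by rewrite e' //; apply: eq_csum => k; rewrite ec'.
have hc : cps c.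
  move=> r /andP[r0 r1]; have [] := key ((r + 1) / 2).
  - by clear - r0; lra.
  - by clear - r1; lra.
  move=> B hB _; exists B => k; apply: le_trans (hB k); rewrite ler_wpM2l ?normc_ge0 //.
  by rewrite lerXn2r ?nnegrE; lra.
exists c => // z; rewrite inE => zd.
have z1 : normc z < 1 := zd; have z0 := normc_ge0 z.
pose s := (normc z + 1) / 2.
have s1 : s < 1 by rewrite /s; clear - z1; lra.
have s12 : 2^-1 <= s by rewrite /s; clear - z0; lra.
have s0 : 0 < s by apply: lt_le_trans s12; lra.
have zs : normc z < s by rewrite /s; clear - z1; lra.
have [B _ hs] := key s s12 s1.
have sn : s%:C != 0 :> R[i] by rewrite -normc_gt0 normc_nng // ltW.
have qd : disc (z / s%:C).
  by rewrite /disc /= normcM normcV normc_nng ?ltW // ltr_pdivrMr // mul1r.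
have ez : z = s%:C * (z / s%:C) by rewrite mulrC divfK.
rewrite {1}ez (hs _ qd); apply: eq_csum => k.
by rewrite -mulrA -exprMn -ez.
Qed.

End taylor.

End cauchy.

(** * The reproducing property *)

Section reproducing.
Context {R : realType}.
Implicit Types (z w : R[i]) (f g : R[i] -> R[i]) (c : nat -> R[i]).

(** The origin is a null set. *)
Lemma eq_integral_pdisc (a b : R) (f g : R[i] -> R) : measurable_fun disc f ->
  measurable_fun disc g -> {in pdisc, f =1 g} ->
  (\int[mu a b]_(z in disc) (f z)%:E = \int[mu a b]_(z in disc) (g z)%:E)%E.
Proof.
move=> mf mg fg; rewrite [LHS]integralE [RHS]integralE.
have mf' : measurable_fun disc (EFin \o f) by exact/measurable_EFinP.
have mg' : measurable_fun disc (EFin \o g) by exact/measurable_EFinP.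
congr (_ - _)%E.
  rewrite (ge0_integral_mu_pdisc _ _ (measurable_funepos mf')); last by move=> z _; exact: funepos_ge0.
  rewrite (ge0_integral_mu_pdisc _ _ (measurable_funepos mg')); last by move=> z _; exact: funepos_ge0.
  by apply: eq_integral => z zd; rewrite !funeposE /= fg.
rewrite (ge0_integral_mu_pdisc _ _ (measurable_funeneg mf')); last by move=> z _; exact: funeneg_ge0.
rewrite (ge0_integral_mu_pdisc _ _ (measurable_funeneg mg')); last by move=> z _; exact: funeneg_ge0.
by apply: eq_integral => z zd; rewrite !funenegE /= fg.
Qed.

Lemma eq_cintegral_pdisc (a b : R) f g : measurable_fun disc f -> measurable_fun disc g ->
  {in pdisc, f =1 g} -> cintegral (mu a b) disc f = cintegral (mu a b) disc g.
Proof.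
move=> /measurable_cE[mf1 mf2] /measurable_cE[mg1 mg2] fg; rewrite /cintegral /Rintegral.
rewrite (eq_integral_pdisc _ _ mf1 mg1); last by move=> z /fg ->.
by rewrite (eq_integral_pdisc _ _ mf2 mg2) // => z /fg ->.
Qed.

(** Cut-off away from both the origin and the boundary circle. *)
Definition annulus n (t : R) : R := \1_(`[n.+1%:R^-1, 1 - n.+1%:R^-1]) t.

Lemma annulus01 n t : 0 <= annulus n t <= 1.
Proof. by rewrite /annulus indicE; case: (_ \in _); rewrite ?lexx ler01. Qed.

Lemma measurable_annulus n : measurable_fun setT (annulus n).
Proof. by apply: measurable_indic; exact: measurable_itv. Qed.

Lemma annulus0 n : annulus n 0 = 0.
Proof. by rewrite /annulus indicE memNset //= in_itv /= leNgt invr_gt0 ltr0n. Qed.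

Lemma measurable_neq0 : measurable_fun disc (fun z : R[i] => ((z != 0)%:R : R)%:C).
Proof.
apply: measurable_creal; apply: measurable_funTS.
rewrite (_ : (fun z => _) = \1_(~` [set (0 : R[i])])).
  by apply: measurable_indic; apply: measurableC; exact: measurable_set0c.
apply/funext => z; rewrite indicE; case: eqP => [->|z0]; last by rewrite mem_set.
by rewrite memNset // => /(_ erefl).
Qed.

Lemma inv_normc_pow w k : w != 0 ->
  ((normc w ^+ 2) ^- k)%:C = (w ^+ k)^-1 / w^* ^+ k :> R[i].
Proof.
move=> w0; have t0 : normc w ^+ 2 != 0 by rewrite expf_neq0 // gt_eqF // normc_gt0.
apply: (@mulIf _ ((normc w ^+ 2) ^+ k)%:C).
  by rewrite -normc_gt0 normc_real normr_gt0 expf_neq0.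
have e : ((normc w ^+ 2) ^+ k)%:C = w ^+ k * w^* ^+ k :> R[i].
  by rewrite (realX (normc w ^+ 2) k) -mulc_conj exprMn.
rewrite -real_complexM (mulVf (expf_neq0 k t0)) e.
by rewrite mulrACA mulVf ?mulVf ?mulr1 // expf_neq0 // -normc_gt0 ?normc_conj ?normc_gt0.
Qed.

Lemma annulus_cvg t : 0 <= t < 1 -> (fun n => annulus n t) @ \oo --> ((t != 0)%:R : R).
Proof.
move=> /andP[t0 t1]; have [->|tn] := eqVneq t 0.
  by apply: cvg_near_cst; near=> n; exact: annulus0.
have t0' : 0 < t by rewrite lt_neqAle eq_sym tn.
have t1' : 0 < 1 - t by rewrite subr_gt0.
apply: cvg_near_cst; near=> n; rewrite /annulus indicE mem_set //= in_itv /=.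
apply/andP; split; apply: ltW.
  by near: n; exact: (near_infty_natSinv_lt (PosNum t0')).
rewrite ltrBrDr addrC -ltrBrDr.
by near: n; exact: (near_infty_natSinv_lt (PosNum t1')).
Unshelve. all: by end_near. Qed.

Lemma cto_annulus (u : R[i]) w : disc w ->
  cto (fun n => u * (annulus n (normc w ^+ 2))%:C) (u * ((w != 0)%:R : R)%:C).
Proof.
move=> wd; have h := annulus_cvg (disc_sqr wd).
have -> : (w != 0) = (normc w ^+ 2 != 0).
  by rewrite expf_eq0 /= -[X in ~~ X]negbK -normc_gt0 lt_neqAle normc_ge0 andbT negbK eq_sym.
set l : R := _%:R; rewrite -/l in h.
apply: (@cto_le _ _ _ (fun n => normc u * `|annulus n (normc w ^+ 2) - l|)).
  by move=> n; rewrite -mulrBr normcM -raddfB normc_real.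
rewrite -[X in _ --> X](mulr0 (normc u)); apply: cvgM; first exact: cvg_cst.
have h2 : (fun n => `|annulus n (normc w ^+ 2) - l|) @ \oo --> `|l - l|.
  by apply: cvg_norm; apply: cvgB h _; exact: cvg_cst.
by rewrite subrr normr0 in h2.
Qed.

Context (alpha beta0 : R) (m : nat).
Hypotheses (al1 : -1 < alpha) (be01 : -1 < beta0 <= 0).
Let beta := beta0 + m%:R.
Let be1 : -1 < beta. Proof. by case/andP: be01 => h _; rewrite /beta (lt_le_trans h) // lerDl. Qed.
Let be0 : -1 < beta0. Proof. by case/andP: be01. Qed.

(** The bounded functions [cutoff n] increase to [t ^- m], so that [coef_extract] applies
    to them and dominated convergence to their limit. *)
Definition cutoff n (t : R) := t `^ (- m%:R) * annulus n t.

Lemma measurable_cutoff n : measurable_fun setT (cutoff n).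
Proof. by apply: measurable_funM; [exact: measurable_powR|exact: measurable_annulus]. Qed.

Lemma cutoff_bound n t : 0 <= cutoff n t <= n.+1%:R ^+ m.
Proof.
rewrite /cutoff; apply/andP; split; first by rewrite mulr_ge0 ?powR_ge0 //; case/andP: (annulus01 n t).
rewrite /annulus indicE; case E: (t \in _); last by rewrite mulr0 exprn_ge0.
move/set_mem: E; rewrite /= in_itv /= mulr1 => /andP[h _].
have t0 : 0 < t by apply: lt_le_trans h; rewrite invr_gt0.
rewrite powRN (powR_mulrn _ (ltW t0)) -exprVn lerXn2r ?nnegrE ?invr_ge0 ?(ltW t0) //.
by rewrite invf_ple ?posrE.
Qed.

Lemma cutoff_asum c n : cps c -> exists2 B, (forall t, `|cutoff n t| <= B) &
  forall z, disc z -> asum_le (fun j => c j * z ^+ j * (cutoff n (normc z ^+ 2))%:C) B.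
Proof.
move=> hc; pose r : R := Num.sqrt (1 - n.+1%:R^-1).
have n1 : n.+1%:R^-1 <= 1 :> R by rewrite invf_le1 ?ltr0n // ler1n.
have n0 : 0 < n.+1%:R^-1 :> R by rewrite invr_gt0 ltr0n.
have r0 : 0 <= 1 - n.+1%:R^-1 :> R by rewrite subr_ge0.
have r1 : 0 <= r < 1.
  have h1 : 1 - n.+1%:R^-1 < 1 :> R by rewrite gtrBl.
  apply/andP; split; first exact: sqrtr_ge0.
  by rewrite -[X in _ < X]sqrtr1 ltr_sqrt.
have [B hB] := cps_wsum hc r1.
have B0 : 0 <= B by have := hB 0%N; rewrite big_ord0.
pose M : R := n.+1%:R ^+ m; have M0 : 0 <= M by rewrite exprn_ge0.
have cM t : `|cutoff n t| <= M by have /andP[h1 h2] := cutoff_bound n t; rewrite ger0_norm.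
exists (M * (B + 1)) => [t|z zd].
  by apply: le_trans (cM t) _; rewrite ler_peMr // lerDr.
have [/= c0|c0] := eqVneq (cutoff n (normc z ^+ 2)) 0.
  move=> k; rewrite big1; first by rewrite mulr_ge0 // addr_ge0.
  by move=> j _; rewrite c0 mulr0 (normc_nng (lexx 0)).
have zr : normc z <= r.
  move: c0; rewrite /cutoff /annulus indicE; case E: (_ \in _); last by rewrite mulr0 eqxx.
  move/set_mem: E; rewrite /= in_itv /= => /andP[_ h] _.
  by rewrite -[X in X <= _](ger0_norm (normc_ge0 z)) -sqrtr_sqr ler_wsqrtr.
have h := asum_wle zr hB.
move=> k; under eq_bigr do rewrite normcM mulrC normc_real.
rewrite -mulr_sumr; apply: ler_pM => //.
  by apply: sumr_ge0 => j _; exact: normc_ge0.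
by apply: le_trans (h k) _; rewrite lerDl.
Qed.

Lemma cutoff_eq w : w != 0 -> (normc w ^+ 2) `^ (- m%:R) = (normc w ^+ 2) ^- m.
Proof. by move=> w0; rewrite powRN powR_mulrn // exprn_ge0 // normc_ge0. Qed.

Lemma pole_moment k :
  cto (fun n => (\int[mu alpha beta]_(z in disc) ((normc z ^+ 2) ^+ k * cutoff n (normc z ^+ 2)))%:C)
      ((Beta (alpha + 1) (k%:R + (beta0 + 1)) / Beta (alpha + 1) (beta + 1))%:C : R[i]).
Proof.
have mD := @measurable_disc R.
have bk : beta + (k%:R - m%:R) = beta0 + k%:R by rewrite /beta addrACA subrr addr0 // addrC.
have bk1 : -1 < beta + (k%:R - m%:R) by rewrite bk (lt_le_trans be0) // lerDl.
have mm := mu_moment al1 be1 bk1.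
pose G z : R := (normc z ^+ 2) `^ (k%:R - m%:R).
have mG : measurable_fun setT G.
  by apply: (@measurable_radial R (fun t => t `^ _)); exact: measurable_powR.
have G0 z : 0 <= G z by exact: powR_ge0.
have iG : (mu alpha beta).-integrable disc (EFin \o G).
  apply/integrableP; split; first by apply/measurable_EFinP; exact: measurable_funTS mG.
  under eq_integral do rewrite /= ger0_norm ?G0 //.
  by rewrite mm ltry.
have GE z n : normc z ^+ 2 != 0 -> G z * annulus n (normc z ^+ 2) = (normc z ^+ 2) ^+ k * cutoff n (normc z ^+ 2).
  move=> z0; have t0 : 0 < normc z ^+ 2 by rewrite lt_neqAle eq_sym z0 exprn_ge0 // normc_ge0.
  by rewrite /G /cutoff powRD ?z0 ?implybT // powR_mulrn ?ltW // mulrA.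
have GE' z n : (normc z ^+ 2) ^+ k * cutoff n (normc z ^+ 2) = G z * annulus n (normc z ^+ 2).
  have [z0|/GE//] := eqVneq (normc z ^+ 2) 0.
  by rewrite z0 /cutoff annulus0 !mulr0.
have [] := @cintegral_cvg _ _ _ (mu alpha beta) disc mD
  (fun n z => (G z)%:C * (annulus n (normc z ^+ 2))%:C) (fun z => (G z)%:C * ((z != 0)%:R : R)%:C) G.
- move=> n; under eq_fun do rewrite -real_complexM; apply: measurable_creal; apply: measurable_funTS.
  by apply: measurable_funM => //; apply: measurable_radial; exact: measurable_annulus.
- by move=> z zd; exact: cto_annulus.
- exact: iG.
- move=> n z _; rewrite -real_complexM normc_real normrM ger0_norm ?G0 //.
  by rewrite ler_piMr ?G0 // ger0_norm; case/andP: (annulus01 n (normc z ^+ 2)).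
move=> _ _.
rewrite [X in cto _ X](_ : _ = (Beta (alpha + 1) (k%:R + (beta0 + 1)) / Beta (alpha + 1) (beta + 1))%:C).
  apply: cto_eq => n; under eq_cintegral do rewrite -real_complexM -GE'.
  exact: Rintegral_real.
rewrite (@eq_cintegral_pdisc _ _ _ (fun z => (G z)%:C)).
- rewrite Rintegral_real /Rintegral /G mm /= bk addrA [X in Beta _ (X + 1)]addrC; exact: erefl.
- apply: measurable_cM; last exact: measurable_neq0.
  by apply: measurable_creal; exact: measurable_funTS mG.
- by apply: measurable_creal; exact: measurable_funTS mG.
by move=> z; rewrite inE => -[_ /eqP ->]; rewrite mulr1.
Qed.

(** The coefficients of the kernel are the reciprocals of the moments that [coef_extract]
    produces. *)
Lemma pcoef_pole c g k : cps c -> measurable_fun disc g -> wint alpha beta0 m g ->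
  {in pdisc, forall z, g z = pser c z / z ^+ m} ->
  (kconst alpha beta0 m)%:C * pcoef alpha beta0 m g k = c k.
Proof.
move=> hc mg ig gc; have mD := @measurable_disc R.
pose G w : R[i] := pser c w * ((normc w ^+ 2) `^ (- m%:R))%:C * w^* ^+ k.
have mpow : measurable_fun disc (fun w : R[i] => ((normc w ^+ 2) `^ (- m%:R))%:C).
  apply: measurable_creal; apply: measurable_funTS.
  by apply: (@measurable_radial R (fun t => t `^ _)); exact: measurable_powR.
have mck n : measurable_fun disc (fun w : R[i] => w^* ^+ n).
  by apply: measurable_cX; apply: measurable_cconj; exact: measurable_id.
have mG : measurable_fun disc G.
  by apply: measurable_cM (mck k); apply: measurable_cM mpow; exact: measurable_pser.
have Gg w : disc w -> w != 0 -> G w = g w * (w^* ^+ k / w^* ^+ m).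
  move=> wd w0; rewrite gc; last by rewrite inE; split => //; exact/eqP.
  rewrite /G cutoff_eq //.
  rewrite inv_normc_pow //.
  by rewrite -!mulrA; congr (_ * (_ * _)); rewrite mulrC.
have nG w : disc w -> w != 0 -> normc (G w) <= normc (g w) * normc w ^- m.
  move=> wd w0; rewrite Gg // normcM ler_wpM2l ?normc_ge0 // normcM normcV !normcX !normc_conj.
  rewrite ler_piMl ?invr_ge0 ?exprn_ge0 ?normc_ge0 // exprn_ile1 ?normc_ge0 //; exact: ltW.
have man n : measurable_fun disc (fun w : R[i] => (annulus n (normc w ^+ 2))%:C).
  apply: measurable_creal; apply: measurable_funTS.
  by apply: measurable_radial; exact: measurable_annulus.
have [] := @cintegral_cvg _ _ _ (mu alpha beta) disc mD
  (fun n w => G w * (annulus n (normc w ^+ 2))%:C) (fun w => G w * ((w != 0)%:R : R)%:C)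
  (fun w => normc (g w) * normc w ^- m).
- by move=> n; apply: measurable_cM.
- by move=> w wd; exact: cto_annulus.
- exact: ig.
- move=> n w wd; have [->|w0] := eqVneq w 0.
    rewrite (normc_nng (lexx 0)) expr0n annulus0 mulr0 (normc_nng (lexx 0)) mulr_ge0 ?normc_ge0 // invr_ge0 exprn_ge0.
  apply: le_trans (nG w wd w0); rewrite normcM normc_real ler_piMr ?normc_ge0 //.
  by rewrite ger0_norm; case/andP: (annulus01 n (normc w ^+ 2)).
move=> _ _ lim1.
have ex n : cintegral (mu alpha beta) disc (fun w => G w * (annulus n (normc w ^+ 2))%:C) =
   c k * (\int[mu alpha beta]_(z in disc) ((normc z ^+ 2) ^+ k * cutoff n (normc z ^+ 2)))%:C.
  have [B hB1 hB2] := cutoff_asum n hc.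
  rewrite -(@coef_extract R alpha beta c k (cutoff n) B al1 be1 (measurable_cutoff n) hB2 (fun t _ => hB1 t)).
  apply: eq_cintegral => z; rewrite inE => zd.
  have [B' hB'] := pser_asum hc zd.
  under eq_csum do rewrite mulrC.
  rewrite (csumZ _ hB') /G /cutoff -/(pser c z) real_complexM; ring.
have lim2 := ctoZ (c k) (pole_moment k).
have e := cto_unique lim1 (cto_eq (fun n => esym (ex n)) lim2).
rewrite /pcoef.
have -> : cintegral (mu alpha beta) disc (fun w => g w * (w^* ^+ k / w^* ^+ m)) =
   cintegral (mu alpha beta) disc (fun w => G w * ((w != 0)%:R : R)%:C).
  apply: eq_cintegral_pdisc.
  - apply: measurable_cM => //; apply: measurable_cM => //; exact: measurable_cV.
  - by apply: measurable_cM => //; exact: measurable_neq0.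
  move=> w; rewrite inE => -[wd /eqP w0]; rewrite Gg // w0 mulr1; exact: erefl.
rewrite e /dcoef /kconst mulrCA mulrA mulrCA -!real_complexM.
have p1 (x : R) : -1 < x -> 0 < x + 1 by rewrite -ltrBlDr sub0r.
have B1 : Beta (alpha + 1) (k%:R + (beta0 + 1)) != 0.
  by rewrite gt_eqF // Beta_gt0 ?p1 // ltr_wpDl ?p1.
have B2 : Beta (alpha + 1) (beta + 1) != 0 by rewrite gt_eqF // Beta_gt0 ?p1.
have B3 : Beta (alpha + 1) (beta0 + 1) != 0 by rewrite gt_eqF // Beta_gt0 ?p1.
rewrite -[RHS]mulr1; congr (_ * _%:C); rewrite -/beta.
move: B1 B2 B3; move: (Beta (alpha + 1) (k%:R + (beta0 + 1))) (Beta (alpha + 1) (beta + 1)) (Beta (alpha + 1) (beta0 + 1)).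
by move=> x1 x2 x3 B1 B2 B3; field; rewrite B1 B2 B3.
Qed.

Lemma bergman_proj_id c g : cps c -> measurable_fun disc g -> wint alpha beta0 m g ->
  {in pdisc, forall z, g z = pser c z / z ^+ m} ->
  {in pdisc, bergman_proj alpha beta g =1 g}.
Proof.
move=> hc mg ig gc z zd; rewrite gc // .
have zd' : disc z by move: zd; rewrite inE => -[].
have [hp _ -> // _] := proj_series al1 be01 mg ig.
rewrite mulrAC; congr (_ / _).
rewrite -(pserZ _ hp zd'); apply: eq_csum => k.
by rewrite (pcoef_pole k hc mg ig gc).
Qed.

End reproducing.

(** * Necessity: radial test functions *)

Section beta_asymptotics.
Context {R : realType}.
Implicit Types (a b x y e : R) (z : R[i]).

Lemma Beta_anti x y y' : 0 < x -> 0 < y -> y <= y' -> Beta x y' <= Beta x y.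
Proof.
move=> x0 y0 yy; have y'0 : 0 < y' by exact: lt_le_trans yy.
rewrite -lee_fin !EFin_Beta //; apply: ge0_le_integral => //.
- by move=> t _; rewrite lee_fin mulr_ge0 ?powR_ge0.
- by apply/measurable_EFinP; exact: measurable_powR_onem.
- by apply/measurable_EFinP; exact: measurable_powR_onem.
move=> t; rewrite /= in_itv /= => /andP[t0 t1]; rewrite lee_fin ler_wpM2l ?powR_ge0 //.
apply: ger_powR; last by rewrite lerD2r.
by rewrite subr_gt0 t1 gerBl ltW.
Qed.

(** The form of [BetaS] near the pole of the beta function. *)
Lemma recursion_bounds x e u v w q : 0 < x -> 0 < e -> e <= 1 -> 0 < u -> u <= v -> v <= q ->
  (x + e) * v = e * w -> x * u / e <= w /\ w <= (x + 1) * q / e.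
Proof.
move=> x0 e0 e1 u0 uv vq h; rewrite ler_pdivrMr // ler_pdivlMr // [w * e]mulrC -h; split.
  apply: ler_pM; [exact: ltW|exact: ltW|by rewrite lerDl ltW|exact: uv].
have v0 : 0 <= v by apply: le_trans uv; exact: ltW.
by apply: ler_pM; [rewrite addr_ge0 // ltW|exact: v0|rewrite lerD2l|exact: vq].
Qed.

(** The recursion [BetaS] isolates the simple pole at [e = 0]. *)
Lemma Beta_bounds x : 0 < x -> exists c C : R, [/\ 0 < c, 0 < C &
  forall e, 0 < e -> e <= 1 -> c / e <= Beta x e /\ Beta x e <= C / e].
Proof.
move=> x0; exists (x * Beta x 2), ((x + 1) * Beta x 1).
have B1 := Beta_gt0 x0 (ltr01 : (0 : R) < 1).
have B2 := Beta_gt0 x0 (ltr0n R 2 : (0 : R) < 2).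
split; [exact: mulr_gt0|exact: mulr_gt0 (addr_gt0 x0 ltr01) B1|].
move=> e e0 e1; have e10 : 0 < e + 1 by rewrite addr_gt0.
have h := BetaS x0 e0; rewrite BetaC in h; rewrite [Beta e x]BetaC in h.
have h1 : Beta x 2 <= Beta x (e + 1).
  by apply: (Beta_anti x0 e10); rewrite -(@natr1 R 1) lerD2r.
have h2 : Beta x (e + 1) <= Beta x 1.
  by apply: (Beta_anti x0 ltr01); rewrite lerDr ltW.
exact: (recursion_bounds x0 e0 e1 B2 h1 h2 h).
Qed.

Lemma mu_rpow a b x y : -1 < a -> -1 < b -> -1 < a + y -> -1 < b + x ->
  (\int[mu a b]_(z in disc) (rpow x y z)%:E =
    (Beta (a + y + 1) (b + x + 1) / Beta (a + 1) (b + 1))%:E)%E.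
Proof.
move=> a1 b1 ay bx.
have e := @mu_shift R a b x y (fun=> 1%E) a1 b1 ay bx (measurable_cst _) (fun _ _ => lee01).
have e1 := integral_cst (mu (a + y) (b + x)) (@measurable_disc R) 1%E.
have e2 := etrans e1 (etrans (mul1e _) (mu_disc ay bx)).
apply: (etrans _ (etrans e (etrans (congr1 (fun v => _ * v)%E e2) (mule1 _)))).
by apply: eq_integral => z _; exact: (esym (mul1e _)).
Qed.

Lemma rpow_anti x y x' y' z : pdisc z -> x <= x' -> y <= y' -> rpow x' y' z <= rpow x y z.
Proof.
move=> zd xx yy; have r0 := rho_pdisc zd; have r1 := rho_disc (pdisc_disc zd).
rewrite /rpow; apply: ler_pM; rewrite ?powR_ge0 //; apply: ger_powR => //.
  by rewrite r0 -subr_ge0 ltW.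
by rewrite r1 gerBl rho_ge0.
Qed.

Lemma Beta_blowup x A : 0 < x -> exists e, [/\ 0 < e, e <= 1 & A < Beta x e].
Proof.
move=> x0; have [c [C [c0 C0 hc]]] := Beta_bounds x0.
pose e : R := Num.min 1 (c / (`|A| + 1)).
have A0 : 0 < `|A| + 1 by rewrite ltr_pwDr // ltr01.
have e0 : 0 < e by rewrite lt_min ltr01 divr_gt0.
have e1 : e <= 1 by rewrite ge_min lexx.
exists e; split=> //; apply: lt_le_trans (hc e e0 e1).1.
rewrite ltr_pdivlMr //; apply: (@le_lt_trans _ _ (`|A| * e)).
  by rewrite ler_wpM2r ?ler_norm // ltW.
apply: (@lt_le_trans _ _ ((`|A| + 1) * e)); first by rewrite ltr_pM2r // ltrDl.
by rewrite mulrC -ler_pdivlMr // ge_min lexx orbT.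
Qed.

(** Radial powers beyond the critical exponents are not integrable, as [Beta] blows
    up at 0. *)
Lemma rpow_integrable a b x y : -1 < a -> -1 < b ->
  (\int[mu a b]_(z in disc) (rpow x y z)%:E < +oo)%E -> -1 < b + x /\ -1 < a + y.
Proof.
move=> a1 b1 fin.
have B0 : 0 < Beta (a + 1) (b + 1) by rewrite Beta_gt0 // -ltrBlDr sub0r.
have r0 z : disc z -> (0 <= (rpow x y z)%:E)%E by rewrite lee_fin rpow_ge0.
have [A hA] : exists A : R, (\int[mu a b]_(z in disc) (rpow x y z)%:E = A%:E)%E.
  have : (\int[mu a b]_(z in disc) (rpow x y z)%:E)%E \is a fin_num.
    by rewrite ge0_fin_numE // integral_ge0.
  by move/fineK <-; exists (fine (\int[mu a b]_(z in disc) (rpow x y z)%:E)%E).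
have key x' y' : x <= x' -> y <= y' -> -1 < b + x' -> -1 < a + y' ->
    Beta (a + y' + 1) (b + x' + 1) <= A * Beta (a + 1) (b + 1).
  move=> xx yy bx ay; rewrite -ler_pdivrMr // -lee_fin -mu_rpow // -hA.
  have mr u v : measurable_fun disc (fun z : R[i] => (rpow u v z)%:E).
    by apply/measurable_EFinP; exact: measurable_rpow.
  apply: le_integral_mu_pdisc => //.
  - by move=> z _; rewrite lee_fin rpow_ge0.
  by move=> z zd; rewrite lee_fin rpow_anti.
split; rewrite ltNge; apply/negP => h.
  pose y' := Num.max y 0; have ay : -1 < a + y'.
    by apply: lt_le_trans a1 _; rewrite lerDl le_max lexx orbT.
  have ay0 : 0 < a + y' + 1 by rewrite -ltrBlDr sub0r.
  have [e [e0 e1 he]] := Beta_blowup (A * Beta (a + 1) (b + 1)) ay0.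
  have := key (- 1 - b + e) y' _ _ _ ay.
  rewrite (_ : b + (- 1 - b + e) + 1 = e); last by ring.
  rewrite le_max lexx /= (_ : b + (- 1 - b + e) = -1 + e); last by ring.
  have xe : x <= - 1 - b + e by clear - h e0; lra.
  by move=> /(_ xe isT); rewrite ltrDl e0 leNgt he => /(_ isT).
pose x' := Num.max x 0; have bx : -1 < b + x'.
  by apply: lt_le_trans b1 _; rewrite lerDl le_max lexx orbT.
have bx0 : 0 < b + x' + 1 by rewrite -ltrBlDr sub0r.
have [e [e0 e1 he]] := Beta_blowup (A * Beta (a + 1) (b + 1)) bx0.
have := key x' (- 1 - a + e) _ _ bx.
rewrite BetaC (_ : a + (- 1 - a + e) + 1 = e); last by ring.
rewrite le_max lexx /= (_ : a + (- 1 - a + e) = -1 + e); last by ring.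
have xe : y <= - 1 - a + e by clear - h e0; lra.
by move=> /(_ isT xe); rewrite ltrDl e0 leNgt he => /(_ isT).
Qed.

(** The quotient of the two sides is of order [e ^ (1 - p)] as [e] tends to 0. *)
Lemma blowup_order (p c C e0 : R) : 1 < p -> 0 < c -> 0 < e0 ->
  (forall e, 0 < e -> e <= e0 -> (c / e) `^ p <= C / e) -> False.
Proof.
move=> p1 c0 e00 h.
have p0 : 0 < p - 1 by rewrite subr_gt0.
pose K : R := (`|C| / c + 1) `^ (p - 1)^-1.
have K0 : 0 < K by rewrite powR_gt0 // ltr_pwDr // divr_ge0 // ltW.
pose e := Num.min e0 (c / K).
have e_0 : 0 < e by rewrite lt_min e00 divr_gt0.
have ee : e <= e0 by rewrite ge_min lexx.
have eK : K <= c / e by rewrite ler_pdivlMr // mulrC -ler_pdivlMr // ge_min lexx orbT.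
have ce : 0 < c / e by rewrite divr_gt0.
have := h e e_0 ee; rewrite -[p in _ `^ p](subrK 1) powRD; last by apply/implyP => _; rewrite gt_eqF.
rewrite powRr1 ?(ltW ce) // mulrA ler_pM2r ?invr_gt0 // -ler_pdivlMr //.
apply/negP; rewrite -ltNge; apply: (@lt_le_trans _ _ (K `^ (p - 1))); last first.
  by apply: ge0_ler_powR => //; rewrite ?nnegrE ltW.
rewrite /K -powRrM mulVf ?gt_eqF // powRr1; last by rewrite addr_ge0 // divr_ge0 // ltW.
apply: (@le_lt_trans _ _ (`|C| / c)); last by rewrite ltrDl.
by rewrite ler_wpM2r ?ler_norm // invr_ge0 ltW.
Qed.

End beta_asymptotics.

Section arithmetic.
Context {R : realType}.

Lemma bound_rearrange (k i N B C X : R) : 0 < k -> 0 < N -> 0 < B ->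
  k * i * N <= C * (X / B) -> i <= C / (k * N * B) * X.
Proof.
move=> k0 N0 B0; rewrite mulrA ler_pdivlMr // => h.
rewrite mulrAC ler_pdivlMr ?mulr_gt0 //; apply: le_trans h.
by rewrite le_eqVlt; apply/orP; left; apply/eqP; ring.
Qed.

Lemma half_subr (x : R) : x - x / 2 = x / 2.
Proof. by field. Qed.

Lemma gtN1_subr (u v : R) : v < u + 1 -> -1 < u - v.
Proof. by move=> h; rewrite ltrBrDr addrC ltrBlDr. Qed.

Lemma Beta1_gt0 (u v : R) : -1 < u -> -1 < v -> 0 < Beta (u + 1) (v + 1).
Proof. by move=> hu hv; apply: Beta_gt0; rewrite -ltrBlDr sub0r. Qed.

End arithmetic.

Section necessity.
Context {R : realType}.
Implicit Types (z w xi : R[i]) (f g : R[i] -> R[i]) (x y : R).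
Context (a b alpha beta0 p : R) (m : nat).
Hypotheses (a1 : -1 < a) (b1 : -1 < b) (al1 : -1 < alpha) (be01 : -1 < beta0 <= 0) (p1 : 1 <= p).
Let beta := beta0 + m%:R.
Let be0 : -1 < beta0. Proof. by case/andP: be01. Qed.
Let be1 : -1 < beta. Proof. by rewrite /beta (lt_le_trans be0) // lerDl. Qed.
Let x0 : 0 < alpha + 1. Proof. by rewrite -ltrBlDr sub0r. Qed.
Let y0 : 0 < beta0 + 1. Proof. by rewrite -ltrBlDr sub0r. Qed.

(** Near 0 the kernel is comparable to its singular factor. *)
Lemma wint_defined f : measurable_fun disc f ->
  (forall z, pdisc z -> cintegrable (mu alpha beta) disc (kernel_integrand alpha beta f z)) ->
  wint alpha beta0 m f.
Proof.
move=> mf hf.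
pose D := pser (fun k => (dcoef (alpha + 1) (beta0 + 1) k)%:C : R[i]).
have hd := cps_dcoef x0 y0.
have D0 : D 0 = 1 by rewrite /D (pser0 hd) dcoef0.
have h12 : 0 < (2^-1 : R) by rewrite invr_gt0.
have [d d0 hD] := cdiff_cts (pser_cdiff hd disc0) h12.
pose s : R := Num.min 2^-1 (d / 2).
have s0 : 0 < s by rewrite lt_min h12 divr_gt0.
have s1 : s <= 2^-1 by rewrite ge_min lexx.
have sd : s <= d / 2 by rewrite ge_min lexx orbT.
have ns : normc (s%:C : R[i]) = s by rewrite normc_nng // ltW.
have sdisc : disc (s%:C : R[i]) by move: ns; rewrite /disc /= => ->; apply: le_lt_trans s1 _; rewrite invf_lt1 ?ltr1n.
have spd : pdisc (s%:C : R[i]).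
  by split=> //; apply/eqP; rewrite -normc_gt0 ns.
have [mi ii] := (@cintegrableP _ _ _ (mu alpha beta) disc (@measurable_disc R) _).1 (hf _ spd).
have k0 := @kconst_gt0 R alpha beta0 m al1 be0.
have [k k_0 kE] : exists2 k, 0 < k & kconst alpha beta0 m = k by exists (kconst alpha beta0 m).
pose A := k / s ^+ m / 2.
have A0 : 0 < A by apply: divr_gt0; [apply: divr_gt0; [exact: k_0|exact: exprn_gt0]|exact: ltr0n].
have main w : disc w -> normc (f w) * normc w ^- m <= A^-1 * normc (kernel_integrand alpha beta f s%:C w).
  move=> wd; rewrite ler_pdivlMl // (kernelE _ _ al1 be01 sdisc wd) normcM.
  rewrite [A * _]mulrCA; apply: ler_wpM2l; first exact: normc_ge0.
  have zw := mulr_conj_disc sdisc wd.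
  rewrite /kfun normcM [normc (_ / _ ^+ m)]normcM normcV normcX normcM normc_conj ns kE (normc_nng (ltW k_0)).
  have h2 : 2^-1 <= normc (D (s%:C * w^*)).
    have : normc (D (0 + s%:C * w^*) - D 0) <= 2^-1.
      apply: hD; rewrite normcM normc_conj ns; apply: (@le_lt_trans _ _ s).
        by rewrite ler_piMr ?(ltW s0) // ltW.
      by apply: le_lt_trans sd _; rewrite gtr_pMr // invf_lt1 ?ltr1n.
    rewrite add0r D0 => h; have := le_normcD (1 - D (s%:C * w^*)) (D (s%:C * w^*)).
    rewrite subrK (normc_nng ler01) normcB => t.
    have := le_trans t (lerD h (lexx _)); rewrite -lerBlDl; apply: le_trans.
    by rewrite [X in X - _](splitr 1) div1r addrK.
  rewrite exprMn invfM /A -!mulrA ler_wpM2l ?(ltW k_0) //.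
  rewrite ler_wpM2l ?invr_ge0 ?exprn_ge0 ?(ltW s0) // mulrC.
  by rewrite ler_wpM2l // invr_ge0 exprn_ge0 // normc_ge0.
have mD := @measurable_disc R.
rewrite /wint; apply: (le_integrable mD _ _ (integrableZl mD A^-1 ii)).
  apply/measurable_EFinP; apply: measurable_funM; first exact: measurable_cnorm.
  rewrite (_ : (fun w => _) = (fun w => normc ((w ^+ m)^-1))).
    by apply: measurable_cnorm; apply: measurable_cV; apply: measurable_cX; exact: measurable_id.
  by apply/funext => w; rewrite normcV normcX.
move=> w wd; rewrite /= lee_fin ger0_norm; last first.
  by rewrite mulr_ge0 ?normc_ge0 // invr_ge0 exprn_ge0 // normc_ge0.
by apply: le_trans (main w wd) _; exact: ler_norm.
Qed.

(** On the test functions [rtest x y] the projection is a multiple of [z ^- m]. *)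
Definition rtest x y w : R[i] := (rpow x y w)%:C / w ^+ m.

Lemma measurable_rtest x y : measurable_fun disc (rtest x y).
Proof.
apply: measurable_cM; first by apply: measurable_creal; exact: measurable_rpow.
by apply: measurable_cV; apply: measurable_cX; exact: measurable_id.
Qed.

Lemma normc_rtest x y w : pdisc w -> normc (rtest x y w) = rpow (x - m%:R / 2) y w.
Proof.
move=> wd; rewrite /rtest normcM normcV normcX -rpow_normc (normc_nng (rpow_ge0 _ _ _)).
by rewrite rpowD // addr0.
Qed.

Lemma Ip_rtest x y :
  Ip a b p (rtest x y) = (\int[mu a b]_(z in disc) (rpow ((x - m%:R / 2) * p) (y * p) z)%:E)%E.
Proof.
apply: eq_integral_pdisc.
- apply: (measurableT_comp (@measurable_powR R _)); apply: measurable_cnorm.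
  exact: measurable_rtest.
- exact: measurable_rpow.
by move=> z; rewrite inE => zd /=; rewrite normc_rtest // rpowX.
Qed.

Lemma wint_rtest x y : wint alpha beta0 m (rtest x y) -> -1 < beta + (x - m%:R) /\ -1 < alpha + y.
Proof.
move=> /integrableP[mi hi]; apply: rpow_integrable => //.
rewrite (@eq_integral_pdisc R alpha beta _ (fun w => `|normc (rtest x y w) * normc w ^- m|)).
- exact: hi.
- exact: measurable_rpow.
- by apply: measurableT_comp => //; exact/measurable_EFinP.
move=> z; rewrite inE => zd; rewrite normc_rtest // -rpow_normc.
rewrite (ger0_norm (mulr_ge0 (rpow_ge0 _ _ _) (rpow_ge0 _ _ _))) rpowD // addr0.
by congr (rpow _ _ _); field.
Qed.

Lemma proj_rtest x y : wint alpha beta0 m (rtest x y) -> forall z, disc z ->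
  bergman_proj alpha beta (rtest x y) z = 
  (kconst alpha beta0 m * (Beta (alpha + y + 1) (beta + (x - m%:R) + 1) / Beta (alpha + 1) (beta + 1)))%:C / z ^+ m.
Proof.
move=> wi z zd; have [bx ay] := wint_rtest wi.
have mt := measurable_rtest x y.
have [hc _ -> // _] := proj_series al1 be01 mt wi.
pose phi (t : R) := t `^ (x - m%:R) * (1 - t) `^ y.
have mphi : measurable_fun setT phi by exact: measurable_powR_onem.
have pE k : pcoef alpha beta0 m (rtest x y) k = (dcoef (alpha + 1) (beta0 + 1) k)%:C *
   cintegral (mu alpha beta) disc (fun w => w ^+ 0 * w^* ^+ k * (phi (normc w ^+ 2))%:C).
  congr (_ * _); apply: eq_cintegral_pdisc.
  - apply: measurable_cM; first exact: mt.
    by apply: measurable_cM; [|apply: measurable_cV]; apply: measurable_cX;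
      apply: measurable_cconj; exact: measurable_id.
  - by apply: measurable_funTS; exact: measurable_monomial.
  move=> w; rewrite inE => wd; have [_ /eqP w0] := wd.
  rewrite expr0 mul1r /rtest.
  have -> : (phi (normc w ^+ 2))%:C = (rpow x y w)%:C / (w ^+ m * w^* ^+ m) :> R[i].
    have -> : phi (normc w ^+ 2) = rpow x y w * rpow (- m%:R) 0 w by rewrite rpowD // addr0.
    rewrite /rpow powRr0 mulr1 /rho cutoff_eq // real_complexM; congr (_ * _).
    by rewrite inv_normc_pow // invfM.
  by rewrite invfM; ring.
have fin : (\int[mu alpha beta]_(z in disc) (rpow (x - m%:R) y z)%:E < +oo)%E.
  by rewrite mu_rpow // ltry.
have it k : cintegrable (mu alpha beta) disc (fun w => w ^+ 0 * w^* ^+ k * (phi (normc w ^+ 2))%:C).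
  apply: (@cintegrable_le _ _ _ _ _ (@measurable_disc R) _ (rpow (x - m%:R) y)).
  - by apply: measurable_funTS; exact: measurable_monomial.
  - apply/integrableP; split; first by apply/measurable_EFinP; exact: measurable_rpow.
    apply: le_lt_trans fin; rewrite le_eqVlt; apply/orP; left; apply/eqP; apply: eq_integral => w _.
    by rewrite /= ger0_norm ?rpow_ge0.
  move=> w wd; rewrite expr0 mul1r normcM normcX normc_conj normc_real.
  rewrite ger0_norm; last by rewrite mulr_ge0 ?powR_ge0.
  by rewrite ler_piMl ?mulr_ge0 ?powR_ge0 // exprn_ile1 ?normc_ge0 //; exact: ltW.
have pk k : pcoef alpha beta0 m (rtest x y) k.+1 = 0.
  by rewrite pE (cintegral_monomial_neq mphi (it k.+1)) // mulr0.
have -> : pser (pcoef alpha beta0 m (rtest x y)) z = pcoef alpha beta0 m (rtest x y) 0.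
  rewrite (pser_shift hc zd) [X in _ + z * X](_ : _ = 0) ?mulr0 ?addr0 //.
  apply: eq0_normc; apply/eqP; rewrite eq_le normc_ge0 andbT; apply: csum_le => n.
  rewrite big1 // => k _; rewrite pk mul0r; exact: (normc_nng (lexx 0)).
rewrite pE dcoef0 // mul1r.
have := @cintegral_monomial_eq R alpha beta 0 phi; under eq_cintegral do rewrite expr0.
move=> ->; rewrite mulrAC -real_complexM.
apply: (congr1 (fun v => (kconst alpha beta0 m * v)%:C / z ^+ m)).
apply: EFin_inj; rewrite -mu_rpow // /Rintegral fineK.
  by apply: eq_integral => w _; rewrite expr0 mul1r; exact: erefl.
rewrite ge0_fin_numE; last by apply: integral_ge0 => w _; rewrite lee_fin expr0 mul1r mulr_ge0 ?powR_ge0.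
apply: le_lt_trans fin; rewrite le_eqVlt; apply/orP; left; apply/eqP.
by apply: eq_integral => w _; rewrite expr0 mul1r; exact: erefl.
Qed.

Section consequences.
Hypothesis hdef : forall f z, Lp a b p f -> pdisc z ->
  cintegrable (mu alpha beta) disc (kernel_integrand alpha beta f z).
Hypothesis hbd : exists C : R, forall f, Lp a b p f ->
  (norm_p a b p (bergman_proj alpha beta f) <= C%:E * norm_p a b p f)%E.

Let pp : 0 < p. Proof. exact: lt_le_trans p1. Qed.

Lemma Lp_rtest x y : -1 < b + (x - m%:R / 2) * p -> -1 < a + y * p -> Lp a b p (rtest x y).
Proof.
move=> h1 h2; split; first exact: measurable_rtest.
by rewrite norm_p_lty // Ip_rtest mu_rpow // ltry.
Qed.

Lemma Lp_admissible x y : -1 < b + (x - m%:R / 2) * p -> -1 < a + y * p ->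
  -1 < beta + (x - m%:R) /\ -1 < alpha + y.
Proof.
move=> h1 h2; have Lf := Lp_rtest h1 h2; apply: wint_rtest.
by apply: wint_defined; [exact: measurable_rtest|move=> z zd; exact: hdef].
Qed.

Lemma Ip_bound : exists2 C : R, 0 <= C & forall f, Lp a b p f ->
  (Ip a b p (bergman_proj alpha beta f) <= C%:E * Ip a b p f)%E.
Proof.
have [C hC] := hbd; exists (`|C| `^ p); first exact: powR_ge0.
move=> f Lf; have := hC f Lf => h.
have h' : (norm_p a b p (bergman_proj alpha beta f) <= `|C|%:E * norm_p a b p f)%E.
  by apply: le_trans h _; apply: lee_wpmul2r; rewrite ?poweR_ge0 // lee_fin ler_norm.
have N0 g : (0 <= norm_p a b p g)%E by exact: poweR_ge0.
have NE g : (norm_p a b p g `^ p = Ip a b p g)%E.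
  by rewrite /norm_p -poweRrM mulVf ?gt_eqF // poweRe1 //; exact: Ip_ge0.
have c0 : (0 <= `|C|%:E)%E by rewrite lee_fin.
have := gt0_ler_poweR (ltW pp) _ _ h'.
rewrite (poweRM _ c0 (N0 f)) poweR_EFin !NE.
apply; first by rewrite in_itv /= leey andbT poweR_ge0.
by rewrite in_itv /= leey andbT; apply: mule_ge0; [rewrite lee_fin|exact: poweR_ge0].
Qed.

(** The image of one test function is a nonzero multiple of [z ^- m]; the test function
    used here has the modulus of [z ^+ m]. *)
Lemma pole_Lp : -1 < b - m%:R / 2 * p.
Proof.
have hx : -1 < b + (m%:R - m%:R / 2) * p.
  by rewrite half_subr; apply: lt_le_trans b1 _; rewrite lerDl mulr_ge0 ?(ltW pp).
have hy : -1 < a + 0 * p by rewrite mul0r addr0.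
have Lf := Lp_rtest hx hy; have [bx ay] := Lp_admissible hx hy.
have wi : wint alpha beta0 m (rtest m%:R 0).
  by apply: wint_defined; [exact: measurable_rtest|move=> z zd; exact: hdef].
have [C C0 hC] := Ip_bound.
have fin : (Ip a b p (bergman_proj alpha beta (rtest m%:R 0)) < +oo)%E.
  apply: le_lt_trans (hC _ Lf) _; apply: lte_mul_pinfty; rewrite ?lee_fin //.
  by rewrite -norm_p_lty //; exact: Lf.2.
have [] := @rpow_integrable R a b (- (m%:R / 2) * p) 0 a1 b1; last by rewrite mulNr.
pose K := kconst alpha beta0 m * (Beta (alpha + 0 + 1) (beta + (m%:R - m%:R) + 1) / Beta (alpha + 1) (beta + 1)).
have K0 : 0 < K.
  apply: mulr_gt0; first exact: kconst_gt0.
  by apply: divr_gt0; exact: Beta1_gt0.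
have e z : disc z -> normc (bergman_proj alpha beta (rtest m%:R 0) z) `^ p = K `^ p * rpow (- (m%:R / 2) * p) 0 z.
  move=> zd; rewrite proj_rtest // normcM normcV normcX -rpow_normc (normc_nng (ltW K0)).
  by rewrite powRM ?rpow_ge0 ?(ltW K0) // rpowX mul0r.
have Kp : 0 < K `^ p by exact: powR_gt0.
move: fin; rewrite /Ip.
rewrite (eq_integral (fun z => (K `^ p)%:E * (rpow (- (m%:R / 2) * p) 0 z)%:E)%E); last first.
  by move=> z; rewrite inE => zd; rewrite e // EFinM.
rewrite (ge0_integralZl_EFin _ (@measurable_disc R)) //; last 3 first.
- by move=> z _; rewrite lee_fin rpow_ge0.
- by apply/measurable_EFinP; exact: measurable_rpow.
- exact: ltW.
rewrite muleC -lte_pdivlMr // => h; apply: lt_le_trans h _.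
by rewrite leey.
Qed.

(** Both sides of the norm bound are explicit on [rtest x y]: its image is a quotient of
    beta values times [z ^- m], and its norm is another such quotient. *)
Lemma rtest_bound : exists2 C : R, 0 <= C & forall x y,
  -1 < b + (x - m%:R / 2) * p -> -1 < a + y * p ->
  Beta (alpha + y + 1) (beta + (x - m%:R) + 1) `^ p <=
  C * Beta (a + y * p + 1) (b + (x - m%:R / 2) * p + 1).
Proof.
have [C C0 hC] := Ip_bound; have hN := pole_Lp.
pose k := kconst alpha beta0 m / Beta (alpha + 1) (beta + 1).
have k0 : 0 < k by apply: divr_gt0; [exact: kconst_gt0|exact: Beta1_gt0].
pose N := Beta (a + 1) (b - m%:R / 2 * p + 1) / Beta (a + 1) (b + 1).
have N0 : 0 < N by apply: divr_gt0; exact: Beta1_gt0.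
pose B := Beta (a + 1) (b + 1); have B0 : 0 < B by exact: Beta1_gt0.
have kp0 : 0 < k `^ p by exact: powR_gt0.
exists (C / (k `^ p * N * B)).
  by apply: divr_ge0 => //; apply: mulr_ge0; [apply: mulr_ge0|]; exact: ltW.
move=> x y hx hy.
have Lf := Lp_rtest hx hy; have [bx ay] := Lp_admissible hx hy.
have wi : wint alpha beta0 m (rtest x y).
  by apply: wint_defined; [exact: measurable_rtest|move=> z zd; exact: hdef].
pose I := Beta (alpha + y + 1) (beta + (x - m%:R) + 1); have I0 : 0 < I by exact: Beta1_gt0.
have e z : disc z -> normc (bergman_proj alpha beta (rtest x y) z) `^ p =
   (k `^ p * I `^ p) * rpow (- (m%:R / 2) * p) 0 z.
  have K0 : 0 <= kconst alpha beta0 m * (I / Beta (alpha + 1) (beta + 1)).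
    apply: mulr_ge0; first exact: ltW (kconst_gt0 m al1 be0).
    by apply: divr_ge0; [exact: ltW|apply: ltW; exact: Beta1_gt0].
  move=> zd; rewrite proj_rtest // normcM normcV normcX -rpow_normc (normc_nng K0).
  rewrite powRM ?rpow_ge0 // rpowX mul0r -(powRM _ (ltW k0) (ltW I0)).
  by congr (_ `^ _ * _); rewrite /k mulrCA mulrC.
have := hC _ Lf; rewrite Ip_rtest mu_rpow // /Ip.
rewrite (eq_integral (fun z => (k `^ p * I `^ p)%:E * (rpow (- (m%:R / 2) * p) 0 z)%:E)%E); last first.
  by move=> z; rewrite inE => zd; rewrite e // EFinM.
rewrite (ge0_integralZl_EFin _ (@measurable_disc R)) //; last 3 first.
- by move=> z _; rewrite lee_fin rpow_ge0.
- by apply/measurable_EFinP; exact: measurable_rpow.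
- by rewrite mulr_ge0 ?powR_ge0.
rewrite mu_rpow ?addr0 ?mulNr // -!EFinM lee_fin -/N -/B -/I.
exact: bound_rearrange.
Qed.

(** Otherwise a test function at the critical exponent is in the domain, but its
    kernel integrals diverge. *)
Lemma cond_b : b + 1 <= p * (beta + 1 - m%:R / 2).
Proof.
rewrite leNgt; apply/negP => h.
have hy : -1 < a + 0 * p by rewrite mul0r addr0.
have hx : -1 < b + (m%:R - beta - 1 - m%:R / 2) * p.
  have -> : b + (m%:R - beta - 1 - m%:R / 2) * p = b - p * (beta + 1 - m%:R / 2) by field.
  exact: gtN1_subr.
have [+ _] := Lp_admissible hx hy.
by rewrite (_ : beta + _ = -1) ?ltxx //; ring.
Qed.

(** As for [cond_b], at the boundary circle instead of the origin. *)
Lemma cond_a : a + 1 <= p * (alpha + 1).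
Proof.
rewrite leNgt; apply/negP => h.
have hx : -1 < b + (m%:R - m%:R / 2) * p.
  by rewrite half_subr; apply: lt_le_trans b1 _; rewrite lerDl mulr_ge0 ?(ltW pp).
have hy : -1 < a + (- alpha - 1) * p.
  have -> : a + (- alpha - 1) * p = a - p * (alpha + 1) by ring.
  exact: gtN1_subr.
have [_] := Lp_admissible hx hy.
by rewrite (_ : alpha + _ = -1) ?ltxx //; ring.
Qed.

(** In the case of equality the norm bound on test functions that approach the critical
    exponent contradicts [blowup_order]. *)
Lemma cond_b_strict : 1 < p -> b + 1 < p * (beta + 1 - m%:R / 2).
Proof.
move=> p2; rewrite lt_neqAle cond_b andbT; apply/eqP => e.
have [C C0 hC] := rtest_bound.
have hy : -1 < a + 0 * p by rewrite mul0r addr0.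
have hy' : -1 < alpha + 0 by rewrite addr0.
have q1 : 0 < alpha + 0 + 1 by rewrite -ltrBlDr sub0r.
have q2 : 0 < a + 0 * p + 1 by rewrite -ltrBlDr sub0r.
have [c [c' [c0 _ hc]]] := Beta_bounds q1.
have [d [D [_ D0 hD]]] := Beta_bounds q2.
have ip : 0 < p^-1 by rewrite invr_gt0.
apply: (@blowup_order R p c (C * (D / p)) p^-1 p2 c0 ip) => s s0 s1.
have sp0 : 0 < p * s by rewrite mulr_gt0.
have sp1 : p * s <= 1 by rewrite mulrC -ler_pdivlMr // div1r.
have s11 : s <= 1 by apply: le_trans s1 _; rewrite invf_le1.
have e1 : b + (m%:R - beta - 1 + s - m%:R / 2) * p = -1 + p * s.
  have -> : b = p * (beta + 1 - m%:R / 2) - 1 by rewrite -e addrK.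
  by field.
have e2 : beta + (m%:R - beta - 1 + s - m%:R) = -1 + s by ring.
have := hC (m%:R - beta - 1 + s) 0; rewrite e1 e2 ltrDl sp0 => /(_ isT hy).
rewrite (_ : -1 + s + 1 = s); last by ring.
rewrite (_ : -1 + p * s + 1 = p * s); last by ring.
move=> h; apply: (@le_trans _ _ (Beta (alpha + 0 + 1) s `^ p)).
  by apply: ge0_ler_powR; [exact: ltW|rewrite nnegrE; apply: divr_ge0; exact: ltW|rewrite nnegrE; apply: ltW; exact: Beta_gt0|exact: (hc s s0 s11).1].
apply: le_trans h _; rewrite -mulrA; apply: ler_wpM2l => //.
apply: le_trans (hD _ sp0 sp1).2 _.
by rewrite invfM mulrA.
Qed.

Lemma cond_a_strict : 1 < p -> a + 1 < p * (alpha + 1).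
Proof.
move=> p2; rewrite lt_neqAle cond_a andbT; apply/eqP => e.
have [C C0 hC] := rtest_bound.
have hx : -1 < b + (m%:R - m%:R / 2) * p.
  by rewrite half_subr; apply: lt_le_trans b1 _; rewrite lerDl mulr_ge0 ?(ltW pp).
have hx' : -1 < beta + (m%:R - m%:R) by rewrite subrr addr0.
have q1 : 0 < beta + (m%:R - m%:R) + 1 by rewrite -ltrBlDr sub0r.
have q2 : 0 < b + (m%:R - m%:R / 2) * p + 1 by rewrite -ltrBlDr sub0r.
have [c [c' [c0 _ hc]]] := Beta_bounds q1.
have [d [D [_ D0 hD]]] := Beta_bounds q2.
have ip : 0 < p^-1 by rewrite invr_gt0.
apply: (@blowup_order R p c (C * (D / p)) p^-1 p2 c0 ip) => s s0 s1.
have sp0 : 0 < p * s by rewrite mulr_gt0.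
have sp1 : p * s <= 1 by rewrite mulrC -ler_pdivlMr // div1r.
have s11 : s <= 1 by apply: le_trans s1 _; rewrite invf_le1.
have e1 : a + (- alpha - 1 + s) * p = -1 + p * s.
  have -> : a = p * (alpha + 1) - 1 by rewrite -e addrK.
  by ring.
have e2 : alpha + (- alpha - 1 + s) = -1 + s by ring.
have := hC m%:R (- alpha - 1 + s) hx; rewrite e1 e2 ltrDl sp0 => /(_ isT).
rewrite (_ : -1 + s + 1 = s); last by ring.
rewrite (_ : -1 + p * s + 1 = p * s); last by ring.
rewrite BetaC [Beta (p * s) _]BetaC.
move=> h; apply: (@le_trans _ _ (Beta (beta + (m%:R - m%:R) + 1) s `^ p)).
  by apply: ge0_ler_powR; [exact: ltW|rewrite nnegrE; apply: divr_ge0; exact: ltW|rewrite nnegrE; apply: ltW; exact: Beta_gt0|exact: (hc s s0 s11).1].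
apply: le_trans h _; rewrite -mulrA; apply: ler_wpM2l => //.
apply: le_trans (hD _ sp0 sp1).2 _.
by rewrite invfM mulrA.
Qed.

End consequences.

End necessity.

(** * Necessity: the case [p = 1] *)

Section square.
Context {R : realType}.
Implicit Types (z w : R[i]) (a b r e : R).
Local Notation leb := (@lebesgue_measure R).

Definition square r e : set R[i] := [set w | `|complex.Re w - r| < e /\ `|complex.Im w| < e].

Lemma square_rectangle r e : of_pair @^-1` (square r e) =
  `]r - e, r + e[%classic `*` `](- e), e[%classic.
Proof.
apply/seteqP; split => -[u v] /=; rewrite /square /= !in_itv /= !ltr_norml.
  by move=> [/andP[h1 h2] h3]; split=> //; apply/andP; split; lra.
by move=> [/andP[h1 h2] h3]; split=> //; apply/andP; split; lra.
Qed.

Lemma measurable_square r e : measurable (square r e).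
Proof.
have -> : square r e = (fun w => `|complex.Re w - r|) @^-1` `]-oo, e[%classic `&`
    (fun w => `|complex.Im w|) @^-1` `]-oo, e[%classic.
  by apply/seteqP; split => w /=; rewrite /square /= !in_itv.
have m1 : measurable_fun setT (fun w : R[i] => `|complex.Re w - r|).
  apply: measurableT_comp => //; apply: measurable_funB; [exact: measurable_Re|exact: measurable_cst].
have m2 : measurable_fun setT (fun w : R[i] => `|complex.Im w|).
  by apply: measurableT_comp => //; exact: measurable_Im.
apply: measurableI.
  rewrite -[X in measurable X]setTI; exact: (m1 measurableT _ (measurable_itv _)).
rewrite -[X in measurable X]setTI; exact: (m2 measurableT _ (measurable_itv _)).
Qed.

Lemma area_square_gt0 r e : 0 < e -> (0 < area (square r e))%E.
Proof.
move=> e0; rewrite /area square_rectangle.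
have L (u v : R) : u < v -> leb `]u, v[%classic = (v - u)%:E.
  by move=> uv; rewrite lebesgue_measure_itv /= lte_fin uv.
have h1 : r - e < r + e by rewrite ltrBlDr -addrA ltrDl addr_gt0.
have h2 : - e < e by rewrite -subr_gt0 opprK addr_gt0.
have e1 := etrans (product_measure1E leb leb (measurable_itv `]r - e, r + e[) (measurable_itv `](- e), e[))
  (congr2 (fun x y => x * y)%E (L _ _ h1) (L _ _ h2)).
rewrite (e1 : _ = _) -!EFinM lte_fin; apply: mulr_gt0; first by rewrite invr_gt0 pi_gt0.
by apply: mulr_gt0; rewrite subr_gt0.
Qed.

(** The density is positive off the origin. *)
Lemma mu_square_gt0 a b r e : -1 < a -> -1 < b -> 0 < e -> square r e `<=` pdisc ->
  (0 < mu a b (square r e))%E.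
Proof.
move=> a1 b1 e0 sd; rewrite lt_neqAle measure_ge0 andbT; apply/eqP => /esym.
rewrite /mu (setIidl (subset_trans sd pdisc_disc)) => h0.
have mw : measurable_fun (square r e) (fun z => (weight a b z)%:E).
  by apply/measurable_EFinP; apply: measurable_funTS; exact: measurable_weight.
have h1 : (\int[area]_(z in square r e) `|(weight a b z)%:E| = 0)%E.
  by rewrite -h0; apply: eq_integral => z _; rewrite gee0_abs // lee_fin weight_ge0.
have [A [mA A0 sA]] := (ae_eq_integral_abs area (measurable_square r e) mw).1 h1.
have : (area (square r e) <= 0)%E.
  rewrite -A0; apply: le_measure; rewrite ?inE //; first exact: measurable_square.
  move=> z sz; apply: sA => /= hz; have /= := hz sz; case=> /eqP; apply/negP; rewrite gt_eqF //.
  have [zd /eqP z0] := sd _ sz; have zn : 0 < normc z by rewrite normc_gt0.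
  rewrite /weight divr_gt0 ?Beta1_gt0 // mulr_gt0 // powR_gt0 //.
  by rewrite subr_gt0; have /andP[] := disc_sqr zd.
by rewrite leNgt area_square_gt0.
Qed.

End square.

(** The two parts of the product rule are at most one half each. *)
Lemma product_perturbation (R : realType) (A B E F : R[i]) (L v d : R) : 0 <= L -> 0 <= v ->
  normc B = v -> d <= (2 * (v * L + 1))^-1 ->
  normc (A - B) <= (2 * (1 + L))^-1 -> normc E <= 1 + L -> normc (E - F) <= L * d ->
  normc (A * E - B * F) <= 1.
Proof.
move=> L0 v0 Bv dv AB EL EF.
have -> : A * E - B * F = (A - B) * E + B * (E - F) by ring.
apply: le_trans (le_normcD _ _) _; rewrite [leRHS]splitr; apply: lerD.
  rewrite normcM; apply: le_trans (ler_pM (normc_ge0 _) (normc_ge0 _) AB EL) _.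
  by rewrite invfM -mulrA mulVf ?mulr1 ?div1r // gt_eqF // ltr_pwDl.
have K1 : 0 < v * L + 1 by rewrite ltr_wpDl // mulr_ge0.
rewrite normcM Bv; apply: (@le_trans _ _ (v * L * d)); first by rewrite -mulrA ler_wpM2l.
apply: (@le_trans _ _ (v * L * (2 * (v * L + 1))^-1)).
  by rewrite ler_wpM2l // mulr_ge0.
apply: (@le_trans _ _ ((v * L + 1) * (2 * (v * L + 1))^-1)).
  by rewrite ler_wpM2r ?lerDl // invr_ge0 mulr_ge0 // ltW.
by rewrite invfM mulrCA mulfV ?mulr1 ?div1r // gt_eqF.
Qed.

Lemma ge1_double (R : realType) (x : R) : 1 <= 2^-1 + x -> 1 <= 2 * x.
Proof. lra. Qed.

Lemma disc_real (R : realType) (r : R) : 0 <= r < 1 -> disc (r%:C : R[i]).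
Proof. by move=> /andP[r0 r1]; move: (normc_nng r0); rewrite /disc /= => ->. Qed.

Lemma integral_mu_cst (R : realType) (a b v : R) : -1 < a -> -1 < b ->
  (\int[mu a b]_(z in @disc R) v%:E = v%:E)%E.
Proof.
move=> a1 b1; apply: (etrans (integral_cst (mu a b) (@measurable_disc R) v%:E)).
exact: (etrans (congr1 (fun u => v%:E * u)%E (mu_disc a1 b1)) (mule1 _)).
Qed.

Section kernel_mean.
Context {R : realType}.
Implicit Types (z w xi : R[i]) (f g : R[i] -> R[i]) (r e : R).
Context (alpha beta0 b : R) (m : nat).
Hypotheses (b1 : -1 < b) (al1 : -1 < alpha) (be01 : -1 < beta0 <= 0).
Let beta := beta0 + m%:R.
Let be0 : -1 < beta0. Proof. by case/andP: be01. Qed.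
Let be1 : -1 < beta. Proof. by rewrite /beta (lt_le_trans be0) // lerDl. Qed.
Let x0 : 0 < alpha + 1. Proof. by rewrite -ltrBlDr sub0r. Qed.
Let y0 : 0 < beta0 + 1. Proof. by rewrite -ltrBlDr sub0r. Qed.
Let y01 : 0 < beta0 + 1 <= 1.
Proof. by rewrite y0 gerDr; case/andP: be01. Qed.

Let D xi : R[i] := pser (fun k => (dcoef (alpha + 1) (beta0 + 1) k)%:C) xi.

(** Near [xi = 1] the numerator [Qb] has modulus at least one half; away from 1 the left
    side is bounded. *)
Lemma D_lower : exists2 E : R, 0 <= E & forall xi, disc xi ->
  normc (1 - xi) `^ (- (alpha + 2)) <= 2 * normc (D xi) + E.
Proof.
have [B B0 hB] := Qb_lip x0 y01.
pose eta : R := (4 * B)^-1; have eta0 : 0 < eta by rewrite invr_gt0 mulr_gt0.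
have Beta4 : B * (eta + eta) = 2^-1.
  rewrite /eta; have Bn : B != 0 by rewrite gt_eqF.
  by field.
have a2 : 0 <= alpha + 2 by rewrite -[2](@natr1 R 1) addrA addr_ge0 // ltW.
exists (eta `^ (- (alpha + 2))); first exact: powR_ge0.
move=> xi xd; have n0 : 0 < normc (1 - xi) by rewrite normc_gt0 onem_neq0.
have [far|near] := leP eta (normc (1 - xi)).
  by apply: le_trans (powR_neg_le eta0 far a2) _; rewrite lerDr mulr_ge0 ?normc_ge0.
apply: (@le_trans _ _ (2 * normc (D xi))); last by rewrite lerDl powR_ge0.
rewrite /D (pser_dcoef x0 y01 xd) -cpowN ?onem_neq0 // normcM normc_cpow.
rewrite (_ : - (alpha + 1 + 1) = - (alpha + 2)); last by ring.
rewrite mulrA ler_peMl ?powR_ge0 //.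
pose d : R := Num.min 2^-1 eta.
have d0 : 0 < d by rewrite lt_min eta0 invr_gt0 ltr0n.
have d1 : d <= 2^-1 by rewrite ge_min lexx.
have d2 : d <= eta by rewrite ge_min lexx orbT.
have s01 : 0 <= 1 - d < 1.
  by rewrite gtrBl d0 andbT subr_ge0; apply: le_trans d1 _; rewrite invf_le1 ?ler1n.
have sd : disc ((1 - d)%:C : R[i]).
  have n1 : normc ((1 - d)%:C : R[i]) = 1 - d by rewrite normc_nng //; case/andP: s01.
  by move: n1; rewrite /disc /= => ->; case/andP: s01.
have h1 := Qb_ge1 x0 y01 s01.
have h2 := hB _ _ xd sd.
have h3 : normc (xi - (1 - d)%:C) <= eta + eta.
  have -> : xi - (1 - d)%:C = - (1 - xi) + d%:C by rewrite raddfB /= rmorph1; ring.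
  apply: le_trans (le_normcD _ _) _; rewrite normcN (normc_nng (ltW d0)).
  by apply: lerD => //; exact: ltW.
have h4 : normc (Qb (alpha + 1) (beta0 + 1) xi - Qb (alpha + 1) (beta0 + 1) (1 - d)%:C) <= 2^-1.
  by apply: le_trans h2 _; rewrite -Beta4 ler_wpM2l // ltW.
have h5 := le_trans h1 (le_trans (ler_norm _) (le_normc_Re _)).
have h6 := le_normcD (Qb (alpha + 1) (beta0 + 1) (1 - d)%:C - Qb (alpha + 1) (beta0 + 1) xi) (Qb (alpha + 1) (beta0 + 1) xi).
rewrite subrK normcB in h6.
have h7 := le_trans h5 (le_trans h6 (lerD h4 (lexx _))).
exact: ge1_double.
Qed.

(** The singular factor is continuous at [r] and the series is Lipschitz on a smaller
    disc, uniformly in [z]. *)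
Lemma kernel_continuity r : 2^-1 <= r -> r < 1 -> exists e, [/\ 0 < e,
  square r e `<=` pdisc, (forall w, square r e w -> 4^-1 <= normc w) &
  forall z w, disc z -> square r e w ->
   normc ((w^* ^+ m)^-1 * D (z * w^*) - (r%:C^* ^+ m)^-1 * D (z * r%:C^*)) <= 1].
Proof.
move=> r12 r1; have h20 : 0 < (2^-1 : R) by rewrite invr_gt0 ltr0n.
have r0 : 0 < r by exact: lt_le_trans r12.
have rc : conjc (r%:C : R[i]) = r%:C by apply: complexP => /=; rewrite ?oppr0.
pose r' := (1 + r) / 2.
have r'01 : 0 < r' < 1 by apply/andP; split; rewrite /r'; move: r0 r1; lra.
have hd := cps_dcoef x0 y0.
have [L L0 hL] := pser_lip hd r'01.
have rn : (r%:C : R[i]) != 0 by rewrite -normc_gt0 normc_nng // ltW.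
have rm : (r%:C : R[i]) ^+ m != 0 by exact: expf_neq0.
have [E hE] := derivable_cdiff (@derivableV R[i] R[i]^o _ (r%:C : R[i]) 1 rm (@derivable_monomial R m r%:C)).
have e10 : 0 < (2 * (1 + L))^-1 by rewrite invr_gt0 mulr_gt0 // ltr_pwDl.
have [d d0 hd'] := cdiff_cts hE e10.
pose K : R := r ^- m * L; have K0 : 0 <= K by rewrite mulr_ge0 // invr_ge0 exprn_ge0 // ltW.
pose q : R := Num.min (Num.min d (4^-1)) (Num.min ((1 - r) / 2) (2 * (K + 1))^-1).
have q0 : 0 < q.
  rewrite !lt_min d0 invr_gt0 ltr0n /= divr_gt0 ?subr_gt0 //=.
  by rewrite invr_gt0 mulr_gt0 // ltr_wpDl.
have q1 : q <= d by rewrite !ge_min lexx.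
have q2 : q <= 4^-1 by rewrite !ge_min lexx orbT.
have q3 : q <= (1 - r) / 2 by rewrite !ge_min lexx !orbT.
have q4 : q <= (2 * (K + 1))^-1 by rewrite !ge_min lexx !orbT.
have near w : square r (q / 2) w -> normc (w - r%:C) < q.
  move=> [h1 h2]; have := normc_le_ReIm (w - r%:C); rewrite ReD ImD ReN ImN /= subr0 => t.
  by apply: le_lt_trans t _; rewrite [X in _ < X]splitr; apply: ltrD.
have lo w : square r (q / 2) w -> 4^-1 <= normc w.
  move=> /near h; have := le_normcD w (r%:C - w); rewrite addrC subrK normcB (normc_nng (ltW r0)) => t.
  by move: t h q2 r12; lra.
have hi w : square r (q / 2) w -> normc w <= r'.
  move=> /near h; have := le_normcD (w - r%:C) r%:C; rewrite subrK (normc_nng (ltW r0)) => t.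
  by rewrite /r'; move: t h q3; lra.
exists (q / 2); split.
- by rewrite divr_gt0.
- move=> w sw; split; first by apply: le_lt_trans (hi w sw) _; case/andP: r'01.
  by apply/eqP; rewrite -normc_gt0; apply: lt_le_trans (lo w sw); rewrite invr_gt0.
- exact: lo.
move=> z w zd sw; have nw : normc (w^* - r%:C) < q.
  have cB (u v : R[i]) : conjc (u - v) = conjc u - conjc v by exact: rmorphB.
  have e : conjc (w - r%:C) = w^* - r%:C := etrans (cB w r%:C) (congr1 (fun v => w^* - v) rc).
  by rewrite -e normc_conj; exact: near.
have z1 : normc z <= 1 by exact: ltW.
have zr w' : normc w' <= r' -> normc (z * w') <= r'.
  by move=> h; rewrite normcM; apply: le_trans h; rewrite ler_piMl ?normc_ge0.
have wr : normc (z * w^*) <= r' by apply: zr; rewrite normc_conj hi.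
have rr : normc (z * r%:C) <= r'.
  by apply: zr; rewrite (normc_nng (ltW r0)) /r'; move: r1; lra.
have c1 : normc ((w^* ^+ m)^-1 - (r%:C ^+ m)^-1) <= (2 * (1 + L))^-1.
  have := hd' (w^* - r%:C); rewrite subrKC; apply; exact: lt_le_trans q1.
have c2 : normc (D (z * w^*) - D (z * r%:C)) <= L * normc (w^* - r%:C).
  apply: le_trans (hL _ _ wr rr) _; rewrite -mulrBr normcM; apply: ler_wpM2l => //.
  by rewrite ler_piMl ?normc_ge0.
have c3 : normc (D (z * w^*)) <= 1 + L.
  have n0r : normc (0 : R[i]) <= r' by rewrite (normc_nng (lexx 0)) ltW //; case/andP: r'01.
  have := hL _ _ wr n0r; rewrite subr0 (pser0 hd) dcoef0 // => t.
  rewrite -[D _](subrK 1) addrC; apply: le_trans (le_normcD _ _) _.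
  rewrite (normc_nng ler01) lerD2l; apply: le_trans t _.
  by rewrite ler_piMr //; apply: le_trans wr _; rewrite ltW //; case/andP: r'01.
have e' : (conjc (r%:C : R[i]) ^+ m)^-1 * D (z * conjc r%:C) = (r%:C ^+ m)^-1 * D (z * r%:C) by rewrite rc.
rewrite (e' : _ = _).
apply: (@product_perturbation R _ _ _ _ L (r ^- m) (normc (w^* - r%:C)) _ _ _ _ c1 c3 c2).
- exact: L0.
- rewrite invr_ge0; apply: exprn_ge0; exact: ltW.
- by rewrite normcV normcX (normc_nng (ltW r0)).
exact: le_trans (ltW nw) q4.
Qed.

Hypothesis hdef : forall f z, Lp alpha b 1 f -> pdisc z ->
  cintegrable (mu alpha beta) disc (kernel_integrand alpha beta f z).
Hypothesis hbd : exists C : R, forall f, Lp alpha b 1 f ->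
  (norm_p alpha b 1 (bergman_proj alpha beta f) <= C%:E * norm_p alpha b 1 f)%E.
Hypothesis bb : b <= beta.

Lemma Ip1 a' f : Ip a' b 1 f = (\int[mu a' b]_(z in disc) (normc (f z))%:E)%E.
Proof. by apply: eq_integral => z _; rewrite powRr1 ?normc_ge0. Qed.

Lemma integral_mu_indic a' b' (S : set R[i]) : measurable S -> S `<=` disc ->
  (\int[mu a' b']_(z in disc) (\1_S z)%:E = mu a' b' S)%E.
Proof. by move=> mS Sd; rewrite integral_indic ?(setIidl Sd) //; exact: measurable_disc. Qed.

(** Off the origin the two densities differ by a bounded factor, as [b <= beta]. *)
Lemma mu_compare : exists2 C : R, 0 <= C & forall S, measurable S -> S `<=` disc ->
  (forall w, S w -> 4^-1 <= normc w) -> (mu alpha b S <= C%:E * mu alpha beta S)%E.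
Proof.
have bbx : b + (beta - b) = beta by rewrite addrC subrK.
have B0 : 0 < Beta (alpha + 1) (beta + 1) / Beta (alpha + 1) (b + 1).
  by apply: divr_gt0; exact: Beta1_gt0.
pose t0 : R := (4^-1 ^+ 2) `^ (beta - b).
have t00 : 0 < t0 by rewrite powR_gt0 // exprn_gt0 // invr_gt0.
exists (t0^-1 * (Beta (alpha + 1) (beta + 1) / Beta (alpha + 1) (b + 1))).
  by apply: mulr_ge0; [rewrite invr_ge0 ltW|exact: ltW].
move=> S mS Sd lo; have mD := @measurable_disc R.
have m1 : measurable_fun disc (fun z => (\1_S z)%:E : \bar R).
  by apply/measurable_EFinP; apply: measurable_indic.
have := @mu_shift R alpha b (beta - b) 0 (fun z => (\1_S z)%:E) al1 b1.
rewrite addr0 bbx => /(_ al1 be1 m1 (fun z _ => _)) e.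
have {}e := e (fun z => ltac:(by rewrite lee_fin indicE ler0n)).
have e2 := etrans e (congr1 (fun v => _ * v)%E (integral_mu_indic alpha beta mS Sd)).
rewrite EFinM -muleA -e2 -(integral_mu_indic alpha b mS Sd).
have ip : 0 <= t0^-1 by rewrite invr_ge0 ltW.
have mf : measurable_fun disc (fun z : R[i] => ((\1_S z)%:E * ((normc z ^+ 2) `^ (beta - b) * (1 - normc z ^+ 2) `^ 0)%:E)%E).
  apply: emeasurable_funM => //; apply/measurable_EFinP; exact: (measurable_rpow (beta - b) 0).
have f0 z : disc z -> (0 <= (\1_S z)%:E * ((normc z ^+ 2) `^ (beta - b) * (1 - normc z ^+ 2) `^ 0)%:E)%E.
  by move=> _; rewrite -EFinM lee_fin; apply: mulr_ge0; [rewrite indicE ler0n|rewrite mulr_ge0 ?powR_ge0].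
rewrite -(ge0_integralZl_EFin (mu alpha b) mD f0 mf ip).
apply: ge0_le_integral.
- exact: mD.
- by move=> z _; rewrite lee_fin indicE ler0n.
- exact: m1.
- by apply: emeasurable_funM => //; exact: measurable_cst.
move=> z zd; rewrite -!EFinM lee_fin indicE powRr0 mulr1.
case: (boolP (z \in S)) => zS; last by rewrite mul0r mulr0.
rewrite mul1r ler_pdivlMl // mulr1; apply: ge0_ler_powR.
- by rewrite subr_ge0.
- by rewrite nnegrE exprn_ge0 // invr_ge0.
- by rewrite nnegrE exprn_ge0 // normc_ge0.
by rewrite lerXn2r ?nnegrE ?normc_ge0 ?invr_ge0 //; apply: lo; exact/set_mem.
Qed.

(** Applying the operator to the indicator function of a small square about [r]
    bounds the mean of the kernel at [r]. *)
Lemma kernel_mean_bounded : exists2 C : R, 0 <= C & forall r, 2^-1 <= r -> r < 1 ->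
  (\int[mu alpha b]_(z in disc) (normc (D (z * r%:C^*)))%:E <= C%:E)%E.
Proof.
have mD := @measurable_disc R.
have [C C0 hC] := Ip_bound (lexx 1) hbd.
have [C' C'0 hC'] := mu_compare.
have [k k0 kE] : exists2 k, 0 < k & kconst alpha beta0 m = k.
  by exists (kconst alpha beta0 m) => //; exact: kconst_gt0.
exists (k^-1 * (C * C') + 1).
  by rewrite addr_ge0 // mulr_ge0 ?invr_ge0 ?(ltW k0) ?mulr_ge0.
move=> r r12 r1; have [e [e0 Spd lo hK]] := kernel_continuity r12 r1.
pose S := square r e; have mS : measurable S := measurable_square r e.
have Sd : S `<=` disc := subset_trans Spd (@pdisc_disc R).
have Vfin : (mu alpha beta S <= 1)%E.
  by rewrite -(mu_disc al1 be1); apply: le_measure; rewrite ?inE.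
have V0 : (0 < mu alpha beta S)%E by exact: mu_square_gt0.
have [V VE] : exists V : R, mu alpha beta S = V%:E.
  exists (fine (mu alpha beta S)); rewrite fineK // ge0_fin_numE ?measure_ge0 //.
  by apply: le_lt_trans Vfin _; exact: ltry.
rewrite VE lte_fin in V0.
pose f w : R[i] := (\1_S w : R)%:C.
have nf w : normc (f w) = \1_S w by rewrite /f normc_nng // indicE ler0n.
have mf : measurable_fun disc f by apply: measurable_creal; exact: measurable_indic.
have If : Ip alpha b 1 f = mu alpha b S.
  by rewrite Ip1 -(integral_mu_indic _ _ mS Sd); apply: eq_integral => z _; rewrite nf.
have Lf : Lp alpha b 1 f.
  split=> //; rewrite norm_p_lty // If; apply: le_lt_trans (hC' S mS Sd lo) _.
  by rewrite VE -EFinM ltry.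
have wi : wint alpha beta0 m f by apply: wint_defined => // z zd; exact: hdef.
have [hc _ eP eh] := proj_series al1 be01 mf wi.
pose h := pser (pcoef alpha beta0 m f).
have main z : disc z -> V * normc (D (z * r%:C^*)) <= normc (h z) + V.
  move=> zd; have [i1 e1] := eh z zd.
  pose c0 := (r%:C^* ^+ m)^-1 * D (z * r%:C^*) : R[i].
  have intf : cintegrable (mu alpha beta) disc f.
    apply: (@bounded_cintegrable R alpha beta f 1) => // w _.
    by rewrite nf indicE lern1; case: (_ \in _).
  have i2 := cintegrableZ mD (- c0) intf.
  have ef : cintegral (mu alpha beta) disc f = V%:C.
    rewrite Rintegral_real /Rintegral; congr (_%:C).
    by rewrite (integral_mu_indic _ _ mS Sd) VE.
  have e2 : h z + - c0 * V%:C = cintegral (mu alpha beta) disc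
      ((fun w => f w / w^* ^+ m * D (z * w^*)) \+ (fun w => - c0 * f w)).
    by rewrite (cintegralD mD i1 i2) (cintegralZ mD _ intf) ef /h e1.
  have i3 := cintegrableD mD i1 i2.
  have b3 : normc (h z + - c0 * V%:C) <= V.
    rewrite e2; apply: le_trans (le_normc_cintegral mD i3) _.
    have -> : V = \int[mu alpha beta]_(w in disc) (\1_S w : R).
      by rewrite /Rintegral (integral_mu_indic _ _ mS Sd) VE.
    have [_ j3] := (@cintegrableP _ _ _ (mu alpha beta) disc mD _).1 i3.
    have [_ jf] := (@cintegrableP _ _ _ (mu alpha beta) disc mD _).1 intf.
    apply: le_Rintegral => //.
      apply: (eq_integrable mD (EFin \o (fun x => normc (f x)))); last exact: jf.
      by move=> w _; exact: (congr1 EFin (nf w)).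
    move=> w wd /=.
    have -> : f w / w^* ^+ m * D (z * w^*) + - c0 * f w = f w * ((w^* ^+ m)^-1 * D (z * w^*) - c0) by ring.
    rewrite normcM nf indicE; case: (boolP (w \in S)) => ws; last by rewrite mul0r.
    by rewrite mul1r; apply: hK => //; exact/set_mem.
  have nr : normc (r%:C^* : R[i]) = r by rewrite normc_conj normc_nng //; apply: le_trans r12; rewrite invr_ge0.
  have c0D : normc (D (z * r%:C^*)) <= normc c0.
    rewrite /c0 normcM normcV normcX nr ler_peMl ?normc_ge0 //.
    have r0 : 0 < r by apply: lt_le_trans r12; rewrite invr_gt0.
    by rewrite invf_ge1 ?exprn_gt0 // exprn_ile1 // ltW.
  have nV : normc (V%:C : R[i]) = V by rewrite normc_nng // ltW.
  apply: (@le_trans _ _ (normc (c0 * V%:C))).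
    by rewrite normcM nV mulrC ler_wpM2r // ltW.
  have := le_normcD (h z) (- (h z + - c0 * V%:C)).
  have -> : h z + - (h z + - c0 * V%:C) = c0 * V%:C by ring.
  rewrite normcN => t; apply: le_trans t _; by rewrite lerD2l.
have PE z : pdisc z -> normc (h z) <= k^-1 * normc (bergman_proj alpha beta f z).
  move=> zp; have [zd /eqP z0] := zp; rewrite eP // kE normcM normcM normcV normcX (normc_nng (ltW k0)).
  rewrite -/h mulrA mulKf ?gt_eqF // ler_peMl ?normc_ge0 //.
  have zn : 0 < normc z by rewrite normc_gt0.
  by rewrite invf_ge1 ?exprn_gt0 // exprn_ile1 ?normc_ge0 // ltW.
have mP : measurable_fun disc (bergman_proj alpha beta f).
  apply: (eq_measurable_fun (fun z => (kconst alpha beta0 m)%:C / z ^+ m * pser (pcoef alpha beta0 m f) z)).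
    by move=> z /set_mem zd; rewrite eP.
  apply: measurable_cM; last exact: measurable_pser.
  apply: measurable_cM; first exact: measurable_cst.
  by apply: measurable_cV; apply: measurable_cX; exact: measurable_id.
have rd : disc (r%:C : R[i]).
  by apply: disc_real; rewrite r1 andbT; apply: le_trans r12; rewrite invr_ge0.
have mDr : measurable_fun disc (fun z => (normc (D (z * r%:C^*)))%:E).
  apply/measurable_EFinP; apply: measurable_cnorm; apply: measurable_pser_mul rd.
  exact: (cps_dcoef x0 y0).
have nP := measurable_cnorm mP.
have I1 : (V%:E * \int[mu alpha b]_(z in disc) (normc (D (z * r%:C^*)))%:E <=
    \int[mu alpha b]_(z in disc) ((k^-1 * normc (bergman_proj alpha beta f z))%:E + V%:E))%E.
  have n0 z : disc z -> (0 <= (normc (D (z * r%:C^*)))%:E)%E by move=> _; rewrite lee_fin normc_ge0.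
  rewrite -(ge0_integralZl_EFin (mu alpha b) mD n0 mDr (ltW V0)).
  apply: le_integral_mu_pdisc.
  - by apply: emeasurable_funM => //; exact: measurable_cst.
  - apply/measurable_EFinP; apply: measurable_funD; last exact: measurable_cst.
    by apply: measurable_funM => //; exact: measurable_cst.
  - by move=> z zd; apply: mule_ge0; [rewrite lee_fin ltW|exact: n0].
  - by move=> z zd; rewrite -EFinD lee_fin addr_ge0 ?(ltW V0) // mulr_ge0 ?normc_ge0 // invr_ge0 ltW.
  move=> z zp; rewrite -EFinM -EFinD lee_fin; apply: le_trans (main z (pdisc_disc zp)) _.
  by rewrite lerD2r; exact: PE.
have I2 : (\int[mu alpha b]_(z in disc) ((k^-1 * normc (bergman_proj alpha beta f z))%:E + V%:E) =
    (k^-1)%:E * Ip alpha b 1 (bergman_proj alpha beta f) + V%:E)%E.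
  have ik0 : 0 <= k^-1 by rewrite invr_ge0 ltW.
  have mkP : measurable_fun disc (fun z => (k^-1 * normc (bergman_proj alpha beta f z))%:E).
    by apply/measurable_EFinP; apply: measurable_funM => //; exact: measurable_cst.
  rewrite (ge0_integralD (mu alpha b) mD _ mkP _ (measurable_cst V%:E)); last 2 first.
  - by move=> z _; rewrite lee_fin mulr_ge0 ?normc_ge0.
  - by move=> z _; rewrite lee_fin ltW.
  rewrite (integral_mu_cst V al1 b1).
  congr (_ + _)%E; rewrite Ip1.
  have n0 z : disc z -> (0 <= (normc (bergman_proj alpha beta f z))%:E)%E by move=> _; rewrite lee_fin normc_ge0.
  have nP' : measurable_fun disc (fun z => (normc (bergman_proj alpha beta f z))%:E) by exact/measurable_EFinP.
  by rewrite -(ge0_integralZl_EFin (mu alpha b) mD n0 nP' ik0).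
have I3 : (Ip alpha b 1 (bergman_proj alpha beta f) <= (C * C' * V)%:E)%E.
  apply: le_trans (hC f Lf) _; rewrite If -mulrA EFinM; apply: lee_wpmul2l; first by rewrite lee_fin.
  by rewrite EFinM -VE; exact: hC'.
rewrite -(@lee_pmul2l _ V%:E) ?lte_fin //.
apply: le_trans I1 _; rewrite I2.
have -> : (V%:E * (k^-1 * (C * C') + 1)%:E = (k^-1)%:E * (C * C' * V)%:E + V%:E)%E.
  by rewrite -!EFinM -EFinD; congr EFin; ring.
apply: leeD => //; apply: lee_wpmul2l => //; by rewrite lee_fin invr_ge0 ltW.
Qed.

(** By [D_lower] the means of the kernel dominate the limiting Forelli-Rudin integrals. *)
Lemma kernel_mean_unbounded : False.
Proof.
have mD := @measurable_disc R.
have [C C0 hC] := kernel_mean_bounded; have [E E0 hE] := D_lower.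
have a2 : 0 <= alpha + 2 by rewrite -[2](@natr1 R 1) addrA addr_ge0 // ltW.
pose A : R := 2 * C + E + 2^-1 `^ (- (alpha + 2)) + 1.
have [r [r0 r1]] := forelli_rudin_log A al1 b1.
have rd : disc (r%:C : R[i]) by apply: disc_real; rewrite r0.
rewrite -lee_fin -(integral_onem_powR al1 b1 a2 rd).
apply/negP; rewrite -ltNge.
have h20 : 0 < (2^-1 : R) by rewrite invr_gt0.
have mo : measurable_fun disc (fun z => (normc (1 - z * r%:C^*) `^ (- (alpha + 2)))%:E).
  by apply/measurable_EFinP; apply: measurable_funTS; exact: measurable_onem_powR.
have cst (v : R) : (\int[mu alpha b]_(z in @disc R) v%:E = v%:E)%E.
  exact: integral_mu_cst.
have [r12|r12] := leP 2^-1 r.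
  apply: (@le_lt_trans _ _ ((2 * C + E)%:E)); last first.
    by rewrite lte_fin /A -addrA ltrDl ltr_wpDl ?powR_ge0.
  apply: (@le_trans _ _ (\int[mu alpha b]_(z in disc) ((2 * normc (D (z * r%:C^*)))%:E + E%:E))%E).
    apply: ge0_le_integral.
    - exact: mD.
    - by move=> z _; rewrite lee_fin powR_ge0.
    - exact: mo.
    - apply/measurable_EFinP; apply: measurable_funD; last exact: measurable_cst.
      apply: measurable_funM; first exact: measurable_cst.
      apply: measurable_cnorm; apply: measurable_pser_mul rd; exact: (cps_dcoef x0 y0).
    by move=> z zd; rewrite -EFinD lee_fin; apply: hE; exact: mulr_conj_disc.
  have mDr : measurable_fun disc (fun z => (normc (D (z * r%:C^*)))%:E).
    apply/measurable_EFinP; apply: measurable_cnorm; apply: measurable_pser_mul rd.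
    exact: (cps_dcoef x0 y0).
  have n0 z : disc z -> (0 <= (normc (D (z * r%:C^*)))%:E)%E by move=> _; rewrite lee_fin normc_ge0.
  have m2 : measurable_fun disc (fun z => (2 * normc (D (z * r%:C^*)))%:E).
    by apply/measurable_EFinP; apply: measurable_funM; [exact: measurable_cst|exact/measurable_EFinP].
  rewrite (ge0_integralD (mu alpha b) mD _ m2 _ (measurable_cst E%:E)); last 2 first.
  - by move=> z _; rewrite lee_fin mulr_ge0 ?normc_ge0.
  - by move=> z _; rewrite lee_fin.
  rewrite cst EFinD; apply: leeD => //.
  have := ge0_integralZl_EFin (mu alpha b) mD n0 mDr (ler0n R 2) => e.
  apply: (@le_trans _ _ (2%:E * \int[mu alpha b]_(z in disc) (normc (D (z * r%:C^*)))%:E)%E).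
    by rewrite -e.
  rewrite EFinM; apply: lee_wpmul2l; first by rewrite lee_fin.
  exact: hC.
apply: (@le_lt_trans _ _ (2^-1 `^ (- (alpha + 2)))%:E); last first.
  rewrite lte_fin /A -addrA ltr_wpDl ?ltrDl //.
  by rewrite addr_ge0 // mulr_ge0.
rewrite -(cst (2^-1 `^ (- (alpha + 2)))).
apply: ge0_le_integral.
- exact: mD.
- by move=> z _; rewrite lee_fin powR_ge0.
- exact: mo.
- exact: measurable_cst.
move=> z zd; rewrite lee_fin; apply: powR_neg_le => //.
apply: le_trans (onem_disc_ge zd rd); rewrite normc_nng //.
by move: r12; lra.
Qed.

End kernel_mean.

(** * The characterization *)

Section sufficiency.
Context {R : realType}.
Implicit Types (z w : R[i]) (f g : R[i] -> R[i]).
Context (a b alpha beta0 p : R) (m : nat).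
Hypotheses (a1 : -1 < a) (b1 : -1 < b) (al1 : -1 < alpha) (be01 : -1 < beta0 <= 0) (p1 : 1 <= p).
Let beta := beta0 + m%:R.
Hypotheses (h1 : a + 1 < p * (alpha + 1)) (h2 : -1 < b - m%:R / 2 * p).
Hypothesis (h3 : if p == 1 then b <= beta - m%:R / 2 else b + 1 < p * (beta + 1 - m%:R / 2)).

(** By [bergman_proj_id], applied to the series of [proj_series]. *)
Lemma proj_idem f : Lp a b p f ->
  {in pdisc, bergman_proj alpha beta (bergman_proj alpha beta f) =1 bergman_proj alpha beta f}.
Proof.
move=> Lf; have wf := Lp_wint a1 b1 al1 be01 p1 h1 h2 h3 Lf.
have [hc _ eP _] := proj_series al1 be01 Lf.1 wf.
have mP := measurable_proj a1 b1 al1 be01 p1 h1 h2 h3 Lf.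
have LP : Lp a b p (bergman_proj alpha beta f).
  by split=> //; case: (proj_Ap_pole a1 b1 al1 be01 p1 h1 h2 h3 Lf) => -[].
have wP := Lp_wint a1 b1 al1 be01 p1 h1 h2 h3 LP.
have hkc : cps (fun k => (kconst alpha beta0 m)%:C * pcoef alpha beta0 m f k).
  move=> r hr; have [B hB] := hc r hr.
  exists (normc (kconst alpha beta0 m)%:C * B) => k; rewrite normcM -mulrA.
  by apply: ler_wpM2l => //; exact: normc_ge0.
apply: (bergman_proj_id al1 be01 hkc mP wP) => z /set_mem /pdisc_disc zd.
by rewrite eP // (pserZ _ hc zd) mulrAC.
Qed.

(** An element [g] of the target space is itself a preimage; it is measurable because it
    is [z ^- m] times a power series off the origin. *)
Lemma proj_onto g : Ap_pole a b p m g -> exists2 f, Lp a b p f &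
  {in pdisc, bergman_proj alpha beta f =1 g}.
Proof.
move=> [[hg ng] [h hh he]].
have [c hc hE] := taylor (fun z zd => derivable_cdiff (hh z zd)).
have gE : {in pdisc, forall z, g z = pser c z / z ^+ m}.
  move=> z zp; have [zd /eqP z0] := set_mem zp.
  by rewrite -hE ?inE // he // mulrC mulKf // expf_neq0.
have mg : measurable_fun disc g.
  have -> : @disc R = pdisc `|` [set 0].
    by rewrite pdisc_setD setUC setDUK // => z ->; exact: disc0.
  apply/measurable_funU; [exact: measurable_pdisc|exact: measurable_set0c|].
  split; last exact: measurable_fun_set1.
  apply: (eq_measurable_fun (fun z => pser c z / z ^+ m)).
    by move=> z zp; rewrite gE.
  apply: (measurable_funS (@measurable_disc R) pdisc_disc).
  apply: measurable_cM; first exact: measurable_pser.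
  by apply: measurable_cV; apply: measurable_cX; exact: measurable_id.
have Lg : Lp a b p g by split.
exists g => //.
exact: (bergman_proj_id al1 be01 hc mg (Lp_wint a1 b1 al1 be01 p1 h1 h2 h3 Lg) gE).
Qed.

Lemma proj_sufficient : bergman_proj_defined alpha beta (Lp a b p) /\
  bounded_projection (Lp a b p) (Ap_pole a b p m) (norm_p a b p) (bergman_proj alpha beta).
Proof.
split.
  move=> f z Lf zp; have wf := Lp_wint a1 b1 al1 be01 p1 h1 h2 h3 Lf.
  by have [_ + _ _] := proj_series al1 be01 Lf.1 wf; apply; exact: pdisc_disc.
split.
- by move=> c f g Lf Lg; exact: (proj_linear a1 b1 al1 be01 p1 h1 h2 h3).
- by move=> f Lf; exact: (proj_Ap_pole a1 b1 al1 be01 p1 h1 h2 h3).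
- by have [C [_ hC]] := proj_bounded a1 b1 al1 be01 p1 h1 h2 h3; exists C.
- exact: proj_idem.
- exact: proj_onto.
Qed.

End sufficiency.

Theorem corollary1 (R : realType) (a b alpha beta beta0 : R) (m : nat) (p : R) :
  -1 < a -> -1 < b -> -1 < alpha -> -1 < beta ->
  beta = beta0 + m%:R -> J alpha beta0 -> 1 <= p ->
  (bergman_proj_defined alpha beta (Lp a b p) /\
   bounded_projection (Lp a b p) (Ap_pole a b p m) (norm_p a b p)
     (bergman_proj alpha beta))
  <->
  (a + 1 < p * (alpha + 1) /\
   if p == 1 then
     m%:R - 2 < 2 * b /\ 2 * b <= 2 * beta - m%:R
   else
     p * m%:R - 2 < 2 * b /\ 2 * b < p * (2 * beta + 2) - p * m%:R - 2).
Proof.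
move=> a1 b1 al1 _ -> [be01 _] p1; split; last first.
  move=> [h1 h]; apply: proj_sufficient => //; case: eqP h => [e|_] [h2 h3].
  - by rewrite e; lra.
  - by lra.
  - by lra.
  by lra.
move=> [hdef [_ _ hbd _ _]].
have hN := pole_Lp a1 b1 al1 be01 p1 hdef hbd.
have ca := cond_a a1 b1 al1 be01 p1 hdef.
have cb := cond_b a1 b1 al1 be01 p1 hdef.
have [e|p_1] := eqVneq p 1.
  move: hdef hbd hN ca cb; rewrite e !mul1r mulr1 => hdef hbd hN ca cb; split; last by split; lra.
  rewrite lt_neqAle ca andbT; apply/eqP => /addIr ea; rewrite ea in hdef hbd.
  have bb : b <= beta0 + m%:R by have := ler0n R m; lra.
  exact: (kernel_mean_unbounded b1 al1 be01 hdef hbd bb).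
have p2 : 1 < p by rewrite lt_neqAle eq_sym p_1.
split; first exact: (cond_a_strict a1 b1 al1 be01 p1 hdef hbd p2).
have := cond_b_strict a1 b1 al1 be01 p1 hdef hbd p2.
by move: hN => hN cb'; split; lra.
Qed.
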